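(* Let $n\ge 2$, let $A=\begin{bmatrix} a&0\\ 0&A_1\end{bmatrix}$ be a $(2n-1)\times(2n-1)$ real matrix with $a\ge 0$ and $A_1\in\mathfrak{sp}(\omega_1)\simeq\mathfrak{sp}(n-1,\mathbb{R})$ (i.e. the case $v=0$ of the construction in the context), and let $(G_A,\omega,g)$ be the associated almost-Kähler Lie group. (i) If $A$ is either semisimple (over $\mathbb{C}$) or nilpotent, then the symplectic Lie group $(G_A,\omega)$ admits a compatible left-invariant metric $\tilde g$ such that the almost-Kähler structure $(\omega,\tilde g)$ is an SCF-soliton. The condition for $(G_A,\omega,g)$ itself to be an SCF-soliton is, respectively: for $A$ semisimple, that $A$ is normal; for $A\neq 0$ nilpotent, that $$[A,[A,A^t]]=-\frac{|[A,A^t]|^2}{|A|^2}\,A .$$ (ii) If $A$ is neither nilpotent nor semisimple, then the Lie group $G_A$ does not admit any (algebraic) SCF-soliton. (iii) The SCF evolution is equivalent to the following ODE for $A=A(t)$: $$A'=-\tfrac12\big((\operatorname{tr}A)^2+\operatorname{tr}S(A)^2\big)A+\tfrac12[A,[A,A^t]]-\tfrac{\operatorname{tr}A}{2}[A,A^t].$$ That is, if $A(t)$ is the maximal solution with $A(0)=A_0$ and $(\omega(t),g(t))$ is the SCF solution on $G_{A_0}$ starting at $(\omega,g)$, then both have the same maximal interval of existence and for each $t$ there is a Lie group isomorphism $h(t):G_{A_0}\to G_{A(t)}$ with $(\omega(t),g(t))=h(t)^*(\omega,g)$. (iv) Any SCF solution $(\omega(t),g(t))$ in this class is immortal, i.e.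 $T_+=\infty$. (v) The quantity $|[A,A^t]|^2/|A|^4$ (for $A_0\neq 0$) is strictly decreasing along the flow, unless the solution is an SCF-soliton. (vi) If $A_0\ne0$, any accumulation point $A_+$ of the set $\{A(t)/|A(t)|: t\in[0,\infty)\}$ (as $t\to\infty$) gives rise to a limit soliton: $(G_{A_+},\omega,g)$ is an SCF-soliton. If $A_0$ is not nilpotent, then $A_+$ is a normal matrix having the same eigenvalues as $A_0$ up to scaling.
   Context: Almost-Kähler Lie algebras. A (left-invariant) almost-Kähler structure on a Lie group with real Lie algebra $\mathfrak g$ of dimension $2n$ is a pair $(\omega,g)$, where $\omega$ is a non-degenerate 2-form on $\mathfrak g$ which is closed, $\omega([X,Y],Z)+\omega([Y,Z],X)+\omega([Z,X],Y)=0$, and $g$ is an inner product on $\mathfrak g$ compatible with $\omega$, i.e. the map $J$ defined by $\omega=g(J\cdot,\cdot)$ satisfies $J^2=-I$. The Chern-Ricci form is $p(X,Y)=-\frac12\operatorname{tr}(J\operatorname{ad}[X,Y])+\frac12\operatorname{tr}(\operatorname{ad}J[X,Y])$, and the Chern-Ricci operator $P$ is defined by $p=\omega(P\cdot,\cdot)$. $\mathrm{Rc}$ and $\mathrm{Ric}$ are the Ricci tensor and Ricci operator of $g$ ($\mathrm{Rc}=g(\mathrm{Ric}\,\cdot,\cdot)$). For $E\in\operatorname{End}(\mathfrak g)$, $E^{c}=\frac12(E-JEJ)$, $E^{ac}=\frac12(E+JEJ)$; for bilinear forms $q^{c}=\frac12(q+q(J\cdot,J\cdot))$, $q^{ac}=\frac12(q-q(J\cdot,J\cdot))$.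 The symplectic curvature flow (SCF) for left-invariant structures is the ODE $\frac{d}{dt}\omega=-2p$, $\frac{d}{dt}g=-2p^{c}(\cdot,J\cdot)-2\mathrm{Rc}^{ac}$, with maximal interval of existence $(T_-,T_+)\ni 0$. $(\omega,g)$ on $\mathfrak g$ is an SCF-soliton if for some $c\in\mathbb{R}$ and $D\in\operatorname{Der}(\mathfrak g)$, $P=cI+\frac12(D-JD^tJ)$ and $P^{c}+\mathrm{Ric}^{ac}=cI+\frac12(D+D^t)$. It is an algebraic SCF-soliton if $P+\mathrm{Ric}^{ac}=cI+D$ for some $c\in\mathbb{R}$ and $D\in\operatorname{Der}(\mathfrak g)$; this condition is sufficient for being an SCF-soliton. Construction. On $\mathbb{R}^{2n}$ with orthonormal basis $\{e_1,\dots,e_{2n}\}$ (inner product $g$) and dual basis $\{e^i\}$, fix $\omega=e^1\wedge e^{2n}+\omega_1$, where $\omega_1=g(J_1\cdot,\cdot)$ is a non-degenerate 2-form on $\mathfrak n_1=\langle e_2,\dots,e_{2n-1}\rangle$, $J_1^2=-I$; then $Je_1=e_{2n}$, $Je_{2n}=-e_1$, $J|_{\mathfrak n_1}=J_1$. $\mathfrak{sp}(\omega_1)$ is the set of $A_1\in\mathfrak{gl}(\mathfrak n_1)$ with $A_1^tJ_1+J_1A_1=0$. For $A=\begin{bmatrix}a&v^t\\0&A_1\end{bmatrix}$ with $a\ge0$, $v\in\mathbb{R}^{2n-2}$, $A_1\in\mathfrak{sp}(\omega_1)$, $G_A$ is the simply connected Lie group whose Lie algebra is $\mathbb{R}^{2n}$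 with $\mathfrak n=\langle e_1,\dots,e_{2n-1}\rangle$ an abelian ideal and $\operatorname{ad}e_{2n}|_{\mathfrak n}=A$. Then $(G_A,\omega,g)$ is almost-Kähler. Notation: $S(A)=\frac12(A+A^t)$, $|A|^2=\operatorname{tr}(AA^t)$. *)

(* Defs.v *)
From HB Require Import structures.
From mathcomp Require Import all_boot all_order all_algebra.
From mathcomp Require Import complex ring.
From mathcomp Require Import boolp classical_sets functions reals.
From mathcomp Require Import interval_inference ereal topology normedtype.
From mathcomp Require Import sequences derive realfun.

Set Implicit Arguments.
Unset Strict Implicit.
Unset Printing Implicit Defensive.

Import Order.TTheory GRing.Theory Num.Theory.
Import numFieldNormedType.Exports.

Local Open Scope classical_set_scope.
Local Open Scope ring_scope.

(* A d-dimensional real Lie algebra is 'cV[R]_d with a bracket br.  A bilinear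
   form q is stored as its Gram matrix, q(X, Y) = X^T q Y. *)

Section LieAlgebra.
Variables (R : realType) (d : nat) (br : 'cV[R]_d -> 'cV[R]_d -> 'cV[R]_d).

Definition basisv (i : 'I_d) : 'cV[R]_d := delta_mx i 0.

Definition form (q : 'M[R]_d) (X Y : 'cV[R]_d) : R := (X^T *m q *m Y) 0 0.

Definition gram (q : 'cV[R]_d -> 'cV[R]_d -> R) : 'M[R]_d :=
  \matrix_(i, j) q (basisv i) (basisv j).

Definition lie_bracket : Prop :=
  [/\ forall (c : R) X Y Z, br (c *: X + Y) Z = c *: br X Z + br Y Z,
      forall X, br X X = 0,
      forall X Y, br X Y = - br Y X
    & forall X Y Z, br (br X Y) Z + br (br Y Z) X + br (br Z X) Y = 0].

Definition ad (X : 'cV[R]_d) : 'M[R]_d := \matrix_(i, j) br X (basisv j) i 0.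

Definition is_der (D : 'M[R]_d) : Prop :=
  forall X Y, D *m br X Y = br (D *m X) Y + br X (D *m Y).

Section Structure.
Variables (w g : 'M[R]_d).

(* The endomorphism E determined by q(X, Y) = b(E X, Y), b non-degenerate,
   i.e. q = E^T b. *)
Definition endo_of (b q : 'M[R]_d) : 'M[R]_d := (q *m invmx b)^T.

Definition Jop : 'M[R]_d := endo_of g w.

Definition almost_kahler : Prop :=
  [/\ w^T = - w, w \in unitmx,
      forall X Y Z, form w (br X Y) Z + form w (br Y Z) X + form w (br Z X) Y = 0,
      g^T = g /\ (forall X, X != 0 -> 0 < form g X X)
    & Jop *m Jop = - 1%:M].

Definition chern_ricci : 'M[R]_d :=
  gram (fun X Y => - 2^-1 * \tr (Jop *m ad (br X Y))
                   + 2^-1 * \tr (ad (Jop *m br X Y))).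

Definition Pop : 'M[R]_d := endo_of w chern_ricci.

(* Koszul formula for left-invariant fields: the value of g(nabla_X Y, Z). *)
Definition koszul (X Y Z : 'cV[R]_d) : R :=
  2^-1 * (form g (br X Y) Z - form g (br Y Z) X + form g (br Z X) Y).

Definition nabla (X : 'cV[R]_d) : 'M[R]_d :=
  invmx g *m \matrix_(i, j) koszul X (basisv j) (basisv i).

Definition riemann (X Y : 'cV[R]_d) : 'M[R]_d :=
  nabla X *m nabla Y - nabla Y *m nabla X - nabla (br X Y).

(* Rc(X, Y) is the trace of Z |-> R(Z, X) Y. *)
Definition ricci : 'M[R]_d :=
  gram (fun X Y => \sum_(k < d) (riemann (basisv k) X *m Y) k 0).

Definition Ricop : 'M[R]_d := endo_of g ricci.

Definition endo_c (E : 'M[R]_d) : 'M[R]_d := 2^-1 *: (E - Jop *m E *m Jop).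
Definition endo_ac (E : 'M[R]_d) : 'M[R]_d := 2^-1 *: (E + Jop *m E *m Jop).
Definition form_c (q : 'M[R]_d) : 'M[R]_d := 2^-1 *: (q + Jop^T *m q *m Jop).
Definition form_ac (q : 'M[R]_d) : 'M[R]_d := 2^-1 *: (q - Jop^T *m q *m Jop).

(* The transpose of E with respect to g. *)
Definition adj (E : 'M[R]_d) : 'M[R]_d := invmx g *m E^T *m g.

Definition scf_soliton : Prop :=
  almost_kahler /\
  exists (c : R) (D : 'M[R]_d),
    [/\ is_der D,
        Pop = c%:M + 2^-1 *: (D - Jop *m adj D *m Jop)
      & endo_c Pop + endo_ac Ricop = c%:M + 2^-1 *: (D + adj D)].

Definition algebraic_scf_soliton : Prop :=
  almost_kahler /\
  exists (c : R) (D : 'M[R]_d), is_der D /\ Pop + endo_ac Ricop = c%:M + D.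

End Structure.

(* [form_c p *m Jop] is the Gram matrix of p^c(., J .). *)
Definition scf_solution (Tm Tp : \bar R) (wg : R -> 'M[R]_d * 'M[R]_d) : Prop :=
  forall t : R, (Tm < t%:E < Tp)%E ->
  let w := (wg t).1 in let g := (wg t).2 in
  [/\ almost_kahler w g,
      is_derive t (1 : R) (fun s => (wg s).1) (- 2 *: chern_ricci w g)
    & is_derive t (1 : R) (fun s => (wg s).2)
        (- 2 *: (form_c w g (chern_ricci w g) *m Jop w g)
         - 2 *: form_ac w g (ricci g))].

End LieAlgebra.

(* [x] solves the ODE [sol] on the open interval (Tm, Tp) containing 0 and has
   no extension to a solution on a larger open interval. *)
Definition maximal_solution (R : realType) (X : Type)
    (sol : \bar R -> \bar R -> (R -> X) -> Prop) (Tm Tp : \bar R) (x : R -> X) :=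
  [/\ (Tm < 0 < Tp)%E, sol Tm Tp x
    & forall (Tm' Tp' : \bar R) (y : R -> X),
        (Tm' <= Tm)%E -> (Tp <= Tp')%E -> sol Tm' Tp' y ->
        (forall t : R, (Tm < t%:E < Tp)%E -> y t = x t) ->
        Tm' = Tm /\ Tp' = Tp].

Section MatrixNotions.
Variables (R : realType) (k : nat).
Implicit Types A B : 'M[R]_k.

Definition mxbr A B : 'M[R]_k := A *m B - B *m A.
Definition sympart A : 'M[R]_k := 2^-1 *: (A + A^T).
Definition sqnorm A : R := \tr (A *m A^T).
Definition fnorm A : R := Num.sqrt (sqnorm A).
Definition normal_mx A : Prop := A *m A^T = A^T *m A.
Definition nilpotent_mx A : Prop := exists m : nat, A ^+ m = 0.

Definition cplx A : 'M[R[i]]_k := map_mx (real_complex R) A.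
Definition semisimple_mx A : Prop := diagonalizable (cplx A).

(* The eigenvalues are taken in C, with algebraic multiplicities. *)
Definition same_eigenvalues_upto_scaling A B : Prop :=
  exists (c : R) (s : seq R[i]),
    [/\ 0 < c, char_poly (cplx B) = \prod_(z <- s) ('X - z%:P)
      & char_poly (cplx A) = \prod_(z <- s) ('X - ((c%:C)%C * z)%:P)].

Definition mx_exp A : 'M[R]_k :=
  limn (series (fun m : nat => (m`!%:R)^-1 *: A ^+ m)).

Definition mx_flow (Tm Tp : \bar R) (A : R -> 'M[R]_k) : Prop :=
  forall t : R, (Tm < t%:E < Tp)%E ->
  is_derive t (1 : R) A
    (- (2^-1 * ((\tr (A t)) ^+ 2 + \tr (sympart (A t) *m sympart (A t)))) *: A t
     + 2^-1 *: mxbr (A t) (mxbr (A t) (A t)^T)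
     - (\tr (A t) / 2) *: mxbr (A t) (A t)^T).

(* A vector of 'cV_(k + 1) is x + s e_{2n}, with x in the abelian ideal n. *)
Definition npart (X : 'cV[R]_(k + 1)) : 'cV[R]_k := usubmx X.
Definition epart (X : 'cV[R]_(k + 1)) : R := dsubmx X 0 0.

Definition ga_bracket A (X Y : 'cV[R]_(k + 1)) : 'cV[R]_(k + 1) :=
  col_mx (epart X *: (A *m npart Y) - epart Y *: (A *m npart X)) 0.

(* The simply connected group G_A, as the semidirect product of the vector
   groups R and n, where s in R acts on n by exp (s A).  Its neutral element
   is 0 and its Lie algebra is that of [ga_bracket A]. *)
Definition ga_mul A (X Y : 'cV[R]_(k + 1)) : 'cV[R]_(k + 1) :=
  col_mx (npart X + mx_exp (epart X *: A) *m npart Y) ((epart X + epart Y)%:M).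

(* Differentiable homomorphisms of Lie groups are smooth. *)
Definition ga_iso A B (h : 'cV[R]_(k + 1) -> 'cV[R]_(k + 1)) : Prop :=
  (forall X Y, h (ga_mul A X Y) = ga_mul B (h X) (h Y)) /\
  exists h' : 'cV[R]_(k + 1) -> 'cV[R]_(k + 1),
    [/\ cancel h h', cancel h' h, forall X, differentiable h X
      & forall X, differentiable h' X].

(* q' = h^* q for left-invariant forms on the groups of [ga_mul], h a
   homomorphism: it suffices to compare them at the neutral element. *)
Definition is_pullback (h : 'cV[R]_(k + 1) -> 'cV[R]_(k + 1))
    (q q' : 'M[R]_(k + 1)) : Prop :=
  forall X Y, form q' X Y = form q ('d h 0 X) ('d h 0 Y).

End MatrixNotions.

Lemma ga_bracket_lie (R : realType) (k : nat) (A : 'M[R]_k) :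
  lie_bracket (ga_bracket A).
Proof.
rewrite /lie_bracket /ga_bracket /npart /epart; split; [move=> c X Y Z|move=> X|move=> X Y|move=> X Y Z].
- rewrite !linearD !linearZ /= scale_col_mx add_col_mx scaler0 addr0.
  congr col_mx; apply/colP => i; rewrite !mxE; ring.
- by rewrite subrr col_mx0.
- by rewrite opp_col_mx oppr0 opprB.
rewrite !col_mxKu !col_mxKd !mxE !scale0r !sub0r !add_col_mx !addr0.
rewrite !mulmxBr -!scalemxAr -[RHS]col_mx0; congr col_mx.
apply/colP => i; rewrite !mxE; ring.
Qed.

(* The data on R^{2n} = <e_1> + n_1 + <e_{2n}>, with n_1 of dimension 2n - 2. *)
Section Construction.
Variables (R : realType) (m : nat).

Definition in_sp (J1 A1 : 'M[R]_m) : Prop := A1^T *m J1 + J1 *m A1 = 0.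

Definition mxA (a : R) (A1 : 'M[R]_m) : 'M[R]_(1 + m) := block_mx a%:M 0 0 A1.

(* e^1 /\ e^{2n} + g(J_1 ., .) *)
Definition omega (J1 : 'M[R]_m) : 'M[R]_(1 + m + 1) :=
  block_mx (block_mx 0 0 0 J1^T) (col_mx 1%:M 0) (row_mx (- 1%:M) 0) 0.

End Construction.

(* Main.v *)
(* On the abelian ideal, P + Ric^ac of (G_A, omega, g) is the symmetric operator
   X_A = [A, A^t] / 2 - (tr A) S(A) + (a multiple of the projection on e_1), and on
   e_{2n} it is a scalar; hence the soliton equation amounts to [X_A, A] = d A.  If A is
   not nilpotent then d = 0, and pairing the equation with [A, A^t] yields a sum of
   squares, which forces A to be normal.  For an arbitrary structure, Cholesky and
   Householder reductions lead to A = [a, v^t; 0, A_1], and the same sum of squares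
   forces v = 0 as well; so G_A carries a soliton only if A is semisimple or nilpotent.

   Conversely, if the adjoint of A_1 for some inner product is again in sp, a polar
   decomposition turns that inner product into a compatible one without changing the
   adjoint.  For A semisimple the adjoint is an odd polynomial in A, making A normal;
   for A nilpotent it comes from an sl2-triple, built by splitting off the longest
   Jordan strings.

   If A(t) solves the flow, H' = - X_A H and y' = r y with r the scalar of P + Ric^ac on
   e_{2n} up to sign, then diag(H, y) is an isomorphism G_{A(0)} -> G_{A(t)} along which
   the standard structure pulls back to the SCF solution.  As |A|^2 decreases, the flow is
   immortal.  The derivative of |[A, A^t]|^2 / |A|^4 is minus the Cauchy-Schwarz defect of
   the pair [[A, A^t], A], A, up to a positive factor; it vanishes exactly at solitons, and
   these lie on invariant rays since the field is cubic.  By cubic homogeneity the flow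
   near a limit point with nonzero defect would lower the quotient by a fixed amount
   infinitely often, so limit points are solitons.  Their spectrum is that of A(0) up to
   scaling because y A is conjugate to A(0) and has decreasing norm. *)

Require Import Defs.
From HB Require Import structures.
From mathcomp Require Import all_boot all_order all_algebra.
From mathcomp Require Import complex ring lra zify.
From mathcomp Require Import boolp classical_sets functions reals.
From mathcomp Require Import interval_inference ereal topology normedtype.
From mathcomp Require Import sequences derive realfun exp.
From mathcomp Require Import measure lebesgue_measure lebesgue_integral ftc.

Set Implicit Arguments.
Unset Strict Implicit.
Unset Printing Implicit Defensive.

Import Order.TTheory GRing.Theory Num.Theory.
Import numFieldNormedType.Exports.

Local Open Scope classical_set_scope.
Local Open Scope ring_scope.

Local Notation form := (@Defs.form _ _).

(** * Matrix calculus and linear differential inequalities *)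

Section MatrixCalculus.
Variable R : realType.

(** All tensors are computed for the metric [1%:M] only. They are natural under isomorphisms of Lie
    algebras, and the triangular Cholesky factor of a metric is such an isomorphism because it
    preserves the abelian ideal; the Householder step then moves -J e_{2n} onto e_1.

    The only negative term in the sum of squares is -|S(A_1) v|^2. Bessel's inequality for the
    orthogonal pair v, J_1 v absorbs it in tr S(A_1)^2 |v|^2.

    The delicate point of the equivalence is that the two maximal intervals have the same lower end,
    since the norm of A is not controlled backward in time. A solution of the matrix flow yields one
    of the SCF, so its interval is contained in that of the SCF. Conversely, as long as the SCF
    solution lives, the metric and its inverse are bounded on compact intervals; they bound H, y and
    their inverses, hence A = y^{-1} H A_0 H^{-1}, and a maximal solution that stays bounded cannot
    stop. This argument rests on uniqueness for the SCF itself, an equation that involves the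
    inverse of the metric. *)

Lemma mx_entry_le m n (M : 'M[R]_(m, n)) i j : `|M i j| <= `|M|.
Proof.
rewrite [leRHS]/Num.Def.normr/= mx_normrE.
exact: (le_bigmax _ (fun p : 'I_m * 'I_n => `|M p.1 p.2|) (i, j)).
Qed.

Lemma mx_norm_leP m n (M : 'M[R]_(m, n)) (K : R) :
  0 <= K -> (forall i j, `|M i j| <= K) -> `|M| <= K.
Proof.
move=> K0 MK; rewrite [leLHS]/Num.Def.normr/= mx_normrE.
by apply: bigmax_le => // -[i j] _ /=.
Qed.

Lemma mulmx_norm_le m n p (A : 'M[R]_(m, n)) (B : 'M[R]_(n, p)) :
  `|A *m B| <= n%:R * `|A| * `|B|.
Proof.
apply: mx_norm_leP => [|i j]; first by rewrite !mulr_ge0.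
rewrite mxE (le_trans (ler_norm_sum _ _ _))//.
have -> : n%:R * `|A| * `|B| = \sum_(k < n) `|A| * `|B|.
  by rewrite sumr_const card_ord -mulrA mulr_natl.
by apply: ler_sum => k _; rewrite normrM ler_pM// mx_entry_le.
Qed.

Lemma trmx_norm m n (A : 'M[R]_(m, n)) : `|A^T| = `|A|.
Proof.
by apply/eqP; rewrite eq_le; apply/andP; split; apply: mx_norm_leP => // i j;
  [rewrite mxE mx_entry_le|rewrite -[A i j](mxE trmx_key (fun i j => A j i)) mx_entry_le].
Qed.

Lemma is_derive_mxP m n (M : R -> 'M[R]_(m, n)) t (dM : 'M[R]_(m, n)) :
  is_derive t (1 : R) M dM <->
  forall i j, is_derive t (1 : R) (fun s => M s i j) (dM i j).
Proof.
split=> [[Md <-] i j|Md].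
  split; first exact: (derivable_mxP M t 1).1.
  by rewrite derive_mx// mxE.
have dM' : derivable M t 1.
  by apply/derivable_mxP => i j; case: (Md i j).
split=> //; rewrite derive_mx//; apply/matrixP => i j; rewrite mxE.
by case: (Md i j).
Qed.

Lemma is_derive_trmx m n (A : R -> 'M[R]_(m, n)) t dA :
  is_derive t (1 : R) A dA -> is_derive t (1 : R) (fun s => (A s)^T) dA^T.
Proof.
move=> /is_derive_mxP hA; apply/is_derive_mxP => i j.
by rewrite mxE; under eq_fun do rewrite mxE.
Qed.

Lemma is_derive_rsum n (h : 'I_n -> R -> R) t (dh : 'I_n -> R) :
  (forall i, is_derive t (1 : R) (h i) (dh i)) ->
  is_derive t (1 : R) (fun s => \sum_(i < n) h i s) (\sum_(i < n) dh i).
Proof.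
move=> H.
have -> : (fun s => \sum_(i < n) h i s) = \sum_(i < n) h i.
  by apply/funext => s; rewrite fct_sumE.
exact: is_derive_sum.
Qed.

Lemma is_deriveMR (f g : R -> R) t df dg :
  is_derive t (1 : R) f df -> is_derive t (1 : R) g dg ->
  is_derive t (1 : R) (fun s => f s * g s) (df * g t + f t * dg).
Proof.
move=> hf hg; apply: is_derive_eq; rewrite /GRing.scale/= addrC; congr (_ + _).
exact: mulrC.
Qed.

Lemma is_derive_mulmx m n p (A : R -> 'M[R]_(m, n)) (B : R -> 'M[R]_(n, p)) t dA dB :
  is_derive t (1 : R) A dA -> is_derive t (1 : R) B dB ->
  is_derive t (1 : R) (fun s => A s *m B s) (dA *m B t + A t *m dB).
Proof.
move=> /is_derive_mxP hA /is_derive_mxP hB; apply/is_derive_mxP => i j.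
rewrite !mxE -big_split/=; under eq_fun do rewrite mxE.
by apply: is_derive_rsum => k; apply: is_deriveMR.
Qed.

Lemma is_derive_expRM (k t : R) :
  is_derive t (1 : R) (fun s => expR (k * s)) (k * expR (k * t)).
Proof.
have h1 : is_derive t (1 : R) (fun s => k * s) k.
  by have := @is_deriveZ _ _ _ id k t 1 _ (is_derive_id t 1); rewrite /GRing.scale/= mulr1.
have := @is_derive1_comp R expR (fun s => k * s) t _ _ (is_derive_expR _) h1.
by rewrite mulrC.
Qed.

Lemma is_derive_scalemx m n (f : R -> R) (A : R -> 'M[R]_(m, n)) t df dA :
  is_derive t (1 : R) f df -> is_derive t (1 : R) A dA ->
  is_derive t (1 : R) (fun s => f s *: A s) (df *: A t + f t *: dA).
Proof.
move=> hf /is_derive_mxP hA; apply/is_derive_mxP => i j.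
rewrite !mxE; under eq_fun do rewrite mxE.
exact: is_deriveMR.
Qed.

Lemma is_derive_mxtrace n (A : R -> 'M[R]_n) t dA :
  is_derive t (1 : R) A dA -> is_derive t (1 : R) (fun s => \tr (A s)) (\tr dA).
Proof. by move=> /is_derive_mxP hA; apply: is_derive_rsum => i. Qed.

Lemma is_derive_cstmx (V : normedModType R) (c : V) (t : R) : is_derive t (1 : R) (fun=> c) 0.
Proof. exact: is_derive_cst. Qed.

Lemma is_derive_linmx m n (V : normedModType R) (l : {linear 'M[R]_(m, n) -> V})
    (A : R -> 'M[R]_(m, n)) t dA :
  is_derive t (1 : R) A dA -> is_derive t (1 : R) (fun s => l (A s)) (l dA).
Proof.
move=> /is_derive_mxP hA.
have lE M : l M = \sum_i \sum_j M i j *: l (delta_mx i j).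
  rewrite {1}[M]matrix_sum_delta linear_sum; apply: eq_bigr => i _.
  by rewrite linear_sum; apply: eq_bigr => j _; rewrite linearZ.
have -> : (fun s => l (A s)) =
    \sum_i \sum_j (fun s => A s i j *: l (delta_mx i j)).
  apply/funext => s; rewrite lE fct_sumE; apply: eq_bigr => i _.
  by rewrite fct_sumE.
rewrite lE; apply: is_derive_sum => i; apply: is_derive_sum => j.
have [dij vij] := hA i j.
have dd : differentiable (fun s => A s i j) t by exact/derivable1_diffP.
split; first exact/derivable1_diffP/differentiableZl.
rewrite deriveE; last exact: differentiableZl.
by rewrite diffZl// -deriveE// vij.
Qed.

Lemma is_derive_block m1 m2 n1 n2 (A : R -> 'M[R]_(m1, n1)) (B : R -> 'M[R]_(m1, n2))
    (C : R -> 'M[R]_(m2, n1)) (D : R -> 'M[R]_(m2, n2)) t dA dB dC dD :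
  is_derive t (1 : R) A dA -> is_derive t (1 : R) B dB ->
  is_derive t (1 : R) C dC -> is_derive t (1 : R) D dD ->
  is_derive t (1 : R) (fun s => block_mx (A s) (B s) (C s) (D s))
    (block_mx dA dB dC dD).
Proof.
move=> /is_derive_mxP hA /is_derive_mxP hB /is_derive_mxP hC /is_derive_mxP hD.
apply/is_derive_mxP => i j.
case: (split_ordP i) => i' ->; case: (split_ordP j) => j' ->.
- by rewrite block_mxEul; under eq_fun do rewrite block_mxEul.
- by rewrite block_mxEur; under eq_fun do rewrite block_mxEur.
- by rewrite block_mxEdl; under eq_fun do rewrite block_mxEdl.
- by rewrite block_mxEdr; under eq_fun do rewrite block_mxEdr.
Qed.

Lemma is_derive_continuous (V : normedModType R) (f : R -> V) (t : R) df :
  is_derive t (1 : R) f df -> {for t, continuous f}.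
Proof. by case=> fd _; exact/differentiable_continuous/derivable1_diffP. Qed.

Lemma MVT_le (f df : R -> R) (a b : R) (M : R) : a <= b ->
  (forall t, a <= t <= b -> is_derive t (1 : R) f (df t)) ->
  (forall t, a <= t <= b -> df t <= M) -> f b - f a <= M * (b - a).
Proof.
move=> ab fd dM.
have [x||c] := @MVT_segment R f df a b ab.
- by rewrite in_itv/= => /andP[/ltW ? /ltW ?]; apply: fd; apply/andP.
- apply: derivable_within_continuous => x; rewrite in_itv/= => /fd [].
  by [].
- by rewrite in_itv/= => /dM cM ->; rewrite ler_wpM2r// subr_ge0.
Qed.

Lemma derive_le_incr (f df : R -> R) (a b : R) : a <= b ->
  (forall t, a <= t <= b -> is_derive t (1 : R) f (df t)) ->
  (forall t, a <= t <= b -> df t <= 0) -> f b <= f a.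
Proof.
by move=> ab fd d0; rewrite -subr_le0 -(mul0r (b - a)); exact: (MVT_le ab fd).
Qed.

(** The sup norm is not differentiable, so the comparison with [psi] is made for each entry and each
    sign: [e * f i j - psi] does not increase for e = 1 and e = -1. *)
Lemma mx_MVT_le m n (f df : R -> 'M[R]_(m, n)) (psi dpsi : R -> R) (a b : R) :
  a <= b ->
  (forall t, a <= t <= b -> is_derive t (1 : R) f (df t)) ->
  (forall t, a <= t <= b -> is_derive t (1 : R) psi (dpsi t)) ->
  (forall t, a <= t <= b -> `|df t| <= dpsi t) ->
  `|f b - f a| <= psi b - psi a.
Proof.
move=> ab fd pd dl.
have p0 : psi a <= psi b.
  rewrite -lerN2; apply: (derive_le_incr (f := fun t => - psi t) (df := fun t => - dpsi t)) => //.
  - by move=> t tab; have := pd _ tab => h; exact: is_deriveN.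
  - by move=> t tab; rewrite oppr_le0; apply: le_trans (dl _ tab).
apply: mx_norm_leP => [|i j]; first by rewrite subr_ge0.
have key (e : R) : `|e| = 1 -> e * (f b i j) - psi b <= e * f a i j - psi a.
  move=> e1.
  apply: (derive_le_incr (f := fun t => e * f t i j - psi t)
    (df := fun t => e * df t i j - dpsi t)) => //.
  - move=> t tab; have /is_derive_mxP/(_ i j) h1 := fd _ tab.
    by have h2 := pd _ tab; apply: is_deriveB.
  - move=> t tab; rewrite subr_le0; apply: le_trans (dl _ tab).
    apply: le_trans (mx_entry_le _ i j).
    by rewrite (le_trans (ler_norm _))// normrM e1 mul1r.
rewrite !mxE ler_norml; apply/andP; split.
- have := key (-1); rewrite normrN normr1 => /(_ erefl); lra.
- have := key 1; rewrite normr1 => /(_ erefl); lra.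
Qed.

Lemma continuous_mx_bounded m n (f : R -> 'M[R]_(m, n)) (a b : R) :
  (forall t, a <= t <= b -> {for t, continuous f}) ->
  exists2 K, 0 <= K & forall t, a <= t <= b -> `|f t| <= K.
Proof.
move=> cf; have [ab|ba] := leP a b; last first.
  by exists 0 => // t /andP[/le_trans h /h]; rewrite leNgt ba.
have [|c cab cM] := @EVT_max R (fun t => `|f t|) a b ab.
  apply: continuous_in_subspaceT => t; rewrite inE/= in_itv/= => tab.
  exact: (continuous_comp (cf _ tab) (@norm_continuous _ _ _)).
by exists `|f c| => // t tab; apply: cM; rewrite in_itv/=.
Qed.

End MatrixCalculus.

(** * Open intervals with extended endpoints, Gronwall uniqueness, primitives *)

Section Interval.
Variable R : realType.
Implicit Types (Tm Tp : \bar R) (t : R).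

Definition inI Tm Tp t : Prop := (Tm < t%:E < Tp)%E.

Lemma inI_conv Tm Tp (a b t : R) : inI Tm Tp a -> inI Tm Tp b ->
  a <= t <= b -> inI Tm Tp t.
Proof.
rewrite /inI => /andP[a1 _] /andP[_ b2] /andP[at_ tb]; apply/andP; split.
  by apply: lt_le_trans a1 _; rewrite lee_fin.
by apply: le_lt_trans b2; rewrite lee_fin.
Qed.

Lemma inI_ball Tm Tp t : inI Tm Tp t ->
  exists2 e : R, 0 < e & forall s, `|s - t| <= e -> inI Tm Tp s.
Proof.
rewrite /inI => /andP[h1 h2].
have [e1 e10 H1] : exists2 e : R, 0 < e & forall s, `|s - t| <= e -> (Tm < s%:E)%E.
  case: Tm h1 => [r| |]// h1; last by exists 1 => // s _; rewrite ltNyr.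
  rewrite lte_fin in h1; exists ((t - r) / 2); first by rewrite divr_gt0// subr_gt0.
  by move=> s; rewrite ler_norml lte_fin => /andP[h _]; lra.
have [e2 e20 H2] : exists2 e : R, 0 < e & forall s, `|s - t| <= e -> (s%:E < Tp)%E.
  case: Tp h2 => [r| |]// h2; last by exists 1 => // s _; rewrite ltry.
  rewrite lte_fin in h2; exists ((r - t) / 2); first by rewrite divr_gt0// subr_gt0.
  by move=> s; rewrite ler_norml lte_fin => /andP[_ h]; lra.
exists (Num.min e1 e2); first by rewrite lt_min e10.
by move=> s; rewrite /inI le_min => /andP[/H1 -> /H2 ->].
Qed.

Lemma near_dist_le (t e : R) : 0 < e -> \forall s \near t, `|s - t| <= e.
Proof.
move=> e0; near=> s; rewrite distrC; near: s.
exact: (@cvgr_dist_le _ _ _ _ _ id t).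
Unshelve. all: by end_near. Qed.

Lemma inI_near Tm Tp t : inI Tm Tp t ->
  \forall s \near t, inI Tm Tp s.
Proof.
by move=> /inI_ball[e e0 H]; apply: filterS (near_dist_le t e0).
Qed.

Lemma inI_hull Tm Tp t0 t : inI Tm Tp t0 -> inI Tm Tp t ->
  exists a b : R, [/\ inI Tm Tp a, inI Tm Tp b,
    a < t0 < b & a < t < b].
Proof.
move=> I0 It; have [e e0 H] := inI_ball I0; have [e' e'0 H'] := inI_ball It.
exists (if t0 <= t then t0 - e else t - e'), (if t0 <= t then t + e' else t0 + e).
have Ha : inI Tm Tp (t0 - e) by apply: H; rewrite ler_norml; lra.
have Hb : inI Tm Tp (t0 + e) by apply: H; rewrite ler_norml; lra.
have Hc : inI Tm Tp (t - e') by apply: H'; rewrite ler_norml; lra.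
have Hd : inI Tm Tp (t + e') by apply: H'; rewrite ler_norml; lra.
by case: (leP t0 t) => t0t; split=> //; lra.
Qed.

Lemma itvcc_conv (a b x y s : R) :
  a <= x <= b -> a <= y <= b -> x <= s <= y -> a <= s <= b.
Proof.
move=> /andP[ax _] /andP[_ yb] /andP[xs sy].
by rewrite (le_trans ax xs) (le_trans sy yb).
Qed.

(** The sum [q] of the squared entries is differentiable with |q'| <= c q, so q e^{-ct} does not
    increase to the right of [t0] and q e^{ct} does not decrease to its left; both vanish at
    [t0]. *)
Lemma gronwall0 m n (z dz : R -> 'M[R]_(m, n)) (a b t0 L : R) :
  a <= t0 <= b -> (forall t, a <= t <= b -> is_derive t (1 : R) z (dz t)) ->
  (forall t, a <= t <= b -> `|dz t| <= L * `|z t|) -> z t0 = 0 ->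
  forall t, a <= t <= b -> z t = 0.
Proof.
move=> t0ab zd zL z0.
pose q t := \sum_i \sum_j z t i j * z t i j.
pose dq t := \sum_i \sum_j (dz t i j * z t i j + z t i j * dz t i j).
have qd t : a <= t <= b -> is_derive t (1 : R) q (dq t).
  move=> /zd /is_derive_mxP h.
  by apply: is_derive_rsum => i; apply: is_derive_rsum => j; apply: is_deriveMR.
have ezq t : forall i j, z t i j * z t i j <= q t.
  move=> i j; rewrite /q (bigD1 i)//= (bigD1 j)//= -addrA lerDl addr_ge0//.
    by apply: sumr_ge0 => k _; rewrite -expr2 sqr_ge0.
  by apply: sumr_ge0 => k _; apply: sumr_ge0 => l _; rewrite -expr2 sqr_ge0.
have q0 t : 0 <= q t.
  by apply: sumr_ge0 => k _; apply: sumr_ge0 => l _; rewrite -expr2 sqr_ge0.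
have nzq t : `|z t| ^+ 2 <= q t.
  rewrite -[leRHS]sqr_sqrtr// lerXn2r ?nnegrE ?sqrtr_ge0//.
  apply: mx_norm_leP => [|i j]; first exact: sqrtr_ge0.
  by rewrite -sqrtr_sqr ler_wsqrtr// expr2.
(* Each of the m n entries contributes at most 2 |L| q to q'. *)
pose c := (m * n)%:R * (2 * `|L|).
have dqc t : a <= t <= b -> `|dq t| <= c * q t.
  move=> tab; rewrite (le_trans (ler_norm_sum _ _ _))//.
  have -> : c * q t = \sum_(i < m) \sum_(j < n) 2 * `|L| * q t.
    under eq_bigr do rewrite sumr_const card_ord.
    rewrite sumr_const card_ord -mulrnA /c mulnC -[RHS]mulr_natl !mulrA; reflexivity.
  apply: ler_sum => i _; rewrite (le_trans (ler_norm_sum _ _ _))//.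
  apply: ler_sum => j _.
  have h1 : `|dz t i j| <= `|L| * `|z t|.
    apply: le_trans (mx_entry_le _ _ _) _; apply: le_trans (zL _ tab) _.
    by rewrite ler_wpM2r// ler_norm.
  have h2 := mx_entry_le (z t) i j.
  have h3 : `|dz t i j * z t i j| <= `|L| * q t.
    rewrite normrM; apply: le_trans (ler_pM _ _ h1 h2) _ => //.
    by rewrite -mulrA ler_wpM2l// -expr2.
  rewrite [_ + _](_ : _ = 2 * (dz t i j * z t i j)); last by ring.
  by rewrite normrM ger0_norm// -mulrA ler_wpM2l.
have qt0 : q t0 = 0.
  by rewrite /q z0; do 2 (apply: big1 => ? _); rewrite !mxE mul0r.
have fin t : q t <= 0 -> z t = 0.
  move=> qt; apply/matrixP => i j; rewrite mxE; apply/eqP.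
  by rewrite -sqrf_eq0 expr2 eq_le -expr2 sqr_ge0 andbT expr2 (le_trans (ezq _ _ _)).
move=> t tab; apply: fin.
have ep k : 0 < expR (k * t) by exact: expR_gt0.
have [tt|tt] := leP t0 t.
- rewrite -(@pmulr_lle0 _ (expR (- c * t)))//.
  rewrite -(mul0r (expR (- c * t0))) -qt0.
  apply: (derive_le_incr (f := fun s => q s * expR (- c * s))
    (df := fun s => dq s * expR (- c * s) + q s * (- c * expR (- c * s)))) => //.
    move=> s sab; exact: (is_deriveMR (qd _ (itvcc_conv t0ab tab sab)) (is_derive_expRM _ _)).
  move=> s sab; rewrite mulrA -mulrDl pmulr_lle0 ?expR_gt0//.
  have := dqc _ (itvcc_conv t0ab tab sab).
  by rewrite ler_norml mulrN subr_le0 [q s * c]mulrC => /andP[].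
- rewrite -(@pmulr_lle0 _ (expR (c * t)))//.
  rewrite -(mul0r (expR (c * t0))) -qt0 -lerN2.
  apply: (derive_le_incr (f := fun s => - (q s * expR (c * s)))
    (df := fun s => - (dq s * expR (c * s) + q s * (c * expR (c * s))))); first exact: ltW.
    move=> s sab; apply: is_deriveN.
    exact: (is_deriveMR (qd _ (itvcc_conv tab t0ab sab)) (is_derive_expRM _ _)).
  move=> s sab; rewrite mulrA -mulrDl oppr_le0 pmulr_lge0 ?expR_gt0//.
  have := dqc _ (itvcc_conv tab t0ab sab).
  by rewrite ler_norml -lerBlDr sub0r [q s * c]mulrC => /andP[].
Qed.

Lemma gronwall0_itv m n (z dz : R -> 'M[R]_(m, n)) Tm Tp (t0 : R) :
  inI Tm Tp t0 ->
  (forall t, inI Tm Tp t -> is_derive t (1 : R) z (dz t)) ->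
  (forall a b, inI Tm Tp a -> inI Tm Tp b ->
     exists L : R, forall t, a <= t <= b -> `|dz t| <= L * `|z t|) -> z t0 = 0 ->
  forall t, inI Tm Tp t -> z t = 0.
Proof.
move=> I0 zd zL z0 t It; have [a [b [Ia Ib ab0 abt]]] := inI_hull I0 It.
have [L HL] := zL a b Ia Ib.
case/andP: ab0 abt => /ltW a0 /ltW b0 /andP[/ltW at_ /ltW bt].
apply: (gronwall0 (a := a) (b := b) (t0 := t0) (L := L) (dz := dz)) => //.
- by rewrite a0.
- by move=> s sab; apply: zd; exact: inI_conv sab.
- by rewrite at_.
Qed.

Lemma continuous_primitive (f : R -> R) (a : R) : continuous f ->
  exists F, forall t, a < t -> is_derive t (1 : R) F (f t).
Proof.
move=> cf; exists (fun x => (\int[@lebesgue_measure R]_(s in [set` `[a, x]]) (f s))%R).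
move=> t at_.
have ti : (@lebesgue_measure R).-integrable `[a, t + 1] (EFin \o f).
  apply: continuous_compact_integrable; first exact: segment_compact.
  exact: continuous_subspaceT.
have tt : t < t + 1 by rewrite ltrDl.
have [d e] := continuous_FTC1_closed tt ti at_ (cf t).
by rewrite -e derive1E; exact: derivableP.
Qed.

Lemma clamp_continuous (a b : R) : continuous (fun t : R => Num.max a (Num.min b t)).
Proof.
move=> t; apply: continuous_max; first exact: cvg_cst.
by apply: continuous_min; [exact: cvg_cst|exact: cvg_id].
Qed.

(** Composition with the retraction of the line onto [a, b] makes the integrand continuous
    everywhere and leaves it unchanged on [a, b]. Integration starts at a - 1, so that a lies
    strictly to the right of the base point. *)
Lemma segment_primitive (f : R -> R) (a b : R) : a <= b ->
  (forall t, a <= t <= b -> {for t, continuous f}) ->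
  exists F, forall t, a <= t <= b -> is_derive t (1 : R) F (f t).
Proof.
move=> ab cf.
pose c := fun t : R => Num.max a (Num.min b t).
have cab t : a <= c t <= b by rewrite le_max lexx/= ge_max ab/= ge_min lexx.
have [|F HF] := @continuous_primitive (f \o c) (a - 1).
  by move=> t; apply: continuous_comp; [exact: clamp_continuous|exact: cf].
exists F => t /andP[at_ tb]; have := HF t.
by rewrite /= /c (min_idPr tb) (max_idPr at_); apply; lra.
Qed.

(** The interval is exhausted by segments around [t0]. Primitives on them are normalised to vanish
    at [t0], so two of them agree where both are defined, and the diagonal [F t t] of a chosen
    family is a primitive. *)
Lemma primitive_itv (f : R -> R) Tm Tp (t0 : R) : inI Tm Tp t0 ->
  (forall t, inI Tm Tp t -> {for t, continuous f}) ->
  exists F, F t0 = 0 /\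
    forall t, inI Tm Tp t -> is_derive t (1 : R) F (f t).
Proof.
move=> I0 cf.
have loc t : exists F, inI Tm Tp t -> F t0 = 0 /\
    exists a b, [/\ a < t0 < b, a < t < b &
      forall s, a <= s <= b -> is_derive s (1 : R) F (f s)].
  have [It|nIt] := pselect (inI Tm Tp t); last by exists (fun=> 0).
  have [a [b [Ia Ib ab0 abt]]] := inI_hull I0 It.
  have [||F HF] := @segment_primitive f a b; first lra.
    by move=> s /(inI_conv Ia Ib)/cf.
  exists (fun s => F s - F t0) => _; split; first by rewrite subrr.
  exists a, b; split=> // s /HF h.
  by rewrite -[f s]subr0; apply: is_deriveB.
have {loc} /choice[F HF] := loc.
exists (fun t => F t t); split; first by case: (HF t0 I0).
move=> t It; have [Ft0 [a [b [ab0 abt Fd]]]] := HF t It.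
apply: (near_eq_is_derive (f := F t)); last by apply: Fd; lra.
near=> s.
have Is : inI Tm Tp s by near: s; exact: inI_near.
have [Fs0 [a' [b' [ab0' abs Fd']]]] := HF s Is.
have sab : a < s < b.
  near: s; have e0 : 0 < Num.min ((t - a) / 2) ((b - t) / 2) by rewrite lt_min; lra.
  apply: filterS (near_dist_le t e0) => s.
  by rewrite le_min !ler_norml; lra.
have dd u : Num.max a a' <= u <= Num.min b b' ->
    is_derive u (1 : R) (fun u => F t u - F s u) 0.
  rewrite ge_max le_min => /andP[/andP[? ?] /andP[? ?]].
  rewrite -(subrr (f u)).
  by apply: is_deriveB; [apply: Fd|apply: Fd']; lra.
have := @gronwall0 1 1 (fun u => (F t u - F s u)%:M) (fun=> 0)
  (Num.max a a') (Num.min b b') t0 0.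
move=> /(_ _ _ _ _ s) H.
suff : (F t s - F s s)%:M = 0 :> 'M[R]_1.
  by move=> /matrixP/(_ 0 0); rewrite !mxE/= => /eqP; rewrite subr_eq0 => /eqP.
have s1 u : a < u < b -> a' < u < b' -> Num.max a a' <= u <= Num.min b b'.
  by move=> /andP[? ?] /andP[? ?]; rewrite ge_max le_min !ltW.
apply: H; try by apply: s1.
- move=> u /dd h; apply/is_derive_mxP => i j; rewrite !ord1 mxE.
  by under eq_fun do rewrite mxE.
- by move=> u _; rewrite mul0r normr0.
- by rewrite Ft0 Fs0 subrr; apply/matrixP => i j; rewrite !ord1 !mxE.
Unshelve. all: by end_near. Qed.

Lemma mx_primitive_itv m n (f : R -> 'M[R]_(m, n)) Tm Tp (t0 : R) :
  inI Tm Tp t0 ->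
  (forall t, inI Tm Tp t -> {for t, continuous f}) ->
  exists F, F t0 = 0 /\
    forall t, inI Tm Tp t -> is_derive t (1 : R) F (f t).
Proof.
move=> I0 cf.
have H (ij : 'I_m * 'I_n) : exists F, F t0 = 0 /\
    forall t, inI Tm Tp t -> is_derive t (1 : R) F (f t ij.1 ij.2).
  apply: (primitive_itv I0 (f := fun t => f t ij.1 ij.2)) => t /cf h.
  exact: (continuous_comp h (@coord_continuous _ _ _ _ _ _)).
have {H} /choice[F HF] := H.
exists (fun t => \matrix_(i, j) F (i, j) t); split.
  by apply/matrixP => i j; rewrite !mxE; case: (HF (i, j)).
move=> t It; apply/is_derive_mxP => i j.
by under eq_fun do rewrite mxE; case: (HF (i, j)) => _ /(_ t It).
Qed.

End Interval.

(** * Existence of solutions and gluing *)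

Section Picard.
Variable R : realType.

(* The weight [expR (2 L |t - t0|)] makes the Picard operator a contraction. *)
Lemma weighted_contraction m n (u du : R -> 'M[R]_(m, n)) (a b t0 L c : R) :
  0 <= L -> 0 <= c -> a <= t0 <= b -> (forall t, a <= t <= b -> is_derive t (1 : R) u (du t)) ->
  (forall t, a <= t <= b -> `|du t| <= c * L * expR (L * `|t - t0|)) ->
  u t0 = 0 -> forall t, a <= t <= b -> `|u t| <= c * expR (L * `|t - t0|).
Proof.
move=> L0 c0 t0ab ud uL u0 t tab.
have ep (x : R) : 0 <= c * expR x by rewrite mulr_ge0// ltW// expR_gt0.
have sc (k d s : R) : is_derive s (1 : R) (fun s => d * expR (k * s)) (d * (k * expR (k * s))).
  by have := @is_deriveZ _ _ _ _ d s 1 _ (is_derive_expRM k s).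
have [tt|/ltW tt] := leP t0 t.
- have e1 s : t0 <= s -> c * expR (L * `|s - t0|) = c * expR (- (L * t0)) * expR (L * s).
    by move=> ts; rewrite ger0_norm ?subr_ge0// -mulrA -expRD; congr (_ * expR _); ring.
  have -> : u t = u t - u t0 by rewrite u0 subr0.
  apply: le_trans (mx_MVT_le (psi := fun s => c * expR (- (L * t0)) * expR (L * s))
    (dpsi := fun s => c * expR (- (L * t0)) * (L * expR (L * s))) tt _ _ _) _.
  + by move=> s sab; apply: ud; exact: itvcc_conv sab.
  + move=> s sab; have := uL _ (itvcc_conv t0ab tab sab).
    case/andP: sab => ts _; rewrite mulrAC e1// => /le_trans; apply.
    by rewrite le_eqVlt; apply/orP; left; apply/eqP; move: (expR (L * s)) (expR (- L * s)) (expR (- (L * t0))) (expR (L * t0)) => x1 x2 x3 x4; ring.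
  + by rewrite /= -!e1// gerBl.
- have e1 s : s <= t0 -> c * expR (L * `|s - t0|) = c * expR (L * t0) * expR (- L * s).
    by move=> ts; rewrite ler0_norm ?subr_le0// -mulrA -expRD; congr (_ * expR _); ring.
  have -> : `|u t| = `|u t0 - u t| by rewrite u0 sub0r normrN.
  apply: le_trans (mx_MVT_le (psi := fun s => - (c * expR (L * t0)) * expR (- L * s))
    (dpsi := fun s => - (c * expR (L * t0)) * (- L * expR (- L * s))) tt _ _ _) _.
  + by move=> s sab; apply: ud; exact: itvcc_conv sab.
  + move=> s sab; have := uL _ (itvcc_conv tab t0ab sab).
    case/andP: sab => _ ts; rewrite mulrAC e1// => /le_trans; apply.
    by rewrite le_eqVlt; apply/orP; left; apply/eqP; move: (expR (L * s)) (expR (- L * s)) (expR (- (L * t0))) (expR (L * t0)) => x1 x2 x3 x4; ring.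
  + rewrite /= e1// mulNr [X in _ - X]mulNr opprK addrC gerBl.
    by rewrite !mulr_ge0// ltW// expR_gt0.
Qed.

Lemma geometric_cauchy_limR (x : nat -> R) (K : R) :
  0 <= K -> (forall k, `|x k.+1 - x k| <= K * 2^-1 ^+ k) ->
  exists y, forall k, `|y - x k| <= 2 * K * 2^-1 ^+ k.
Proof.
move=> K0 hx.
have h2 : 0 < 2^-1 :> R by rewrite invr_gt0.
have hd k j : `|x (j + k)%N - x k| <= 2 * K * 2^-1 ^+ k - 2 * K * 2^-1 ^+ (j + k).
  elim: j => [|j IH]; first by rewrite add0n !subrr normr0.
  rewrite addSn -(subrK (x (j + k)%N) (x (j + k).+1)) -addrA.
  rewrite (le_trans (ler_normD _ _))//.
  apply: le_trans (lerD (hx _) IH) _; rewrite exprS.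
  by rewrite le_eqVlt; apply/orP; left; apply/eqP; field.
have cvs : cvgn (series (fun k => x k.+1 - x k)).
  apply: normed_cvg.
  apply: (@series_le_cvg _ _ (geometric K 2^-1)).
  - by move=> k /=.
  - by move=> k /=; rewrite mulr_ge0// exprn_ge0// ltW.
  - by move=> k /=; exact: hx.
  - by apply: is_cvg_geometric_series; rewrite ger0_norm ?(ltW h2)// invf_lt1// ltr1n.
pose y := x 0%N + limn (series (fun k => x k.+1 - x k)).
have xy : x @ \oo --> y.
  have -> : x = (fun k => x 0%N + series (fun k => x k.+1 - x k) k).
    by apply/funext => k; rewrite /series/= telescope_sumr// addrC subrK.
  by apply: cvgD; [exact: cvg_cst|exact: cvs].
exists y => k; apply/ler_addgt0Pr => e e0.
have /cvgrPdist_le/(_ e e0)[N _ HN] := xy.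
have HNk := HN (N + k)%N (leq_addr _ _).
rewrite -(subrK (x (N + k)%N) y) -addrA (le_trans (ler_normD _ _))// [leRHS]addrC lerD//.
by apply: le_trans (hd k N) _; rewrite gerBl !mulr_ge0// exprn_ge0// ltW.
Qed.

Lemma geometric_cauchy_lim m n (x : nat -> 'M[R]_(m, n)) (K : R) :
  0 <= K -> (forall k, `|x k.+1 - x k| <= K * 2^-1 ^+ k) ->
  exists y, forall k, `|y - x k| <= 2 * K * 2^-1 ^+ k.
Proof.
move=> K0 hx.
have H (ij : 'I_m * 'I_n) : exists y : R, forall k,
    `|y - x k ij.1 ij.2| <= 2 * K * 2^-1 ^+ k.
  apply: geometric_cauchy_limR => // k; apply: le_trans (hx k).
  by have := mx_entry_le (x k.+1 - x k) ij.1 ij.2; rewrite !mxE.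
have {H} /choice[y Hy] := H.
exists (\matrix_(i, j) y (i, j)) => k; apply: mx_norm_leP => [|i j].
  by rewrite !mulr_ge0// exprn_ge0// invr_ge0.
by rewrite !mxE; exact: (Hy (i, j)).
Qed.

(** Successive approximation from the constant [x0]. The Lipschitz bound is global in x and uniform
    for t in compact subintervals, so convergence is geometric on each of these and the solution
    lives on the whole interval. Locally Lipschitz fields are brought into this form by a cutoff. *)
Theorem picard_lindelof m n (F : R -> 'M[R]_(m, n) -> 'M[R]_(m, n)) (Tm Tp : \bar R)
    (t0 : R) (x0 : 'M[R]_(m, n)) :
  inI Tm Tp t0 ->
  (forall a b, inI Tm Tp a -> inI Tm Tp b -> exists L : R,
     forall t, a <= t <= b -> forall x y, `|F t x - F t y| <= L * `|x - y|) ->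
  (forall x : R -> 'M[R]_(m, n), (forall t, inI Tm Tp t -> {for t, continuous x}) ->
     forall t, inI Tm Tp t -> {for t, continuous (fun s => F s (x s))}) ->
  exists y, y t0 = x0 /\
    forall t, inI Tm Tp t -> is_derive t (1 : R) y (F t (y t)).
Proof.
move=> I0 Lip cF.
pose cont (x : R -> 'M[R]_(m, n)) := forall t, inI Tm Tp t -> {for t, continuous x}.
have [Pr HPr] : exists Pr : (R -> 'M[R]_(m, n)) -> (R -> 'M[R]_(m, n)), forall x,
    cont x -> Pr x t0 = x0 /\
      forall t, inI Tm Tp t -> is_derive t (1 : R) (Pr x) (F t (x t)).
  suff H x : exists Prx : R -> 'M[R]_(m, n), cont x -> Prx t0 = x0 /\
      forall t, inI Tm Tp t -> is_derive t (1 : R) Prx (F t (x t)).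
    by have /choice[Pr HPr] := H; exists Pr.
  have [cx|ncx] := pselect (cont x); last by exists x.
  have [G [G0 Gd]] := mx_primitive_itv I0 (cF _ cx).
  exists (fun t => x0 + G t) => _; split; first by rewrite G0 addr0.
  move=> t It; rewrite -[F t _]add0r.
  by apply: is_deriveD; apply: Gd.
pose xs k := iter k Pr (fun=> x0).
have cxs k : cont (xs k).
  elim: k => [|k IH] t It; first exact: cvg_cst.
  by have [_ /(_ t It)] := HPr _ IH; exact: is_derive_continuous.
have xs0 k : xs k t0 = x0.
  by case: k => [//|k]; have [] := HPr _ (cxs k).
have xsd k t : inI Tm Tp t -> is_derive t (1 : R) (xs k.+1) (F t (xs k t)).
  by have [_] := HPr _ (cxs k); apply.
have est a b : inI Tm Tp a -> inI Tm Tp b -> a <= t0 <= b -> exists2 K, 0 <= K &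
    forall k t, a <= t <= b -> `|xs k.+1 t - xs k t| <= K * 2^-1 ^+ k.
  move=> Ia Ib t0ab; have [L0 HL0] := Lip a b Ia Ib.
  pose L := Num.max L0 0.
  have L_ge0 : 0 <= L by rewrite le_max lexx orbT.
  have HL t x y : a <= t <= b -> `|F t x - F t y| <= L * `|x - y|.
    move=> tab; apply: le_trans (HL0 _ tab _ _) _.
    by rewrite ler_wpM2r// le_max lexx.
  have inab t : a <= t <= b -> inI Tm Tp t by exact: inI_conv.
  have [C C0 HC] : exists2 C, 0 <= C & forall t, a <= t <= b -> `|xs 1%N t - xs 0%N t| <= C.
    apply: (@continuous_mx_bounded _ _ _ (fun t => xs 1%N t - xs 0%N t)) => t tab.
    by apply: continuousB; apply: cxs; exact: inab.
  have H k t : a <= t <= b ->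
      `|xs k.+1 t - xs k t| <= C * 2^-1 ^+ k * expR (2 * L * `|t - t0|).
    elim: k t => [|k IH] t tab.
      rewrite mulr1; apply: le_trans (HC _ tab) _; rewrite ler_peMr//.
      by rewrite -expR0 ler_expR !mulr_ge0.
    (* The weight has rate 2 L while the field has Lipschitz constant L; the quotient is the factor
       1/2 gained in each iteration. *)
    apply: (weighted_contraction (u := fun t => xs k.+2 t - xs k.+1 t)
      (du := fun t => F t (xs k.+1 t) - F t (xs k t)) (a := a) (b := b)) => //.
    - by rewrite mulr_ge0.
    - by rewrite mulr_ge0// exprn_ge0// invr_ge0.
    - by move=> s /inab sI; apply: is_deriveB; exact: xsd.
    - move=> s sab; apply: le_trans (HL _ _ _ sab) _.
      apply: le_trans (ler_wpM2l L_ge0 (IH _ sab)) _; rewrite exprS.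
      by rewrite le_eqVlt; apply/orP; left; apply/eqP; field.
    - by rewrite !xs0 subrr.
  exists (C * expR (2 * L * (b - a))).
    by rewrite mulr_ge0// ltW// expR_gt0.
  move=> k t tab; apply: le_trans (H _ _ tab) _.
  rewrite -!mulrA ler_wpM2l// mulrC ler_wpM2r ?exprn_ge0 ?invr_ge0//.
  rewrite ler_expR -?mulrA !ler_wpM2l//.
  case/andP: t0ab tab => ? ? /andP[? ?].
  by rewrite ler_norml; apply/andP; split; lra.
(* One value [y t] has to satisfy the estimate for every admissible K, because the constants of
   [est] depend on the segment. *)
have [y Hy] : exists y : R -> 'M[R]_(m, n), forall t, inI Tm Tp t ->
    forall K : R, 0 <= K -> (forall k, `|xs k.+1 t - xs k t| <= K * 2^-1 ^+ k) ->
    forall k, `|y t - xs k t| <= 2 * K * 2^-1 ^+ k.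
  suff H t : exists yt, inI Tm Tp t -> forall K : R, 0 <= K ->
      (forall k, `|xs k.+1 t - xs k t| <= K * 2^-1 ^+ k) ->
      forall k, `|yt - xs k t| <= 2 * K * 2^-1 ^+ k.
    by have /choice[y Hy] := H; exists y.
  have [It|] := pselect (inI Tm Tp t); last by exists 0.
  have [a [b [Ia Ib /andP[/ltW ? /ltW ?] /andP[/ltW ? /ltW ?]]]] := inI_hull I0 It.
  have [|K K0 HK] := est a b Ia Ib; first by apply/andP.
  have [|y0 Hy0] := @geometric_cauchy_lim _ _ (fun k => xs k t) K K0.
    by move=> k; apply: HK; apply/andP.
  exists y0 => _ K' K'0 HK'.
  have [y1 Hy1] := @geometric_cauchy_lim _ _ (fun k => xs k t) K' K'0 HK'.
  suff -> : y0 = y1 by [].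
  apply/eqP; rewrite -subr_eq0 -normr_eq0 eq_le normr_ge0 andbT.
  apply/ler_addgt0Pr => e e0; rewrite add0r.
  have KK : 0 <= 2 * K + 2 * K' by rewrite addr_ge0// mulr_ge0.
  have [N HN] : exists N, (2 * K + 2 * K') * 2^-1 ^+ N <= e.
    have : geometric (2 * K + 2 * K') (2^-1 : R) @ \oo --> 0.
      by apply: cvg_geometric; rewrite ger0_norm ?invr_ge0// invf_lt1// ltr1n.
    move=> /cvgrPdist_le/(_ e e0)[N _ HN]; exists N.
    by have := HN N (leqnn N); rewrite /= sub0r normrN; apply: le_trans; exact: ler_norm.
  apply: le_trans HN; rewrite -(subrK (xs N t) y0) -addrA.
  have h0 := Hy0 N; have h1 := Hy1 N; rewrite distrC in h1.
  by apply: le_trans (ler_normD _ _) _; rewrite mulrDl; exact: lerD.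
have Hyu a b : inI Tm Tp a -> inI Tm Tp b -> a <= t0 <= b -> exists2 K, 0 <= K &
    forall k t, a <= t <= b -> `|y t - xs k t| <= K * 2^-1 ^+ k.
  move=> Ia Ib ab0; have [K K0 HK] := est a b Ia Ib ab0.
  exists (2 * K); first by rewrite mulr_ge0.
  move=> k t tab; apply: Hy => //; first exact: inI_conv tab.
  by move=> j; exact: HK.
have small (K e : R) : 0 <= K -> 0 < e -> exists N, K * 2^-1 ^+ N <= e.
  move=> K0 e0.
  have : geometric K (2^-1 : R) @ \oo --> 0.
    by apply: cvg_geometric; rewrite ger0_norm ?invr_ge0// invf_lt1// ltr1n.
  move=> /cvgrPdist_le/(_ e e0)[N _ HN]; exists N.
  by have := HN N (leqnn N); rewrite /= sub0r normrN; apply: le_trans; exact: ler_norm.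
have cy : cont y.
  move=> t It; have [a [b [Ia Ib /andP[/ltW ? /ltW ?] abt]]] := inI_hull I0 It.
  have [|K K0 HK] := Hyu a b Ia Ib; first by apply/andP.
  apply/cvgrPdist_le => e e0.
  have e30 : 0 < e / 3 by rewrite divr_gt0.
  have [N HN] := small K (e / 3) K0 e30.
  have /cvgrPdist_le/(_ _ e30) := cxs N t It; near_simpl => Hc.
  have tab : a <= t <= b by case/andP: (abt) => /ltW -> /ltW ->.
  near=> s.
  have sab : a <= s <= b.
    near: s; case/andP: abt => at_ tb.
    have d0 : 0 < Num.min (t - a) (b - t) by rewrite lt_min !subr_gt0 at_.
    apply: filterS (near_dist_le t d0) => s; rewrite le_min !ler_norml.
    by move=> /andP[/andP[? ?] /andP[? ?]]; apply/andP; split; lra.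
  have -> : y t - y s = (y t - xs N t) + ((xs N t - xs N s) + (xs N s - y s)).
    by rewrite !subrKA.
  have -> : e = e / 3 + (e / 3 + e / 3) by field.
  rewrite (le_trans (ler_normD _ _))// lerD//; first exact: (le_trans (HK _ _ tab) HN).
  rewrite (le_trans (ler_normD _ _))// lerD//; first by near: s.
  by rewrite distrC; exact: (le_trans (HK _ _ sab) HN).
have [z0 zd] := HPr y cy.
(* [y] is continuous as a locally uniform limit, so [Pr y] is a primitive of t |-> F t (y t);
   differentiability of [y] comes from its equality with [Pr y]. *)
suff yz t : inI Tm Tp t -> y t = Pr y t.
  exists y; split; first by rewrite yz.
  move=> t It; apply: (near_eq_is_derive (f := Pr y)); last exact: zd.
  by have := inI_near It; apply: filterS => s /yz ->.
move=> It; have [a [b [Ia Ib /andP[/ltW a0 /ltW b0] /andP[/ltW at_ /ltW bt]]]] := inI_hull I0 It.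
have t0ab : a <= t0 <= b by rewrite a0.
have tab : a <= t <= b by rewrite at_.
have [K K0 HK] := Hyu a b Ia Ib t0ab.
have [L0 HL0] := Lip a b Ia Ib.
pose L := Num.max L0 1.
have L_gt0 : 0 < L by rewrite lt_max ltr01 orbT.
have HL s x x' : a <= s <= b -> `|F s x - F s x'| <= L * `|x - x'|.
  move=> sab; apply: le_trans (HL0 _ sab _ _) _.
  by rewrite ler_wpM2r// le_max lexx.
apply/eqP; rewrite -subr_eq0 -normr_eq0 eq_le normr_ge0 andbT.
apply/ler_addgt0Pr => e e0; rewrite add0r.
have [|N HN] := small (K + K * expR (L * `|t - t0|)) e _ e0.
  by rewrite addr_ge0// mulr_ge0// ltW// expR_gt0.
apply: le_trans HN; rewrite mulrDl -(subrK (xs N.+1 t) (y t)) -addrA.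
rewrite (le_trans (ler_normD _ _))// lerD//.
  apply: le_trans (HK _ _ tab) _; rewrite ler_wpM2l// exprS.
  by rewrite ler_piMl// ?exprn_ge0 ?invr_ge0// invf_le1// ler1n.
rewrite -[leRHS]mulrA [expR _ * _]mulrC mulrA.
apply: (weighted_contraction (u := fun t => xs N.+1 t - Pr y t)
  (du := fun t => F t (xs N t) - F t (y t)) (a := a) (b := b)) => //.
- exact: ltW.
- by rewrite mulr_ge0// exprn_ge0// invr_ge0.
- move=> s sab; have sI := inI_conv Ia Ib sab.
  by apply: is_deriveB; [exact: xsd|exact: zd].
- move=> s sab; apply: le_trans (HL _ _ _ sab) _.
  have h1 : L * `|xs N s - y s| <= L * (K * 2^-1 ^+ N).
    by rewrite ler_wpM2l ?(ltW L_gt0)// distrC; exact: HK.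
  apply: le_trans h1 _; rewrite [_ * L]mulrC ler_peMr//.
    by rewrite !mulr_ge0 ?exprn_ge0 ?invr_ge0// ltW.
  by rewrite -expR0 ler_expR mulr_ge0// ltW.
- by rewrite xs0 z0 subrr.
Unshelve. all: by end_near. Qed.

End Picard.

(** * Gluing a solution to a maximal one *)

Section Gluing.
Variables (R : realType) (X : Type) (Pt : (R -> X) -> R -> Prop).
Hypothesis germ : forall x y t, (\forall s \near t, x s = y s) -> Pt x t -> Pt y t.
Let sol (Tm Tp : \bar R) (x : R -> X) := forall t : R, (Tm < t%:E < Tp)%E -> Pt x t.

(** Two solutions that agree on the overlap glue to a solution on the union, which is an interval
    since both contain [t0]; maximality of [x] bounds it. The equation enters only through its
    locality [germ], so the lemma serves both the matrix flow and the SCF. *)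
Lemma maximal_solution_absorbs Tm Tp x Tm' Tp' y (t0 : R) :
  maximal_solution sol Tm Tp x -> sol Tm' Tp' y ->
  inI Tm Tp t0 -> inI Tm' Tp' t0 ->
  (forall t, inI Tm Tp t -> inI Tm' Tp' t -> y t = x t) ->
  (Tm <= Tm')%E /\ (Tp' <= Tp)%E.
Proof.
move=> [_ solx maxx] soly I0 I0' xy.
pose z t := if `[< inI Tm Tp t >] then x t else y t.
have zx t : inI Tm Tp t -> z t = x t by move=> /asboolP; rewrite /z => ->.
have zy t : inI Tm' Tp' t -> z t = y t.
  by move=> It; rewrite /z; case: asboolP => // /xy ->.
have cover t : inI (mine Tm Tm') (maxe Tp Tp') t -> inI Tm Tp t \/ inI Tm' Tp' t.
  rewrite /inI gt_min lt_max => /andP[h1 h2].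
  move: I0 I0'; rewrite /inI => /andP[a1 a2] /andP[b1 b2].
  have [t0t|tt0] := leP t0 t.
    rewrite (lt_le_trans a1) ?lee_fin// (lt_le_trans b1) ?lee_fin//=.
    by case/orP: h2 => ->; [left|right].
  rewrite (lt_trans _ a2) ?lte_fin// (lt_trans _ b2) ?lte_fin// !andbT.
  by case/orP: h1 => ->; [left|right].
have [] := maxx (mine Tm Tm') (maxe Tp Tp') z; last first.
- by move=> <- <-; rewrite ge_min le_max !lexx !orbT.
- by move=> t; exact: zx.
- move=> t /cover[It|It].
    apply: germ (solx _ It); have := inI_near It.
    by apply: filterS => s /zx.
  apply: germ (soly _ It); have := inI_near It.
  by apply: filterS => s /zy.
- by rewrite le_max lexx.
- by rewrite ge_min lexx.
Qed.

End Gluing.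

(** * A calculus of Lipschitz estimates *)

Section Closeness.
Variables (R : realType) (T : Type) (S : set T) (delta : T -> R).
Hypothesis delta_ge0 : forall t, S t -> 0 <= delta t.

(* Compositional form of local Lipschitz estimates: [u] and [v] evaluate the same
   expression at two bounded inputs that are O(delta) apart. *)
Definition close (V : normedModType R) (u v : T -> V) : Prop :=
  exists2 K : R, 0 <= K &
    forall t, S t -> [/\ `|u t| <= K, `|v t| <= K & `|u t - v t| <= K * delta t].

Lemma close_cst (V : normedModType R) (c : V) : close (fun=> c) (fun=> c).
Proof.
exists `|c| => // t St; split=> //.
by rewrite subrr normr0 mulr_ge0// delta_ge0.
Qed.

Lemma closeD (V : normedModType R) (u v u' v' : T -> V) : close u v -> close u' v' ->
  close (fun t => u t + u' t) (fun t => v t + v' t).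
Proof.
move=> [K K0 H] [K' K'0 H']; exists (K + K'); first exact: addr_ge0.
move=> t St; have [a1 a2 a3] := H _ St; have [b1 b2 b3] := H' _ St; split.
- by apply: le_trans (ler_normD _ _) _; exact: lerD.
- by apply: le_trans (ler_normD _ _) _; exact: lerD.
- rewrite mulrDl opprD addrACA.
  by apply: le_trans (ler_normD _ _) _; exact: lerD.
Qed.

Lemma closeN (V : normedModType R) (u v : T -> V) : close u v ->
  close (fun t => - u t) (fun t => - v t).
Proof.
move=> [K K0 H]; exists K => // t /H[a1 a2 a3].
by split; rewrite -?opprD normrN.
Qed.

Lemma closeB (V : normedModType R) (u v u' v' : T -> V) : close u v -> close u' v' ->
  close (fun t => u t - u' t) (fun t => v t - v' t).
Proof. by move=> h h'; apply: closeD => //; exact: closeN. Qed.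

Lemma close_sum (V : normedModType R) n (u v : 'I_n -> T -> V) :
  (forall i, close (u i) (v i)) ->
  close (fun t => \sum_i u i t) (fun t => \sum_i v i t).
Proof.
move=> H; elim: n u v H => [|n IH] u v H.
  have -> : (fun t => \sum_(i < 0) u i t) = (fun=> 0).
    by apply/funext => t; rewrite big_ord0.
  have -> : (fun t => \sum_(i < 0) v i t) = (fun=> 0).
    by apply/funext => t; rewrite big_ord0.
  exact: close_cst.
have -> : (fun t => \sum_(i < n.+1) u i t) =
    (fun t => u ord0 t + \sum_(i < n) u (lift ord0 i) t).
  by apply/funext => t; rewrite big_ord_recl.
have -> : (fun t => \sum_(i < n.+1) v i t) =
    (fun t => v ord0 t + \sum_(i < n) v (lift ord0 i) t).
  by apply/funext => t; rewrite big_ord_recl.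
by apply: closeD => //; exact: IH.
Qed.

Lemma close_mulmx m n p (u v : T -> 'M[R]_(m, n)) (u' v' : T -> 'M[R]_(n, p)) :
  close u v -> close u' v' ->
  close (fun t => u t *m u' t) (fun t => v t *m v' t).
Proof.
move=> [K K0 H] [K' K'0 H']; exists (2 * (n%:R * K * K')).
  by rewrite !mulr_ge0.
have nn : 0 <= n%:R * K * K' by rewrite !mulr_ge0.
have w (a b : R) (A : 'M[R]_(m, n)) (B : 'M[R]_(n, p)) :
    `|A| <= a -> `|B| <= b -> `|A *m B| <= n%:R * a * b.
  move=> ha hb; apply: le_trans (mulmx_norm_le _ _) _.
  by apply: ler_pM => //; rewrite ler_wpM2l.
move=> t St; have [a1 a2 a3] := H _ St; have [b1 b2 b3] := H' _ St; split.
- by apply: le_trans (w _ _ _ _ a1 b1) _; rewrite ler_peMl// ler1n.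
- by apply: le_trans (w _ _ _ _ a2 b2) _; rewrite ler_peMl// ler1n.
- have -> : u t *m u' t - v t *m v' t = (u t - v t) *m u' t + v t *m (u' t - v' t).
    by rewrite mulmxBl mulmxBr subrKA.
  apply: le_trans (ler_normD _ _) _.
  apply: le_trans (lerD (w _ _ _ _ a3 b1) (w _ _ _ _ a2 b3)) _.
  by rewrite le_eqVlt; apply/orP; left; apply/eqP; ring.
Qed.

Lemma closeM (u v u' v' : T -> R) : close u v -> close u' v' ->
  close (fun t => u t * u' t) (fun t => v t * v' t).
Proof.
move=> [K K0 H] [K' K'0 H']; exists (2 * (K * K')).
  by rewrite !mulr_ge0.
have nn : 0 <= K * K' by rewrite !mulr_ge0.
have w (a b A B : R) : `|A| <= a -> `|B| <= b -> `|A * B| <= a * b.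
  by move=> ha hb; rewrite normrM ler_pM.
move=> t St; have [a1 a2 a3] := H _ St; have [b1 b2 b3] := H' _ St; split.
- by apply: le_trans (w _ _ _ _ a1 b1) _; rewrite ler_peMl// ler1n.
- by apply: le_trans (w _ _ _ _ a2 b2) _; rewrite ler_peMl// ler1n.
- have -> : u t * u' t - v t * v' t = (u t - v t) * u' t + v t * (u' t - v' t).
    by ring.
  apply: le_trans (ler_normD _ _) _.
  apply: le_trans (lerD (w _ _ _ _ a3 b1) (w _ _ _ _ a2 b3)) _.
  by rewrite le_eqVlt; apply/orP; left; apply/eqP; ring.
Qed.

Lemma close_scale (V : normedModType R) (u v : T -> R) (u' v' : T -> V) :
  close u v -> close u' v' ->
  close (fun t => u t *: u' t) (fun t => v t *: v' t).
Proof.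
move=> [K K0 H] [K' K'0 H']; exists (2 * (K * K')).
  by rewrite !mulr_ge0.
have nn : 0 <= K * K' by rewrite !mulr_ge0.
have w (a b A : R) (B : V) : `|A| <= a -> `|B| <= b -> `|A *: B| <= a * b.
  by move=> ha hb; rewrite normrZ ler_pM.
move=> t St; have [a1 a2 a3] := H _ St; have [b1 b2 b3] := H' _ St; split.
- by apply: le_trans (w _ _ _ _ a1 b1) _; rewrite ler_peMl// ler1n.
- by apply: le_trans (w _ _ _ _ a2 b2) _; rewrite ler_peMl// ler1n.
- have -> : u t *: u' t - v t *: v' t = (u t - v t) *: u' t + v t *: (u' t - v' t).
    by rewrite scalerBl scalerBr subrKA.
  apply: le_trans (ler_normD _ _) _.
  apply: le_trans (lerD (w _ _ _ _ a3 b1) (w _ _ _ _ a2 b3)) _.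
  by rewrite le_eqVlt; apply/orP; left; apply/eqP; ring.
Qed.

Lemma linmx_bound m n (V : normedModType R) (l : {linear 'M[R]_(m, n) -> V}) :
  exists2 C : R, 0 <= C & forall M, `|l M| <= C * `|M|.
Proof.
exists (\sum_i \sum_j `|l (delta_mx i j)|).
  by apply: sumr_ge0 => i _; exact: sumr_ge0.
move=> M; rewrite {1}[M]matrix_sum_delta linear_sum mulr_suml.
rewrite (le_trans (ler_norm_sum _ _ _))// ler_sum// => i _.
rewrite linear_sum mulr_suml (le_trans (ler_norm_sum _ _ _))// ler_sum// => j _.
by rewrite linearZ normrZ mulrC ler_wpM2l// mx_entry_le.
Qed.

Lemma close_lin m n (V : normedModType R) (l : {linear 'M[R]_(m, n) -> V})
    (u v : T -> 'M[R]_(m, n)) : close u v ->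
  close (fun t => l (u t)) (fun t => l (v t)).
Proof.
move=> [K K0 H]; have [C C0 HC] := linmx_bound l.
exists (C * K); first exact: mulr_ge0.
move=> t /H[a1 a2 a3]; split.
- by apply: le_trans (HC _) _; rewrite ler_wpM2l.
- by apply: le_trans (HC _) _; rewrite ler_wpM2l.
- by rewrite -linearB; apply: le_trans (HC _) _; rewrite -mulrA ler_wpM2l.
Qed.

Lemma close_mx m n (u v : T -> 'M[R]_(m, n)) :
  (forall i j, close (fun t => u t i j) (fun t => v t i j)) -> close u v.
Proof.
move=> H.
have {H} /choice[K HK] : forall ij : 'I_m * 'I_n, exists K : R, 0 <= K /\
    forall t, S t -> [/\ `|u t ij.1 ij.2| <= K, `|v t ij.1 ij.2| <= K &
      `|u t ij.1 ij.2 - v t ij.1 ij.2| <= K * delta t].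
  by move=> [i j]; have [K K0 HK] := H i j; exists K.
have K0 ij : 0 <= K ij by case: (HK ij).
have Kle ij : K ij <= \sum_ij K ij.
  by rewrite (bigD1 ij)//= lerDl sumr_ge0.
have S0 : 0 <= \sum_ij K ij by exact: sumr_ge0.
exists (\sum_ij K ij) => // t St; split; apply: mx_norm_leP => //.
- by move=> i j; case: (HK (i, j)) => _ /(_ _ St)[/le_trans + _ _]; apply.
- by move=> i j; case: (HK (i, j)) => _ /(_ _ St)[_ /le_trans + _]; apply.
- by rewrite mulr_ge0// delta_ge0.
- move=> i j; case: (HK (i, j)) => _ /(_ _ St)[_ _ /le_trans +].
  by rewrite !mxE; apply; rewrite ler_wpM2r// delta_ge0.
Qed.

Lemma close_trmx m n (u v : T -> 'M[R]_(m, n)) : close u v ->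
  close (fun t => (u t)^T) (fun t => (v t)^T).
Proof. exact: (close_lin trmx). Qed.

Lemma close_mxtrace n (u v : T -> 'M[R]_n) : close u v ->
  close (fun t => \tr (u t)) (fun t => \tr (v t)).
Proof. exact: (close_lin (@mxtrace R n)). Qed.

(** From u^{-1} - v^{-1} = u^{-1} (v - u) v^{-1}. The inverses carry their own bound, because a
    bounded family of units can approach a singular matrix. *)
Lemma close_invmx n (u v : T -> 'M[R]_n) : close u v ->
  (forall t, S t -> u t \in unitmx) -> (forall t, S t -> v t \in unitmx) ->
  (exists K : R, forall t, S t -> `|invmx (u t)| <= K /\ `|invmx (v t)| <= K) ->
  close (fun t => invmx (u t)) (fun t => invmx (v t)).
Proof.
move=> [K K0 H] uu vu [K' H'].
exists (Num.max `|K'| (n%:R * (n%:R * `|K'| * K) * `|K'|)); first by rewrite le_max normr_ge0.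
move=> t St; have [a1 a2 a3] := H _ St; have [b1 b2] := H' _ St.
have b1' := le_trans b1 (ler_norm K'); have b2' := le_trans b2 (ler_norm K').
split; try by rewrite le_max (b1', b2').
have -> : invmx (u t) - invmx (v t) = invmx (u t) *m (v t - u t) *m invmx (v t).
  by rewrite mulmxBr mulmxBl mulVmx ?uu// mul1mx -mulmxA mulmxV ?vu// mulmx1.
apply: le_trans (mulmx_norm_le _ _) _.
apply: le_trans (_ : n%:R * (n%:R * `|K'| * (K * delta t)) * `|K'| <= _); last first.
  rewrite [X in X <= _](_ : _ = n%:R * (n%:R * `|K'| * K) * `|K'| * delta t); last by ring.
  by rewrite ler_wpM2r ?delta_ge0// le_max lexx orbT.
rewrite ler_pM ?mulr_ge0// ler_wpM2l//.
apply: le_trans (mulmx_norm_le _ _) _.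
by rewrite ler_pM ?mulr_ge0// ?ler_wpM2l// distrC.
Qed.

Lemma eq_close (V : normedModType R) (u v u' v' : T -> V) :
  u =1 u' -> v =1 v' -> close u v -> close u' v'.
Proof. by move=> /funext <- /funext <-. Qed.

End Closeness.

(** * Naturality of the tensors *)

Section BilinearGram.
Variables (R : realType) (d : nat).
Implicit Types (q : 'M[R]_d) (f : 'cV[R]_d -> 'cV[R]_d -> R).

Definition bilin f : Prop :=
  (forall c X Y Z, f (c *: X + Y) Z = c * f X Z + f Y Z) /\
  (forall c X Y Z, f Z (c *: X + Y) = c * f Z X + f Z Y).

Lemma mulmx_basisv m (A : 'M[R]_(m, d)) j : A *m basisv R j = col j A.
Proof. by rewrite colE. Qed.

Lemma cV_sum_basis (X : 'cV[R]_d) : X = \sum_i X i 0 *: basisv R i.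
Proof.
apply/colP => i; rewrite summxE (bigD1 i)//= big1 ?addr0.
  by rewrite !mxE !eqxx mulr1.
by move=> j ji; rewrite !mxE eq_sym (negbTE ji) mulr0.
Qed.

Lemma linear_sum_basis (V : lmodType R) (l : 'cV[R]_d -> V) :
  (forall c X Y, l (c *: X + Y) = c *: l X + l Y) ->
  forall X, l X = \sum_i X i 0 *: l (basisv R i).
Proof.
move=> ll X; have l0 : l 0 = 0.
  have := ll 1 0 0; rewrite scaler0 addr0 scale1r => /eqP.
  by rewrite -subr_eq0 opprD addrA subrr sub0r oppr_eq0 => /eqP.
rewrite {1}[X]cV_sum_basis.
elim/big_rec2: _ => [|i y1 y2 _ <-]; first exact: l0.
by rewrite ll.
Qed.

Lemma eq_mx_cV m (A B : 'M[R]_(m, d)) :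
  (forall Y : 'cV_d, A *m Y = B *m Y) -> A = B.
Proof.
move=> AB; apply/matrixP => i j; have := AB (basisv R j).
by rewrite !mulmx_basisv => /colP/(_ i); rewrite !mxE.
Qed.

Lemma form_basisv q i j : form q (basisv R i) (basisv R j) = q i j.
Proof.
by rewrite /form mulmx_basisv !mxE (bigD1 i)//= big1 ?addr0
  => [|k ki]; rewrite !mxE ?eqxx ?mul1r// (negbTE ki) mul0r.
Qed.

Lemma eq_form q q' : (forall X Y, form q X Y = form q' X Y) -> q = q'.
Proof. by move=> qq; apply/matrixP => i j; rewrite -!form_basisv. Qed.

Lemma bilin_form q : bilin (form q).
Proof.
by split=> c X Y Z; rewrite /form ?linearD ?linearZ/= ?mulmxDl ?mulmxDr ?mulmxDl
  -?scalemxAl -?scalemxAr -?scalemxAl !mxE.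
Qed.

Lemma gram_form f : bilin f -> forall X Y, form (gram f) X Y = f X Y.
Proof.
move=> [fl fr] X Y.
rewrite (@linear_sum_basis R^o (fun X => f X Y)); last by move=> c X1 X2; exact: fl.
rewrite (@linear_sum_basis R^o (fun X => form (gram f) X Y)); last first.
  by move=> c X1 X2; case: (bilin_form (gram f)) => h _; exact: h.
apply: eq_bigr => i _; congr (_ *: _).
rewrite (@linear_sum_basis R^o (f (basisv R i))); last by move=> c X1 X2; exact: fr.
rewrite (@linear_sum_basis R^o (form (gram f) (basisv R i))); last first.
  by move=> c X1 X2; case: (bilin_form (gram f)) => _ h; exact: h.
by apply: eq_bigr => j _; rewrite form_basisv mxE.
Qed.

Lemma form_congr q (h : 'M[R]_d) X Y :
  form (h^T *m q *m h) X Y = form q (h *m X) (h *m Y).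
Proof. by rewrite /form trmx_mul !mulmxA. Qed.

Lemma gram_congr f f' (h : 'M[R]_d) : bilin f' ->
  (forall X Y, f X Y = f' (h *m X) (h *m Y)) ->
  gram f = h^T *m gram f' *m h.
Proof.
move=> bf ff; have bf1 : bilin f.
  have [fl fr] := bf.
  by split=> c X1 X2 Z; rewrite !ff mulmxDr -scalemxAr ?fl ?fr.
apply: eq_form => X Y; rewrite gram_form//.
by rewrite form_congr gram_form.
Qed.

Lemma posdef_unitmx q : (forall X, X != 0 -> 0 < form q X X) -> q \in unitmx.
Proof.
move=> pq; rewrite -unitmx_tr -row_free_unit -kermx_eq0; apply/eqP/row_matrixP => i.
rewrite row0; apply/eqP/negPn/negP => ki0.
have := pq (row i (kermx q^T))^T; rewrite trmx_eq0 => /(_ ki0).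
have /sub_kermxP k0 := row_sub i (kermx q^T).
rewrite /form trmxK (_ : _ *m q *m _ = 0) ?mxE ?ltxx//.
by apply: trmx_inj; rewrite !trmx_mul trmxK mulmxA k0 mul0mx trmx0.
Qed.

End BilinearGram.

Section Naturality.
Variables (R : realType) (d : nat).
Implicit Types br : 'cV[R]_d -> 'cV[R]_d -> 'cV[R]_d.

Lemma bracketDl br : lie_bracket br ->
  forall c X Y Z, br (c *: X + Y) Z = c *: br X Z + br Y Z.
Proof. by case. Qed.

Lemma bracketDr br : lie_bracket br ->
  forall c X Y Z, br Z (c *: X + Y) = c *: br Z X + br Z Y.
Proof.
case=> hl _ hs _ c X Y Z.
by rewrite hs hl (hs X Z) (hs Y Z) opprD scalerN !opprK.
Qed.

Lemma adE br : lie_bracket br -> forall X Y, ad br X *m Y = br X Y.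
Proof.
move=> hb X Y.
rewrite (@linear_sum_basis _ _ _ (br X)); last by move=> *; exact: bracketDr.
rewrite {1}[Y]cV_sum_basis mulmx_sumr; apply: eq_bigr => i _.
rewrite -scalemxAr mulmx_basisv; congr (_ *: _).
by apply/colP => j; rewrite !mxE.
Qed.

Lemma adD br : lie_bracket br ->
  forall c X Y, ad br (c *: X + Y) = c *: ad br X + ad br Y.
Proof.
move=> hb c X Y; apply: eq_mx_cV => Z.
by rewrite mulmxDl -scalemxAl !adE// bracketDl.
Qed.

Variables (br br' : 'cV[R]_d -> 'cV[R]_d -> 'cV[R]_d).
Hypotheses (hbr : lie_bracket br) (hbr' : lie_bracket br').

Lemma bilin_koszul (g : 'M[R]_d) X : bilin (fun Z Y => koszul br g X Y Z).
Proof.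
have [fl fr] := bilin_form g.
split=> c X1 X2 Z; rewrite /koszul !(bracketDl hbr) !(bracketDr hbr) !fl ?fr; ring.
Qed.

Lemma koszulDl (g : 'M[R]_d) c X1 X2 Y Z :
  koszul br g (c *: X1 + X2) Y Z = c * koszul br g X1 Y Z + koszul br g X2 Y Z.
Proof.
have [fl fr] := bilin_form g.
by rewrite /koszul !(bracketDl hbr) !(bracketDr hbr) !fl ?fr; ring.
Qed.

Lemma nabla_gram (g : 'M[R]_d) X :
  nabla br g X = invmx g *m gram (fun Z Y => koszul br g X Y Z).
Proof. by congr (_ *m _); apply/matrixP => i j; rewrite !mxE. Qed.

Lemma nablaD (g : 'M[R]_d) c X Y :
  nabla br g (c *: X + Y) = c *: nabla br g X + nabla br g Y.
Proof.
rewrite /nabla scalemxAr -mulmxDr; congr (_ *m _); apply/matrixP => i j.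
by rewrite !mxE koszulDl.
Qed.

Lemma riemannDl (g : 'M[R]_d) c X1 X2 Y :
  riemann br g (c *: X1 + X2) Y = c *: riemann br g X1 Y + riemann br g X2 Y.
Proof.
rewrite /riemann (bracketDl hbr) !nablaD mulmxDl mulmxDr -scalemxAl -scalemxAr.
rewrite !scalerBr !opprD; apply/matrixP => i j; rewrite !mxE; ring.
Qed.

Lemma riemannDr (g : 'M[R]_d) c X1 X2 Y :
  riemann br g Y (c *: X1 + X2) = c *: riemann br g Y X1 + riemann br g Y X2.
Proof.
rewrite /riemann (bracketDr hbr) !nablaD mulmxDl mulmxDr -scalemxAl -scalemxAr.
rewrite !scalerBr !opprD; apply/matrixP => i j; rewrite !mxE; ring.
Qed.

Definition ricci_form (g : 'M[R]_d) (X Y : 'cV[R]_d) : R :=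
  \sum_(k < d) (riemann br g (basisv R k) X *m Y) k 0.

Lemma ricciE (g : 'M[R]_d) : ricci br g = gram (ricci_form g).
Proof. by []. Qed.

Lemma bilin_ricci (g : 'M[R]_d) : bilin (ricci_form g).
Proof.
split=> c X Y Z; rewrite /ricci_form mulr_sumr -big_split/=; apply: eq_bigr => k _.
  by rewrite riemannDr mulmxDl -scalemxAl !mxE.
by rewrite mulmxDr -scalemxAr !mxE.
Qed.

Lemma ricci_form_trace (g : 'M[R]_d) X Y (M : 'M[R]_d) :
  (forall Z, riemann br g Z X *m Y = M *m Z) -> ricci_form g X Y = \tr M.
Proof.
by move=> H; apply: eq_bigr => k _; rewrite H mulmx_basisv mxE.
Qed.

(** Realising Z |-> R(Z, X) Y by a matrix turns the basis sum in the Ricci form into a trace, which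
    is invariant under conjugation. *)
Lemma riemann_mx (g : 'M[R]_d) X Y :
  exists M : 'M[R]_d, forall Z, riemann br g Z X *m Y = M *m Z.
Proof.
exists (\matrix_(i, j) (riemann br g (basisv R j) X *m Y) i 0) => Z.
rewrite (@linear_sum_basis _ _ _ (fun Z => riemann br g Z X *m Y)); last first.
  by move=> c X1 X2; rewrite riemannDl mulmxDl -scalemxAl.
rewrite {2}[Z]cV_sum_basis mulmx_sumr; apply: eq_bigr => i _.
rewrite -scalemxAr mulmx_basisv; congr (_ *: _).
by apply/colP => j; rewrite !mxE.
Qed.

Definition chern_ricci_form (w g : 'M[R]_d) (X Y : 'cV[R]_d) : R :=
  - 2^-1 * \tr (Jop w g *m ad br (br X Y)) + 2^-1 * \tr (ad br (Jop w g *m br X Y)).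

Lemma chern_ricciE w g : chern_ricci br w g = gram (chern_ricci_form w g).
Proof. by []. Qed.

Lemma bilin_chern_ricci (w g : 'M[R]_d) : bilin (chern_ricci_form w g).
Proof.
split=> c X Y Z; rewrite /chern_ricci_form ?(bracketDl hbr) ?(bracketDr hbr).
  rewrite mulmxDr -scalemxAr !(adD hbr) mulmxDr -scalemxAr !mxtraceD !mxtraceZ; ring.
by rewrite mulmxDr -scalemxAr !(adD hbr) mulmxDr -scalemxAr !mxtraceD !mxtraceZ; ring.
Qed.

End Naturality.

(** * Transport of structures along an isomorphism of Lie algebras *)

Section Transport.
Variables (R : realType) (d : nat) (br br' : 'cV[R]_d -> 'cV[R]_d -> 'cV[R]_d).
Hypotheses (hbr : lie_bracket br) (hbr' : lie_bracket br').
Variables (h w g : 'M[R]_d).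
Hypothesis hu : h \in unitmx.
Hypothesis hom : forall X Y, br' (h *m X) (h *m Y) = h *m br X Y.
Local Notation cong q := (h^T *m q *m h).
Local Notation conj M := (invmx h *m M *m h).

Lemma conjK M : h *m conj M *m invmx h = M.
Proof. by rewrite !mulmxA mulmxV// mul1mx -mulmxA mulmxV// mulmx1. Qed.

Lemma conjM (M N : 'M[R]_d) : conj M *m conj N = conj (M *m N).
Proof. by rewrite !mulmxA mulmxK. Qed.

Lemma conj_scalar c : conj (c%:M) = c%:M :> 'M[R]_d.
Proof. by rewrite mul_mx_scalar -scalemxAl mulVmx// scalemx1. Qed.

Lemma conjD (M N : 'M[R]_d) : conj M + conj N = conj (M + N).
Proof. by rewrite mulmxDr mulmxDl. Qed.

Lemma conjB (M N : 'M[R]_d) : conj M - conj N = conj (M - N).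
Proof. by rewrite mulmxBr mulmxBl. Qed.

Lemma conjZ c (M : 'M[R]_d) : c *: conj M = conj (c *: M).
Proof. by rewrite -scalemxAr -scalemxAl. Qed.

Lemma conj_inj (M N : 'M[R]_d) : conj M = conj N -> M = N.
Proof. by move=> e; rewrite -[M]conjK e conjK. Qed.

Lemma mxtrace_conj (M : 'M[R]_d) : \tr (conj M) = \tr M.
Proof. by rewrite mxtrace_mulC mulmxA mulmxV// mul1mx. Qed.

Lemma hT_unit : h^T \in unitmx. Proof. by rewrite unitmx_tr. Qed.

Lemma invmx_congr (b : 'M[R]_d) : b \in unitmx ->
  invmx (cong b) = invmx h *m invmx b *m invmx h^T.
Proof.
move=> bu; have cu : cong b \in unitmx by rewrite !unitmx_mul hT_unit bu hu.
apply: (can_inj (mulKmx cu)); rewrite mulmxV// !mulmxA.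
by rewrite !mulmxK ?mulmxV ?hT_unit.
Qed.

Lemma endo_of_congr (b q : 'M[R]_d) : b \in unitmx ->
  endo_of (cong b) (cong q) = conj (endo_of b q).
Proof.
move=> bu; rewrite /endo_of invmx_congr// !mulmxA mulmxK// !trmx_mul.
by rewrite trmx_inv trmxK !mulmxA.
Qed.

Lemma ad_transport X : ad br X = conj (ad br' (h *m X)).
Proof.
apply: eq_mx_cV => Y; rewrite -!mulmxA !adE// hom.
by rewrite mulKmx.
Qed.

Section Metric.
Hypothesis gu : g \in unitmx.

Lemma Jop_transport : Jop (cong w) (cong g) = conj (Jop w g).
Proof. exact: endo_of_congr. Qed.

Lemma nabla_transport X : nabla br (cong g) X = conj (nabla br' g (h *m X)).
Proof.
rewrite !nabla_gram invmx_congr//.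
rewrite (@gram_congr _ _ _ (fun Z Y => koszul br' g (h *m X) Y Z) h).
- by rewrite !mulmxA mulmxKV ?hT_unit.
- exact: bilin_koszul.
- by move=> Z Y; rewrite /koszul !form_congr !hom.
Qed.

Lemma riemann_transport X Y :
  riemann br (cong g) X Y = conj (riemann br' g (h *m X) (h *m Y)).
Proof. by rewrite /riemann !nabla_transport !conjM !conjB hom. Qed.

Lemma ricci_transport : ricci br (cong g) = cong (ricci br' g).
Proof.
rewrite !ricciE; apply: gram_congr; first exact: bilin_ricci.
move=> X Y; have [M HM] := riemann_mx hbr' g (h *m X) (h *m Y).
rewrite (ricci_form_trace HM) -(mxtrace_conj M); apply: ricci_form_trace => Z.
by rewrite riemann_transport -!mulmxA HM.
Qed.

Lemma chern_ricci_transport :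
  chern_ricci br (cong w) (cong g) = cong (chern_ricci br' w g).
Proof.
rewrite !chern_ricciE; apply: gram_congr; first exact: bilin_chern_ricci.
move=> X Y; rewrite /chern_ricci_form Jop_transport hom !ad_transport !conjM.
rewrite !mxtrace_conj; congr (_ + _ * \tr (ad br' _)).
by rewrite !mulmxA mulmxV// mul1mx -!mulmxA.
Qed.

Lemma Ricop_transport : Ricop br (cong g) = conj (Ricop br' g).
Proof. by rewrite /Ricop ricci_transport endo_of_congr. Qed.

Lemma form_c_transport q :
  form_c (cong w) (cong g) (cong q) = cong (form_c w g q).
Proof.
rewrite /form_c Jop_transport !trmx_mul trmx_inv -!scalemxAr -!scalemxAl.
rewrite mulmxDr mulmxDl !mulmxA; congr (_ *: (_ + _)).
by rewrite mulmxKV ?hT_unit// mulmxK.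
Qed.

Lemma form_ac_transport q :
  form_ac (cong w) (cong g) (cong q) = cong (form_ac w g q).
Proof.
rewrite /form_ac Jop_transport !trmx_mul trmx_inv -!scalemxAr -!scalemxAl.
rewrite mulmxBr mulmxBl !mulmxA; congr (_ *: (_ - _)).
by rewrite mulmxKV ?hT_unit// mulmxK.
Qed.

Lemma endo_c_transport E :
  endo_c (cong w) (cong g) (conj E) = conj (endo_c w g E).
Proof. by rewrite /endo_c Jop_transport !conjM conjB conjZ. Qed.

Lemma endo_ac_transport E :
  endo_ac (cong w) (cong g) (conj E) = conj (endo_ac w g E).
Proof. by rewrite /endo_ac Jop_transport !conjM conjD conjZ. Qed.

Lemma adj_transport E : adj (cong g) (conj E) = conj (adj g E).
Proof.
rewrite /adj invmx_congr// !trmx_mul trmx_inv !mulmxA.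
by rewrite !mulmxKV ?hT_unit.
Qed.

Hypothesis wu : w \in unitmx.

Lemma Pop_transport : Pop br (cong w) (cong g) = conj (Pop br' w g).
Proof. by rewrite /Pop chern_ricci_transport endo_of_congr. Qed.

Lemma is_der_transport D : is_der br (conj D) <-> is_der br' D.
Proof.
have e1 X : conj D *m (invmx h *m X) = invmx h *m (D *m X).
  by rewrite -!mulmxA mulKVmx.
have hom' X Y : h *m br (invmx h *m X) (invmx h *m Y) = br' X Y.
  by rewrite -hom !mulKVmx.
split=> H X Y.
  have := H (invmx h *m X) (invmx h *m Y) => /(congr1 (mulmx h)).
  by rewrite mulmxDr !e1 !hom' -!mulmxA mulKVmx// hom'.
apply: (can_inj (mulKmx hu)); rewrite mulmxDr -!mulmxA mulKVmx// -!hom H.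
by rewrite !mulKVmx.
Qed.

End Metric.

Lemma almost_kahler_transport :
  almost_kahler br (cong w) (cong g) <-> almost_kahler br' w g.
Proof.
have cq q : cong q = 0 -> q = 0.
  move=> e; apply: (can_inj (mulKmx hT_unit)); apply: (can_inj (mulmxK hu)).
  by rewrite e mulmx0 mul0mx.
split; case=> [wT wu wc [gT gpos] JJ].
- have gpos' X : X != 0 -> 0 < form g X X.
    move=> X0; have := gpos (invmx h *m X); rewrite form_congr !mulmxA mulmxV// mul1mx.
    apply; apply/negP => /eqP e; move/negP: X0; apply; apply/eqP.
    by rewrite -[X](mulKVmx hu) e mulmx0.
  have gu := posdef_unitmx gpos'; split.
  + apply/eqP; rewrite -subr_eq0; apply/eqP/cq; rewrite mulmxBr mulmxBl.
    by rewrite -[w in X in _ - X]opprK mulmxN mulNmx opprK -wT !trmx_mul trmxK mulmxA subrr.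
  + by move: wu; rewrite !unitmx_mul => /andP[/andP[_ ->]].
  + move=> X Y Z; have := wc (invmx h *m X) (invmx h *m Y) (invmx h *m Z).
    by rewrite !form_congr -!hom !mulmxA !mulmxV// !mul1mx.
  + split=> //; apply/eqP; rewrite -subr_eq0; apply/eqP/cq; rewrite mulmxBr mulmxBl.
    by rewrite -[X in _ - X]gT !trmx_mul trmxK mulmxA subrr.
  + apply: conj_inj; rewrite -conjM -Jop_transport// JJ.
    by rewrite -scaleN1r -conjZ conj_scalar.
- have gu := posdef_unitmx gpos; split.
  + by rewrite !trmx_mul trmxK wT mulmxA mulmxN mulNmx.
  + by rewrite !unitmx_mul hT_unit wu hu.
  + by move=> X Y Z; rewrite !form_congr -!hom.
  + split; first by rewrite !trmx_mul trmxK gT mulmxA.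
    move=> X X0; rewrite form_congr; apply: gpos.
    apply/negP => /eqP e; move/negP: X0; apply; apply/eqP.
    by rewrite -[X](mulKmx hu) e mulmx0.
  + by rewrite Jop_transport// conjM JJ -scaleN1r -conjZ conj_scalar.
Qed.

Lemma soliton_equations_transport c D : g \in unitmx -> w \in unitmx ->
  [/\ is_der br (conj D),
      Pop br (cong w) (cong g) = c%:M + 2^-1 *: (conj D -
        Jop (cong w) (cong g) *m adj (cong g) (conj D) *m Jop (cong w) (cong g))
    & endo_c (cong w) (cong g) (Pop br (cong w) (cong g)) +
      endo_ac (cong w) (cong g) (Ricop br (cong g)) =
      c%:M + 2^-1 *: (conj D + adj (cong g) (conj D))] <->
  [/\ is_der br' D,
      Pop br' w g = c%:M + 2^-1 *: (D - Jop w g *m adj g D *m Jop w g)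
    & endo_c w g (Pop br' w g) + endo_ac w g (Ricop br' g) =
      c%:M + 2^-1 *: (D + adj g D)].
Proof.
move=> gu wu; have iD := is_der_transport D; rewrite Jop_transport// adj_transport// Pop_transport//.
rewrite Ricop_transport// endo_c_transport// endo_ac_transport// !conjM conjB conjZ.
rewrite -(conj_scalar c) !conjD conjZ conjD conj_scalar.
split=> -[/iD H1 H2 H3]; split=> //; try exact: conj_inj.
  by rewrite H2.
by rewrite H3.
Qed.

Lemma scf_soliton_transport :
  scf_soliton br (cong w) (cong g) <-> scf_soliton br' w g.
Proof.
rewrite /scf_soliton almost_kahler_transport.
have [ak|nak] := pselect (almost_kahler br' w g); last by split=> -[].
have [_ wu _ [_ /posdef_unitmx gu] _] := ak.
split=> -[_ [c [D H]]]; split=> //; exists c.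
  have eD : D = conj (h *m D *m invmx h) by rewrite -!mulmxA mulKmx// mulVmx// mulmx1.
  by exists (h *m D *m invmx h); apply/(soliton_equations_transport _ _ gu wu); rewrite -eD.
by exists (conj D); apply/soliton_equations_transport.
Qed.

Lemma algebraic_scf_soliton_transport :
  algebraic_scf_soliton br (cong w) (cong g) <-> algebraic_scf_soliton br' w g.
Proof.
rewrite /algebraic_scf_soliton almost_kahler_transport.
have [ak|nak] := pselect (almost_kahler br' w g); last by split=> -[].
have [_ wu _ [_ /posdef_unitmx gu] _] := ak.
rewrite Pop_transport// Ricop_transport// endo_ac_transport// conjD.
split=> -[_ [c [D [HD HE]]]]; split=> //; exists c.
  have eD : D = conj (h *m D *m invmx h) by rewrite -!mulmxA mulKmx// mulVmx// mulmx1.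
  exists (h *m D *m invmx h); rewrite eD in HD HE; split; first exact/is_der_transport.
  by apply: conj_inj; rewrite HE -(conj_scalar c) conjD conj_scalar.
exists (conj D); split; first exact/is_der_transport.
by rewrite HE -(conj_scalar c) conjD conj_scalar.
Qed.

End Transport.

(** * Tensors of almost abelian Lie algebras *)

Section DotProduct.
Variable R : realType.

Definition dot k (x y : 'cV[R]_k) : R := (x^T *m y) 0 0.

Lemma dotC k (x y : 'cV[R]_k) : dot x y = dot y x.
Proof. by rewrite /dot -[y^T *m x]trmxK trmx_mul trmxK [RHS]mxE. Qed.

Lemma dotDl k (x y z : 'cV[R]_k) : dot (x + y) z = dot x z + dot y z.
Proof. by rewrite /dot linearD mulmxDl mxE. Qed.

Lemma dotZl k c (x z : 'cV[R]_k) : dot (c *: x) z = c * dot x z.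
Proof. by rewrite /dot linearZ/= -scalemxAl mxE. Qed.

Lemma dotNl k (x z : 'cV[R]_k) : dot (- x) z = - dot x z.
Proof. by rewrite /dot linearN mulNmx mxE. Qed.

Lemma dotDr k (x y z : 'cV[R]_k) : dot z (x + y) = dot z x + dot z y.
Proof. by rewrite dotC dotDl !(dotC z). Qed.

Lemma dotZr k c (x z : 'cV[R]_k) : dot z (c *: x) = c * dot z x.
Proof. by rewrite dotC dotZl (dotC z). Qed.

Lemma dotNr k (x z : 'cV[R]_k) : dot z (- x) = - dot z x.
Proof. by rewrite dotC dotNl (dotC z). Qed.

Lemma dot0l k (x : 'cV[R]_k) : dot 0 x = 0.
Proof. by rewrite /dot trmx0 mul0mx mxE. Qed.

Lemma dot0r k (x : 'cV[R]_k) : dot x 0 = 0.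
Proof. by rewrite dotC dot0l. Qed.

Definition dotE := (dotDl, dotZl, dotNl, dotDr, dotZr, dotNr).

Lemma dot_mull k l (A : 'M[R]_(k, l)) x y : dot (A *m x) y = dot x (A^T *m y).
Proof. by rewrite /dot trmx_mul mulmxA. Qed.

Lemma dot_ge0 k (x : 'cV[R]_k) : 0 <= dot x x.
Proof. by rewrite /dot mxE sumr_ge0// => i _; rewrite mxE -expr2 sqr_ge0. Qed.

Lemma dot_eq0 k (x : 'cV[R]_k) : dot x x = 0 -> x = 0.
Proof.
rewrite /dot mxE => /eqP; rewrite psumr_eq0 => [/allP H|i _]; last first.
  by rewrite mxE -expr2 sqr_ge0.
apply/colP => i; have := H i (mem_index_enum _); rewrite !mxE -expr2 sqrf_eq0.
by move=> /eqP.
Qed.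

Lemma mul_trmx_dot k (x y : 'cV[R]_k) : x^T *m y = (dot x y)%:M.
Proof. exact: mx11_scalar. Qed.

Lemma mxtrace_outer k (x y : 'cV[R]_k) : \tr (x *m y^T) = dot y x.
Proof. by rewrite mxtrace_mulC mul_trmx_dot mxtrace_scalar. Qed.

Lemma mxtrace_antisym k (A : 'M[R]_k) : \tr A = - \tr A -> \tr A = 0.
Proof. move=> e; have : 2 * \tr A = 0 by rewrite mulr_natl mulr2n {1}e addNr.
by move=> /eqP; rewrite mulf_eq0 pnatr_eq0/= => /eqP. Qed.

Lemma mxtrace_skew_sym k (K S : 'M[R]_k) : K^T = - K -> S^T = S -> \tr (K *m S) = 0.
Proof.
move=> hK hS; apply: mxtrace_antisym.
by rewrite -{1}mxtrace_tr trmx_mul hK hS mulmxN linearN/= mxtrace_mulC.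
Qed.

End DotProduct.

(** * Levi-Civita connection and Ricci tensor for the metric [1%:M] *)

Section AlmostAbelian.
Variables (R : realType) (k : nat) (B : 'M[R]_k).
Implicit Types X Y Z : 'cV[R]_(k + 1).
Let S := sympart B.
Let K : 'M[R]_k := 2^-1 *: (B - B^T).

Lemma cV_npart_epart X : X = col_mx (npart X) (epart X)%:M.
Proof. by rewrite -mx11_scalar vsubmxK. Qed.

Lemma npart_col (x : 'cV[R]_k) (y : 'cV[R]_1) : npart (col_mx x y) = x.
Proof. exact: col_mxKu. Qed.

Lemma epart_col (x : 'cV[R]_k) (y : 'cV[R]_1) : epart (col_mx x y) = y 0 0.
Proof. by rewrite /epart col_mxKd. Qed.

Lemma form1_dot X Y : form 1%:M X Y = dot (npart X) (npart Y) + epart X * epart Y.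
Proof.
rewrite /form mulmx1 {1}[X]cV_npart_epart {1}[Y]cV_npart_epart tr_col_mx mul_row_col.
by rewrite mul_trmx_dot tr_scalar_mx -scalar_mxM mxE !mxE.
Qed.

Lemma form_block (P : 'M[R]_k) (q p : 'cV[R]_k) (r : R) X Y :
  form (block_mx P q p^T r%:M) X Y =
  dot (npart X) (P *m npart Y) + epart Y * dot (npart X) q
   + epart X * dot p (npart Y) + r * epart X * epart Y.
Proof.
rewrite /form {1}[X]cV_npart_epart {1}[Y]cV_npart_epart -mulmxA mul_block_col.
rewrite tr_col_mx mul_row_col tr_scalar_mx mulmxDr mulmxDr mul_trmx_dot.
rewrite mul_mx_scalar -scalemxAr mul_trmx_dot mul_trmx_dot.
rewrite -!scalar_mxM scale_scalar_mx !mxE/= !mulr1n; ring.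
Qed.

Lemma form_block0 (P : 'M[R]_k) (r : R) X Y :
  form (block_mx P 0 0 r%:M) X Y =
  dot (npart X) (P *m npart Y) + r * epart X * epart Y.
Proof.
have := form_block P 0 0 r X Y; rewrite trmx0 => ->.
by rewrite dot0l dot0r !mulr0 !addr0.
Qed.

Lemma ga_bracket_ad X :
  ad (ga_bracket B) X = block_mx (epart X *: B) (- (B *m npart X)) 0 0.
Proof.
apply: eq_mx_cV => Y; rewrite adE; last exact: ga_bracket_lie.
rewrite [Y in RHS]cV_npart_epart mul_block_col !mul0mx addr0 /ga_bracket.
by rewrite mul_mx_scalar -scalemxAl scalerN.
Qed.

Lemma scalar_mx0 j : 0%:M = 0 :> 'M[R]_j.
Proof. exact: raddf0. Qed.

(** By Koszul's formula e_{2n} acts on the ideal by the skew part K of [B], while the symmetric part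
    S is, up to sign, the second fundamental form of the ideal. *)
Lemma ga_nabla X : nabla (ga_bracket B) 1%:M X =
  block_mx (epart X *: K) (- (S *m npart X)) (S *m npart X)^T 0.
Proof.
rewrite nabla_gram invmx1 mul1mx; apply: eq_form => Z Y.
rewrite gram_form; last exact/bilin_koszul/ga_bracket_lie.
rewrite -(scalar_mx0 1) form_block /koszul !form1_dot /ga_bracket.
rewrite !npart_col !epart_col !mxE /S /K /sympart.
rewrite -!scalemxAl !mulmxBl !mulmxDl !dotE.
rewrite -(dot_mull B (npart Z) (npart Y)) -(dot_mull B (npart Z) (npart X)).
rewrite (dotC (B^T *m _)) -dot_mull !(dotC (npart Z)).
by field.
Qed.

(** The endomorphism Z |-> nabla_Z Y. It makes Z |-> R(Z, X) Y an explicit matrix whose trace can be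
    computed by blocks. *)
Definition nabla_fun Y : 'M[R]_(k + 1) :=
  block_mx (- (epart Y *: S)) (K *m npart Y) (S *m npart Y)^T 0.

Lemma ga_nablaE Z Y : nabla (ga_bracket B) 1%:M Z *m Y = nabla_fun Y *m Z.
Proof.
rewrite ga_nabla {1}[Y]cV_npart_epart [Z in RHS]cV_npart_epart !mul_block_col.
rewrite !mul0mx !addr0 !mul_mx_scalar; congr col_mx.
  by rewrite -[(epart Z *: K) *m _]scalemxAl mulNmx -[(epart Y *: S) *m _]scalemxAl scalerN addrC.
by rewrite !mul_trmx_dot dot_mull /S /sympart linearZ/= linearD/= trmxK [B^T + B]addrC dotC.
Qed.

Lemma sympart_tr : S^T = S.
Proof. by rewrite /S /sympart linearZ/= linearD/= trmxK addrC. Qed.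

Lemma sympart_trace : \tr S = \tr B.
Proof. by rewrite /S /sympart mxtraceZ mxtraceD mxtrace_tr; field. Qed.

Lemma skewpart_tr : K^T = - K.
Proof. by rewrite /K linearZ/= linearB/= trmxK -scalerN opprB. Qed.

Lemma sym_skew : B = S + K.
Proof. by rewrite /S /K /sympart; apply/matrixP => i j; rewrite !mxE; field. Qed.

Lemma sym_skew_tr : B^T = S - K.
Proof. by rewrite /S /K /sympart; apply/matrixP => i j; rewrite !mxE; field. Qed.

Lemma ga_ricci : ricci (ga_bracket B) 1%:M =
  block_mx (2^-1 *: mxbr B B^T - \tr B *: S) 0 0 (- \tr (S *m S))%:M.
Proof.
have brl := ga_bracket_lie B.
have curvE (N1 N2 N3 : 'M[R]_(k + 1)) (Y : 'cV[R]_(k + 1)) :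
    (N1 *m N2 - N2 *m N1 - N3) *m Y = N1 *m (N2 *m Y) - N2 *m (N1 *m Y) - N3 *m Y.
  by rewrite !mulmxBl !mulmxA.
have linE (N1 N2 N3 N4 N5 : 'M[R]_(k + 1)) (Y : 'cV[R]_(k + 1)) :
    (N1 - N2 *m N3 + N4 *m N5) *m Y = N1 *m Y - N2 *m (N3 *m Y) + N4 *m (N5 *m Y).
  by rewrite mulmxDl mulmxBl !mulmxA.
rewrite ricciE; apply: eq_form => X Y; rewrite gram_form; last exact: bilin_ricci.
(* In R(Z, X) Y = nabla_Z nabla_X Y - nabla_X nabla_Z Y - nabla_{[Z,X]} Y, the last term equals +
   nabla_{[X,Z]} Y, whence the factor [ad X]. *)
rewrite (@ricci_form_trace _ _ _ _ _ _
  (nabla_fun (nabla (ga_bracket B) 1%:M X *m Y) - nabla (ga_bracket B) 1%:M X *m nabla_fun Y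
   + nabla_fun Y *m ad (ga_bracket B) X)); last first.
  move=> Z; have [_ _ h _] := brl; have := h Z X; have := adE brl X Z.
  move: (ga_nablaE Z (nabla (ga_bracket B) 1%:M X *m Y)) (ga_nablaE Z Y).
  move: (ga_nablaE (ga_bracket B Z X) Y).
  rewrite /riemann; move: (nabla _ _ Z) (nabla _ _ X) (nabla _ _ (ga_bracket B Z X)) (ad _ X).
  move: (ga_bracket B Z X) (ga_bracket B X Z) (nabla_fun Y) => c c' NY NZ NX Nc aX.
  move: (nabla_fun (NX *m Y)) => NXY.
  by rewrite curvE linE => -> -> -> -> ->; rewrite mulmxN opprK.
have SK0 : \tr (S *m K) = 0 by rewrite mxtrace_mulC mxtrace_skew_sym// ?skewpart_tr ?sympart_tr.
have e1 : epart (nabla (ga_bracket B) 1%:M X *m Y) = dot (npart X) (S *m npart Y).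
  rewrite ga_nabla {1}[Y]cV_npart_epart mul_block_col epart_col mul0mx addr0.
  by rewrite mul_trmx_dot dot_mull sympart_tr mxE mulr1n.
rewrite !mxtraceD linearN/= {1}/nabla_fun mxtrace_block linearN/= mxtraceZ e1 sympart_trace.
rewrite mxtrace0 addr0 ga_nabla /nabla_fun ga_bracket_ad !mulmx_block !mxtrace_block.
rewrite form_block0.
have := sym_skew; have := sym_skew_tr; have := SK0; have := sympart_tr; have := skewpart_tr.
move: (npart X) (npart Y) (epart X) (epart Y) S K.
clear=> x y s u S K KT ST SK BT BE.
rewrite !mul0mx !mulmx0 !addr0.
rewrite ![\tr (_ *m _ + _)]mxtraceD.
have -> : \tr (s *: K *m - (u *: S)) = 0.
  by rewrite mulmxN linearN/= -scalemxAl -scalemxAr !mxtraceZ (mxtrace_mulC K) SK !mulr0 oppr0.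
have -> : \tr (- (S *m x) *m (S *m y)^T) = - dot x (S *m (S *m y)).
  by rewrite mulNmx linearN/= mxtrace_outer dotC dot_mull ST.
have -> : \tr ((S *m x)^T *m (K *m y)) = dot x (S *m (K *m y)).
  by rewrite mul_trmx_dot mxtrace_scalar dot_mull ST.
have -> : \tr ((S *m y)^T *m - (B *m x)) = - dot x (B^T *m (S *m y)).
  by rewrite mulmxN linearN/= mul_trmx_dot mxtrace_scalar dotC dot_mull.
have -> : \tr (- (u *: S) *m (s *: B)) = - (u * (s * \tr (S *m S))).
  by rewrite mulNmx linearN/= -scalemxAl -scalemxAr !mxtraceZ BE mulmxDr mxtraceD SK addr0.
have -> : 2^-1 *: mxbr B B^T = K *m S - S *m K.
  rewrite /mxbr BT BE !(mulmxDr, mulmxDl, mulmxN, mulNmx).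
  move: (S *m S) (S *m K) (K *m S) (K *m K) => a b c d.
  by apply/matrixP => i j; rewrite !mxE; field.
rewrite BT !mulmxBl -!scalemxAl -!mulmxA !dotE.
move: (dot x (S *m y)) (dot x (S *m (S *m y))) (dot x (S *m (K *m y))) (dot x (K *m (S *m y))).
by move: (\tr B) (\tr (S *m S)) => a b c d e f; ring.
Qed.

End AlmostAbelian.

(** * Chern-Ricci form and operator *)

Section ComplexStructure.
Variables (R : realType) (k : nat) (B Jn : 'M[R]_k) (f : 'cV[R]_k) (w : 'M[R]_(k + 1)).
Let J : 'M[R]_(k + 1) := block_mx Jn (- f) f^T 0.
Hypotheses (wJ : w^T = J) (wT : w^T = - w) (JJ : J *m J = - 1%:M).

Lemma Jop1 : Jop w 1%:M = J.
Proof. by rewrite /Jop /endo_of invmx1 mulmx1. Qed.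

Lemma Jop_tr : J^T = - J.
Proof. by rewrite -{2}wJ wT opprK -wJ trmxK. Qed.

Lemma invmx_w : invmx w = J.
Proof.
have wE : w = - J by rewrite -wJ wT opprK.
have wu : w \in unitmx.
  by have /mulmx1_unit[] : w *m J = 1%:M by rewrite wE mulNmx JJ opprK.
by apply: (can_inj (mulKmx wu)); rewrite mulmxV// wE mulNmx JJ opprK.
Qed.

(** Brackets vanish on the ideal, so the Chern-Ricci form only pairs the ideal with e_{2n}. This
    vector represents that pairing; here f = -J e_{2n}. *)
Definition chern_covector : 'cV[R]_k :=
  2^-1 *: (B^T *m (B^T *m f) + \tr B *: (B^T *m f)).
Let q := chern_covector.

Lemma ga_chern_ricci :
  chern_ricci (ga_bracket B) w 1%:M = block_mx 0 (- q) q^T 0.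
Proof.
have brl := ga_bracket_lie B.
rewrite chern_ricciE; apply: eq_form => X Y; rewrite gram_form; last exact: bilin_chern_ricci.
rewrite -(scalar_mx0 R 1) form_block /chern_ricci_form Jop1 !ga_bracket_ad.
rewrite mulmx_block !mxtrace_block !mulmx0 !addr0 mxtrace0 addr0 /ga_bracket.
rewrite npart_col epart_col mxE scale0r mulmx0 mxtrace0 add0r.
rewrite mul_block_col !mulmx0 !addr0 epart_col mxtraceZ mulmxN linearN/=.
rewrite !mul_trmx_dot mxtrace_scalar mxE mulr1n.
move: (npart X) (npart Y) (epart X) (epart Y) => x y s u.
rewrite mulmxBr -!scalemxAr !dotE mul0mx dot0r (dotC x (B^T *m f)) (dotC x (B^T *m (B^T *m f))).
by rewrite !dot_mull !trmxK eqxx mulr1n; field.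
Qed.

Lemma ga_Pop : Pop (ga_bracket B) w 1%:M =
  block_mx (- (f *m q^T)) (- (Jn *m q)) 0 (- (f^T *m q)).
Proof.
rewrite /Pop /endo_of invmx_w ga_chern_ricci trmx_mul Jop_tr tr_block_mx.
rewrite !trmx0 trmxK linearN/= mulNmx mulmx_block !mulmx0 !mul0mx !add0r !addr0.
by rewrite mulNmx mulmxN opprK opp_block_mx oppr0.
Qed.

(** This is the skewness of the Chern-Ricci form; it makes P^c the symmetric part of P. *)
Lemma Pop_tr : - (J *m Pop (ga_bracket B) w 1%:M *m J) = (Pop (ga_bracket B) w 1%:M)^T.
Proof.
have pT : (chern_ricci (ga_bracket B) w 1%:M)^T = - chern_ricci (ga_bracket B) w 1%:M.
  rewrite ga_chern_ricci tr_block_mx opp_block_mx !trmx0 trmxK [(- q)^T]linearN/= opprK.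
  by rewrite !oppr0.
rewrite /Pop /endo_of invmx_w trmxK trmx_mul Jop_tr pT.
move: (chern_ricci _ _ _) J JJ => p J' JJ'.
by rewrite !(mulNmx, mulmxN) !opprK mulmxA JJ' !mulNmx mul1mx opprK.
Qed.

End ComplexStructure.

(** * Frobenius norm, commutators and derivations *)

Section SquareNorm.
Variables (R : realType) (k : nat).
Implicit Types A B K D M : 'M[R]_k.

Lemma sqnorm_sum A : sqnorm A = \sum_i \sum_j A i j ^+ 2.
Proof.
by apply: eq_bigr => i _; rewrite mxE; apply: eq_bigr => j _; rewrite mxE expr2.
Qed.

Lemma sqnorm_ge0 A : 0 <= sqnorm A.
Proof. by rewrite sqnorm_sum; do 2 apply: sumr_ge0 => ? _; exact: sqr_ge0. Qed.

Lemma sqnorm_eq0 A : (sqnorm A == 0) = (A == 0).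
Proof.
apply/eqP/eqP => [|->]; last by rewrite /sqnorm mul0mx mxtrace0.
rewrite sqnorm_sum => /eqP; rewrite psumr_eq0 => [/allP H|i _]; last first.
  by apply: sumr_ge0 => j _; exact: sqr_ge0.
apply/matrixP => i j; have := H i (mem_index_enum _); rewrite /= psumr_eq0 => [/allP H'|l _].
  by have := H' j (mem_index_enum _); rewrite /= sqrf_eq0 mxE => /eqP.
exact: sqr_ge0.
Qed.

Lemma sqnorm_gt0 A : A != 0 -> 0 < sqnorm A.
Proof. by rewrite -sqnorm_eq0 lt_def sqnorm_ge0 andbT. Qed.

Lemma mxbr_tr A B : (mxbr A B)^T = mxbr B^T A^T.
Proof. by rewrite /mxbr linearB/= !trmx_mul. Qed.

Lemma mxbrC A B : mxbr A B = - mxbr B A.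
Proof. by rewrite /mxbr opprB. Qed.

Lemma mxbr_self_tr_sym A : (mxbr A A^T)^T = mxbr A A^T.
Proof. by rewrite mxbr_tr trmxK. Qed.

Lemma mxtrace_mxbr A B M : \tr (mxbr A B *m M) = \tr (A *m mxbr B M).
Proof.
rewrite /mxbr mulmxBl mulmxBr !linearB/= !mulmxA; congr (_ - _).
by rewrite -[B *m A *m M]mulmxA mxtrace_mulC.
Qed.

Lemma mxbr0_mxtrace A B : \tr (mxbr A B) = 0.
Proof. by rewrite /mxbr linearB/= mxtrace_mulC subrr. Qed.

Lemma mxtrace_self_mxbr A : \tr (A *m mxbr A A^T) = 0.
Proof. by rewrite -mxtrace_mxbr /mxbr subrr mul0mx mxtrace0. Qed.

Lemma mxtrace_mxbr_sq A (M := mxbr A A^T) : \tr (M *m M) = sqnorm M.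
Proof. by rewrite /sqnorm mxbr_self_tr_sym. Qed.

(* Infinitesimal invariance of [A |-> |[A, A^T]|^2] under conjugation by O(k). *)
Lemma mxtrace_skew_mxbr A K : K^T = - K ->
  \tr (mxbr (mxbr A A^T) A *m (mxbr K A)^T) = 0.
Proof.
move=> hK; set M := mxbr A A^T.
have MT : M^T = M by exact: mxbr_self_tr_sym.
have e1 : (mxbr K A)^T = mxbr K A^T.
  by rewrite mxbr_tr hK /mxbr mulmxN mulNmx opprK addrC.
rewrite e1 mxtrace_mxbr.
have e2 : (mxbr A (mxbr K A^T))^T = mxbr (mxbr K A) A^T.
  by rewrite mxbr_tr -e1 trmxK.
have e3 : mxbr K M = mxbr (mxbr K A) A^T + mxbr A (mxbr K A^T).
  rewrite /M /mxbr !mulmxBl !mulmxBr !mulmxA.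
  move: (K *m A *m A^T) (A *m K *m A^T) => a b.
  move: (A^T *m K *m A) (A^T *m A *m K) (A *m A^T *m K) (K *m A^T *m A) (A *m K *m A^T).
  by move=> c d e f g; apply/matrixP => i j; rewrite !mxE; ring.
have e4 : \tr (M *m mxbr K M) = 0.
  by rewrite mxtrace_mulC mxtrace_mxbr /mxbr subrr mulmx0 mxtrace0.
have e5 : \tr (M *m mxbr (mxbr K A) A^T) = \tr (M *m mxbr A (mxbr K A^T)).
  by rewrite -e2 -{1}MT -trmx_mul mxtrace_tr mxtrace_mulC.
move: e4; rewrite e3 mulmxDr linearD/= e5 => /eqP.
by rewrite -mulr2n mulrn_eq0/= => /eqP.
Qed.

Lemma derivation_power (D B : 'M[R]_k) d : mxbr D B = d *: B ->
  forall j, mxbr D (B ^+ j) = (j%:R * d) *: B ^+ j.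
Proof.
move=> DB; elim=> [|j IH].
  by rewrite expr0 mul0r scale0r /mxbr mulmx1 mul1mx subrr.
have -> : mxbr D (B ^+ j.+1) = mxbr D B *m B ^+ j + B *m mxbr D (B ^+ j).
  by rewrite exprS -!mulmxE /mxbr mulmxBl mulmxBr !mulmxA subrKA.
rewrite DB IH -scalemxAl -scalemxAr -scalerDl exprS; congr (_ *: _).
by rewrite -natr1; ring.
Qed.

(** By the Leibniz rule [D, .] maps B^j to j d B^j. Its operator norm is at most [N], so B^j = 0
    once j |d| > N. *)
Lemma derivation_nilpotent (D B : 'M[R]_k) d : d != 0 -> mxbr D B = d *: B ->
  nilpotent_mx B.
Proof.
move=> d0 /derivation_power H.
pose N := 2 * (k%:R * `|D|).
have [j jN] : exists j : nat, N < j%:R * `|d|.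
  exists (Num.bound (N / `|d|)); rewrite -ltr_pdivrMr ?normr_gt0//.
  by apply: archi_boundP; rewrite divr_ge0// !mulr_ge0.
exists j; apply/eqP; rewrite -normr_eq0 eq_le normr_ge0 andbT leNgt.
apply/negP => Bj0.
have : `|mxbr D (B ^+ j)| <= N * `|B ^+ j|.
  apply: le_trans (ler_normB _ _) _.
  apply: le_trans (lerD (mulmx_norm_le _ _) (mulmx_norm_le _ _)) _.
  by rewrite le_eqVlt; apply/orP; left; apply/eqP; rewrite /N; ring.
rewrite H normrZ normrM normr_nat ler_pM2r//.
by rewrite leNgt jN.
Qed.

End SquareNorm.

(** * The standard structure [omega J1], [1%:M] *)

Section StandardStructure.
Variables (R : realType) (m : nat) (J1 : 'M[R]_m).
Hypotheses (J1T : J1^T = - J1) (J1J1 : J1 *m J1 = - 1%:M).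
Let f : 'cV[R]_(1 + m) := col_mx 1%:M 0.
Let Jn : 'M[R]_(1 + m) := block_mx 0 0 0 J1.
Let w := omega J1.
Let J : 'M[R]_(1 + m + 1) := block_mx Jn (- f) f^T 0.

Lemma omega_tr : w^T = J.
Proof.
rewrite /w /omega /J /Jn /f tr_block_mx !trmx0 tr_block_mx !trmx0 trmxK.
by rewrite tr_col_mx tr_row_mx opp_col_mx trmx0 oppr0 linearN/= trmx1 trmx0.
Qed.

Lemma omega_skew : w^T = - w.
Proof.
rewrite omega_tr /w /omega /J /Jn /f J1T opp_block_mx opp_block_mx !oppr0 opprK.
by rewrite opp_row_mx opprK oppr0 tr_col_mx trmx0 trmx1.
Qed.

Lemma Jn_f : Jn *m f = 0.
Proof. by rewrite /Jn /f mul_block_col !mul0mx mulmx0 !addr0 col_mx0. Qed.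

Lemma f_Jn : f^T *m Jn = 0.
Proof. by rewrite /Jn /f tr_col_mx mul_row_block !mulmx0 trmx0 mul0mx !addr0 row_mx0. Qed.

Lemma f_f : f^T *m f = 1%:M.
Proof. by rewrite /f tr_col_mx mul_row_col !mulmx0 trmx1 mulmx1 addr0. Qed.

Lemma ff_block : f *m f^T = block_mx 1%:M 0 0 0.
Proof. by rewrite /f tr_col_mx mul_col_row trmx0 trmx1 !mulmx0 !mul0mx mulmx1. Qed.

Lemma Jn_Jn : Jn *m Jn = f *m f^T - 1%:M.
Proof.
rewrite ff_block (scalar_mx_block 1) opp_block_mx add_block_mx !oppr0 !addr0 subrr.
by rewrite /Jn mulmx_block !mulmx0 !mul0mx !add0r J1J1.
Qed.

Lemma J_J : J *m J = - 1%:M.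
Proof.
rewrite /J mulmx_block !mulmxN !mulNmx Jn_f f_Jn f_f Jn_Jn !mulmx0 mul0mx !addr0 oppr0.
rewrite addrAC subrr sub0r.
by rewrite addr0 (scalar_mx_block (1 + m) 1) opp_block_mx !oppr0.
Qed.

Let Jop1E : Jop w 1%:M = J := Jop1 omega_tr.

Lemma form1_pos d (X : 'cV[R]_d) : X != 0 -> 0 < form 1%:M X X.
Proof.
move=> X0; rewrite /form mulmx1 -/(dot X X) lt_def dot_ge0 andbT.
by apply/negP => /eqP/dot_eq0 => e; rewrite e eqxx in X0.
Qed.

Section StandardTensors.
Variable B : 'M[R]_(1 + m).
Let P := Pop (ga_bracket B) w 1%:M.
Let q := chern_covector B f.
Let Ric := Ricop (ga_bracket B) 1%:M.
Let Rn := 2^-1 *: mxbr B B^T - \tr B *: sympart B.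
Let r := - \tr (sympart B *m sympart B).

(** Closedness is decided on two vectors of the ideal and e_{2n}, where it says that (x, y) |-> <B
    x, Jn y> is symmetric. *)
Lemma standard_almost_kahler : Jn *m B = - (B^T *m Jn) ->
  almost_kahler (ga_bracket B) w 1%:M.
Proof.
move=> JB; have wE : w = - J by rewrite -omega_tr omega_skew opprK.
split.
- exact: omega_skew.
- by have /mulmx1_unit[] : w *m J = 1%:M by rewrite wE mulNmx J_J opprK.
- have fw X Y : form w X Y = - dot (npart X) (Jn *m npart Y)
      + epart Y * dot f (npart X) - epart X * dot f (npart Y).
    rewrite wE /J opp_block_mx opprK oppr0 -(scalar_mx0 R 1).
    rewrite (_ : - f^T = (- f)^T); last by rewrite linearN.
    by rewrite form_block mulNmx !dotE (dotC _ f); ring.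
  have JT x y : dot x (Jn *m y) = - dot y (Jn *m x).
    rewrite dotC dot_mull /Jn tr_block_mx !trmx0 J1T.
    rewrite (_ : block_mx _ _ _ _ = - Jn); last by rewrite opp_block_mx !oppr0.
    by rewrite mulNmx dotNr.
  move=> X Y Z; rewrite !fw /ga_bracket !npart_col !epart_col !mxE.
  move: (npart X) (npart Y) (npart Z) (epart X) (epart Y) (epart Z) => x y z s u t.
  have BJ a b : dot (B *m a) (Jn *m b) = dot (B *m b) (Jn *m a).
    rewrite dot_mull mulmxA (_ : B^T *m Jn = - (Jn *m B)); last by rewrite JB opprK.
    by rewrite mulNmx dotNr -[Jn *m B *m b]mulmxA (JT a) opprK.
  rewrite !dotE (BJ z x) (BJ z y) (BJ y x); ring.
- by split; [rewrite trmx1|exact: form1_pos].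
- by rewrite Jop1E J_J.
Qed.

Let PT : - (J *m P *m J) = P^T.
Proof. exact: Pop_tr omega_tr omega_skew J_J. Qed.

Lemma Rn_sym : Rn^T = Rn.
Proof.
rewrite /Rn; have := sympart_tr B; have := mxbr_self_tr_sym B.
move: (mxbr B B^T) (sympart B) => M S hM hS.
by rewrite linearB/= !linearZ/= hM hS.
Qed.

Lemma Ric1 : Ric = block_mx Rn 0 0 r%:M.
Proof.
rewrite /Ric /Ricop /endo_of invmx1 mulmx1 ga_ricci tr_block_mx !trmx0 tr_scalar_mx.
by rewrite Rn_sym.
Qed.

Lemma Ric_sym : Ric^T = Ric.
Proof. by rewrite Ric1 tr_block_mx !trmx0 tr_scalar_mx Rn_sym. Qed.

Let JT : J^T = - J. Proof. exact: Jop_tr omega_tr omega_skew. Qed.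

Lemma endo_ac_sym : (endo_ac w 1%:M Ric)^T = endo_ac w 1%:M Ric.
Proof.
rewrite /endo_ac Jop1E linearZ/= linearD/= !trmx_mul Ric_sym JT.
by move: J Ric => j ric; rewrite !(mulNmx, mulmxN) opprK mulmxA.
Qed.

Lemma endo_ac_anti : J *m endo_ac w 1%:M Ric *m J = endo_ac w 1%:M Ric.
Proof.
rewrite /endo_ac Jop1E; have := J_J; move: J Ric => j ric jj.
rewrite -scalemxAr -scalemxAl mulmxDr mulmxDl addrC !mulmxA jj -[_ *m j *m j]mulmxA jj.
by rewrite !mulNmx mul1mx mulmxN mulmx1 opprK.
Qed.

Lemma endo_cP : endo_c w 1%:M P = 2^-1 *: (P + P^T).
Proof. by rewrite /endo_c Jop1E -PT. Qed.

(** E = Ric^ac is symmetric with J E J = E, and -J P J = P^t. Hence D = P + E - c has transpose P^t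
    + E - c, and both soliton equations follow for the same c and D. *)
Lemma algebraic_soliton_soliton :
  algebraic_scf_soliton (ga_bracket B) w 1%:M -> scf_soliton (ga_bracket B) w 1%:M.
Proof.
move=> [ak [c [D [derD HD]]]]; split=> //; exists c, D.
have DE : D = P + endo_ac w 1%:M Ric - c%:M by rewrite HD addrC addKr.
have DT : D^T = P^T + endo_ac w 1%:M Ric - c%:M.
  by rewrite DE linearB/= linearD/= endo_ac_sym tr_scalar_mx.
have adj1 E : adj 1%:M E = E^T :> 'M[R]_(1 + m + 1) by rewrite /adj invmx1 mul1mx mulmx1.
rewrite -/P -/Ric endo_cP Jop1E adj1 DT.
have := J_J; have := endo_ac_anti; have := PT.
move: P^T derD => PT'; rewrite DE.
move: P (endo_ac w 1%:M Ric) J => p e j derD <- je jj; split=> //.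
- have jpj : j *m - (j *m p *m j) *m j = - p.
    rewrite mulmxN mulNmx !mulmxA jj -[_ *m j *m j]mulmxA jj.
    by rewrite !mulNmx mul1mx mulmxN mulmx1 opprK.
  rewrite mulmxBr mulmxBl mulmxDr mulmxDl jpj je mul_mx_scalar -scalemxAl jj.
  by rewrite scalerN scalemx1; apply/matrixP => i k; rewrite !mxE; field.
- move: (- (j *m p *m j)) => p'.
  by apply/matrixP => i k; rewrite !mxE; field.
Qed.

Lemma block_derivation (Dn : 'M[R]_(1 + m)) (d : R) : mxbr Dn B = d *: B ->
  is_der (ga_bracket B) (block_mx Dn 0 0 d%:M).
Proof.
move=> DB X Y.
have nD Z : npart (block_mx Dn 0 0 d%:M *m Z) = Dn *m npart Z.
  by rewrite {1}[Z]cV_npart_epart mul_block_col mul0mx addr0 npart_col.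
have eD Z : epart (block_mx Dn 0 0 d%:M *m Z) = d * epart Z.
  rewrite {1}[Z]cV_npart_epart mul_block_col !mul0mx add0r epart_col.
  by rewrite -scalar_mxM mxE mulr1n.
rewrite /ga_bracket !nD !eD mul_block_col !mulmx0 mul0mx !addr0 add_col_mx addr0.
have DBy y : Dn *m (B *m y) = d *: (B *m y) + B *m (Dn *m y).
  by rewrite !mulmxA -[Dn *m B](subrK (B *m Dn)) -/(mxbr Dn B) DB mulmxDl -scalemxAl.
congr col_mx; rewrite mulmxBr -!scalemxAr !DBy.
move: (B *m npart X) (B *m npart Y) (B *m (Dn *m npart X)) (B *m (Dn *m npart Y)).
by move=> x1 x2 x3 x4; apply/colP => i; rewrite !mxE; ring.
Qed.

(** The ideal component of the derivation identity at e_{2n} and y in n involves only the diagonal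
    blocks of D. *)
Lemma derivation_block (D : 'M[R]_(1 + m + 1)) : is_der (ga_bracket B) D ->
  mxbr (ulsubmx D) B = (drsubmx D 0 0) *: B.
Proof.
move=> H; apply: eq_mx_cV => y.
have DE (x : 'cV[R]_(1 + m)) (s : 'M[R]_1) : D *m col_mx x s =
    col_mx (ulsubmx D *m x + ursubmx D *m s) (dlsubmx D *m x + drsubmx D *m s).
  by rewrite -{1}[D]submxK mul_block_col.
have := H (col_mx 0 1%:M) (col_mx y 0) => /(congr1 (@npart R (1 + m))).
rewrite /ga_bracket !npart_col !epart_col !DE !npart_col !epart_col.
rewrite add_col_mx npart_col !mulmx0 !addr0 !add0r mulmx1 !mxE eqxx mulr1n !scale1r !scale0r !subr0.
rewrite scaler0 subr0 => e.
by rewrite /mxbr mulmxBl -!mulmxA e addrK -scalemxAl.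
Qed.

Lemma soliton_tensorE : endo_c w 1%:M P + endo_ac w 1%:M Ric =
  2^-1 *: block_mx (- (f *m q^T) - q *m f^T + Rn + Jn *m Rn *m Jn - r *: (f *m f^T))
    (- (Jn *m q) - Jn *m Rn *m f) (- (Jn *m q)^T + f^T *m Rn *m Jn)
    ((- 2 * dot f q + r - dot f (Rn *m f))%:M).
Proof.
rewrite endo_cP /endo_ac Jop1E -scalerDr; congr (_ *: _).
rewrite /P (ga_Pop B omega_tr omega_skew J_J) -/q Ric1 /J tr_block_mx !trmx0 !add_block_mx.
rewrite !mulmx_block !mulmx0 !mul0mx !addr0 !add0r.
rewrite (_ : (- (f *m q^T))^T = - (q *m f^T)); last by rewrite linearN/= trmx_mul trmxK.
rewrite (_ : (- (f^T *m q))^T = - (dot f q)%:M); last first.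
  by rewrite linearN/= mul_trmx_dot tr_scalar_mx.
rewrite mul_mx_scalar (_ : f^T *m Rn *m - f = - (dot f (Rn *m f))%:M); last first.
  by rewrite mulmxN -mulmxA mul_trmx_dot.
rewrite mul_trmx_dot (_ : (- (Jn *m q))^T = - (Jn *m q)^T); last by rewrite linearN.
rewrite !add_block_mx !add0r mul0mx addr0; congr block_mx.
- rewrite (_ : r *: - f *m f^T = - (r *: (f *m f^T))); last by rewrite scalerN mulNmx -scalemxAl.
  move: (f *m q^T) (q *m f^T) (r *: (f *m f^T)) Rn (Jn *m Rn *m Jn) => x1 x2 x3 x4 x5.
  by apply/matrixP => i j; rewrite !mxE; ring.
- by rewrite mulmxN.
- by apply/matrixP => i j; rewrite !ord1 !mxE eqxx !mulr1n; ring.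
Qed.

End StandardTensors.
End StandardStructure.

(** * The soliton equation for adapted structures *)

Section SymplecticBlock.
Variables (R : realType) (m : nat) (J1 B1 : 'M[R]_m).
Hypotheses (J1T : J1^T = - J1) (J1J1 : J1 *m J1 = - 1%:M) (sp : in_sp J1 B1).

Lemma sp_J : J1 *m B1 = - (B1^T *m J1).
Proof. by apply/eqP; rewrite -addr_eq0 addrC; apply/eqP. Qed.

Lemma sp_JJ : J1 *m B1 *m J1 = B1^T.
Proof. by rewrite sp_J mulNmx -mulmxA J1J1 mulmxN mulmx1 opprK. Qed.

Lemma sp_trJJ : J1 *m B1^T *m J1 = B1.
Proof. by rewrite -sp_JJ !mulmxA J1J1 -mulmxA J1J1 mulNmx mul1mx mulmxN mulmx1 opprK. Qed.

Lemma sp_trace : \tr B1 = 0.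
Proof.
apply: mxtrace_antisym; rewrite -{1}mxtrace_tr -sp_JJ mxtrace_mulC mulmxA J1J1.
by rewrite mulNmx mul1mx linearN.
Qed.

Lemma sp_sympart : J1 *m sympart B1 *m J1 = sympart B1.
Proof. by rewrite /sympart -scalemxAr -scalemxAl mulmxDr mulmxDl sp_JJ sp_trJJ addrC. Qed.

Lemma sp_mxbr : J1 *m mxbr B1 B1^T *m J1 = mxbr B1 B1^T.
Proof.
have e (X Y : 'M[R]_m) : J1 *m (X *m Y) *m J1 = - (J1 *m X *m J1 *m (J1 *m Y *m J1)).
  by rewrite !mulmxA -[J1 *m X *m J1 *m J1]mulmxA J1J1 mulmxN mulmx1 !mulNmx opprK.
by rewrite /mxbr mulmxBr mulmxBl !e sp_JJ sp_trJJ opprK addrC.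
Qed.

Lemma dot_J_self (S : 'M[R]_m) v : J1 *m S *m J1 = S ->
  dot (J1 *m v) (S *m (J1 *m v)) = - dot v (S *m v).
Proof.
by move=> h; rewrite dot_mull J1T mulNmx dotNr !mulmxA h.
Qed.

Lemma dot_v_Jv v : dot v (J1 *m v) = 0.
Proof.
have : dot v (J1 *m v) = - dot v (J1 *m v).
  by rewrite {1}dotC dot_mull J1T mulNmx dotNr.
by move=> e; apply/eqP; rewrite -[_ == 0](mulrn_eq0 _ 2) mulr2n {1}e addNr.
Qed.

(* Bessel's inequality for the orthogonal pair [v], [J1 v] of equal length. *)
Lemma sp_bessel v (S := sympart B1) :
  2 * dot (S *m v) (S *m v) <= \tr (S *m S) * dot v v.
Proof.
have SJS : J1 *m S *m J1 = S by exact: sp_sympart.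
have ST : S^T = S by exact: sympart_tr.
have [/dot_eq0 ->|vn0] := eqVneq (dot v v) 0.
  by rewrite mulmx0 dot0r !mulr0.
have vv : 0 < dot v v by rewrite lt_def vn0 dot_ge0.
set u := J1 *m v; pose Q := v *m v^T + u *m u^T.
have uu : dot u u = dot v v.
  by rewrite /u dot_mull J1T mulNmx dotNr mulmxA J1J1 mulNmx mul1mx dotNr opprK.
have vu : dot v u = 0 by exact: dot_v_Jv.
have QT : Q^T = Q by rewrite /Q linearD/= !trmx_mul !trmxK.
have QQ : Q *m Q = dot v v *: Q.
  have oo (x y z t : 'cV[R]_m) : x *m y^T *m (z *m t^T) = dot y z *: (x *m t^T).
    by rewrite -mulmxA (mulmxA y^T) mul_trmx_dot mul_scalar_mx -scalemxAr.
  by rewrite /Q mulmxDl !mulmxDr !oo uu (dotC u) vu !scale0r addr0 add0r scalerDr.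
have SuSu : dot (S *m u) (S *m u) = dot (S *m v) (S *m v).
  have JS : S *m J1 = - (J1 *m S).
    by rewrite -{1}SJS -[_ *m J1 *m J1]mulmxA J1J1 mulmxN mulmx1.
  rewrite /u !mulmxA JS !mulNmx dotNl dotNr opprK -!mulmxA [LHS]dot_mull J1T mulNmx.
  by rewrite dotNr (mulmxA J1 J1) J1J1 mulNmx mul1mx dotNr opprK.
clearbody u.
have trSQS : \tr (S *m Q *m S) = 2 * dot (S *m v) (S *m v).
  rewrite mxtrace_mulC mulmxA /Q mulmxDr linearD/= !mulmxA !mxtrace_outer.
  have e z : dot z (S *m S *m z) = dot (S *m z) (S *m z) by rewrite -mulmxA dot_mull ST.
  by rewrite !e SuSu; ring.
pose N := S *m (dot v v *: 1%:M - Q).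
have : 0 <= \tr (N *m N^T) by exact: sqnorm_ge0.
have NE : N = dot v v *: S - S *m Q by rewrite /N mulmxBr -scalemxAr mulmx1.
have NTE : N^T = dot v v *: S - Q *m S by rewrite NE linearB/= linearZ/= trmx_mul ST QT.
have -> : \tr (N *m N^T) = dot v v * (dot v v * \tr (S *m S) - 2 * dot (S *m v) (S *m v)).
  rewrite NTE NE; clear NE NTE; clearbody N Q S; rewrite mulmxBl !mulmxBr -!scalemxAl -!scalemxAr !mulmxA.
  rewrite -[S *m Q *m Q]mulmxA QQ -scalemxAr -scalemxAl !linearB/= !mxtraceZ trSQS.
  by ring.
by rewrite pmulr_rge0// subr_ge0 [X in _ -> _ <= X]mulrC.
Qed.

End SymplecticBlock.

Section OuterTraces.
Variables (R : realType) (k : nat).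
Implicit Types (N S : 'M[R]_k) (v u : 'cV[R]_k).

Lemma mxtraceB N S : \tr (N - S) = \tr N - \tr S.
Proof. exact: raddfB. Qed.

Lemma mxtrace_combB N S T (x y : R) :
  \tr ((x *: N - y *: S) *m T) = x * \tr (N *m T) - y * \tr (S *m T).
Proof. by rewrite mulmxBl -!scalemxAl mxtraceB !mxtraceZ. Qed.

Lemma mxtrace_comb5 N1 N2 N3 N4 N5 T (x : R) :
  \tr ((- N1 - N2 + N3 + N4 - x *: N5) *m T) =
  - \tr (N1 *m T) - \tr (N2 *m T) + \tr (N3 *m T) + \tr (N4 *m T) - x * \tr (N5 *m T).
Proof.
by rewrite mulmxBl mxtraceB !mulmxDl !mulNmx !mxtraceD -scalemxAl mxtraceZ !raddfN.
Qed.

Lemma mxtrace_combD N S T (c : R) : \tr ((c%:M + 2^-1 *: (N + S)) *m T) =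
  c * \tr T + 2^-1 * (\tr (N *m T) + \tr (S *m T)).
Proof. by rewrite mulmxDl -scalemxAl mulmxDl mul_scalar_mx !(mxtraceD, mxtraceZ). Qed.

Lemma mxtrace_mul_outer N v u : \tr (N *m (v *m u^T)) = dot u (N *m v).
Proof. by rewrite mulmxA mxtrace_outer. Qed.

Lemma mxtrace_outer_outer v u x y : \tr (v *m u^T *m (x *m y^T)) = dot u x * dot y v.
Proof.
by rewrite -mulmxA (mulmxA u^T) mul_trmx_dot mul_scalar_mx -scalemxAr mxtraceZ mxtrace_outer.
Qed.

Lemma mxtrace_sub_outer N v : \tr ((N - v *m v^T) *m (N - v *m v^T)) =
  \tr (N *m N) - 2 * dot v (N *m v) + dot v v ^+ 2.
Proof.
rewrite mulmxBl !mulmxBr !mxtraceB mxtrace_outer_outer mxtrace_mul_outer.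
by rewrite (mxtrace_mulC (v *m v^T)) mxtrace_mul_outer expr2; ring.
Qed.

Lemma mxtrace_outer_pair N S v u (a : R) : dot v u = 0 ->
  \tr ((2^-1 *: (N - v *m v^T) - a *: S) *m (N + u *m u^T)) =
  2^-1 * (\tr (N *m N) + dot u (N *m u) - dot v (N *m v)) - a * (\tr (S *m N) + dot u (S *m u)).
Proof.
move=> vu; rewrite mulmxBl -!scalemxAl mulmxBl !mulmxDr mxtraceB !mxtraceZ mxtraceB !mxtraceD.
rewrite mxtrace_outer_outer !mxtrace_mul_outer vu mul0r.
by rewrite (mxtrace_mulC (v *m v^T)) mxtrace_mul_outer; ring.
Qed.

End OuterTraces.

(** With x = B_1 v and y = S_1 v, the equation reads t + |v|^4 / 2 + s |v|^2 + 2 |x - y/2|^2 + 2 |a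
    v - y/2|^2 - |y|^2 = 0, and Bessel's inequality 2 |y|^2 <= s |v|^2 outweighs the negative
    term. *)
Lemma sos_bound (R : realFieldType) (a vy s t vv yy xx xy : R) :
  0 <= t -> 0 <= yy -> 0 <= vv -> 0 <= xx - 2^-1 * xy - 2^-1 * (xy - 2^-1 * yy) ->
  0 <= a * (a * vv - 2^-1 * vy) - 2^-1 * (a * vy - 2^-1 * yy) ->
  2 * yy <= s * vv ->
  t + 2^-1 * vv ^+ 2 + s * vv + 2 * xx - 2 * xy - 2 * a * vy + 2 * a ^+ 2 * vv = 0 ->
  vv = 0.
Proof.
move=> h1 h4 h5 h2 h3 h6 E.
have : vv ^+ 2 <= 0 by nra.
by rewrite le_eqVlt ltNge sqr_ge0 orbF sqrf_eq0 => /eqP.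
Qed.

(** * The sum of squares for B = [a, v^t; 0, B_1] *)

Section AdaptedBlock.
Variables (R : realType) (m : nat) (J1 : 'M[R]_m) (a : R) (v : 'cV[R]_m) (B1 : 'M[R]_m).
Hypotheses (J1T : J1^T = - J1) (J1J1 : J1 *m J1 = - 1%:M) (sp : in_sp J1 B1).
Let f : 'cV[R]_(1 + m) := col_mx 1%:M 0.
Let Jn : 'M[R]_(1 + m) := block_mx 0 0 0 J1.
Let B : 'M[R]_(1 + m) := block_mx a%:M v^T 0 B1.
Let M := mxbr B B^T.
Let M1 := mxbr B1 B1^T.
Let S1 := sympart B1.
Let q := chern_covector B f.
Let Rn := 2^-1 *: mxbr B B^T - \tr B *: sympart B.
Let r := - \tr (sympart B *m sympart B).

Lemma block_Jn : Jn *m B = - (B^T *m Jn).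
Proof.
rewrite /Jn /B tr_block_mx !trmx0 !mulmx_block !mulmx0 !mul0mx !addr0 !add0r.
by rewrite (sp_J sp) opp_block_mx !oppr0.
Qed.

Lemma block_trace : \tr B = a.
Proof. by rewrite /B mxtrace_block mxtrace_scalar mulr1n (sp_trace J1J1 sp) addr0. Qed.

Lemma block_trT : B^T = block_mx a%:M 0 v B1^T.
Proof. by rewrite /B tr_block_mx trmx0 trmxK tr_scalar_mx. Qed.

Lemma block_BTf : B^T *m f = col_mx a%:M v.
Proof. by rewrite block_trT /f mul_block_col !mulmx0 !addr0 !mulmx1. Qed.

Lemma block_q : q = col_mx (a ^+ 2)%:M (a *: v + 2^-1 *: (B1^T *m v)).
Proof.
rewrite /q /chern_covector block_BTf block_trace block_trT mul_block_col !mul0mx addr0.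
rewrite [v *m _]mul_mx_scalar -scalar_mxM !scale_col_mx scale_scalar_mx add_col_mx scale_col_mx.
congr col_mx; first by apply/matrixP => i j; rewrite !ord1 !mxE eqxx !mulr1n; field.
by move: (B1^T *m v) => x; apply/colP => i; rewrite !mxE; field.
Qed.

Lemma block_M : M = block_mx (dot v v)%:M (B1 *m v - a *: v)^T (B1 *m v - a *: v) (M1 - v *m v^T).
Proof.
rewrite /M /mxbr block_trT /B !mulmx_block !mulmx0 !mul0mx !addr0 !add0r.
rewrite mul_trmx_dot -!scalar_mxM opp_block_mx add_block_mx; congr block_mx.
- by rewrite addrC addrA addNr add0r.
- by rewrite mul_scalar_mx -trmx_mul; apply/matrixP => i j; rewrite !mxE.
- by rewrite mul_mx_scalar.
- rewrite /M1 /mxbr; move: (B1 *m B1^T) (v *m v^T) (B1^T *m B1) => x y z.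
  by apply/matrixP => i j; rewrite !mxE; ring.
Qed.

Lemma block_sympart : sympart B = block_mx a%:M (2^-1 *: v^T) (2^-1 *: v) S1.
Proof.
rewrite /sympart block_trT /B add_block_mx scale_block_mx addr0 add0r.
congr block_mx.
by apply/matrixP => i j; rewrite !ord1 !mxE eqxx !mulr1n; field.
Qed.

Lemma block_r : r = - (a ^+ 2 + 2^-1 * dot v v + \tr (S1 *m S1)).
Proof.
rewrite /r block_sympart mulmx_block mxtrace_block !mxtraceD -scalar_mxM mxtrace_scalar.
rewrite -!scalemxAl -!scalemxAr !mxtraceZ mxtrace_outer mul_trmx_dot mxtrace_scalar.
by rewrite mulr1n; field.
Qed.

Lemma block_Mf : M *m f = col_mx (dot v v)%:M (B1 *m v - a *: v).
Proof. by rewrite block_M /f mul_block_col !mulmx0 !addr0 !mulmx1. Qed.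

Lemma dot_col (x1 y1 : 'cV[R]_1) (x y : 'cV[R]_m) :
  dot (col_mx x1 x) (col_mx y1 y) = dot x1 y1 + dot x y.
Proof. by rewrite /dot tr_col_mx mul_row_col mxE. Qed.

Lemma dot_scalar (x y : R) : dot (x%:M) (y%:M) = x * y.
Proof. by rewrite /dot tr_scalar_mx -scalar_mxM mxE mulr1n. Qed.

(** The first factor is twice the block of P^c + Ric^ac on the ideal. Every term reduces to x = B_1
    v and y = S_1 v by means of B_1^t v = 2 y - x and <v, x> = <v, y>. *)
Lemma tensor_trace :
  \tr ((- (f *m q^T) - q *m f^T + Rn + Jn *m Rn *m Jn - r *: (f *m f^T)) *m M) =
  \tr ((M1 - v *m v^T) *m (M1 - v *m v^T)) + 2^-1 * dot v v ^+ 2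
  + \tr (S1 *m S1) * dot v v + 2 * dot (B1 *m v) (B1 *m v)
  - 2 * dot (B1 *m v) (S1 *m v) - 2 * a * dot v (S1 *m v) + 2 * a ^+ 2 * dot v v.
Proof.
have MT : M^T = M by exact: mxbr_self_tr_sym.
have M1T : M1^T = M1 by exact: mxbr_self_tr_sym.
have S1T : S1^T = S1 by exact: sympart_tr.
have JMJ : J1 *m M1 *m J1 = M1 by exact: sp_mxbr.
have JSJ : J1 *m S1 *m J1 = S1 by exact: sp_sympart.
set x := B1 *m v; set y := S1 *m v.
have BTv : B1^T *m v = 2 *: y - x.
  rewrite /y /x /S1 /sympart -scalemxAl mulmxDl; move: (B1 *m v) (B1^T *m v) => p p'.
  by apply/colP => i; rewrite !mxE; field.
have vx : dot v x = dot v y.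
  have e : dot v (B1^T *m v) = dot v x by rewrite -dot_mull dotC.
  by move: e; rewrite BTv !dotE => e; lra.
have vM1v : dot v (M1 *m v) = 4 * dot y y - 4 * dot x y.
  rewrite /M1 /mxbr mulmxBl !dotE -!mulmxA -/x.
  rewrite (_ : dot v (B1 *m (B1^T *m v)) = dot (B1^T *m v) (B1^T *m v)); last first.
    by rewrite [RHS]dot_mull trmxK.
  rewrite (_ : dot v (B1^T *m x) = dot x x); last by rewrite -dot_mull.
  by rewrite BTv !dotE (dotC y x); ring.
have trMM : \tr (M *m M) = dot v v ^+ 2 + 2 * dot (x - a *: v) (x - a *: v)
    + \tr ((M1 - v *m v^T) *m (M1 - v *m v^T)).
  rewrite block_M -/x; move: (M1 - _) (x - _) => N z.
  rewrite mulmx_block mxtrace_block !mxtraceD -scalar_mxM mxtrace_scalar.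
  by rewrite mul_trmx_dot mxtrace_scalar mxtrace_outer !mulr1n; ring.
have trM1 : \tr ((M1 - v *m v^T) *m (M1 - v *m v^T)) =
    \tr (M1 *m M1) - 2 * dot v (M1 *m v) + dot v v ^+ 2.
  exact: mxtrace_sub_outer.
have trSM : \tr (sympart B *m M) = 0.
  rewrite /sympart -scalemxAl mxtraceZ mulmxDl linearD/= mxtrace_self_mxbr add0r.
  rewrite (_ : \tr (B^T *m M) = \tr (B *m M)); first by rewrite mxtrace_self_mxbr mulr0.
  by rewrite -{1}MT -trmx_mul mxtrace_tr mxtrace_mulC.
have trSM1 : \tr (S1 *m M1) = 0.
  rewrite /S1 /sympart -scalemxAl mxtraceZ mulmxDl linearD/= mxtrace_self_mxbr add0r.
  rewrite (_ : \tr (B1^T *m M1) = \tr (B1 *m M1)); first by rewrite mxtrace_self_mxbr mulr0.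
  by rewrite -{1}M1T -trmx_mul mxtrace_tr mxtrace_mulC.
have t1 : \tr (f *m q^T *m M) = dot q (M *m f).
  by rewrite -mulmxA mxtrace_mulC -mulmxA mul_trmx_dot mxtrace_scalar.
have t2 : \tr (q *m f^T *m M) = dot q (M *m f).
  by rewrite -mulmxA mxtrace_mulC -mulmxA mul_trmx_dot mxtrace_scalar mulr1n dotC dot_mull MT.
have t3 : \tr (f *m f^T *m M) = dot f (M *m f).
  by rewrite -mulmxA mxtrace_mulC -mulmxA mul_trmx_dot mxtrace_scalar.
have t4 : \tr (Rn *m M) = 2^-1 * \tr (M *m M).
  by rewrite /Rn mxtrace_combB trSM mulr0 subr0.
have t5 : \tr (Jn *m Rn *m Jn *m M) =
    \tr ((2^-1 *: (M1 - v *m v^T) - a *: S1) *m (M1 + (J1 *m v) *m (J1 *m v)^T)).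
  rewrite -!mulmxA mxtrace_mulC -!mulmxA.
  have -> : Jn *m (M *m Jn) = block_mx 0 0 0 (M1 + (J1 *m v) *m (J1 *m v)^T).
    rewrite block_M /Jn !mulmx_block !mulmx0 !mul0mx !addr0 !add0r; congr block_mx; rewrite ?mulmx0//.
    rewrite mulmxA mulmxBr mulmxBl JMJ; congr (_ + _).
    by rewrite trmx_mul J1T !mulmxA mulmxN.
  have -> : Rn = block_mx (ulsubmx Rn) (ursubmx Rn) (dlsubmx Rn) (2^-1 *: (M1 - v *m v^T) - a *: S1).
    rewrite -{1}[Rn]submxK; congr block_mx.
    rewrite /Rn -/M block_M block_sympart block_trace !scale_block_mx opp_block_mx add_block_mx.
    by rewrite block_mxKdr.
  by rewrite mulmx_block mxtrace_block !mulmx0 !addr0 mxtrace0 add0r add0r -!mulmxA.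
have t5' : \tr (Jn *m Rn *m Jn *m M) = 2^-1 * \tr (M1 *m M1) - dot v (M1 *m v) + a * dot v y.
  rewrite t5 (mxtrace_outer_pair _ _ _ (dot_v_Jv J1T v)) trSM1.
  by rewrite !(dot_J_self J1T)//; field.
rewrite mxtrace_comb5 t1 t2 t3 t4 t5' trMM trM1 vM1v block_Mf block_q.
rewrite /f block_r -/x !dot_col !dot_scalar BTv !dotE ?dot0l ?dot0r (dotC y x) (dotC y v) (dotC x v) vx.
by field.
Qed.

Lemma adapted_soliton_normal : ~ nilpotent_mx B -> scf_soliton (ga_bracket B) (omega J1) 1%:M ->
  v = 0 /\ mxbr B1 B1^T = 0.
Proof.
move=> nB [_ [c [D [/derivation_block derD _ eqD]]]].
have d0 : drsubmx D 0 0 = 0.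
  by apply/eqP/negPn/negP => d0; apply: nB; exact: derivation_nilpotent derD.
rewrite d0 scale0r in derD.
have MT : M^T = M by exact: mxbr_self_tr_sym.
(* [D_n, B] = 0 makes D_n and its transpose orthogonal to M; scalars are orthogonal to M because it
   is a commutator. The right-hand side of the soliton equation thus disappears. *)
have trDM : \tr (ulsubmx D *m M) = 0.
  by rewrite -mxtrace_mxbr derD mul0mx mxtrace0.
have trDTM : \tr ((ulsubmx D)^T *m M) = 0.
  by rewrite -mxtrace_tr trmx_mul trmxK MT mxtrace_mulC.
have := eqD => /(congr1 ulsubmx).
rewrite soliton_tensorE// /adj invmx1 mul1mx mulmx1 scale_block_mx block_mxKul.
have -> : ulsubmx (c%:M + 2^-1 *: (D + D^T)) = c%:M + 2^-1 *: (ulsubmx D + (ulsubmx D)^T).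
  by rewrite (scalar_mx_block (1 + m) 1) -{1 2}[D]submxK tr_block_mx add_block_mx
    scale_block_mx add_block_mx block_mxKul.
move=> /(congr1 (fun N => \tr (N *m M))).
rewrite mxtrace_combD trDM trDTM addr0 mulr0 addr0 mxbr0_mxtrace mulr0.
rewrite -scalemxAl mxtraceZ tensor_trace => /eqP.
rewrite mulf_eq0 invr_eq0 pnatr_eq0/= => /eqP E.
have bes : 2 * dot (S1 *m v) (S1 *m v) <= \tr (S1 *m S1) * dot v v := sp_bessel J1T J1J1 sp v.
have h1 : 0 <= \tr ((M1 - v *m v^T) *m (M1 - v *m v^T)).
  rewrite -[X in _ *m X](_ : (M1 - v *m v^T)^T = _); first exact: sqnorm_ge0.
  by rewrite linearB/= trmx_mul trmxK mxbr_self_tr_sym.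
have h2 := dot_ge0 (B1 *m v - 2^-1 *: (S1 *m v)).
have h3 := dot_ge0 (a *: v - 2^-1 *: (S1 *m v)).
have h4 := dot_ge0 (S1 *m v).
have v0 : dot v v = 0.
  move: h2 h3 bes E; rewrite !dotE (dotC (S1 *m v) (B1 *m v)) (dotC (S1 *m v) v).
  have := dot_ge0 v; move: h1 h4; rewrite -/S1.
  move: (dot v v) (dot (S1 *m v) (S1 *m v)) (dot (B1 *m v) (B1 *m v)) (dot (B1 *m v) (S1 *m v)).
  move: (dot v (S1 *m v)) (\tr (S1 *m S1)) (\tr _) => vy s t vv yy xx xy.
  by move=> h1 h4 h5 h2 h3 h6 E; exact: (sos_bound h1 h4 h5 h2 h3 h6 E).
have vE := dot_eq0 v0; split=> //; move: E; rewrite vE mul0mx subr0 mulmx0 !dot0r.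
rewrite !dot0l expr0n !mulr0 !subr0 !addr0 mxtrace_mxbr_sq => /eqP.
by rewrite sqnorm_eq0 => /eqP.
Qed.

End AdaptedBlock.

Lemma half_double (R : numFieldType) (V : lmodType R) (x : V) : 2^-1 *: (x + x) = x.
Proof. by rewrite -mulr2n -[x *+ 2]scaler_nat scalerA mulVf ?scale1r ?pnatr_eq0. Qed.

(** * The operator P + Ric^ac for v = 0 *)

Section StandardOperator.
Variables (R : realType) (m : nat).
Let f : 'cV[R]_(1 + m) := col_mx 1%:M 0.
Implicit Types A : 'M[R]_(1 + m).

(* The nonzero blocks of [P + Ric^ac] on the ideal and on e_{2n}. *)
Definition flow_op A : 'M[R]_(1 + m) :=
  2^-1 *: mxbr A A^T - \tr A *: sympart A
  + (2^-1 * (\tr (sympart A *m sympart A) - (\tr A) ^+ 2)) *: (f *m f^T).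

Definition flow_rate A : R := 2^-1 * ((\tr A) ^+ 2 + \tr (sympart A *m sympart A)).

Definition flow_op_ext A : 'M[R]_(1 + m + 1) :=
  block_mx (flow_op A) 0 0 (- flow_rate A)%:M.

End StandardOperator.

Section StandardBlock.
Variables (R : realType) (m : nat) (J1 : 'M[R]_m) (a : R) (A1 : 'M[R]_m).
Hypotheses (J1T : J1^T = - J1) (J1J1 : J1 *m J1 = - 1%:M) (sp : in_sp J1 A1).
Let f : 'cV[R]_(1 + m) := col_mx 1%:M 0.
Let Jn : 'M[R]_(1 + m) := block_mx 0 0 0 J1.
Let w := omega J1.
Let J : 'M[R]_(1 + m + 1) := block_mx Jn (- f) f^T 0.
Let A := mxA a A1.
Let M := mxbr A A^T.
Let P := Pop (ga_bracket A) w 1%:M.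
Let E := endo_ac w 1%:M (Ricop (ga_bracket A) 1%:M).

Lemma mxA_block : A = block_mx a%:M (0 : 'cV_m)^T 0 A1.
Proof. by rewrite trmx0. Qed.

Lemma mxA_Jn : Jn *m A = - (A^T *m Jn).
Proof. by rewrite mxA_block; exact: block_Jn. Qed.

Lemma mxA_almost_kahler : almost_kahler (ga_bracket A) w 1%:M.
Proof. by apply: standard_almost_kahler => //; exact: mxA_Jn. Qed.

Lemma mxA_trace : \tr A = a.
Proof. by rewrite mxA_block (block_trace _ _ J1J1 sp). Qed.

Lemma mxA_tr : A^T = mxA a A1^T.
Proof. by rewrite /A /mxA tr_block_mx !trmx0 tr_scalar_mx. Qed.

Lemma mxA_f : A *m f = a *: f.
Proof.
by rewrite /A /mxA /f mul_block_col !mulmx0 mul0mx !addr0 mulmx1 scale_col_mx scalemx1 scaler0.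
Qed.

Lemma mxA_trf : A^T *m f = a *: f.
Proof.
rewrite mxA_tr /mxA /f mul_block_col !mulmx0 mul0mx !addr0 mulmx1.
by rewrite scale_col_mx scalemx1 scaler0.
Qed.

Lemma mxA_covector : chern_covector A f = a ^+ 2 *: f.
Proof.
rewrite /chern_covector mxA_trf -scalemxAr mxA_trf mxA_trace.
by move: f => g; apply/colP => i; rewrite !mxE; field.
Qed.

Lemma mxA_P : P = block_mx (- (a ^+ 2 *: (f *m f^T))) 0 0 (- a ^+ 2)%:M.
Proof.
rewrite /P (ga_Pop A (omega_tr J1) (omega_skew J1T) (J_J J1J1)) mxA_covector.
rewrite linearZ/= -!scalemxAr; congr block_mx.
- by rewrite -/Jn Jn_f scaler0 oppr0.
- rewrite -/f f_f; apply/matrixP => i j; rewrite !mxE; by rewrite !ord1 !mulr1n; ring.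
Qed.

Lemma mxA_P_sym : P^T = P.
Proof.
rewrite mxA_P tr_block_mx !trmx0 tr_scalar_mx; congr block_mx.
by rewrite linearN/= linearZ/= trmx_mul trmxK.
Qed.

Lemma mxA_mxbr : M = block_mx 0 0 0 (mxbr A1 A1^T).
Proof.
rewrite /M /mxbr mxA_tr /A /mxA !mulmx_block !mulmx0 !mul0mx !addr0 !add0r.
by rewrite opp_block_mx add_block_mx !oppr0 !addr0 subrr.
Qed.

Lemma mxA_sympart : sympart A = block_mx a%:M 0 0 (sympart A1).
Proof. by rewrite mxA_block block_sympart !(trmx0, scaler0). Qed.

Lemma mxA_operator : P + E = flow_op_ext A.
Proof.
have cP : endo_c w 1%:M P = P.
  by rewrite endo_cP// mxA_P_sym half_double.
rewrite -cP /E /P soliton_tensorE// -/f -/Jn mxA_covector mxA_trace.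
set Rn := 2^-1 *: mxbr A A^T - a *: sympart A.
set S := sympart A.
have Rnf : Rn *m f = - (a ^+ 2) *: f.
  have M0 : mxbr A A^T *m f = 0.
    by rewrite /mxbr mulmxBl -!mulmxA mxA_trf mxA_f -!scalemxAr mxA_trf mxA_f subrr.
  have Sf : S *m f = a *: f by rewrite /S /sympart -scalemxAl mulmxDl mxA_f mxA_trf half_double.
  rewrite /Rn -/S; move: (mxbr A A^T) S M0 Sf => N T Nf Tf.
  by rewrite mulmxBl -!scalemxAl Nf Tf scaler0 sub0r scalerA scaleNr.
(* The n_1 block of Rn is fixed by X |-> J_1 X J_1, while its e_1 entry -a^2 is killed by Jn. *)
have JRJ : Jn *m Rn *m Jn = Rn + a ^+ 2 *: (f *m f^T).
  have -> : Rn = block_mx (- a ^+ 2)%:M 0 0 (2^-1 *: mxbr A1 A1^T - a *: sympart A1).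
    rewrite /Rn -/M mxA_mxbr mxA_sympart !scale_block_mx !scaler0 opp_block_mx add_block_mx.
    rewrite !oppr0 !addr0 add0r; congr block_mx.
    by apply/matrixP => i j; rewrite !ord1 !mxE eqxx !mulr1n; ring.
  rewrite /Jn !mulmx_block !mulmx0 !mul0mx !addr0 !add0r ff_block scale_block_mx !scaler0.
  have := sp_mxbr J1J1 sp; have := sp_sympart J1J1 sp.
  move: (mxbr A1 A1^T) (sympart A1) => N T eT eN.
  rewrite add_block_mx !addr0 !mul0mx mulmxBr mulmxBl -!scalemxAr -!scalemxAl eT eN.
  congr block_mx.
  by apply/matrixP => i j; rewrite !ord1 !mxE eqxx !mulr1n; ring.
have dff : dot f f = 1 by rewrite /dot -/f f_f mxE.
have JRf : Jn *m Rn *m f = 0 by rewrite -mulmxA Rnf -scalemxAr Jn_f scaler0.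
have Jaf : Jn *m (a ^+ 2 *: f) = 0 by rewrite -scalemxAr Jn_f scaler0.
have fRJ : f^T *m Rn *m Jn = 0.
  have RnT : Rn^T = Rn by rewrite /Rn -mxA_trace Rn_sym.
  by rewrite -RnT -trmx_mul Rnf linearZ/= -scalemxAl f_Jn scaler0.
have faT : f *m (a ^+ 2 *: f)^T = a ^+ 2 *: (f *m f^T) by rewrite linearZ/= -scalemxAr.
have afT : a ^+ 2 *: f *m f^T = a ^+ 2 *: (f *m f^T) by rewrite -scalemxAl.
rewrite JRf Jaf fRJ faT afT JRJ Rnf !dotE dff trmx0 !oppr0 !addr0.
rewrite scale_block_mx !scaler0 /flow_op_ext /flow_op /flow_rate mxA_trace -/f -/S -/M.
congr block_mx.
  rewrite /Rn -/S -/M; move: (f *m f^T) M S (\tr _) => F M' S' t.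
  by apply/matrixP => i j; rewrite !mxE; field.
rewrite scale_scalar_mx; congr (_%:M); move: (\tr _) => t; by field.
Qed.

Lemma flow_op_sym : (flow_op A)^T = flow_op A.
Proof.
rewrite /flow_op; have := sympart_tr A; have := mxbr_self_tr_sym A; rewrite -/M.
move: M (sympart A) => M' S hM hS.
by rewrite linearD/= linearB/= !linearZ/= hM hS trmx_mul trmxK.
Qed.

Lemma flow_op_ext_sym : (flow_op_ext A)^T = flow_op_ext A.
Proof. by rewrite /flow_op_ext tr_block_mx !trmx0 tr_scalar_mx flow_op_sym. Qed.

(** The projection on e_1 commutes with A, as e_1 is an eigenvector of both A and A^t for a, and
    [S(A), A] = -[A, A^t] / 2. *)
Lemma flow_op_mxbr : mxbr (flow_op A) A = 2^-1 *: mxbr M A + (a / 2) *: M.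
Proof.
have FA : f *m f^T *m A = a *: (f *m f^T).
  by rewrite -mulmxA -[f^T *m A]trmxK trmx_mul trmxK mxA_trf linearZ/= -scalemxAr.
have AF : A *m (f *m f^T) = a *: (f *m f^T) by rewrite mulmxA mxA_f -scalemxAl.
have SA : sympart A *m A - A *m sympart A = - (2^-1 *: M).
  rewrite /sympart -scalemxAl -scalemxAr mulmxDl mulmxDr -scalerBr -scalerN; congr (_ *: _).
  by rewrite /M /mxbr opprD addrACA subrr add0r opprB.
rewrite /flow_op -/M mxA_trace; move: (2^-1 * _) => t; move: (sympart A) M SA => S M' SA.
rewrite /mxbr !mulmxDl !mulmxDr mulNmx mulmxN -!scalemxAl -!scalemxAr FA AF.
move: SA; move: (S *m A) (A *m S) (M' *m A) (A *m M') (f *m f^T) => s1 s2 m1 m2 F e.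
have -> : s1 = s2 - 2^-1 *: M' by rewrite -e addrC subrK.
by apply/matrixP => i j; rewrite !mxE; field.
Qed.

Lemma mxA_soliton_of_derivation (d : R) : mxbr (flow_op A) A = d *: A ->
  scf_soliton (ga_bracket A) w 1%:M.
Proof.
move=> H; apply: algebraic_soliton_soliton => //; split; first exact: mxA_almost_kahler.
(* P + Ric^ac is minus [flow_rate A] on e_{2n}, and D takes the value d there; c is the
   difference. *)
pose c := - flow_rate A - d.
exists c, (block_mx (flow_op A - c%:M) 0 0 d%:M); split.
  apply: block_derivation; rewrite -H /mxbr mulmxBl mulmxBr mul_scalar_mx mul_mx_scalar.
  by rewrite opprB addrA subrK.
rewrite -/w -/P -/E mxA_operator /flow_op_ext (scalar_mx_block (1 + m) 1) add_block_mx !addr0.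
congr block_mx; first by rewrite addrC subrK.
by apply/matrixP => i j; rewrite !ord1 !mxE eqxx !mulr1n /c subrK.
Qed.

Lemma mxA_soliton_of_normal : normal_mx A -> scf_soliton (ga_bracket A) w 1%:M.
Proof.
move=> nA; apply: (@mxA_soliton_of_derivation 0).
have M0 : M = 0 by rewrite /M /mxbr nA subrr.
by rewrite flow_op_mxbr M0 /mxbr mul0mx mulmx0 subrr !scaler0 addr0 scale0r.
Qed.

(** Both sides are applied to e_1, where M e_1 = 0 and A e_1 = a e_1. *)
Lemma critical_a0 (mu : R) : mxbr M A = mu *: A -> mu * a = 0.
Proof.
move=> /(congr1 (mulmx^~ f)) /=.
have Mf : M *m f = 0 by rewrite mxA_mxbr /f mul_block_col !mul0mx mulmx0 !addr0 col_mx0.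
rewrite /mxbr mulmxBl -!mulmxA Mf mulmx0 subr0 mxA_f -scalemxAr Mf scaler0 -scalemxAl mxA_f.
move=> /esym/(congr1 (dot f)); rewrite dot0r !dotZr.
by rewrite [dot f f]/dot f_f mxE mulr1.
Qed.

(** If mu = 0, then |M|^2 = <[M, A], A> = 0 and A is normal. Otherwise a = 0, so [X_A, A] = [M, A] /
    2 and d = mu / 2. *)
Lemma mxA_soliton_of_critical (mu : R) : mxbr M A = mu *: A ->
  scf_soliton (ga_bracket A) w 1%:M.
Proof.
move=> H; have /eqP := critical_a0 H; rewrite mulf_eq0 => /orP[/eqP mu0|/eqP a0].
  apply: mxA_soliton_of_normal.
  have trM : \tr (M *m M) = 0.
    have -> : \tr (M *m M) = \tr (mxbr M A *m A^T) by rewrite mxtrace_mxbr.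
    by rewrite H mu0 scale0r mul0mx mxtrace0.
  have /eqP : M = 0 by apply/eqP; rewrite -sqnorm_eq0 -mxtrace_mxbr_sq trM.
  by rewrite subr_eq0 => /eqP.
apply: (@mxA_soliton_of_derivation (mu / 2)).
by rewrite flow_op_mxbr H a0 mul0r scale0r addr0 scalerA mulrC.
Qed.

Lemma nilpotent_mxA_a0 : nilpotent_mx A -> a = 0.
Proof.
move=> [k]; have Af j : A ^+ j *m f = a ^+ j *: f.
  elim: j => [|j IH]; first by rewrite expr0 mul1mx scale1r.
  by rewrite exprS -mulmxE -mulmxA IH -scalemxAr mxA_f scalerA exprSr.
have := Af k => /[swap] ->; rewrite mul0mx => /esym/colP/(_ (lshift m 0)).
rewrite /f !mxE; case: (splitP _) => // j _; rewrite mxE ord1 eqxx mulr1 => /eqP.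
by rewrite expf_eq0 => /andP[_ /eqP].
Qed.

(** A derivation may have a skew part K on the ideal, with [K, A] = d A - [M, A] / 2. But [K, A] is
    orthogonal to A, as tr (K M) = 0, and to [M, A], by the invariance of |M|^2 under O(k); so it
    vanishes. Pairing with A identifies 2 d. *)
Lemma nilpotent_soliton_critical : A != 0 -> nilpotent_mx A ->
  scf_soliton (ga_bracket A) w 1%:M ->
  mxbr A M = - (sqnorm M / sqnorm A) *: A.
Proof.
move=> A0 /nilpotent_mxA_a0 a0 [_ [c [D [/derivation_block derD _ eqD]]]].
have cP : endo_c w 1%:M P = P.
  by rewrite endo_cP// mxA_P_sym half_double.
have := eqD; rewrite -/w -/P cP -/E mxA_operator => /(congr1 ulsubmx).
rewrite /adj invmx1 mul1mx mulmx1.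
have -> : ulsubmx (c%:M + 2^-1 *: (D + D^T)) = c%:M + 2^-1 *: (ulsubmx D + (ulsubmx D)^T).
  by rewrite (scalar_mx_block (1 + m) 1) -{1 2}[D]submxK tr_block_mx add_block_mx
    scale_block_mx add_block_mx block_mxKul.
rewrite /flow_op_ext block_mxKul.
move: (ulsubmx D) (drsubmx D 0 0) derD => Dn d derD eDn.
pose K := 2^-1 *: (Dn - Dn^T).
have KT : K^T = - K by exact: skewpart_tr.
have DnE : Dn = flow_op A - c%:M + K.
  rewrite eDn /K; move: Dn^T => Dn'.
  by apply/matrixP => i j; rewrite !mxE; field.
have MT : M^T = M by exact: mxbr_self_tr_sym.
have KA : mxbr K A = d *: A - 2^-1 *: mxbr M A.
  rewrite -derD DnE [mxbr (_ + _) A]/mxbr mulmxDl mulmxDr mulmxBl mulmxBr.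
  rewrite mul_scalar_mx mul_mx_scalar.
  have := flow_op_mxbr; rewrite a0 mul0r scale0r addr0 => <-.
  rewrite /mxbr; move: (flow_op A *m A) (A *m flow_op A) (K *m A) (A *m K) (c *: A).
  by move=> x1 x2 x3 x4 x5; apply/matrixP => i j; rewrite !mxE; ring.
have KA0 : mxbr K A = 0.
  apply/eqP; rewrite -sqnorm_eq0 /sqnorm {1}KA mulmxBl -!scalemxAl mxtraceB !mxtraceZ.
  rewrite mxtrace_skew_mxbr// mulr0 subr0 -mxtrace_tr trmx_mul trmxK.
  by rewrite mxtrace_mxbr -/M mxtrace_skew_sym// mulr0.
have dA : mxbr M A = (2 * d) *: A.
  move: KA; rewrite KA0 => /esym/eqP; rewrite subr_eq0 => /eqP e.
  by rewrite -scalerA e scalerA divff ?scale1r ?pnatr_eq0.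
have e2 : sqnorm M = 2 * d * sqnorm A.
  have <- : \tr (mxbr M A *m A^T) = sqnorm M by rewrite mxtrace_mxbr mxtrace_mxbr_sq.
  by rewrite dA -scalemxAl mxtraceZ.
rewrite mxbrC dA e2 mulfK ?scaleNr//.
by rewrite sqnorm_eq0.
Qed.

(** The infinitesimal action of X = P + Ric^ac on omega: P commutes with J and counts twice, Ric^ac
    anticommutes with J and cancels. *)
Lemma mxA_chern_ricci_flow : 2 *: chern_ricci (ga_bracket A) w 1%:M =
  (flow_op_ext A)^T *m w + w *m flow_op_ext A.
Proof.
have wt : w^T = J := omega_tr J1.
have wE : w = - J by rewrite -wt omega_skew// opprK.
have wJ : w *m J = 1%:M by rewrite wE mulNmx J_J// opprK.
have pE : chern_ricci (ga_bracket A) w 1%:M = P *m w.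
  rewrite -mxA_P_sym /P /Pop /endo_of trmxK -mulmxA mulVmx ?mulmx1//.
  by have [] := mulmx1_unit wJ.
have Jop1E : Jop w 1%:M = J := Jop1 (omega_tr J1).
have EJ : E *m J = - (J *m E).
  have EJE : J *m E *m J = E by exact: endo_ac_anti.
  rewrite -{1}EJE -[_ *m J *m J]mulmxA J_J//.
  by rewrite mulmxN mulmx1.
have PJ : P *m J = J *m P.
  have PT : - (J *m P *m J) = P^T := Pop_tr A (omega_tr J1) (omega_skew J1T) (J_J J1J1).
  rewrite mxA_P_sym in PT; rewrite -{2}PT mulmxN !mulmxA J_J//.
  by rewrite !mulNmx mul1mx opprK.
rewrite flow_op_ext_sym pE -mxA_operator mulmxDl mulmxDr wE !(mulNmx, mulmxN) EJ PJ.
by move: (J *m P) (J *m E) => x y; apply/matrixP => i j; rewrite !mxE; ring.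
Qed.

(** Together with the previous lemma this shows that both SCF equations are the action of the single
    operator P + Ric^ac, so one moving frame integrates them. *)
Lemma mxA_metric_flow :
  form_c w 1%:M (chern_ricci (ga_bracket A) w 1%:M) *m Jop w 1%:M
  + form_ac w 1%:M (ricci (ga_bracket A) 1%:M) = flow_op_ext A.
Proof.
have wt : w^T = J := omega_tr J1.
have wE : w = - J by rewrite -wt omega_skew// opprK.
have wJ : w *m J = 1%:M by rewrite wE mulNmx J_J// opprK.
have pE : chern_ricci (ga_bracket A) w 1%:M = - (P *m J).
  rewrite -mulmxN -wE -mxA_P_sym /P /Pop /endo_of trmxK -mulmxA mulVmx ?mulmx1//.
  by have [] := mulmx1_unit wJ.
have Jop1E : Jop w 1%:M = J := Jop1 (omega_tr J1).
have JT : J^T = - J by exact: Jop_tr (omega_tr J1) (omega_skew J1T).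
have PT : - (J *m P *m J) = P.
  by have := Pop_tr A (omega_tr J1) (omega_skew J1T) (J_J J1J1); rewrite -/P mxA_P_sym.
have RicE : ricci (ga_bracket A) 1%:M = Ricop (ga_bracket A) 1%:M.
  by rewrite -Ric_sym /Ricop /endo_of invmx1 mulmx1 trmxK.
rewrite -mxA_operator /E /form_c /form_ac /endo_ac Jop1E JT RicE pE.
have jj := J_J J1J1; rewrite -/Jn -/f -/J in jj.
move: (Ricop _ _) P PT => ric p pj; move: J jj pj => j jj pj.
congr (_ + _); last by rewrite !(mulNmx, mulmxN) opprK.
have -> : - j *m - (p *m j) *m j = - (j *m p).
  by rewrite !(mulNmx, mulmxN) opprK mulmxA -[_ *m j *m j]mulmxA jj mulmxN mulmx1.
have pjjp : j *m p = p *m j.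
  by rewrite -{1}pj mulmxN !mulmxA jj !mulNmx mul1mx opprK.
by rewrite pjjp -scalemxAl mulmxDl !mulNmx -mulmxA jj mulmxN mulmx1 opprK half_double.
Qed.

End StandardBlock.

(** * Reduction of an arbitrary structure *)

Section Cholesky.
Variable R : realType.

Definition posdef d (g : 'M[R]_d) : Prop :=
  g^T = g /\ forall X : 'cV[R]_d, X != 0 -> 0 < form g X X.

(** Induction through the Schur complement C - x^{-1} b b^t: its value at X is the minimum of g over
    the first coordinate, attained at -x^{-1} <b, X>, hence positive. *)
Lemma cholesky d (g : 'M[R]_d) : posdef g -> exists2 h, h \in unitmx & g = h^T *m h.
Proof.
elim: d g => [|d IH] g [gT gpos].
  by exists 1%:M; [exact: unitmx1|apply/matrixP => -[]].
pose G : 'M[R]_(1 + d) := g.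
pose x := ulsubmx G 0 0; pose b := dlsubmx G; pose C := drsubmx G.
have GE : G = block_mx x%:M b^T b C.
  rewrite -[LHS]submxK; congr block_mx; first exact: mx11_scalar.
  by rewrite /b trmx_dlsub /G gT.
have formG (s : R) (X : 'cV[R]_d) : form G (col_mx s%:M X) (col_mx s%:M X) =
    x * s ^+ 2 + 2 * s * dot b X + dot X (C *m X).
  rewrite /form -mulmxA GE mul_block_col tr_col_mx mul_row_col tr_scalar_mx mulmxDr mulmxDr.
  rewrite (mul_trmx_dot b X) (mul_trmx_dot X (C *m X)) (mul_mx_scalar s b) -scalemxAr.
  rewrite (mul_trmx_dot X b) -!scalar_mxM !mxE/= !mulr1n (dotC X b) expr2; ring.
have x0 : 0 < x.
  have := gpos (col_mx 1%:M 0 : 'cV[R]_(1 + d)); rewrite -/G formG !dot0l ?dot0r.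
  rewrite !mulr0 expr1n mulr1 !addr0; apply; apply/eqP => /(congr1 (@usubmx _ 1 d 1)).
  by rewrite col_mxKu linear0 => /matrixP/(_ 0 0)/eqP; rewrite !mxE oner_eq0.
pose C' := C - x^-1 *: (b *m b^T).
have [|H Hu HC] := IH C'.
  split; first by rewrite /C' linearB/= linearZ/= trmx_mul trmxK /C trmx_drsub /G gT.
  move=> X X0; have := gpos (col_mx (- (x^-1 * dot b X))%:M X : 'cV[R]_(1 + d)).
  rewrite -/G formG.
  have -> : form C' X X = x * (- (x^-1 * dot b X)) ^+ 2 +
      2 * (- (x^-1 * dot b X)) * dot b X + dot X (C *m X).
    rewrite /form -mulmxA -/(dot _ _) /C' mulmxBl -scalemxAl -mulmxA mul_trmx_dot.
    by rewrite mul_mx_scalar !dotE (dotC X b) expr2; field; exact: lt0r_neq0.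
  apply; apply: contra X0 => /eqP/(congr1 (@dsubmx _ 1 d 1)).
  by rewrite col_mxKd linear0 => ->.
pose s := Num.sqrt x.
have s0 : s != 0 by rewrite gt_eqF// sqrtr_gt0.
have ss : s * s = x by rewrite -expr2 sqr_sqrtr// ltW.
pose h : 'M[R]_(1 + d) := block_mx s%:M (s^-1 *: b)^T 0 H.
have hdet : \det h = s * \det H by rewrite det_ublock det_scalar.
suff hG : h^T *m h = G by exists h; rewrite // unitmxE hdet unitrM -unitmxE Hu andbT unitfE.
rewrite GE /h tr_block_mx mulmx_block trmx0 !trmxK tr_scalar_mx !mulmx0 !mul0mx !addr0.
rewrite -scalar_mxM ss mul_mx_scalar mul_scalar_mx linearZ/= !scalerA divff// !scale1r.
rewrite -scalemxAl -scalemxAr scalerA -invfM ss -HC /C'.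
by rewrite addrC subrK.
Qed.

(** Eliminating the last coordinate gives a block upper triangular factor. It preserves the ideal n,
    and so it is an isomorphism onto another almost abelian algebra. *)
Lemma block_cholesky k (g : 'M[R]_(k + 1)) : posdef g ->
  exists (H : 'M[R]_k) (u : 'cV[R]_k) (y : R), [/\ H \in unitmx, y != 0 &
    g = (block_mx H u 0 y%:M)^T *m block_mx H u 0 y%:M].
Proof.
move=> [gT gpos].
pose G := ulsubmx g; pose b := ursubmx g; pose c := drsubmx g 0 0.
have GE : g = block_mx G b b^T c%:M.
  rewrite -[LHS]submxK; congr block_mx; last exact: mx11_scalar.
  by rewrite /b trmx_ursub gT.
have formG (s : R) (X : 'cV[R]_k) : form g (col_mx X s%:M) (col_mx X s%:M) =
    dot X (G *m X) + 2 * s * dot b X + c * s ^+ 2.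
  rewrite {1}GE form_block !npart_col !epart_col !mxE !mulr1n (dotC X b) expr2; ring.
have [|H Hu HG] := @cholesky _ G.
  split; first by rewrite /G trmx_ulsub gT.
  move=> X X0; have := gpos (col_mx X 0%:M).
  rewrite formG mulr0 mul0r addr0 expr0n mulr0 addr0 /form -mulmxA; apply.
  apply: contra X0 => /eqP/colP e; apply/eqP/colP => i.
  by have := e (lshift 1 i); rewrite col_mxEu !mxE.
pose u := invmx H^T *m b.
have HTu : H^T *m u = b by rewrite /u mulmxA mulmxV ?mul1mx// unitmx_tr.
have y0 : 0 < c - dot u u.
  have := gpos (col_mx (- (invmx H *m u)) 1%:M); rewrite formG.
  have -> : dot (- (invmx H *m u)) (G *m - (invmx H *m u)) + 2 * 1 * dot b (- (invmx H *m u))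
      + c * 1 ^+ 2 = c - dot u u.
    have e1 : dot (invmx H *m u) (G *m (invmx H *m u)) = dot u u.
      by rewrite HG -mulmxA mulKVmx// -dot_mull mulKVmx.
    have e2 : dot b (invmx H *m u) = dot u u by rewrite -HTu dot_mull trmxK mulKVmx.
    by rewrite !mulmxN !dotE e1 e2; ring.
  apply; apply/eqP => /colP/(_ (rshift k 0)).
  by rewrite col_mxEd !mxE => /eqP; rewrite oner_eq0.
exists H, u, (Num.sqrt (c - dot u u)); split=> //; first by rewrite gt_eqF// sqrtr_gt0.
rewrite GE tr_block_mx mulmx_block trmx0 tr_scalar_mx !mulmx0 !mul0mx !addr0 HTu -HG.
congr block_mx; first by rewrite -HTu trmx_mul trmxK.
rewrite mul_trmx_dot -scalar_mxM -expr2 sqr_sqrtr ?(ltW y0)//.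
by apply/matrixP => i j; rewrite !ord1 !mxE eqxx !mulr1n addrC subrK.
Qed.

Lemma householder k (x y : 'cV[R]_k) : dot x x = 1 -> dot y y = 1 ->
  exists Q : 'M[R]_k, [/\ Q^T = Q, Q *m Q = 1%:M & Q *m x = y].
Proof.
move=> xx yy; have [->|xy] := eqVneq x y.
  by exists 1%:M; rewrite trmx1 !mul1mx.
pose u := x - y; pose c := 2 / dot u u.
have uu0 : dot u u != 0.
  by apply: contra xy => /eqP/dot_eq0/eqP; rewrite subr_eq0.
have cu : c * dot u u = 2 by rewrite /c divfK.
exists (1%:M - c *: (u *m u^T)); split.
- by rewrite linearB/= linearZ/= trmx_mul trmxK trmx1.
- rewrite mulmxBl mul1mx mulmxBr mulmx1 -scalemxAl -scalemxAr -mulmxA (mulmxA u^T).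
  rewrite mul_trmx_dot mul_scalar_mx -scalemxAr (scalerA c (dot u u)) cu.
  by apply/matrixP => i j; rewrite !mxE; ring.
- rewrite mulmxBl mul1mx -scalemxAl -mulmxA mul_trmx_dot mul_mx_scalar scalerA.
  have -> : c * dot u x = 1.
    have e : dot u u = 2 * dot u x by rewrite /u !dotE xx yy (dotC y x); ring.
    by have := cu; rewrite e mulrCA -[X in _ = X]mulr1 => /mulfI -> //; rewrite pnatr_eq0.
  by rewrite scale1r /u opprB addrC subrK.
Qed.

End Cholesky.

(** * Semisimple, normal and nilpotent matrices *)

Section Semisimple.
Variables (R : realType) (k : nat).
Implicit Types A B : 'M[R]_k.

Lemma semisimpleP A : semisimple_mx A <->
  exists P D, P \in unitmx /\ cplx A = invmx P *m diag_mx D *m P.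
Proof.
rewrite /semisimple_mx; split.
  move=> [P Pu /(diagonalizable_forLR Pu)[D]].
  rewrite mxpoly.conjumx ?unitmx_inv// invmxK => e.
  by exists P, D.
move=> [P [D [Pu e]]]; exists P => //; apply/(diagonalizable_forLR Pu); exists D.
by rewrite mxpoly.conjumx ?unitmx_inv// invmxK.
Qed.

Lemma cplxM A B : cplx (A *m B) = cplx A *m cplx B.
Proof. exact: map_mxM. Qed.

Lemma cplxZ c A : cplx (c *: A) = (c%:C)%C *: cplx A.
Proof. exact: map_mxZ. Qed.

Lemma cplx_inv A : cplx (invmx A) = invmx (cplx A).
Proof. exact: map_invmx. Qed.

Lemma cplx_unit A : (cplx A \in unitmx) = (A \in unitmx).
Proof. exact: map_unitmx. Qed.

Lemma normal_semisimple A : normal_mx A -> semisimple_mx A.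
Proof.
move=> nA; apply/semisimpleP; exists (spectralmx (cplx A)), (spectral_diag (cplx A)).
split; first exact: spectral_unit.
apply/orthomx_spectralP/normalmxP.
have cA (B : 'M[R]_k) : map_mx Num.conj (cplx B)^T = cplx B^T.
  by apply/matrixP => i j; rewrite !mxE; apply/eqP; rewrite eq_complex/= oppr0 !eqxx.
by rewrite cA -!cplxM nA.
Qed.

Lemma semisimple_similar A B (c : R) (H : 'M[R]_k) : H \in unitmx -> c != 0 ->
  B = c *: (H *m A *m invmx H) -> semisimple_mx B -> semisimple_mx A.
Proof.
move=> Hu c0 BE /semisimpleP[P [D [Pu e]]]; apply/semisimpleP.
exists (P *m cplx H), ((c^-1)%:C%C *: D); split; first by rewrite unitmx_mul Pu cplx_unit.
have -> : A = c^-1 *: (invmx H *m B *m H).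
  rewrite BE -!scalemxAr -scalemxAl scalerA mulVf// scale1r -!mulmxA mulVmx// mulmx1.
  by rewrite mulKmx.
rewrite cplxZ !cplxM e cplx_inv; set K := cplx H; have Ku : K \in unitmx by rewrite cplx_unit.
have -> : invmx (P *m K) = invmx K *m invmx P.
  have PKu : P *m K \in unitmx by rewrite unitmx_mul Pu.
  by apply: (can_inj (mulKmx PKu)); rewrite mulmxV// -mulmxA mulKVmx// mulmxV.
have -> : diag_mx ((c^-1)%:C%C *: D) = (c^-1)%:C%C *: diag_mx D by exact: linearZ.
move: (diag_mx D) (invmx K) (invmx P) => X Y Z.
by rewrite -!scalemxAr -!scalemxAl !mulmxA.
Qed.

Lemma nilpotent_semisimple0 A : nilpotent_mx A -> semisimple_mx A -> A = 0.
Proof.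
move=> [j Aj] /semisimpleP[P [D [Pu e]]].
have De : forall l, cplx (A ^+ l) = invmx P *m diag_mx (\row_i D 0 i ^+ l) *m P.
  elim=> [|l IH].
    rewrite expr0 (_ : diag_mx _ = 1%:M) ?mulmx1 ?mulVmx//; last first.
      by apply/matrixP => i i'; rewrite !mxE expr0.
    exact: map_mx1.
  have cM (X Y : 'M[R[i]]_k) : invmx P *m X *m P *m (invmx P *m Y *m P) = invmx P *m (X *m Y) *m P.
    by rewrite !mulmxA mulmxK.
  rewrite exprS -mulmxE cplxM IH e cM; congr (invmx P *m (_ : 'M_k) *m P).
  apply/matrixP => i i'; rewrite mul_diag_mx !mxE.
  by case: eqP => _; rewrite ?mulr1n ?mulr0n ?mulr0// exprS.
have D0 : diag_mx (\row_i D 0 i ^+ j) = 0.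
  have := De j; rewrite Aj /cplx map_mx0 => /(congr1 (fun M => P *m M *m invmx P)).
  by rewrite mulmx0 mul0mx !mulmxA mulmxV// mul1mx mulmxK.
have D1 : D = 0.
  apply/rowP => i; have /matrixP/(_ i i) := D0.
  by rewrite !mxE eqxx mulr1n => /eqP; rewrite expf_eq0 => /andP[_ /eqP].
have : cplx A = 0 by rewrite e D1 (_ : diag_mx 0 = 0) ?mulmx0 ?mul0mx//; exact: raddf0.
move=> /matrixP A0; apply/matrixP => i l; have := A0 i l; rewrite !mxE => /eqP.
by rewrite eq_complex/= eqxx andbT => /eqP.
Qed.

Lemma nilpotent_similar A B (c : R) (H : 'M[R]_k) : H \in unitmx ->
  B = c *: (H *m A *m invmx H) -> nilpotent_mx A -> nilpotent_mx B.
Proof.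
move=> Hu BE [j Aj]; exists j.
have : forall l, B ^+ l = c ^+ l *: (H *m A ^+ l *m invmx H).
  elim=> [|l IH]; first by rewrite !expr0 mulmx1 mulmxV// scale1r.
  rewrite !exprS IH BE -!mulmxE -scalemxAl -scalemxAr scalerA; congr (_ *: _).
  by rewrite !mulmxA mulmxKV.
by move=> ->; rewrite Aj mulmx0 mul0mx scaler0.
Qed.

End Semisimple.

Section AlmostAbelianHom.
Variables (R : realType) (k : nat).
Implicit Types A B H : 'M[R]_k.

Definition ga_lin H (u : 'cV[R]_k) (y : R) : 'M[R]_(k + 1) := block_mx H u 0 y%:M.

Lemma ga_lin_col H u y X : ga_lin H u y *m X =
  col_mx (H *m npart X + epart X *: u) (y * epart X)%:M.
Proof.
rewrite {1}(cV_npart_epart X) mul_block_col mul0mx add0r -scalar_mxM.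
by rewrite mul_mx_scalar.
Qed.

Lemma ga_lin_hom A B H u y : H *m A = y *: (B *m H) -> forall X Y,
  ga_bracket B (ga_lin H u y *m X) (ga_lin H u y *m Y) = ga_lin H u y *m ga_bracket A X Y.
Proof.
move=> HA X Y; rewrite !ga_lin_col /ga_bracket !npart_col !epart_col !mxE mulr0 mulr1n.
rewrite scale0r addr0 scalar_mx0; congr col_mx.
move: (npart X) (npart Y) (epart X) (epart Y) => x z s t.
rewrite mulmxBr !mulmxDr -!scalemxAr (mulmxA H A z) (mulmxA H A x) HA -!scalemxAl !mulmxA.
by apply/matrixP => i j; rewrite !mxE !mulr1n; ring.
Qed.

Lemma ga_lin_unit H u y : H \in unitmx -> y != 0 -> ga_lin H u y \in unitmx.
Proof.
by move=> Hu y0; rewrite unitmxE det_ublock det_scalar expr1 unitrM -unitmxE Hu unitfE.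
Qed.

End AlmostAbelianHom.

(** * Normal form of an almost-Kahler structure *)

Section NormalForm.
Variable R : realType.

Lemma submxN m1 m2 n1 n2 (M : 'M[R]_(m1 + m2, n1 + n2)) :
  [/\ ulsubmx (- M) = - ulsubmx M, ursubmx (- M) = - ursubmx M,
      dlsubmx (- M) = - dlsubmx M & drsubmx (- M) = - drsubmx M].
Proof. by split; apply/matrixP => i j; rewrite !mxE. Qed.

Lemma cholesky_form k (A : 'M[R]_k) w g : almost_kahler (ga_bracket A) w g ->
  exists (H : 'M[R]_k) u y w', let B := y^-1 *: (H *m A *m invmx H) in
  [/\ H \in unitmx, y != 0, w = (ga_lin H u y)^T *m w' *m ga_lin H u y,
      g = (ga_lin H u y)^T *m 1%:M *m ga_lin H u y
    & forall X Y, ga_bracket B (ga_lin H u y *m X) (ga_lin H u y *m Y) =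
        ga_lin H u y *m ga_bracket A X Y].
Proof.
move=> [_ _ _ [gT gpos] _]; have [H [u [y [Hu y0 gE]]]] := block_cholesky (conj gT gpos).
pose h := ga_lin H u y; have hu : h \in unitmx by exact: ga_lin_unit.
exists H, u, y, (invmx h^T *m w *m invmx h); split=> //.
- by rewrite !mulmxA mulmxV ?unitmx_tr// mul1mx mulmxKV.
- by rewrite mulmx1.
- by apply: ga_lin_hom; rewrite -scalemxAl scalerA divff// scale1r mulmxKV.
Qed.

(** For the metric 1 the form w is skew with w^2 = -1, so its column f at e_{2n} is a unit vector of
    the ideal. A reflection taking f to e_1 brings w to [omega J1], and closedness of w dictates the
    shape of the conjugated B. *)
Lemma householder_form m (B : 'M[R]_(1 + m)) w : almost_kahler (ga_bracket B) w 1%:M ->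
  exists Q J1 a v B1, [/\ Q \in unitmx, Q *m B *m invmx Q = block_mx a%:M v^T 0 B1,
    w = (ga_lin Q 0 1)^T *m omega J1 *m ga_lin Q 0 1,
    1%:M = (ga_lin Q 0 1)^T *m 1%:M *m ga_lin Q 0 1
  & [/\ J1^T = - J1, J1 *m J1 = - 1%:M & in_sp J1 B1]].
Proof.
move=> [wT _ wcl _ JJ].
have Jw : Jop w 1%:M = - w.
  by rewrite /Jop /endo_of invmx1 mulmx1.
have ww : w *m w = - 1%:M by move: JJ; rewrite Jw mulNmx mulmxN opprK.
pose O := ulsubmx w; pose f := ursubmx w.
have [Nul Nur Ndl Ndr] := submxN w.
have OT : O^T = - O by rewrite /O trmx_ulsub wT Nul.
have wE : w = block_mx O f (- f^T) 0.
  rewrite -[LHS]submxK; congr block_mx.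
    by rewrite /f trmx_ursub wT Ndl opprK.
  have /matrixP/(_ 0 0) : drsubmx w = - drsubmx w.
    rewrite -Ndr -wT -trmx_drsub; apply/matrixP => i j; rewrite !ord1 [RHS]mxE; by [].
  rewrite [in RHS]mxE => e; apply/matrixP => i j; rewrite !ord1 [RHS]mxE.
  by move/eqP: e; rewrite -addr_eq0 -mulr2n mulrn_eq0/= => /eqP.
have /eq_block_mx[wO wf _ ff] : block_mx (O *m O - f *m f^T) (O *m f) (- (f^T *m O)) (- (f^T *m f))
    = block_mx (- 1%:M) 0 0 (- 1%:M).
  have := ww; rewrite wE mulmx_block !mulmx0 !mul0mx !addr0 mulmxN mulNmx mulNmx.
  by move=> ->; rewrite (@scalar_mx_block R (1 + m) 1 1) opp_block_mx !oppr0.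
(* Closedness of w on x, y in n and e_{2n}. *)
have BO : B^T *m O = - (O *m B).
  have bil x y : dot (B *m x) (O *m y) - dot (B *m y) (O *m x) = 0.
    have wE' : w = block_mx O f (- f)^T 0%:M by rewrite wE scalar_mx0 linearN.
    have := wcl (col_mx x 0) (col_mx y 0) (col_mx 0 1%:M).
    rewrite /ga_bracket !npart_col !epart_col !mxE !mulmx0 !scale0r !subr0 !sub0r.
    rewrite !scale1r wE' !form_block !npart_col !epart_col !mxE !dotE !mulmx0 ?dot0l ?dot0r.
    by move=> <-; ring.
  apply: eq_form => x y.
  have -> : form (B^T *m O) x y = dot (B *m x) (O *m y) by rewrite /form /dot trmx_mul !mulmxA.
  have -> : form (- (O *m B)) x y = dot (B *m y) (O *m x).
    by rewrite dotC /form /dot trmx_mul OT !mulmxN !mulNmx !mulmxA.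
  by apply/eqP; rewrite -subr_eq0 bil.
have ff1 : dot f f = 1.
  by move/matrixP: ff => /(_ 0 0); rewrite mul_trmx_dot !mxE !mulr1n => /oppr_inj.
have e1 : dot (col_mx 1%:M 0 : 'cV[R]_(1 + m)) (col_mx 1%:M 0) = 1.
  by rewrite dot_col dot_scalar mulr1 dot0l addr0.
have [Q [QT QQ Qf]] := householder ff1 e1.
have [Qi _] := mulmx1_unit QQ.
have QiE : invmx Q = Q by rewrite -[LHS]mulmx1 -QQ mulKmx.
pose C := Q *m B *m Q; pose N := Q *m O *m Q.
have NE : N = block_mx 0 0 0 (drsubmx N).
  have Nf : N *m col_mx 1%:M 0 = 0 :> 'cV[R]_(1 + m).
    by rewrite -Qf /N -!mulmxA (mulmxA Q Q) QQ mul1mx wf mulmx0.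
  have NT : N^T = - N by rewrite /N !trmx_mul QT OT !mulNmx mulmxN mulmxA.
  have := Nf; rewrite -{1}[N]submxK mul_block_col !mulmx0 !addr0 !mulmx1 -[0]vsubmxK.
  move=> /eq_col_mx[]; rewrite !linear0 => ul dl.
  rewrite -[LHS]submxK ul dl; congr block_mx.
  by rewrite -[ursubmx N]trmxK trmx_ursub NT; have [_ _ -> _] := submxN N; rewrite dl oppr0 trmx0.
pose J1 := (drsubmx N)^T.
have NN : N *m N - col_mx 1%:M 0 *m (col_mx 1%:M 0)^T = - 1%:M :> 'M[R]_(1 + m).
  rewrite -Qf trmx_mul QT /N.
  have -> : Q *m O *m Q *m (Q *m O *m Q) = Q *m (O *m O) *m Q.
    by rewrite !mulmxA -(mulmxA _ Q Q) QQ mulmx1.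
  have -> : Q *m f *m (f^T *m Q) = Q *m (f *m f^T) *m Q by rewrite !mulmxA.
  by rewrite -mulmxBl -mulmxBr wO mulmxN mulNmx mulmx1 QQ.
have NT : N^T = - N by rewrite /N !trmx_mul QT OT !mulNmx mulmxN mulmxA.
have J1T : J1^T = - J1.
  by rewrite /J1 trmxK trmx_drsub NT; have [_ _ _ ->] := submxN N; rewrite opprK.
pose N1 := drsubmx N.
have N1N1 : N1 *m N1 = - 1%:M.
  have := NN; rewrite NE mulmx_block tr_col_mx mul_col_row trmx0 trmx1 !mulmx0 !mul0mx mulmx1 !addr0.
  rewrite !add0r opp_block_mx add_block_mx (@scalar_mx_block R 1 m 1) opp_block_mx.
  by move=> /eq_block_mx[_ _ _]; rewrite oppr0 addr0.
have J1J1 : J1 *m J1 = - 1%:M.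
  by rewrite -trmx_mul N1N1; apply/matrixP => i j; rewrite !mxE eq_sym.
have J1N : N1 = - J1 by rewrite -J1T trmxK.
have CN : C^T *m N = - (N *m C).
  have -> : C^T *m N = Q *m (B^T *m O) *m Q.
    by rewrite /C /N !trmx_mul QT !mulmxA -(mulmxA _ Q Q) QQ mulmx1.
  by rewrite BO /C /N mulmxN mulNmx !mulmxA -(mulmxA _ Q Q) QQ mulmx1.
pose C3 := dlsubmx C; pose C4 := drsubmx C.
have CE : C = block_mx (ulsubmx C) (ursubmx C) C3 C4 by rewrite submxK.
(* N kills e_1 and is invertible on n_1. The two right-hand blocks of C^t N = -N C give C_3 = 0 and
   the sp relation for C_4. *)
have [C3E C4E] : C3 = 0 /\ C4^T *m N1 = - (N1 *m C4).
  have := CN; rewrite NE CE tr_block_mx !mulmx_block !mulmx0 !mul0mx !add0r.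
  rewrite opp_block_mx oppr0 => /eq_block_mx[_ e _ ->]; split=> //.
  apply: (can_inj trmxK); rewrite trmx0 -[LHS]opprK -[in LHS](mulmx1 C3^T) -mulmxN -N1N1.
  by rewrite mulmxA e oppr0 mul0mx oppr0.
exists Q, J1, (ulsubmx C 0 0), (ursubmx C)^T, C4; split=> //.
- by rewrite QiE -/C {1}CE C3E trmxK; congr block_mx; exact: mx11_scalar.
- have NO : Q *m N *m Q = O.
    by rewrite /N !mulmxA QQ mul1mx -mulmxA QQ mulmx1.
  have Qe : Q *m (col_mx 1%:M 0) = f by rewrite -Qf mulmxA QQ mul1mx.
  have fe : row_mx (- 1%:M) 0 *m Q = - f^T.
    by rewrite -Qe trmx_mul QT tr_col_mx trmx1 trmx0 -mulNmx opp_row_mx oppr0.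
  rewrite wE /omega /ga_lin /J1 trmxK -[block_mx 0 0 0 _]NE tr_block_mx mulmx_block.
  rewrite mulmx_block !trmx0 trmx1 !mulmx0 !mul0mx !mulmx1 !mul1mx !addr0 !add0r QT NO fe.
  by rewrite -[X in block_mx _ X]Qe.
- rewrite mulmx1 /ga_lin tr_block_mx mulmx_block !trmx0 trmx1 !mulmx0 !mul0mx !mulmx1 !addr0 !add0r QT QQ.
  exact: (@scalar_mx_block R (1 + m) 1 1).
- split=> //; rewrite /in_sp; move: C4E; rewrite J1N mulmxN mulNmx opprK => e.
  by rewrite -e subrr.
Qed.

Lemma soliton_semisimple m (A : 'M[R]_(1 + m)) w g : ~ nilpotent_mx A ->
  scf_soliton (ga_bracket A) w g \/ algebraic_scf_soliton (ga_bracket A) w g ->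
  semisimple_mx A.
Proof.
move=> nA sol; have ak : almost_kahler (ga_bracket A) w g by case: sol => -[].
have [H [u [y [w' [Hu y0 wE gE hom]]]]] := cholesky_form ak.
set B := y^-1 *: _ in hom; have BE : B = y^-1 *: (H *m A *m invmx H) by [].
move: B BE hom => B BE hom.
have hu : ga_lin H u y \in unitmx by exact: ga_lin_unit.
have lA := ga_bracket_lie A; have lB := ga_bracket_lie B.
rewrite wE gE in sol ak.
have {}ak : almost_kahler (ga_bracket B) w' 1%:M.
  exact: (iffLR (almost_kahler_transport _ _ hu hom) ak).
have {}sol : scf_soliton (ga_bracket B) w' 1%:M \/ algebraic_scf_soliton (ga_bracket B) w' 1%:M.
  case: sol => sol; [left|right].
    exact: (iffLR (scf_soliton_transport lA lB _ _ hu hom) sol).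
  exact: (iffLR (algebraic_scf_soliton_transport lA lB _ _ hu hom) sol).
have [Q [J1 [a [v [B1 [Qu CE w'E oneE [J1T J1J1 sp]]]]]]] := householder_form ak.
set C := block_mx _ _ _ _ in CE.
have lC := ga_bracket_lie C.
have hQu : ga_lin Q 0 1 \in unitmx by apply: ga_lin_unit => //; exact: oner_neq0.
have homQ : forall X Y, ga_bracket C (ga_lin Q 0 1 *m X) (ga_lin Q 0 1 *m Y) =
    ga_lin Q 0 1 *m ga_bracket B X Y.
  by apply: ga_lin_hom; rewrite scale1r -CE mulmxKV.
rewrite w'E oneE in sol.
have {}sol : scf_soliton (ga_bracket C) (omega J1) 1%:M.
  case: sol => sol; last apply: algebraic_soliton_soliton => //.
    exact: (iffLR (scf_soliton_transport lB lC _ _ hQu homQ) sol).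
  exact: (iffLR (algebraic_scf_soliton_transport lB lC _ _ hQu homQ) sol).
have CB : C = 1 *: (Q *m B *m invmx Q) by rewrite scale1r.
have nC : ~ nilpotent_mx C.
  move=> nC; apply: nA; apply: (nilpotent_similar (c := y) (H := invmx H) (A := B)).
  - by rewrite unitmx_inv.
  - rewrite invmxK BE -scalemxAr -scalemxAl scalerA divff// scale1r -!mulmxA mulVmx// mulmx1.
    by rewrite mulKmx.
  - apply: (nilpotent_similar (c := 1) (H := invmx Q) (A := C)) => //.
      by rewrite unitmx_inv.
    by rewrite scale1r invmxK CB scale1r -!mulmxA mulVmx// mulmx1 mulKmx.
have [v0 M0] := adapted_soliton_normal J1T J1J1 sp nC sol.
have {}v0 : normal_mx C.
  have CA : C = mxA a B1 by rewrite /C v0 trmx0.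
  apply/eqP; rewrite -subr_eq0 -[_ - _]/(mxbr C C^T) CA mxA_mxbr.
  by rewrite M0 block_mx0.
have sC := normal_semisimple v0.
have sB := semisimple_similar Qu (oner_neq0 R) CB sC.
exact: (semisimple_similar Hu (invr_neq0 y0) BE sB).
Qed.

End NormalForm.

(** * Compatible solitons: the semisimple case *)

Section Interpolation.
Variable K : fieldType.

Lemma interpolation (f : K -> K) (s : seq K) :
  exists p : {poly K}, forall x, x \in s -> p.[x] = f x.
Proof.
elim: s => [|x s [p ps]]; first by exists 0.
have [xs|xs] := boolP (x \in s).
  by exists p => z; rewrite inE => /predU1P[->|]; exact: ps.
pose q := \prod_(z <- s) ('X - z%:P).
have qx : q.[x] != 0 by rewrite -rootE root_prod_XsubC.
exists (p + ((f x - p.[x]) / q.[x]) *: q) => z.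
rewrite inE hornerD hornerZ => /predU1P[->|zs]; first by rewrite divfK// addrC subrK.
by have /rootP -> : root q z; rewrite ?root_prod_XsubC// mulr0 addr0 ps.
Qed.

End Interpolation.

Section ConjugateDiagonal.
Variables (F : fieldType) (k : nat).
Implicit Types (P : 'M[F]_k) (D E : 'rV[F]_k).

Definition conjd P D : 'M[F]_k := invmx P *m diag_mx D *m P.

Lemma eq_conjd P D E : (forall j, D 0 j = E 0 j) -> conjd P D = conjd P E.
Proof. by move=> /rowP ->. Qed.

Lemma conjd_mul P D E : P \in unitmx ->
  conjd P D *m conjd P E = conjd P (\row_j (D 0 j * E 0 j)).
Proof.
move=> Pu; rewrite /conjd -[in RHS](mulmx_diag D E).
by move: (diag_mx D) (diag_mx E) => X Y; rewrite !mulmxA mulmxK.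
Qed.

Lemma conjd_exp P D i : P \in unitmx -> conjd P D ^+ i = conjd P (\row_j D 0 j ^+ i).
Proof.
move=> Pu; elim: i => [|i IH].
  rewrite expr0 /conjd (_ : diag_mx _ = 1%:M) ?mulmx1 ?mulVmx//.
  by apply/matrixP => j l; rewrite !mxE expr0.
by rewrite exprS -mulmxE IH (conjd_mul _ _ Pu); apply: eq_conjd => j; rewrite !mxE exprS.
Qed.

Lemma conjd_sum P n (c : 'I_n -> F) (D : 'I_n -> 'rV[F]_k) :
  \sum_i c i *: conjd P (D i) = conjd P (\sum_i c i *: D i).
Proof.
rewrite /conjd linear_sum mulmx_sumr mulmx_suml; apply: eq_bigr => i _.
by rewrite linearZ/= -scalemxAr -scalemxAl.
Qed.

End ConjugateDiagonal.

(** * Real polynomials in a matrix; positive roots *)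

Section MatrixPolynomial.
Variables (R : realType) (k : nat).
Implicit Types A B : 'M[R]_k.

Definition polymx (p : {poly R}) A : 'M[R]_k := \sum_(i < size p) p`_i *: A ^+ i.

Lemma mulmx_exp_intertwine A B C : A *m B = B *m C -> forall i, A ^+ i *m B = B *m C ^+ i.
Proof.
move=> AB; elim=> [|i IH]; first by rewrite !expr0 mul1mx mulmx1.
by rewrite !exprSr -!mulmxE -mulmxA AB mulmxA IH mulmxA.
Qed.

Lemma polymx_intertwine p A B C : A *m B = B *m C ->
  polymx p A *m B = B *m polymx p C.
Proof.
move=> AB; rewrite mulmx_suml mulmx_sumr; apply: eq_bigr => i _.
by rewrite -scalemxAl -scalemxAr (mulmx_exp_intertwine AB).
Qed.

Lemma trmx_exp A i : (A ^+ i)^T = A^T ^+ i.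
Proof.
elim: i => [|i IH]; first by rewrite !expr0 trmx1.
by rewrite exprS exprSr -!mulmxE trmx_mul IH.
Qed.

Lemma polymx_tr p A : (polymx p A)^T = polymx p A^T.
Proof. by rewrite linear_sum; apply: eq_bigr => i _; rewrite linearZ/= trmx_exp. Qed.

Lemma cplx_exp A i : cplx (A ^+ i) = cplx A ^+ i.
Proof.
elim: i => [|i IH]; first by rewrite !expr0; exact: map_mx1.
by rewrite !exprS -!mulmxE cplxM IH.
Qed.

Lemma cplx_polymx p A (P : 'M[R[i]]_k) D : P \in unitmx -> cplx A = conjd P D ->
  cplx (polymx p A) = conjd P (\row_j (map_poly (real_complex R) p).[D 0 j]).
Proof.
move=> Pu AE; rewrite /cplx map_mx_sum.
rewrite (eq_bigr (fun i : 'I_(size p) =>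
    (p`_i)%:C%C *: conjd P (\row_j D 0 j ^+ i))) => [|i _]; last first.
  by rewrite -/(cplx _) cplxZ cplx_exp AE conjd_exp.
rewrite conjd_sum; apply: eq_conjd => j; rewrite summxE mxE.
rewrite (@horner_coef_wide _ (size p)) ?size_map_poly//.
by apply: eq_bigr => i _; rewrite !mxE coef_map.
Qed.

Lemma cplx_inj : injective (@cplx R k).
Proof. by move=> A B /matrixP e; apply/matrixP => i j; have := e i j; rewrite !mxE => -[]. Qed.

(** The spectral theorem is used over C. With N = H^t H the eigenvalues are squared norms of the
    rows of the invertible matrix P H^t, hence real and positive. *)
Lemma spectral_posdef (N : 'M[R]_k) : posdef N -> exists (P : 'M[R[i]]_k) (D : 'rV[R]_k),
  [/\ P \in unitmx, forall j, 0 < D 0 j & cplx N = conjd P (map_mx (real_complex R) D)].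
Proof.
move=> Npos; have [H Hu NE] := cholesky Npos.
have cA (B : 'M[R]_k) : map_mx Num.conj (cplx B)^T = cplx B^T.
  by apply/matrixP => i j; rewrite !mxE; apply/eqP; rewrite eq_complex/= oppr0 !eqxx.
have [P [D [Pu PP AE]]] : exists P D, [/\ P \in unitmx, P *m map_mx Num.conj P^T = 1%:M
    & cplx N = invmx P *m diag_mx D *m P].
  exists (spectralmx (cplx N)), (spectral_diag (cplx N)); split.
  - exact: spectral_unit.
  - by apply/unitarymxP; exact: spectral_unitarymx.
  - by apply/orthomx_spectralP/normalmxP; rewrite cA -!cplxM Npos.1.
have Pi : invmx P = map_mx Num.conj P^T by rewrite -[LHS]mulmx1 -PP mulKmx.
pose W := P *m cplx H^T.
have WE : diag_mx D = W *m map_mx Num.conj W^T.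
  rewrite /W trmx_mul map_mxM /= -Pi.
  have -> : map_mx Num.conj (cplx H^T)^T = cplx H by rewrite cA trmxK.
  by rewrite !mulmxA -(mulmxA P) -cplxM -NE AE !mulmxA mulmxV// mul1mx mulmxK.
have D0 j : 0 < D 0 j.
  have -> : D 0 j = \sum_l `|W j l| ^+ 2.
    have /matrixP/(_ j j) := WE; rewrite [LHS]mxE eqxx mulr1n => ->.
    by rewrite mxE; apply: eq_bigr => l _; rewrite !mxE normCK.
  rewrite lt0r sumr_ge0 ?andbT => [|l _]; last by rewrite exprn_ge0.
  rewrite psumr_eq0 => [|l _]; last by rewrite exprn_ge0.
  apply/negP => /allP W0; have Wu : W \in unitmx.
    by rewrite unitmx_mul Pu cplx_unit unitmx_tr.
  have : row j W = 0.
    apply/rowP => l; have := W0 l (mem_index_enum _); rewrite !mxE /=.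
    by rewrite expf_eq0/= normr_eq0 => /eqP.
  move=> /(congr1 (mulmx^~ (invmx W))); rewrite mul0mx -row_mul mulmxV//.
  by move=> /rowP/(_ j)/eqP; rewrite !mxE eqxx oner_eq0.
exists P, (map_mx (@complex.Re R) D); split; first exact: Pu.
  by move=> j; rewrite mxE; have := D0 j; rewrite ltcE /= => /andP[].
rewrite AE; apply: eq_conjd => j; rewrite !mxE.
by have := D0 j; rewrite ltcE/= => /andP[/eqP e _]; apply/eqP; rewrite eq_complex/= -e !eqxx.
Qed.

(** Interpolating x^{1/4} at the eigenvalues makes the root a real polynomial in N; it is then
    symmetric and commutes with everything that commutes with N. *)
Lemma fourth_root (N : 'M[R]_k) : posdef N ->
  exists p, polymx p N *m polymx p N *m (polymx p N *m polymx p N) = N.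
Proof.
move=> /spectral_posdef[P [D [Pu D0 NE]]].
have [p ps] := interpolation (fun x => Num.sqrt (Num.sqrt x)) [seq D 0 j | j : 'I_k].
exists p; apply: cplx_inj; rewrite !cplxM (cplx_polymx p Pu NE) NE.
rewrite (conjd_mul _ _ Pu) (conjd_mul _ _ Pu); apply: eq_conjd => j.
rewrite !mxE horner_map -!rmorphM/= ps; last by apply/mapP; exists j; rewrite ?mem_enum.
congr (_%:C%C); set x := Num.sqrt (Num.sqrt _).
have -> : x * x = Num.sqrt (D 0 j) by rewrite -expr2 sqr_sqrtr// sqrtr_ge0.
by rewrite -expr2 sqr_sqrtr// ltW.
Qed.

End MatrixPolynomial.

(** * Polar decomposition of the symplectic form *)

Section Polar.
Variables (R : realType) (m : nat) (J1 A1 As g0 : 'M[R]_m).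
Hypotheses (J1T : J1^T = - J1) (J1J1 : J1 *m J1 = - 1%:M) (spA : in_sp J1 A1).
Hypotheses (g0pos : posdef g0) (Asg : A1^T *m g0 = g0 *m As) (spAs : in_sp J1 As).

(** In an orthonormal basis of [g0] the form is a skew O, and -O^2 is positive and commutes with A
    and A^t, since both satisfy the sp relation. A further change of basis by S = |O|^{1/2}, where
    |O| = (-O^2)^{1/2}, turns O into a complex structure and leaves A unchanged; this is why a
    fourth root of -O^2 is taken. *)
Lemma sp_polar : exists C Jh Ah, [/\ C \in unitmx, Jh^T = - Jh, Jh *m Jh = - 1%:M, in_sp Jh Ah
  & [/\ J1 = C^T *m Jh *m C, C *m A1 = Ah *m C & C *m As = Ah^T *m C]].
Proof.
have [C0 C0u g0E] := cholesky g0pos.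
pose U := invmx C0.
have CU : C0 *m U = 1%:M by rewrite mulmxV.
have UC : U *m C0 = 1%:M by rewrite mulVmx.
have CUT : U^T *m C0^T = 1%:M by rewrite -trmx_mul CU trmx1.
have UCT : C0^T *m U^T = 1%:M by rewrite -trmx_mul UC trmx1.
pose O := U^T *m J1 *m U; pose A := C0 *m A1 *m U.
have AT : A^T = C0 *m As *m U.
  have /(congr1 (fun M => U^T *m M *m U)) := Asg.
  by rewrite g0E !mulmxA CUT mul1mx -mulmxA -mulmxA CU mulmx1 => <-; rewrite /A !trmx_mul !mulmxA.
have OT : O^T = - O by rewrite /O !trmx_mul trmxK J1T mulmxA mulmxN mulNmx.
have sp_conj B : in_sp J1 B -> (C0 *m B *m U)^T *m O = - (O *m (C0 *m B *m U)).
  move=> /eqP; rewrite addr_eq0 => /eqP spB.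
  have -> : (C0 *m B *m U)^T *m O = U^T *m (B^T *m J1) *m U.
    by rewrite /O !trmx_mul !mulmxA -(mulmxA _ C0^T) UCT mulmx1.
  have -> : O *m (C0 *m B *m U) = U^T *m (J1 *m B) *m U.
    by rewrite /O !mulmxA -(mulmxA _ U C0) UC mulmx1.
  by rewrite spB mulmxN mulNmx.
have OA : A^T *m O = - (O *m A) by exact: sp_conj.
have OAT : A *m O = - (O *m A^T) by rewrite AT -(sp_conj _ spAs) -AT trmxK.
have Ou : O \in unitmx.
  have J1u : J1 \in unitmx.
    by have [] := @mulmx1_unit _ _ J1 (- J1); rewrite // mulmxN J1J1 opprK.
  by rewrite !unitmx_mul unitmx_tr unitmx_inv C0u J1u.
pose N := - (O *m O).
have Npos : posdef N.
  split; first by rewrite linearN/= trmx_mul OT mulNmx mulmxN opprK.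
  move=> X X0; have -> : form N X X = dot (O *m X) (O *m X).
    by rewrite dot_mull OT /N /form /dot mulmxN !mulNmx mulmxN !mulmxA.
  rewrite lt_neqAle dot_ge0 andbT eq_sym; apply: contra X0 => /eqP/dot_eq0 OX.
  by rewrite -(mulKmx Ou X) OX mulmx0.
have NA : N *m A = A *m N.
  rewrite /N mulNmx mulmxN (mulmxA A) OAT mulNmx -mulmxA -[in LHS](opprK (O *m A)) -OA.
  by rewrite mulmxN mulmxA.
have NT : N^T = N by case: Npos.
have NAT : N *m A^T = A^T *m N.
  by rewrite -[in LHS]NT -trmx_mul -NA trmx_mul NT.
have NO : N *m O = O *m N by rewrite mulNmx mulmxN (mulmxA O O O).
have [p] := fourth_root Npos; set S := polymx p N => S4.
have ST : S^T = S by rewrite polymx_tr NT.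
have SA : S *m A = A *m S := polymx_intertwine p NA.
have SAT : S *m A^T = A^T *m S := polymx_intertwine p NAT.
have SO : S *m O = O *m S := polymx_intertwine p NO.
have Su : S \in unitmx.
  have : N \in unitmx := posdef_unitmx Npos.2.
  by rewrite -S4 !unitmx_mul => /andP[/andP[]].
move: S ST SA SAT SO Su S4 => S ST SA SAT SO Su S4.
pose T := invmx S.
have TS : T *m S = 1%:M by rewrite mulVmx.
have S_T : S *m T = 1%:M by rewrite mulmxV.
have TT : T^T = T by rewrite trmx_inv ST.
have Tcomm X : S *m X = X *m S -> T *m X = X *m T.
  by move=> SX; rewrite -[LHS]mulmx1 -S_T !mulmxA -(mulmxA T X) -SX mulmxA TS mul1mx.
have TA := Tcomm _ SA; have TAT := Tcomm _ SAT; have TO := Tcomm _ SO.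
have OE : O = U^T *m J1 *m U by [].
have AE : A = C0 *m A1 *m U by [].
have NE : N = - (O *m O) by [].
clearbody N; clearbody O A.
exists (S *m C0), (T *m O *m T), A; split.
- by rewrite unitmx_mul Su.
- by rewrite !trmx_mul TT OT !mulNmx !mulmxN mulmxA.
- have -> : T *m O *m T *m (T *m O *m T) = O *m O *m (T *m T *m (T *m T)).
    by rewrite TO !mulmxA -(mulmxA _ T O) TO mulmxA -(mulmxA _ T O) TO mulmxA.
  rewrite -[O *m O]opprK -NE -S4 mulNmx; congr (- _).
  by rewrite !mulmxA -(mulmxA _ S T) S_T mulmx1 -(mulmxA _ S T) S_T mulmx1 -(mulmxA _ S T) S_T mulmx1 S_T.
- rewrite /in_sp !mulmxA -TAT -(mulmxA _ T A) TA !mulmxA.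
  rewrite -(mulmxA T (A^T)) OA -(mulmxA T O A) -mulmxDl mulmxN addNr mul0mx; by [].
- split.
  + rewrite trmx_mul ST !mulmxA -(mulmxA _ S T) S_T mulmx1 -(mulmxA _ T S) TS mulmx1 OE !mulmxA.
    by rewrite UCT mul1mx -mulmxA UC mulmx1.
  + by rewrite mulmxA -SA AE !mulmxA -(mulmxA _ U C0) UC mulmx1.
  + by rewrite mulmxA -SAT AT !mulmxA -(mulmxA _ U C0) UC mulmx1.
Qed.

(** The search for a metric is reduced to the standard one: A_1 is replaced by a conjugate for which
    the adjoint [As] has become the transpose. *)
Lemma compatible_soliton a :
  (forall Jh Ah C, Jh^T = - Jh -> Jh *m Jh = - 1%:M -> in_sp Jh Ah -> C \in unitmx ->
    C *m A1 = Ah *m C -> C *m As = Ah^T *m C ->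
    scf_soliton (ga_bracket (mxA a Ah)) (omega Jh) 1%:M) ->
  exists g, scf_soliton (ga_bracket (mxA a A1)) (omega J1) g.
Proof.
move=> sol; have [C [Jh [Ah [Cu JhT JhJh spAh [J1E CA CAs]]]]] := sp_polar.
have {}sol := sol Jh Ah C JhT JhJh spAh Cu CA CAs.
pose H : 'M[R]_(1 + m) := mxA 1 C; pose h := ga_lin H 0 1.
have hu : h \in unitmx.
  apply: ga_lin_unit; last exact: oner_neq0.
  by rewrite unitmxE /H /mxA det_ublock det_scalar expr1 mul1r -unitmxE.
have hom : forall X Y, ga_bracket (mxA a Ah) (h *m X) (h *m Y) = h *m ga_bracket (mxA a A1) X Y.
  apply: ga_lin_hom; rewrite scale1r /H /mxA !mulmx_block !mulmx0 !mul0mx !addr0 !add0r CA.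
  by rewrite mulmx1 mul1mx.
exists (h^T *m 1%:M *m h).
have -> : omega J1 = h^T *m omega Jh *m h.
  have HT : H^T = block_mx 1%:M 0 0 C^T by rewrite /H /mxA tr_block_mx !trmx0 trmx1.
  have HJ : H^T *m block_mx 0 0 0 Jh^T *m H = block_mx 0 0 0 J1^T.
    rewrite HT /H /mxA !mulmx_block !mulmx0 !mul0mx !addr0 !add0r.
    by rewrite !mul0mx J1E !trmx_mul trmxK mulmxA.
  have He : H^T *m col_mx 1%:M 0 = col_mx 1%:M 0 :> 'cV[R]_(1 + m).
    by rewrite HT mul_block_col !mulmx0 !mul0mx mulmx1 !addr0.
  have rH : row_mx (- 1%:M) 0 *m H = row_mx (- 1%:M) 0 :> 'rV[R]_(1 + m).
    by rewrite /H /mxA mul_row_block !mulmx0 !mul0mx mulmx1 !addr0.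
  rewrite /h /ga_lin /omega tr_block_mx !mulmx_block !trmx0 !trmx1.
  by rewrite !mulmx0 !mul0mx !mulmx1 !mul1mx !addr0 !add0r HJ He rH.
apply/(scf_soliton_transport _ _ _ _ hu hom) => //; exact: ga_bracket_lie.
Qed.

End Polar.

(** Averaging the monomial a z^i over conjugation and, with sign, over z |-> -z keeps the real part
    of a for odd i and gives 0 for even i. *)
Lemma odd_real_part (C : numClosedFieldType) (a z : C) i :
  4^-1 * (a * z ^+ i + Num.conj (a * Num.conj z ^+ i) - a * (- z) ^+ i
    - Num.conj (a * (- Num.conj z) ^+ i)) =
  if odd i then 2^-1 * (a + Num.conj a) * z ^+ i else 0.
Proof.
have -> : Num.conj (a * Num.conj z ^+ i) = Num.conj a * z ^+ i.
  by rewrite rmorphM rmorphXn/= conjCK.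
have -> : Num.conj (a * (- Num.conj z) ^+ i) = Num.conj a * (- z) ^+ i.
  by rewrite rmorphM rmorphXn/= rmorphN/= conjCK.
rewrite (exprNn z i) -(signr_odd C i).
move: (z ^+ i) (Num.conj a) => x b; case: (odd i); rewrite ?expr0 ?expr1; last by ring.
by field.
Qed.

Lemma conj_adjoint (F : fieldType) k (P S T E : 'M[F]_k) : P \in unitmx -> T *m S = 1%:M ->
  S *m (E *m T) *m (S *m P) = S *m P *m (invmx P *m E *m P).
Proof. by move=> Pu TS; rewrite !mulmxA mulmxK// -(mulmxA _ T) TS mulmx1. Qed.

(** * An inner product adapted to the eigenvectors *)

Section SemisimpleCompatible.
Variable R : realType.
Local Notation Re := (@complex.Re R).

Lemma Re_sum I (r : seq I) (P : pred I) (F : I -> R[i]) :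
  Re (\sum_(i <- r | P i) F i) = \sum_(i <- r | P i) Re (F i).
Proof. by apply: (big_morph Re) => // -[x y] [z t]. Qed.

Lemma Re_cplx_mul m n p (A : 'M[R]_(m, n)) (Y : 'M[R[i]]_(n, p)) :
  map_mx Re (map_mx (real_complex R) A *m Y) = A *m map_mx Re Y.
Proof.
apply/matrixP => i j; rewrite !mxE Re_sum; apply: eq_bigr => l _.
by rewrite !mxE; case: (Y l j) => x y /=; rewrite mul0r subr0.
Qed.

Lemma Re_mul_cplx m n p (A : 'M[R]_(n, p)) (Y : 'M[R[i]]_(m, n)) :
  map_mx Re (Y *m map_mx (real_complex R) A) = map_mx Re Y *m A.
Proof.
apply/matrixP => i j; rewrite !mxE Re_sum; apply: eq_bigr => l _.
by rewrite !mxE; case: (Y i l) => x y /=; rewrite mulr0 subr0.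
Qed.

Definition adjointmx m n (Y : 'M[R[i]]_(m, n)) : 'M[R[i]]_(n, m) := map_mx Num.conj Y^T.

Lemma adjointmxM m n p (A : 'M[R[i]]_(m, n)) (Y : 'M[R[i]]_(n, p)) :
  adjointmx (A *m Y) = adjointmx Y *m adjointmx A.
Proof. by rewrite /adjointmx trmx_mul map_mxM. Qed.

Lemma adjointmx_cplx m n (A : 'M[R]_(m, n)) :
  adjointmx (map_mx (real_complex R) A) = map_mx (real_complex R) A^T.
Proof. by apply/matrixP => i j; rewrite !mxE; apply/eqP; rewrite eq_complex/= oppr0 !eqxx. Qed.

Lemma posdef_Re_adjoint k (P : 'M[R[i]]_k) : P \in unitmx ->
  posdef (map_mx Re (adjointmx P *m P)).
Proof.
move=> Pu; split.
  apply/matrixP => i j; rewrite !mxE !Re_sum; apply: eq_bigr => l _; rewrite !mxE.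
  by case: (P l i) (P l j) => [x y] [z t] /=; ring.
move=> X X0; rewrite /form -Re_cplx_mul -Re_mul_cplx.
set Y := map_mx (real_complex R) X.
have -> : map_mx (real_complex R) X^T *m (adjointmx P *m P) *m Y =
    adjointmx (P *m Y) *m (P *m Y) by rewrite adjointmxM adjointmx_cplx !mulmxA.
have PY0 : P *m Y != 0.
  apply: contra X0 => /eqP PY; have Y0 : Y = 0 by rewrite -(mulKmx Pu Y) PY mulmx0.
  apply/eqP/matrixP => i j; have /matrixP/(_ i j) := Y0; rewrite !mxE => /eqP.
  by rewrite eq_complex/= eqxx andbT => /eqP.
move: (P *m Y) PY0 => Z Z0; rewrite !mxE Re_sum.
have ge0 i : 0 <= Re (adjointmx Z 0 i * Z i 0).
  by rewrite !mxE; case: (Z i 0) => x y /=; rewrite mulNr opprK -!expr2 addr_ge0 ?sqr_ge0.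
rewrite lt0r sumr_ge0 ?andbT//; apply: contra Z0; rewrite psumr_eq0// => /allP Zi.
apply/eqP/matrixP => i j; rewrite (ord1 j) [RHS]mxE; have := Zi i (mem_index_enum _).
rewrite !mxE; case: (Z i 0) => x y /=; rewrite mulNr opprK -!expr2.
by rewrite paddr_eq0 ?sqr_ge0// !sqrf_eq0 => /andP[/eqP -> /eqP ->].
Qed.

(** Conjugation is odd and commutes with itself. If p interpolates it on a set stable under sign and
    conjugation, the polynomial formed by the real parts of the odd coefficients of p still does. *)
Lemma conj_interpolation (s : seq R[i]) : exists p : {poly R},
  (forall i, ~~ odd i -> p`_i = 0) /\
  forall z, z \in s -> (map_poly (real_complex R) p).[z] = Num.conj z.
Proof.
pose s' := flatten [seq [:: z; - z; Num.conj z; - Num.conj z] | z <- s].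
have [p ps] := interpolation (fun z : R[i] => Num.conj z) s'.
exists (\poly_(i < size p) if odd i then Re p`_i else 0); split.
  by move=> i /negbTE oi; rewrite coef_poly oi; case: ifP.
move=> z zs.
have ms w : w \in [:: z; - z; Num.conj z; - Num.conj z] -> p.[w] = Num.conj w.
  by move=> ws; apply: ps; apply/flatten_mapP; exists z.
have e1 := ms z; have e2 := ms (- z); have e3 := ms (Num.conj z); have e4 := ms (- Num.conj z).
rewrite (@horner_coef_wide _ (size p)); last first.
  by rewrite size_map_poly size_poly.
transitivity (4^-1 * (p.[z] + Num.conj p.[Num.conj z] - p.[- z] - Num.conj p.[- Num.conj z])).
  rewrite 4!horner_coef !rmorph_sum/= -big_split/= -!sumrB mulr_sumr; apply: eq_bigr => i _.
  rewrite odd_real_part coef_map coef_poly ltn_ord; case: (odd i) => /=; last by rewrite mul0r.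
  congr (_ * _); move: p`_i => q.
  have -> : q + Num.conj q = 2 * (Re q)%:C%C.
    by rewrite mulr_natl mulr2n; case: q => x y; apply/eqP; rewrite eq_complex/= addr0 subrr !eqxx.
  by rewrite mulKf// pnatr_eq0.
rewrite e1 ?e2 ?e3 ?e4 ?inE ?eqxx ?orbT// conjCK !rmorphN/= conjCK.
move: (Num.conj z) => w; by field.
Qed.

(** A_1^t J_1 = J_1 (-A_1) gives p(A_1)^t J_1 = J_1 p(-A_1), which is -J_1 p(A_1) for p odd. *)
Lemma odd_polymx_sp m (J1 A1 : 'M[R]_m) (p : {poly R}) : in_sp J1 A1 -> (forall i, ~~ odd i -> p`_i = 0) ->
  in_sp J1 (polymx p A1).
Proof.
move=> /eqP; rewrite addr_eq0 -mulmxN => /eqP spA podd.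
have oddN : polymx p (- A1) = - polymx p A1.
  rewrite -sumrN; apply: eq_bigr => i _; have [oi|/podd ->] := boolP (odd i); last first.
    by rewrite !scale0r oppr0.
  by rewrite exprNn -signr_odd oi expr1 mulN1r scalerN.
by rewrite /in_sp polymx_tr (polymx_intertwine _ spA) oddN mulmxN addNr.
Qed.

Lemma polymx_mxA m p a (A1 : 'M[R]_m) : polymx p (mxA a A1) = mxA p.[a] (polymx p A1).
Proof.
have mxAX i : mxA a A1 ^+ i = mxA (a ^+ i) (A1 ^+ i).
  elim: i => [|i IH]; first by rewrite !expr0 /mxA -scalar_mx_block.
  rewrite !exprS IH -!mulmxE /mxA mulmx_block !mulmx0 !mul0mx !addr0 !add0r.
  by rewrite -scalar_mxM.
rewrite /polymx horner_coef.
under eq_bigr => i _ do rewrite mxAX.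
elim/big_rec3: _ => [|i x X Y _ ->]; first by rewrite /mxA scalar_mx0 block_mx0.
rewrite /mxA scale_block_mx add_block_mx !scaler0 !addr0 scale_scalar_mx.
by rewrite -raddfD.
Qed.

(** For the Hermitian form P^* P the eigenvectors are orthonormal, so the adjoint of A is P^{-1}
    conj(D) P = p(A) with p odd and real. This adjoint is real, so it is also the one for the real
    part of the form, whose block on n_1 is then used. *)
Lemma semisimple_compatible m (J1 : 'M[R]_m) a A1 : J1^T = - J1 -> J1 *m J1 = - 1%:M ->
  in_sp J1 A1 -> semisimple_mx (mxA a A1) ->
  exists g, scf_soliton (ga_bracket (mxA a A1)) (omega J1) g.
Proof.
move=> J1T J1J1 sp /semisimpleP[P [D [Pu AE]]].
have [p [podd pD]] := conj_interpolation [seq D 0 j | j <- enum 'I_(1 + m)].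
pose A := mxA a A1; pose Q := polymx p A; pose As := polymx p A1.
pose g := map_mx Re (adjointmx P *m P).
have gpos : posdef g := posdef_Re_adjoint Pu.
have QE : cplx Q = conjd P (map_mx Num.conj D).
  rewrite (cplx_polymx p Pu AE); apply: eq_conjd => j; rewrite !mxE pD//.
  by apply/mapP; exists j; rewrite ?mem_enum.
have gQ : A^T *m g = g *m Q.
  rewrite -Re_cplx_mul -Re_mul_cplx -adjointmx_cplx; congr map_mx.
  have -> : map_mx (real_complex R) Q = conjd P (map_mx Num.conj D) := QE.
  have -> : map_mx (real_complex R) A = conjd P D := AE.
  rewrite /conjd !adjointmxM.
  have -> : adjointmx (diag_mx D) = diag_mx (map_mx Num.conj D).
    by rewrite /adjointmx tr_diag_mx map_diag_mx.
  have PP : adjointmx (invmx P) *m adjointmx P = 1%:M.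
    by rewrite -adjointmxM mulmxV// /adjointmx trmx1 map_mx1.
  exact: conj_adjoint Pu PP.
have QB : Q = mxA p.[a] As by exact: polymx_mxA.
pose g1 := drsubmx g.
have gE : g = block_mx (ulsubmx g) (ursubmx g) (dlsubmx g) g1 by rewrite submxK.
have Asg : A1^T *m g1 = g1 *m As.
  have := gQ; rewrite QB /A mxA_tr gE /mxA !mulmx_block !mulmx0 !mul0mx !addr0 !add0r.
  by move=> /eq_block_mx[].
have g1pos : posdef g1.
  split; first by rewrite /g1 trmx_drsub gpos.1.
  move=> X X0; have : col_mx 0 X != 0 :> 'cV[R]_(1 + m).
    by apply: contra X0 => /eqP/(congr1 (@dsubmx _ 1 m 1)); rewrite col_mxKd linear0 => ->.
  move=> /gpos.2; rewrite gE /form -!mulmxA mul_block_col tr_col_mx mul_row_col !mulmx0 trmx0.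
  by rewrite mul0mx !add0r.
have spAs : in_sp J1 As by exact: odd_polymx_sp.
apply: (compatible_soliton J1T J1J1 sp g1pos Asg spAs) => Jh Ah C JhT JhJh spAh Cu CA CAs.
apply: mxA_soliton_of_normal => //.
have AhN : Ah *m Ah^T = Ah^T *m Ah.
  have AA : A1 *m As = As *m A1 by rewrite /As (polymx_intertwine p (erefl (A1 *m A1))).
  have := congr1 (fun M => C *m M *m invmx C) AA; rewrite !mulmxA CA CAs -!mulmxA.
  rewrite !(mulmxA C) CA CAs -!mulmxA mulmxV// !mulmx1; exact.
apply/eqP; rewrite -subr_eq0 -/(mxbr (mxA a Ah) (mxA a Ah)^T) mxA_mxbr.
by rewrite /mxbr AhN subrr block_mx0.
Qed.

End SemisimpleCompatible.

(** * Compatible solitons: the nilpotent case *)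

Lemma trmx_scale_mul (R : realType) m n p c (X : 'M[R]_(m, n)) (Y : 'M[R]_(n, p)) :
  (c *: X *m Y)^T = c *: (X *m Y)^T.
Proof. by rewrite -scalemxAl linearZ. Qed.

Lemma trmx_skew_word (R : realType) m r (O : 'M[R]_m) (g : 'M[R]_r) c (a b : 'M[R]_(r, m)) d h :
  O^T = - O -> g^T = d *: h ->
  (c *: (O *m a^T *m g *m b *m O))^T = (c * d) *: (O *m b^T *m h *m a *m O).
Proof.
move=> OT gT; rewrite linearZ/= !trmx_mul trmxK gT OT mulNmx !mulmxN opprK -scalemxAl.
by rewrite -!scalemxAr scalerA !mulmxA.
Qed.

Section NilpotentCompatible.
Variables (R : realType) (m : nat) (A O : 'M[R]_m).
Hypotheses (OT : O^T = - O) (AO : A *m O = - (O *m A^T)).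

(* [F] completes [A] to an sl2-like pair on the image of the projection [Q], and [G]
   is an inner product there for which [F] is the adjoint of [A]. *)
Definition sl2_piece (Q F G : 'M[R]_m) : Prop :=
  [/\ Q *m F = F, F *m Q = F, F *m O = - (O *m F^T) & mxbr A (mxbr A F) = (- 2) *: (Q *m A)] /\
  [/\ G^T = G, G *m Q = G, A^T *m G = G *m F, forall X, 0 <= form G X X
    & forall X, form G X X = 0 -> Q *m X = 0].

Lemma mxbrDr (X Y : 'M[R]_m) : mxbr A (X + Y) = mxbr A X + mxbr A Y.
Proof. by rewrite /mxbr mulmxDr mulmxDl opprD addrACA. Qed.

Lemma sl2_pieceD Q F G Q' F' G' : Q *m Q' = 0 -> Q' *m Q = 0 ->
  sl2_piece Q F G -> sl2_piece Q' F' G' -> sl2_piece (Q + Q') (F + F') (G + G').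
Proof.
move=> QQ' Q'Q [[QF FQ FO AF] [GT GQ AG G0 GK]] [[QF' FQ' FO' AF'] [GT' GQ' AG' G0' GK']].
have formD X : form (G + G') X X = form G X X + form G' X X.
  by rewrite /form mulmxDr mulmxDl mxE.
split; split.
- rewrite mulmxDr !mulmxDl QF QF' -[in Q *m F']QF' mulmxA QQ' mul0mx -[in Q' *m F]QF mulmxA Q'Q.
  by rewrite mul0mx addr0 add0r.
- rewrite mulmxDr !mulmxDl FQ FQ' -[in F *m Q']FQ -mulmxA QQ' mulmx0 -[in F' *m Q]FQ' -mulmxA Q'Q.
  by rewrite mulmx0 addr0 add0r.
- by rewrite linearD/= mulmxDl mulmxDr FO FO' opprD.
- by rewrite (mxbrDr F F') mxbrDr AF AF' mulmxDl scalerDr.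
- by rewrite linearD/= GT GT'.
- rewrite mulmxDr !mulmxDl GQ GQ' -[in G *m Q']GQ -mulmxA QQ' mulmx0 -[in G' *m Q]GQ' -mulmxA Q'Q.
  by rewrite mulmx0 addr0 add0r.
- rewrite mulmxDr AG AG' mulmxDl !mulmxDr -[in G *m F']GQ -[in G *m Q *m F']QF' mulmxA -(mulmxA G).
  rewrite QQ' mulmx0 mul0mx -[in G' *m F]GQ' -[in G' *m Q' *m F]QF mulmxA -(mulmxA G') Q'Q.
  by rewrite mulmx0 mul0mx addr0 add0r.
- by move=> X; rewrite formD addr_ge0.
- move=> X; rewrite formD => /eqP; rewrite paddr_eq0// => /andP[/eqP/GK e /eqP/GK' e'].
  by rewrite mulmxDl e e' addr0.
Qed.

Lemma exp_O i : A ^+ i *m O = (-1) ^+ i *: (O *m (A ^+ i)^T).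
Proof.
elim: i => [|i IH]; first by rewrite !expr0 trmx1 mul1mx mulmx1 scale1r.
rewrite [in LHS]exprSr -mulmxE -mulmxA AO mulmxN mulmxA IH -scalemxAl exprS mulN1r scaleNr.
by rewrite exprS -mulmxE trmx_mul !mulmxA.
Qed.

(** * Jordan strings of equal length *)

Section String.
Variables (r k : nat) (E : 'M[R]_(r, m)).

(** The rows of E generate strings E, E A, ..., E A^k of covectors; this is the Gram matrix, for the
    skew form O, of the generators against their j-th images. *)
Let gam j := E *m O *m (A ^+ j)^T *m E^T.

Lemma gam_tr j : (gam j)^T = (-1) ^+ j.+1 *: gam j.
Proof.
rewrite /gam !trmx_mul !trmxK OT -!mulmxA (mulmxA _ (- O)) mulmxN exp_O exprS mulN1r scaleNr.
by rewrite mulNmx mulmxN -!scalemxAl -scalemxAr !mulmxA.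
Qed.

Lemma gamE i j : E *m A ^+ i *m O *m (E *m A ^+ j)^T = (-1) ^+ i *: gam (i + j).
Proof.
rewrite /gam trmx_mul -(mulmxA E) exp_O -scalemxAr -!scalemxAl exprD -mulmxE trmx_mul !mulmxA.
by rewrite -[in RHS](mulmxA _ _ (A ^+ i)^T) -trmx_mul -[A ^+ i *m A ^+ j]/(A ^+ i * A ^+ j) -exprD addnC exprD -mulmxE trmx_mul !mulmxA.
Qed.

Hypothesis EAk : E *m A ^+ k.+1 = 0.

Lemma EA0 j : (k < j)%N -> E *m A ^+ j = 0.
Proof. by move=> kj; rewrite -(subnKC kj) exprD -mulmxE mulmxA EAk mul0mx. Qed.

Lemma gam0 j : (k < j)%N -> gam j = 0.
Proof. by move=> kj; rewrite /gam -mulmxA -trmx_mul EA0// trmx0 mulmx0. Qed.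

Hypotheses (gam_low : forall j, (j < k)%N -> gam j = 0) (gu : gam k \in unitmx).

Let e i := E *m A ^+ i.
(** The dual basis of the strings, by [eC]: as [gam] is nonzero only at level k, level i is dual to
    level k - i under O. *)
Let C i := (-1) ^+ i *: (O *m (e (k - i))^T *m invmx (gam k)).

Lemma eA i : e i *m A = e i.+1.
Proof. by rewrite /e exprSr -mulmxE mulmxA. Qed.

Lemma eC i j : (i <= k)%N -> (j <= k)%N -> e j *m C i = (i == j)%:R%:M.
Proof.
move=> ik jk; rewrite /C -scalemxAr !mulmxA gamE -scalemxAl scalerA.
have [->|ij] := eqVneq i j.
  by rewrite subnKC// mulmxV// -exprD -signr_odd oddD addbb expr0 scale1r.
have -> : gam (j + (k - i)) = 0.
  have [lt|gt] : (j + (k - i) < k \/ k < j + (k - i))%N by lia.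
    exact: gam_low.
  exact: gam0.
by rewrite mul0mx scaler0 scalar_mx0.
Qed.

Lemma AC i : (i < k)%N -> A *m C i.+1 = C i.
Proof.
move=> ik; rewrite /C -scalemxAr !mulmxA AO !mulNmx scalerN exprS mulN1r scaleNr opprK.
congr (_ *: (_ *m _)); rewrite -mulmxA -trmx_mul /e -mulmxA; congr (_ *m (_ *m _)^T).
by rewrite mulmxE -exprSr; congr (_ ^+ _); lia.
Qed.

Lemma AC0 : A *m C 0 = 0.
Proof.
rewrite /C expr0 scale1r subn0 !mulmxA AO !mulNmx -(mulmxA O) -trmx_mul eA.
by rewrite /e EAk trmx0 mulmx0 mul0mx oppr0.
Qed.

Let P (c : nat -> R) := \sum_(i < k.+1) c i *: (C i *m e i).
Let U (c : nat -> R) := \sum_(i < k) c i *: (C i *m e i.+1).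
(** The structure constants of the irreducible sl2-module of dimension k + 1; the differences f i -
    f (i - 1) = k - 2 i are its weights. *)
Let f i : R := i.+1%:R * (k - i)%:R.
Let F := \sum_(i < k) f i *: (C i.+1 *m e i).

Lemma A_P c : A *m P c = U (c \o S).
Proof.
rewrite /P big_ord_recl mulmxDr -scalemxAr mulmxA AC0 mul0mx scaler0 add0r mulmx_sumr.
by apply: eq_bigr => i _; rewrite -scalemxAr mulmxA AC.
Qed.

Lemma P_A c : P c *m A = U c.
Proof.
rewrite /P big_ord_recr mulmxDl -scalemxAl -mulmxA eA /= /e EAk mulmx0 scaler0 addr0 mulmx_suml.
by apply: eq_bigr => i _; rewrite -scalemxAl -mulmxA eA.
Qed.

Lemma A_F : A *m F = P f.
Proof.
rewrite /P big_ord_recr /= /f subnn mulr0 scale0r addr0 mulmx_sumr.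
by apply: eq_bigr => i _; rewrite -scalemxAr mulmxA AC.
Qed.

Lemma F_A : F *m A = P (fun i => i%:R * (k.+1 - i)%:R).
Proof.
rewrite /P big_ord_recl /= mul0r scale0r add0r mulmx_suml.
by apply: eq_bigr => i _; rewrite -scalemxAl -mulmxA eA /f subSS.
Qed.

Lemma P_B c c' : P c - P c' = P (fun i => c i - c' i).
Proof. by rewrite -sumrB; apply: eq_bigr => i _; rewrite scalerBl. Qed.

(** [A, F] acts on level i by the weight k - 2 i, and consecutive weights differ by -2. *)
Lemma mxbr_A_A_F : mxbr A (mxbr A F) = (- 2) *: (P (fun=> 1) *m A).
Proof.
rewrite /mxbr A_F F_A P_B A_P !P_A -sumrB scaler_sumr; apply: eq_bigr => i _.
rewrite -scalerBl scalerA mulr1; congr (_ *: _); rewrite /f /=.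
have ik := ltn_ord i; rewrite subSS (natrB _ ik) (natrB _ (ltnW ik)) (natrB _ (leqW (ltnW ik))).
by rewrite -!natr1; ring.
Qed.

Lemma e_P i : (i <= k)%N -> e i *m P (fun=> 1) = e i.
Proof.
move=> ik; rewrite /P mulmx_sumr (bigD1 (Ordinal (ik : (i < k.+1)%N)))//= big1 ?addr0.
  by rewrite scale1r mulmxA eC// eqxx mul1mx.
move=> j ji; rewrite scale1r mulmxA eC//; last by rewrite -ltnS.
by rewrite -val_eqE /= in ji; rewrite (negbTE ji) scalar_mx0 mul0mx.
Qed.

Lemma P_C i : (i <= k)%N -> P (fun=> 1) *m C i = C i.
Proof.
move=> ik; rewrite /P mulmx_suml (bigD1 (Ordinal (ik : (i < k.+1)%N)))//= big1 ?addr0.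
  by rewrite scale1r -mulmxA eC// eqxx mulmx1.
move=> j ji; rewrite scale1r -mulmxA eC//; last by rewrite -ltnS.
by rewrite -val_eqE eq_sym /= in ji; rewrite (negbTE ji) scalar_mx0 mulmx0.
Qed.

Lemma P_P : P (fun=> 1) *m P (fun=> 1) = P (fun=> 1).
Proof.
rewrite [in RHS]/P mulmx_sumr; apply: eq_bigr => i _.
by rewrite -scalemxAr mulmxA P_C// -ltnS.
Qed.

Lemma P_F : P (fun=> 1) *m F = F.
Proof.
rewrite [in RHS]/F mulmx_sumr; apply: eq_bigr => i _.
by rewrite -scalemxAr mulmxA P_C.
Qed.

Lemma F_P : F *m P (fun=> 1) = F.
Proof.
rewrite [in RHS]/F mulmx_suml; apply: eq_bigr => i _.
by rewrite -scalemxAl -mulmxA e_P// ltnW.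
Qed.

Lemma CeO i j : C i *m e j *m O =
  (-1) ^+ i *: (O *m (e (k - i))^T *m invmx (gam k) *m e j *m O).
Proof. by rewrite /C -!scalemxAl. Qed.

Lemma CeO_tr i j : (C i *m e j *m O)^T =
  (-1) ^+ (i + k).+1 *: (O *m (e j)^T *m invmx (gam k) *m e (k - i) *m O).
Proof.
have gT : (invmx (gam k))^T = (-1) ^+ k.+1 *: invmx (gam k).
  by rewrite trmx_inv gam_tr invmxZ ?invr_sign// unitmxZ// unitrX// unitrN1.
by rewrite CeO (trmx_skew_word _ _ _ OT gT) -exprD addnS.
Qed.

(** Reversing the strings, i |-> k - 1 - i, exchanges the summands of F O with their transposes, and
    f is invariant under it. *)
Lemma F_O : F *m O = - (O *m F^T).
Proof.
suff FOT : (F *m O)^T = F *m O by rewrite -[LHS]FOT trmx_mul OT mulNmx.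
rewrite mulmx_suml linear_sum (reindex_inj rev_ord_inj)/=; apply: eq_bigr => i _.
have ik := ltn_ord i.
rewrite trmx_scale_mul -(scalemxAl (f i) (C i.+1 *m e i) O) CeO_tr (CeO i.+1 i) !scalerA /f.
have -> : (k - (k - i.+1))%N = i.+1 by lia.
have -> : (k - (k - i.+1).+1)%N = i by lia.
have -> : (k - i.+1).+1 = (k - i)%N by lia.
congr (_ *: _); rewrite (mulrC (k - i)%:R); congr (_ * _).
rewrite -signr_odd -[RHS]signr_odd; congr (_ ^+ _); congr nat_of_bool.
have -> : (k - i + k).+1 = ((k - i) * 2 + i.+1)%N by lia.
by rewrite oddD oddM andbF.
Qed.

Lemma P_O : P (fun=> 1) *m O = O *m (P (fun=> 1))^T.
Proof.
suff POT : (P (fun=> 1) *m O)^T = - (P (fun=> 1) *m O).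
  by rewrite -[LHS]opprK -POT trmx_mul OT mulNmx opprK.
rewrite mulmx_suml linear_sum (reindex_inj rev_ord_inj)/= -sumrN; apply: eq_bigr => i _.
have ik := ltn_ord i.
rewrite trmx_scale_mul -(scalemxAl 1 (C i *m e i) O) !scale1r CeO_tr (CeO i i).
rewrite subSS (_ : (k - (k - i))%N = i); last by lia.
rewrite -scaleNr; congr (_ *: _); rewrite -[RHS]mulN1r -exprS.
rewrite -signr_odd -[RHS]signr_odd; congr (_ ^+ _); congr nat_of_bool.
have -> : (k - i + k).+1 = ((k - i) * 2 + i.+1)%N by lia.
by rewrite oddD oddM andbF.
Qed.

(** Weights with w (i + 1) f i = w i, the condition for F to be the adjoint of A with respect to
    G. *)
Let w i : R := (\prod_(j < i) f j)^-1.
Let G := \sum_(i < k.+1) w i *: ((e i)^T *m e i).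

Lemma f_gt0 i : (i < k)%N -> 0 < f i.
Proof. by move=> ik; rewrite mulr_gt0 ?ltr0n ?subn_gt0. Qed.

Lemma w_gt0 i : (i <= k)%N -> 0 < w i.
Proof.
move=> ik; rewrite invr_gt0 prodr_gt0// => j _; apply: f_gt0.
exact: leq_trans (ltn_ord j) ik.
Qed.

Lemma w_f i : (i < k)%N -> w i.+1 * f i = w i.
Proof.
by move=> ik; rewrite /w big_ord_recr invfM mulfVK// gt_eqF// f_gt0.
Qed.

Lemma e_F i : (i < k)%N -> e i.+1 *m F = f i *: e i.
Proof.
move=> ik; rewrite /F mulmx_sumr (bigD1 (Ordinal ik))//= big1 ?addr0.
  by rewrite -scalemxAr mulmxA eC// eqxx mul1mx.
move=> j ji; rewrite -scalemxAr mulmxA eC// eqSS.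
by rewrite -val_eqE /= in ji; rewrite (negbTE ji) scalar_mx0 mul0mx scaler0.
Qed.

Lemma e0_F : e 0 *m F = 0.
Proof.
rewrite /F mulmx_sumr big1// => j _.
by rewrite -scalemxAr mulmxA eC// scalar_mx0 mul0mx scaler0.
Qed.

Lemma G_F : A^T *m G = G *m F.
Proof.
have ek : e k.+1 = 0 by exact: EAk.
rewrite mulmx_suml big_ord_recl -scalemxAl -mulmxA e0_F mulmx0 scaler0 add0r.
rewrite mulmx_sumr big_ord_recr /= -scalemxAr mulmxA -trmx_mul eA ek trmx0 mul0mx scaler0 addr0.
apply: eq_bigr => i _; rewrite -scalemxAr mulmxA -trmx_mul eA -scalemxAl -mulmxA e_F//.
by rewrite -scalemxAr scalerA w_f.
Qed.

Lemma form_G X : form G X X = \sum_(i < k.+1) w i * dot (e i *m X) (e i *m X).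
Proof.
rewrite /form mulmx_sumr mulmx_suml summxE; apply: eq_bigr => i _.
by rewrite -scalemxAr -scalemxAl mxE /dot (trmx_mul (e i) X) !mulmxA.
Qed.

Lemma string_piece : sl2_piece (P (fun=> 1)) F G.
Proof.
split; split.
- exact: P_F.
- exact: F_P.
- exact: F_O.
- exact: mxbr_A_A_F.
- by rewrite linear_sum; apply: eq_bigr => i _; rewrite linearZ/= trmx_mul trmxK.
- rewrite [in RHS]/G mulmx_suml; apply: eq_bigr => i _.
  by rewrite -scalemxAl -mulmxA e_P// -ltnS.
- exact: G_F.
- move=> X; rewrite form_G sumr_ge0// => i _.
  by rewrite mulr_ge0 ?dot_ge0// ltW// w_gt0// -ltnS.
- move=> X; rewrite form_G => /eqP; rewrite psumr_eq0 => [/allP e0|i _]; last first.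
    by rewrite mulr_ge0 ?dot_ge0// ltW// w_gt0// -ltnS.
  rewrite mulmx_suml big1 => [//|i _]; rewrite scale1r -mulmxA.
  have wi : 0 < w i by rewrite w_gt0// -ltnS.
  have := e0 i (mem_index_enum _); rewrite implyTb mulf_eq0 (gt_eqF wi) orFb => /eqP/dot_eq0 ->.
  by rewrite mulmx0.
Qed.

(** The strings and their duals are built from E, A and O, so a Q that fixes E and is compatible
    with A and O fixes all of them. *)
Lemma P_comm (Q : 'M[R]_m) : E *m Q = E -> Q *m A = A *m Q -> Q *m O = O *m Q^T ->
  P (fun=> 1) *m Q = P (fun=> 1) /\ Q *m P (fun=> 1) = P (fun=> 1).
Proof.
move=> EQ QA QO.
have eQ i : e i *m Q = e i.
  by rewrite /e -mulmxA (mulmx_exp_intertwine (esym QA)) mulmxA EQ.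
split.
  by rewrite [in RHS]/P mulmx_suml; apply: eq_bigr => i _; rewrite -scalemxAl -mulmxA eQ.
rewrite [in RHS]/P mulmx_sumr; apply: eq_bigr => i _; rewrite -scalemxAr mulmxA.
by rewrite {1}/C -scalemxAr !mulmxA QO -(mulmxA O) -trmx_mul eQ.
Qed.

Lemma string_split : exists P F G, [/\ sl2_piece P F G, P *m P = P, P *m A = A *m P, P *m O = O *m P^T
  & (E *m A ^+ k) *m P = E *m A ^+ k /\ forall Q : 'M[R]_m, E *m Q = E -> Q *m A = A *m Q ->
    Q *m O = O *m Q^T -> P *m Q = P /\ Q *m P = P].
Proof.
exists (P (fun=> 1)), F, G; split; first exact: string_piece.
- exact: P_P.
- by rewrite P_A A_P.
- exact: P_O.
- by split; [exact: e_P|exact: P_comm].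
Qed.

End String.
End NilpotentCompatible.

(** * Splitting off the longest strings *)

Section NilpotentInduction.
Variables (R : realType) (m : nat) (A O : 'M[R]_m).
Hypotheses (OT : O^T = - O) (AO : A *m O = - (O *m A^T)) (Ou : O \in unitmx).
Local Notation gam E j := (E *m O *m (A ^+ j)^T *m E^T).

Lemma half_cancel (V : lmodType R) (X : V) : X - 2^-1 *: X - 2^-1 *: X = 0.
Proof. by rewrite -addrA -opprD -scalerDr half_double subrr. Qed.

Lemma sign_correct r (g b : 'M[R]_r) (c s p q : R) : b \in unitmx ->
  g^T = p *: g -> b^T = q *: b -> invmx b^T = q *: invmx b ->
  s * c = - 2^-1 -> c * q * p = - 2^-1 ->
  g + s *: (c *: (g *m invmx b) *m b) + b *m (c *: (g *m invmx b))^T = 0.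
Proof.
move=> bu gT bT bi sc cqp; rewrite -scalemxAl mulmxKV// scalerA sc linearZ/= trmx_mul trmx_inv.
rewrite gT bi -scalemxAl -!scalemxAr scalerA mulmxA mulmxV// mul1mx scalerA cqp.
by rewrite scaleNr half_cancel.
Qed.

Lemma gamDl r (E D : 'M[R]_(r, m)) j : gam (E + D) j =
  gam E j + D *m O *m (E *m A ^+ j)^T + E *m O *m (D *m A ^+ j)^T + D *m O *m (D *m A ^+ j)^T.
Proof.
rewrite !trmx_mul [in LHS]linearD/= !mulmxDl !mulmxDr !mulmxA.
by rewrite -!addrA; congr (_ + _); rewrite addrCA.
Qed.

(** Adding L times the string shifted by k - j changes [gam j] by two cross terms, each equal to
    -1/2 of [gam E j] for the chosen L. The quadratic term and all changes above level j involve
    [gam] beyond k, where it vanishes. *)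
Lemma gam_correct r k j (E : 'M[R]_(r, m)) : (j < k)%N -> E *m A ^+ k.+1 = 0 ->
  gam E k \in unitmx -> exists L : 'M[R]_r, let E' := E + L *m E *m A ^+ (k - j) in
  [/\ E' *m A ^+ k = E *m A ^+ k, gam E' j = 0
    & forall i, (j < i)%N -> gam E' i = gam E i].
Proof.
move=> jk EAk gu; set s := (k - j)%N; set b := gam E k in gu *.
have s0 : (0 < s)%N by rewrite subn_gt0.
pose L := (- 2^-1 * (-1) ^+ s) *: (gam E j *m invmx b).
have EA i : (k < i)%N -> E *m A ^+ i = 0 by exact: EA0.
have gamE' a c : E *m A ^+ a *m O *m (E *m A ^+ c)^T = (-1) ^+ a *: gam E (a + c).
  exact: gamE.
have g0 i : (k < i)%N -> gam E i = 0 by exact: gam0.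
have LE : L = (- 2^-1 * (-1) ^+ s) *: (gam E j *m invmx b) by [].
clearbody L; exists L => E'; pose D := L *m E *m A ^+ s.
have DA i : D *m A ^+ i = L *m (E *m A ^+ (s + i)).
  by rewrite /D -!mulmxA exprD.
have t1 i : D *m O *m (E *m A ^+ i)^T = (-1) ^+ s *: (L *m gam E (s + i)).
  by rewrite /D -!(mulmxA L) gamE' -scalemxAr.
have t2 i : E *m O *m (D *m A ^+ i)^T = gam E (s + i) *m L^T.
  by rewrite DA trmx_mul mulmxA trmx_mul !mulmxA.
have t3 i : D *m O *m (D *m A ^+ i)^T = (-1) ^+ s *: (L *m gam E (s + (s + i)) *m L^T).
  by rewrite DA trmx_mul mulmxA /D -!(mulmxA L) gamE' -!scalemxAl -!scalemxAr mulmxA.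
have sk : (k < s + k)%N by rewrite -[X in (X < _)%N]add0n ltn_add2r.
have kE : (s + j)%N = k by rewrite /s subnK// ltnW.
split.
- by rewrite /E' mulmxDl -/D DA (EA _ sk) mulmx0 addr0.
- rewrite /E' -/D gamDl t1 t2 t3 kE (g0 _ sk) mulmx0 mul0mx scaler0 addr0.
  have gj := gam_tr OT AO E j; have gk := gam_tr OT AO E k.
  rewrite LE; apply: sign_correct gj gk _ _ _ => //.
  - by rewrite (gam_tr OT AO E k) invmxZ ?invr_sign// unitmxZ// unitrX// unitrN1.
  - by rewrite mulrCA -exprD addnn -signr_odd odd_double mulr1.
  - rewrite -!mulrA -!exprD -signr_odd.
    have -> : (s + (k.+1 + j.+1))%N = k.+1.*2 by lia.
    by rewrite odd_double mulr1.
- move=> i ji; rewrite /E' -/D gamDl t1 t2 t3.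
  have ki : (k < s + i)%N by rewrite -kE ltn_add2l.
  have ki' : (k < s + (s + i))%N := leq_trans ki (leq_addl _ _).
  by rewrite (g0 _ ki) (g0 _ ki') mulmx0 !mul0mx !scaler0 !addr0.
Qed.

(** Levels are cleared downwards from k - 1, because a correction at level j preserves the levels
    above it and the top image E A^k. *)
Lemma gam_correct_all r k (E Z : 'M[R]_(r, m)) (Q : 'M[R]_m) : E *m A ^+ k = Z ->
  E *m Q = E -> Q *m A = A *m Q -> E *m A ^+ k.+1 = 0 -> gam E k \in unitmx ->
  exists E', [/\ E' *m A ^+ k = Z, E' *m Q = E', gam E' k \in unitmx
    & forall j, (j < k)%N -> gam E' j = 0].
Proof.
move=> EZ EQ QA EAk gu.
suff H n : (n <= k)%N -> exists E', [/\ E' *m A ^+ k = Z, E' *m Q = E', gam E' k \in unitmx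
    & forall j, (k - n <= j)%N -> (j < k)%N -> gam E' j = 0].
  have [E' [e1 e2 e3 e4]] := H k (leqnn k); exists E'; split=> // j jk.
  by apply: e4 => //; rewrite subnn.
elim: n => [_|n IH nk].
  exists E; split=> // j; rewrite subn0 => kj jk.
  by have := leq_trans jk kj; rewrite ltnn.
have [E1 [e1 e2 e3 e4]] := IH (ltnW nk).
have E1A : E1 *m A ^+ k.+1 = 0.
  by rewrite exprSr -mulmxE mulmxA e1 -EZ -mulmxA mulmxE -exprSr.
have jk : (k - n.+1 < k)%N by lia.
have [L [f1 f2 f3]] := gam_correct jk E1A e3.
set E2 := E1 + _ in f1 f2 f3; exists E2; split.
- by rewrite f1.
- rewrite /E2 mulmxDl e2; congr (_ + _).
  by rewrite -!mulmxA (mulmx_exp_intertwine (esym QA)) (mulmxA E1) e2.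
- by rewrite f3.
- move=> j; rewrite leq_eqVlt => /predU1P[<- _|lt jk']; first exact: f2.
  by rewrite f3//; apply: e4 => //; lia.
Qed.

(** Induction on the order of nilpotency on the range of Q. E generates all strings of maximal
    length at once: the rows of E A^k form a basis of the row space of Q A^k. They span the piece P,
    and (Q - P) A^k = 0 feeds the induction. *)
Lemma nilpotent_piece k (Q : 'M[R]_m) : Q *m Q = Q -> Q *m A = A *m Q -> Q *m O = O *m Q^T ->
  Q *m A ^+ k = 0 -> exists F G, sl2_piece A O Q F G.
Proof.
elim: k Q => [|k IH] Q QQ QA QO QAk.
  have Q0 : Q = 0 by rewrite -QAk expr0 mulmx1.
  exists 0, 0; rewrite Q0; split; split.
  - by rewrite mulmx0.
  - by rewrite mulmx0.
  - by rewrite trmx0 mulmx0 mul0mx oppr0.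
  - by rewrite /mxbr !(mulmx0, mul0mx, subrr, scaler0).
  - by rewrite trmx0.
  - by rewrite mulmx0.
  - by rewrite mulmx0 mul0mx.
  - by move=> X; rewrite /form mulmx0 mul0mx mxE.
  - by move=> X _; rewrite mul0mx.
have QAc i : Q *m A ^+ i = A ^+ i *m Q := esym (mulmx_exp_intertwine (esym QA) i).
pose B := Q *m A ^+ k.
have [r [Z [X [Y [V [ZX BY ZV]]]]]] : exists r (Z : 'M[R]_(r, m)) X Y V,
    [/\ Z = X *m B, B = Y *m Z & Z *m V = 1%:M].
  have /row_freeP[V ZV] := row_base_free B.
  have [X ZX] : exists X, row_base B = X *m B by apply/submxP; rewrite eq_row_base.
  have [Y BY] : exists Y, B = Y *m row_base B by apply/submxP; rewrite eq_row_base.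
  by exists (\rank B), (row_base B), X, Y, V.
pose E := X *m Q.
have EZ : E *m A ^+ k = Z by rewrite ZX /E -mulmxA.
have EQ : E *m Q = E by rewrite /E -mulmxA QQ.
have EAk : E *m A ^+ k.+1 = 0 by rewrite /E -mulmxA QAk mulmx0.
(* If x gam = 0, then x E is O-orthogonal to the row space of Q A^k. Moving A^k across O turns this
   into x Z O = 0, and O is invertible while the rows of Z are independent. *)
have gu : gam E k \in unitmx.
  rewrite -row_free_unit; apply: inj_row_free => x xg.
  have xZ : x *m Z *m O = 0.
    have -> : x *m Z *m O = (-1) ^+ k *: (x *m (E *m O *m B^T)).
      have EO : E *m O = E *m O *m Q^T by rewrite -[in LHS]EQ -!mulmxA QO.
      rewrite -EZ -!mulmxA exp_O// -!scalemxAr /B QAc trmx_mul; congr (_ *: (_ *m _)).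
      by rewrite !mulmxA -EO.
    rewrite BY trmx_mul -EZ trmx_mul.
    have -> : x *m (E *m O *m ((A ^+ k)^T *m E^T *m Y^T)) = x *m gam E k *m Y^T.
      by rewrite !mulmxA.
    by rewrite xg mul0mx scaler0.
  have xZ0 : x *m Z = 0 by rewrite -[LHS](mulmxK Ou) xZ mul0mx.
  by rewrite -[x]mulmx1 -ZV mulmxA xZ0 mul0mx.
have [E' [E'Z E'Q gu' glow]] := gam_correct_all EZ EQ QA EAk gu.
have E'Ak : E' *m A ^+ k.+1 = 0.
  by rewrite exprSr -mulmxE mulmxA E'Z -EZ -mulmxA mulmxE -exprSr.
have [P [F [G [piece PP PA PO [ZP Pcomm]]]]] := string_split OT AO E'Ak glow gu'.
have [PQ QP] := Pcomm Q E'Q QA QO.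
have PAk : P *m A ^+ k = B.
  have BP : B *m P = B by rewrite BY -mulmxA -E'Z ZP.
  by rewrite -QP -mulmxA (esym (mulmx_exp_intertwine (esym PA) k)) mulmxA -/B BP.
have [||||F' [G' piece']] := IH (Q - P).
- by rewrite mulmxBr !mulmxBl QQ PQ QP PP subrr subr0.
- by rewrite mulmxBl mulmxBr QA PA.
- by rewrite mulmxBl linearB/= mulmxBr QO PO.
- by rewrite mulmxBl PAk -/B subrr.
exists (F + F'), (G + G'); rewrite -[Q](subrK P) addrC.
by apply: sl2_pieceD => //; rewrite ?mulmxBr ?mulmxBl ?PQ ?QP PP subrr.
Qed.

End NilpotentInduction.

(** With Q = 1, F is the adjoint of A_1 for G and lies in sp. After the polar decomposition it
    becomes the transpose, and the sl2 relation reads [[A, A^t], A] = 2 A. *)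
Lemma nilpotent_compatible (R : realType) m (J1 : 'M[R]_m) a A1 :
  J1^T = - J1 -> J1 *m J1 = - 1%:M -> in_sp J1 A1 -> nilpotent_mx (mxA a A1) ->
  exists g, scf_soliton (ga_bracket (mxA a A1)) (omega J1) g.
Proof.
move=> J1T J1J1 sp nA; have a0 : a = 0 by exact: nilpotent_mxA_a0 nA.
have Ju : J1 \in unitmx.
  by have [] := @mulmx1_unit _ _ J1 (- J1); rewrite // mulmxN J1J1 opprK.
have JXJJ X : J1 *m (X *m J1) *m J1 = - (J1 *m X).
  by rewrite !mulmxA -mulmxA J1J1 mulmxN mulmx1.
have JJXJ X : J1 *m - (J1 *m X) *m J1 = X *m J1.
  by rewrite mulmxN mulNmx !mulmxA J1J1 !mulNmx mul1mx opprK.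
have AJ : A1 *m J1 = - (J1 *m A1^T).
  have /(congr1 (fun M => J1 *m M *m J1)) : A1^T *m J1 = - (J1 *m A1).
    by apply/eqP; rewrite -addr_eq0; apply/eqP.
  by rewrite JXJJ JJXJ => <-.
have [k Ak] : exists k, A1 ^+ k = 0.
  have [k Ak] := nA; exists k; have mxAX i : mxA a A1 ^+ i = mxA (a ^+ i) (A1 ^+ i).
    elim: i => [|i IH]; first by rewrite !expr0 /mxA -scalar_mx_block.
    rewrite !exprS IH -!mulmxE /mxA mulmx_block !mulmx0 !mul0mx !addr0 !add0r.
    by rewrite -scalar_mxM.
  by move: Ak; rewrite mxAX -block_mx0 => /eq_block_mx[].
have [F [G [[_ _ FJ AAF] [GT _ AG G0 GK]]]] : exists F G, sl2_piece A1 J1 1%:M F G.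
  apply: (nilpotent_piece J1T AJ Ju (k := k)); rewrite ?mulmx1 ?mul1mx ?trmx1 ?mulmx1//.
have Gpos : posdef G.
  split=> // X X0; rewrite lt_neqAle G0 andbT eq_sym; apply: contra X0 => /eqP/GK.
  by rewrite mul1mx => ->.
have spF : in_sp J1 F.
  have /(congr1 (fun M => J1 *m M *m J1)) := FJ.
  rewrite JXJJ JJXJ => e.
  by rewrite /in_sp -e addNr.
apply: (compatible_soliton J1T J1J1 sp Gpos AG spF) => Jh Ah C JhT JhJh spAh Cu CA CF.
suff crit : mxbr (mxbr (mxA a Ah) (mxA a Ah)^T) (mxA a Ah) = 2 *: mxA a Ah.
  exact: mxA_soliton_of_critical crit.
have br X Y X' Y' : C *m X = X' *m C -> C *m Y = Y' *m C -> C *m mxbr X Y = mxbr X' Y' *m C.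
  by move=> e e'; rewrite /mxbr mulmxBr mulmxBl !mulmxA e e' -!mulmxA e e'.
have := br _ _ _ _ CA (br _ _ _ _ CA CF).
rewrite AAF mul1mx -scalemxAr CA => e.
have {}e : mxbr (mxbr Ah Ah^T) Ah = 2 *: Ah.
  rewrite mxbrC; apply: (can_inj (mulmxK Cu)); rewrite mulNmx -e scaleNr opprK.
  by rewrite scalemxAl.
rewrite mxA_mxbr a0 /mxA scalar_mx0 /mxbr !mulmx_block !mulmx0 !mul0mx !addr0 !add0r.
by rewrite opp_block_mx add_block_mx !oppr0 !addr0 -/(mxbr _ _) e scale_block_mx !scaler0.
Qed.

(** * Locally Lipschitz equations *)

Lemma maxr_lipschitz (R : realDomainType) (c x y : R) :
  `|Num.max c x - Num.max c y| <= `|x - y|.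
Proof.
have := ler_norm (x - y); have := ler_norm (y - x); rewrite (distrC y x) => h1 h2.
by case: (lerP c x) => cx; case: (lerP c y) => cy; rewrite ?subrr ?normr0 // ler_norml; lra.
Qed.

Lemma minr_lipschitz (R : realDomainType) (c x y : R) :
  `|Num.min c x - Num.min c y| <= `|x - y|.
Proof.
have := ler_norm (x - y); have := ler_norm (y - x); rewrite (distrC y x) => h1 h2.
by case: (lerP c x) => cx; case: (lerP c y) => cy; rewrite ?subrr ?normr0 // ler_norml; lra.
Qed.

Section LocallyLipschitz.
Variables (R : realType) (m n : nat).
Implicit Types (V : 'M[R]_(m, n) -> 'M[R]_(m, n)).

Definition loc_lipschitz V : Prop := forall B : R, exists2 L, 0 <= L &
  forall M N, `|M| <= B -> `|N| <= B -> `|V M - V N| <= L * `|M - N|.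

Lemma solution_bounded (x dx : R -> 'M[R]_(m, n)) Tm Tp (a b : R) :
  (forall t, inI Tm Tp t -> is_derive t (1 : R) x (dx t)) -> inI Tm Tp a -> inI Tm Tp b ->
  exists2 K, 0 <= K & forall t, a <= t <= b -> `|x t| <= K.
Proof.
move=> xd Ia Ib; apply: continuous_mx_bounded => t tab.
exact: is_derive_continuous (xd t (inI_conv Ia Ib tab)).
Qed.

Lemma loc_lipschitz_unique V (x y : R -> 'M[R]_(m, n)) Tm Tp t0 : loc_lipschitz V ->
  inI Tm Tp t0 ->
  (forall t, inI Tm Tp t -> is_derive t (1 : R) x (V (x t))) ->
  (forall t, inI Tm Tp t -> is_derive t (1 : R) y (V (y t))) ->
  x t0 = y t0 -> forall t, inI Tm Tp t -> x t = y t.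
Proof.
move=> VL I0 xd yd xy0 t It; apply/eqP; rewrite -subr_eq0; apply/eqP.
apply: (gronwall0_itv (z := fun s => x s - y s) (dz := fun s => V (x s) - V (y s)) I0) It.
- by move=> s Is; apply: is_deriveB; [exact: xd|exact: yd].
- move=> a b Ia Ib; have [K K0 xK] := solution_bounded xd Ia Ib.
  have [K' K'0 yK] := solution_bounded yd Ia Ib.
  have [L L0 VLK] := VL (K + K'); exists L => s sab; apply: VLK.
    by rewrite (le_trans (xK _ sab))// lerDl.
  by rewrite (le_trans (yK _ sab))// lerDr.
- by rewrite xy0 subrr.
Qed.

(** Gronwall for z = x - p x: since p fixes V (p x), z' = (id - p)(V x - V (p x)), which is O(|z|)
    on compact intervals. *)
Lemma loc_lipschitz_invariant V (p : {linear 'M[R]_(m, n) -> 'M[R]_(m, n)})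
    (x : R -> 'M[R]_(m, n)) Tm Tp t0 : loc_lipschitz V ->
  inI Tm Tp t0 -> (forall M, p (V (p M)) = V (p M)) ->
  (forall t, inI Tm Tp t -> is_derive t (1 : R) x (V (x t))) ->
  p (x t0) = x t0 -> forall t, inI Tm Tp t -> p (x t) = x t.
Proof.
move=> VL I0 pV xd p0 t It; apply/esym/eqP; rewrite -subr_eq0; apply/eqP.
pose dz s := (V (x s) - V (p (x s))) - p (V (x s) - V (p (x s))).
apply: (gronwall0_itv (z := fun s => x s - p (x s)) (dz := dz) I0) It.
- move=> s Is; have -> : dz s = V (x s) - p (V (x s)).
    by rewrite /dz linearB pV opprB subrKA.
  by apply: is_deriveB; [exact: xd|apply: is_derive_linmx; exact: xd].
- move=> a b Ia Ib; have [K K0 xK] := solution_bounded xd Ia Ib.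
  have [C C0 pC] := linmx_bound p.
  have [L L0 VLK] := VL (K + C * K); exists (L + C * L) => s sab.
  have CK : 0 <= C * K by exact: mulr_ge0.
  have VV : `|V (x s) - V (p (x s))| <= L * `|x s - p (x s)|.
    apply: VLK; first by rewrite (le_trans (xK _ sab))// lerDl.
    by rewrite (le_trans (pC _))// -[leLHS]add0r lerD// ler_wpM2l// xK.
  rewrite /dz (le_trans (ler_normB _ _))// mulrDl lerD//.
  by rewrite (le_trans (pC _))// -mulrA ler_wpM2l.
- by rewrite p0 subrr.
Qed.

Lemma lipschitz_ode (W : 'M[R]_(m, n) -> 'M[R]_(m, n)) (L : R) x0 Tm Tp t0 :
  (forall M N, `|W M - W N| <= L * `|M - N|) -> inI Tm Tp t0 ->
  exists y, y t0 = x0 /\ forall t, inI Tm Tp t -> is_derive t (1 : R) y (W (y t)).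
Proof.
move=> WL I0; apply: (picard_lindelof (F := fun _ M => W M)) => //.
  by move=> a b _ _; exists L.
move=> x cx t It; have cxt := cx t It.
apply/cvgrPdist_le => e e0.
pose L1 := Num.max L 1; have L1_gt0 : 0 < L1 by rewrite lt_max ltr01 orbT.
have eL : 0 < e / L1 by exact: divr_gt0.
move/cvgrPdist_le : cxt => /(_ _ eL); near_simpl => H; near=> s.
apply: le_trans (WL _ _) _; apply: le_trans (_ : L1 * `|x t - x s| <= _).
  by rewrite ler_wpM2r// le_max lexx.
by rewrite mulrC -ler_pdivlMr//; near: s.
Unshelve. all: by end_near. Qed.

Definition cutoff (B : R) (M : 'M[R]_(m, n)) : R := Num.max 0 (Num.min 1 (2 - `|M| / B)).

Lemma cutoff_ge0 B M : 0 <= cutoff B M.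
Proof. by rewrite le_max lexx. Qed.

Lemma cutoff_le1 B M : cutoff B M <= 1.
Proof. by rewrite ge_max ler01 ge_min lexx. Qed.

Lemma cutoff1 B M : 0 < B -> `|M| <= B -> cutoff B M = 1.
Proof.
move=> B0 MB; have le1 : `|M| / B <= 1 by rewrite ler_pdivrMr// mul1r.
by rewrite /cutoff min_l ?max_r//; move: (`|M| / B) le1 => x; lra.
Qed.

Lemma cutoff0 B M : 0 < B -> 2 * B <= `|M| -> cutoff B M = 0.
Proof.
move=> B0 MB; have le1 : 2 <= `|M| / B by rewrite ler_pdivlMr.
rewrite /cutoff max_l// ge_min; apply/orP; right.
by move: (`|M| / B) le1 => x; lra.
Qed.

Lemma cutoff_lipschitz B M N : 0 < B -> `|cutoff B M - cutoff B N| <= B^-1 * `|M - N|.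
Proof.
move=> B0; apply: le_trans (maxr_lipschitz _ _ _) _; apply: le_trans (minr_lipschitz _ _ _) _.
have -> : 2 - `|M| / B - (2 - `|N| / B) = B^-1 * (`|N| - `|M|) by ring.
have Bi : 0 <= B^-1 by rewrite invr_ge0 ltW.
by rewrite normrM (ger0_norm Bi) ler_wpM2l// (distrC M) ler_dist_dist.
Qed.

(** The damped field vanishes outside the ball of radius 2 B, so only the bound and the Lipschitz
    constant of V on that ball enter. *)
Lemma cutoff_field V B : loc_lipschitz V -> 0 < B ->
  exists L, forall M N, `|cutoff B M *: V M - cutoff B N *: V N| <= L * `|M - N|.
Proof.
move=> VL B0; have [L L0 VLB] := VL (2 * B).
pose K := `|V 0| + L * (2 * B).
have VK M : `|M| <= 2 * B -> `|V M| <= K.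
  move=> MB; rewrite -[V M](subrK (V 0)) (le_trans (ler_normD _ _))// addrC lerD//.
  have B2 : 0 <= 2 * B by rewrite mulr_ge0// ltW.
  rewrite (le_trans (VLB _ _ MB _)) ?normr0// subr0 ler_wpM2l//.
have K0 : 0 <= K by rewrite addr_ge0// mulr_ge0// mulr_ge0// ltW.
have Bi : 0 <= B^-1 by rewrite invr_ge0 ltW.
exists (L + B^-1 * K) => M N.
have out X Y : `|X| <= 2 * B -> 2 * B <= `|Y| ->
    `|cutoff B X *: V X - cutoff B Y *: V Y| <= (L + B^-1 * K) * `|X - Y|.
  move=> XB YB; rewrite (cutoff0 B0 YB) scale0r subr0.
  have -> : cutoff B X = cutoff B X - cutoff B Y by rewrite (cutoff0 B0 YB) subr0.
  rewrite normrZ mulrDl -[leLHS]add0r lerD ?mulr_ge0// mulrAC ler_pM ?cutoff_lipschitz ?VK//.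
case: (lerP `|M| (2 * B)) => MB; case: (lerP `|N| (2 * B)) => NB.
- have -> : cutoff B M *: V M - cutoff B N *: V N =
      cutoff B M *: (V M - V N) + (cutoff B M - cutoff B N) *: V N.
    by rewrite scalerBr scalerBl addrA subrK.
  rewrite (le_trans (ler_normD _ _))// !normrZ mulrDl lerD//; last first.
    by rewrite mulrAC ler_pM ?cutoff_lipschitz ?VK.
  rewrite ger0_norm ?cutoff_ge0// (le_trans (ler_piMl _ (cutoff_le1 _ _)))// VLB//.
- by apply: out => //; exact: ltW.
- by rewrite distrC [X in _ <= _ * X]distrC; apply: out => //; exact: ltW.
- rewrite !cutoff0// ?(ltW MB) ?(ltW NB)// !scale0r subrr normr0 mulr_ge0//.
  by rewrite addr_ge0 ?mulr_ge0.
Qed.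

(** The cut-off equation has a solution y on all of (a, b), equal to x where x lives. At an endpoint
    of the interval of x inside (a, b), continuity keeps |y| strictly below the cut-off radius [B1]
    > B, so y solves the original equation a little further, against maximality. *)
Lemma bounded_extends V (x : R -> 'M[R]_(m, n)) Tm Tp (a b B : R) : loc_lipschitz V ->
  maximal_solution (fun Tm Tp x => forall t : R, (Tm < t%:E < Tp)%E ->
    is_derive t (1 : R) x (V (x t))) Tm Tp x ->
  a < 0 < b -> (forall t, inI Tm Tp t -> a < t < b -> `|x t| <= B) ->
  (Tm <= a%:E)%E /\ (b%:E <= Tp)%E.
Proof.
move=> VL xmax ab xB; have [I0 xd _] := xmax.
pose B1 := `|B| + 1; have B1_gt0 : 0 < B1 by rewrite ltr_wpDl.
have BB1 : B < B1 by rewrite (le_lt_trans (ler_norm B))// ltrDl.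
have [L WL] := cutoff_field VL B1_gt0.
have I0' : inI a%:E b%:E 0 by rewrite /inI !lte_fin.
have [y [y0 yd]] := lipschitz_ode (x 0) WL I0'.
have ab_dec t : inI a%:E b%:E t = (a < t < b) by rewrite /inI !lte_fin.
have cap A C D E t : inI (Order.max A C) (Order.min D E) t <-> inI A D t /\ inI C E t.
  by rewrite /inI gt_max lt_min andbACA; split=> /andP.
have WL' : loc_lipschitz (fun M => cutoff B1 M *: V M).
  move=> C; exists `|L| => [//|M N _ _]; apply: le_trans (WL M N) _.
  by rewrite ler_wpM2r// ler_norm.
have xy t : inI Tm Tp t -> a < t < b -> y t = x t.
  move=> It tab; have Ic : inI (Order.max Tm a%:E) (Order.min Tp b%:E) t.
    by apply/cap; rewrite ab_dec.
  apply: (loc_lipschitz_unique WL' _ _ _ y0 Ic); first by apply/cap.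
    by move=> s /cap[_ Is]; exact: yd.
  move=> s /cap[Is sab]; have sab' : a < s < b by rewrite -ab_dec.
  rewrite cutoff1 ?scale1r//; first exact: xd.
  by rewrite (le_trans (xB _ Is sab'))// ltW.
have ysol t : a < t < b -> `|y t| < B1 -> is_derive t (1 : R) y (V (y t)).
  move=> tab yB; have := yd t; rewrite ab_dec => /(_ tab).
  by rewrite cutoff1 ?(ltW yB)// scale1r.
have ycont r e : a < r < b -> 0 < e ->
    exists2 d, 0 < d & forall s, `|s - r| <= d -> a < s < b /\ `|y s - y r| <= e.
  move=> rab e0; have Ir : inI a%:E b%:E r by rewrite ab_dec.
  have /cvgrPdist_le/(_ _ e0) := is_derive_continuous (yd r Ir); near_simpl.
  move=> [d d0 Hd]; have [d' d'0 Hd'] := inI_ball Ir.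
  exists (Num.min (d / 2) d'); first by rewrite lt_min divr_gt0.
  move=> s; rewrite le_min => /andP[sd sd']; split; first by rewrite -ab_dec; exact: Hd'.
  rewrite distrC; apply: Hd; rewrite /ball/= distrC (le_lt_trans sd)// ltr_pdivrMr//.
  by rewrite ltr_pMr// ltr1n.
have yr r : a < r < b -> (forall d, 0 < d -> exists2 s, `|s - r| <= d & inI Tm Tp s) ->
    `|y r| < B1.
  move=> rab rI; have e0 : 0 < (B1 - B) / 2 by rewrite divr_gt0// subr_gt0.
  have [d d0 Hd] := ycont _ _ rab e0; have [s sd Is] := rI _ d0.
  have [sab ys] := Hd _ sd; have := xB _ Is sab; rewrite -xy// => yB.
  have := ler_normD (y s) (y r - y s); rewrite addrC subrK distrC => h.
  move: (`|y r|) (`|y s|) (`|y s - y r|) h ys yB e0 => u v w h1 h2 h3 h4.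
  by clear -h1 h2 h3 h4 BB1; lra.
have germ (u v : R -> 'M[R]_(m, n)) (t : R) : (\forall s \near t, u s = v s) ->
    is_derive t (1 : R) u (V (u t)) -> is_derive t (1 : R) v (V (v t)).
  move=> uv ud; rewrite -(nbhs_singleton uv); apply: near_eq_is_derive ud.
  by apply: filterS uv => s ->.
have absorb A C : (A < 0)%E -> (0 < C)%E ->
    (forall t, inI A C t -> is_derive t (1 : R) y (V (y t))) ->
    (forall t, inI A C t -> a < t < b) -> (Tm <= A)%E /\ (C <= Tp)%E.
  move=> A0 C0 sol ACab; apply: (maximal_solution_absorbs germ xmax sol I0).
    by rewrite /inI A0.
  by move=> t It /ACab; exact: xy.
have xyB t : inI Tm Tp t -> a < t < b -> `|y t| < B1.
  by move=> It tab; rewrite xy// (le_lt_trans (xB _ It tab)).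
case/andP: (ab) => a0 b0; case/andP: (I0) => Tm0 Tp0.
split; apply/negP => /negP; rewrite -ltNge => lt.
- have [r rE] : exists r, Tm = r%:E.
    by case: (Tm) lt Tm0 => [r| |]//; exists r.
  rewrite rE !lte_fin in lt Tm0.
  have rab : a < r < b by rewrite lt (lt_trans Tm0).
  have yrB : `|y r| < B1.
    apply: yr => // d d0; pose c := Num.min d (- r / 2).
    have c0 : 0 < c by rewrite lt_min d0 divr_gt0// oppr_gt0.
    exists (r + c); first by rewrite addrC addKr gtr0_norm// ge_min lexx.
    apply: (inI_conv _ I0 (a := r + c / 2)); last first.
      rewrite lerD2l; apply/andP; split; first by rewrite ler_pdivrMr// ler_pMr// ler1n.
      have : c <= - r / 2 by rewrite ge_min lexx orbT.
      by clear -Tm0; lra.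
    rewrite /inI rE !lte_fin ltrDl divr_gt0//= (lt_trans _ Tp0)// lte_fin.
    have : c <= - r / 2 by rewrite ge_min lexx orbT.
    by clear -Tm0 c0; lra.
  have e0 : 0 < (B1 - `|y r|) / 2 by rewrite divr_gt0// subr_gt0.
  have [d d0 Hd] := ycont _ _ rab e0.
  have [||||] := absorb (r - d)%:E (Order.min Tp b%:E).
  + by rewrite lte_fin subr_lt0 (lt_trans Tm0).
  + by rewrite lt_min Tp0.
  + move=> t; rewrite /inI lt_min => /and3P[rt tTp tb]; rewrite !lte_fin in rt tb.
    have [tr|rt'] := lerP t r.
      have [|tab yt] := Hd t; first by rewrite ler_norml; apply/andP; split; clear -tr rt d0; lra.
      apply: ysol => //; have := ler_normD (y r) (y t - y r); rewrite addrC subrK.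
      move: (`|y t|) (`|y r|) (`|y t - y r|) yrB yt => u v w; clear; lra.
    have tab : a < t < b by rewrite tb (lt_trans lt).
    by apply: ysol => //; apply: xyB => //; rewrite /inI rE lte_fin rt'.
  + move=> t; rewrite /inI lt_min => /and3P[rt tTp tb]; rewrite !lte_fin in rt tb.
    rewrite tb andbT; have [] := Hd (r - d); first by rewrite addrAC subrr add0r normrN ger0_norm// ltW.
    by move=> /andP[ard _] _; exact: lt_trans ard rt.
  + by rewrite rE lee_fin => h _; clear -h d0; lra.
- have [r rE] : exists r, Tp = r%:E.
    by case: (Tp) lt Tp0 => [r| |]//; exists r.
  rewrite rE !lte_fin in lt Tp0.
  have rab : a < r < b by rewrite lt (lt_trans a0).
  have yrB : `|y r| < B1.
    apply: yr => // d d0; pose c := Num.min d (r / 2).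
    have c0 : 0 < c by rewrite lt_min d0 divr_gt0.
    have cr : c <= r / 2 by rewrite ge_min lexx orbT.
    exists (r - c); first by rewrite addrAC subrr add0r normrN gtr0_norm// ge_min lexx.
    apply: (inI_conv I0 _ (b := r - c / 2)); last first.
      by apply/andP; split; clear -cr c0 Tp0; lra.
    rewrite /inI rE !lte_fin (lt_trans Tm0) ?lte_fin//=; last by clear -cr c0 Tp0; lra.
    by clear -c0; lra.
  have e0 : 0 < (B1 - `|y r|) / 2 by rewrite divr_gt0// subr_gt0.
  have [d d0 Hd] := ycont _ _ rab e0.
  have [||||] := absorb (Order.max Tm a%:E) (r + d)%:E.
  + by rewrite gt_max Tm0.
  + by rewrite lte_fin (lt_trans Tp0)// ltrDl.
  + move=> t; rewrite /inI gt_max => /andP[/andP[tTm at_] rt]; rewrite !lte_fin in rt at_.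
    have [tr|rt'] := lerP r t.
      have [|tab yt] := Hd t; first by rewrite ler_norml; apply/andP; split; clear -tr rt d0; lra.
      apply: ysol => //; have := ler_normD (y r) (y t - y r); rewrite addrC subrK.
      move: (`|y t|) (`|y r|) (`|y t - y r|) yrB yt => u v w; clear; lra.
    have tab : a < t < b by rewrite at_ (lt_trans rt').
    by apply: ysol => //; apply: xyB => //; rewrite /inI rE lte_fin rt' tTm.
  + move=> t; rewrite /inI gt_max => /andP[/andP[tTm at_] rt]; rewrite !lte_fin in rt at_.
    rewrite at_; have [] := Hd (r + d); first by rewrite addrAC subrr add0r ger0_norm// ltW.
    by move=> /andP[_ ard] _; exact: lt_trans rt ard.
  + by rewrite rE lee_fin => _ h; clear -h d0; lra.
Qed.

End LocallyLipschitz.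

(** * The matrix flow *)

Section FlowField.
Variables (R : realType) (k : nat).
Implicit Types A : 'M[R]_k.

Definition flow_field A : 'M[R]_k :=
  - (2^-1 * ((\tr A) ^+ 2 + \tr (sympart A *m sympart A))) *: A
  + 2^-1 *: mxbr A (mxbr A A^T) - (\tr A / 2) *: mxbr A A^T.

Lemma close_ball B : close [set p : 'M[R]_k * 'M[R]_k | `|p.1| <= B /\ `|p.2| <= B]
  (fun p => `|p.1 - p.2|) fst snd.
Proof.
exists (Num.max `|B| 1); first by rewrite le_max normr_ge0.
move=> [M N] [MB NB]; split=> /=.
- by rewrite le_max (le_trans MB (ler_norm B)).
- by rewrite le_max (le_trans NB (ler_norm B)).
- by rewrite ler_peMl// le_max lexx orbT.
Qed.

Lemma flow_field_lipschitz : loc_lipschitz flow_field.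
Proof.
move=> B; pose S : set ('M[R]_k * 'M[R]_k) := [set p | `|p.1| <= B /\ `|p.2| <= B].
pose delta (p : 'M[R]_k * 'M[R]_k) := `|p.1 - p.2|.
have d0 t : S t -> 0 <= delta t by move=> _; exact: normr_ge0.
have cA : close S delta fst snd := close_ball B.
have ctr := close_mxtrace cA; have cT := close_trmx cA.
have cS : close S delta (fun p => sympart p.1) (fun p => sympart p.2).
  by apply: close_scale; [exact: close_cst|exact: closeD].
have cbr u v u' v' : close S delta u v -> close S delta u' v' ->
    close S delta (fun p => mxbr (u p) (u' p) : 'M[R]_k) (fun p => mxbr (v p) (v' p)).
  by move=> c c'; apply: closeB; exact: close_mulmx.
have [K K0 HK] : close S delta (fun p => flow_field p.1) (fun p => flow_field p.2).
  apply: closeB.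
    apply: closeD.
      apply: close_scale => //; apply: closeN; apply: closeM; first exact: close_cst.
      apply: closeD; first by apply: eq_close (closeM ctr ctr) => p; rewrite expr2.
      by apply: close_mxtrace; exact: close_mulmx.
    by apply: close_scale; [exact: close_cst|exact: (cbr _ _ _ _ cA (cbr _ _ _ _ cA cT))].
  apply: close_scale; last exact: cbr.
  by apply: closeM => //; exact: close_cst.
by exists K => // M N MB NB; have [] := HK (M, N) (conj MB NB).
Qed.

Lemma is_derive_sqnorm (A : R -> 'M[R]_k) t dA : is_derive t (1 : R) A dA ->
  is_derive t (1 : R) (fun s => sqnorm (A s)) (2 * \tr (dA *m (A t)^T)).
Proof.
move=> Ad; have -> : 2 * \tr (dA *m (A t)^T) = \tr (dA *m (A t)^T + A t *m dA^T).
  have -> : A t *m dA^T = (dA *m (A t)^T)^T by rewrite trmx_mul trmxK.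
  by rewrite mxtraceD mxtrace_tr mulr_natl mulr2n.
by apply: is_derive_mxtrace; apply: is_derive_mulmx; apply: is_derive_trmx.
Qed.

Lemma flow_rate_ge0 A : 0 <= 2^-1 * ((\tr A) ^+ 2 + \tr (sympart A *m sympart A)).
Proof.
rewrite mulr_ge0 ?invr_ge0// addr_ge0 ?sqr_ge0//.
rewrite -[X in _ *m X](sympart_tr A); exact: sqnorm_ge0.
Qed.

Lemma mxtrace_flow_field A : \tr (flow_field A *m A^T) =
  - (2^-1 * ((\tr A) ^+ 2 + \tr (sympart A *m sympart A))) * sqnorm A
  - 2^-1 * sqnorm (mxbr A A^T).
Proof.
set M := mxbr A A^T; rewrite /flow_field -/M; set f := 2^-1 * _.
have MA0 : \tr (M *m A^T) = 0.
  by rewrite -mxtrace_tr trmx_mul trmxK mxbr_self_tr_sym mxtrace_self_mxbr.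
have AMA : \tr (mxbr A M *m A^T) = - sqnorm M.
  rewrite mxbrC mulNmx raddfN/= mxtrace_mxbr -/M; congr (- _).
  exact: mxtrace_mxbr_sq.
rewrite mulmxBl mulmxDl -!scalemxAl mxtraceB mxtraceD !mxtraceZ AMA MA0 /sqnorm.
by rewrite mulr0 subr0 mulrN.
Qed.

Lemma flow_field_tr_le0 A : \tr (flow_field A *m A^T) <= 0.
Proof.
rewrite mxtrace_flow_field mulNr -opprD oppr_le0 addr_ge0// mulr_ge0 ?sqnorm_ge0 ?flow_rate_ge0//.
Qed.

Lemma mx_norm_fnorm A : `|A| <= fnorm A.
Proof.
apply: mx_norm_leP => [|i j]; first exact: sqrtr_ge0.
rewrite -sqrtr_sqr ler_wsqrtr// sqnorm_sum (bigD1 i)//= (bigD1 j)//= -addrA lerDl.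
by rewrite addr_ge0// sumr_ge0// => l _; rewrite ?sqr_ge0// sumr_ge0// => l' _; exact: sqr_ge0.
Qed.

(** Forward in time |A|^2 does not increase; a compactness bound on a short backward interval
    supplies the part of the neighbourhood of 0 that [bounded_extends] asks for. *)
Lemma flow_immortal Tm Tp (A : R -> 'M[R]_k) : maximal_solution (@mx_flow R k) Tm Tp A ->
  Tp = +oo%E.
Proof.
move=> Amax; have [I0 Ad _] := Amax.
have le0 t : inI Tm Tp t -> 0 <= t -> sqnorm (A t) <= sqnorm (A 0).
  move=> It t0; apply: (derive_le_incr (f := fun s => sqnorm (A s))
    (df := fun s => 2 * \tr (flow_field (A s) *m (A s)^T))) => // s s0t.
    by apply: is_derive_sqnorm; apply: Ad; exact: inI_conv I0 It s0t.
  by rewrite pmulr_rle0// flow_field_tr_le0.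
have [e e0 He] := inI_ball I0.
have Ie : inI Tm Tp (- e) by apply: He; rewrite subr0 normrN gtr0_norm.
have [K K0 AK] := solution_bounded Ad Ie I0.
have ext b : 0 < b -> (b%:E <= Tp)%E.
  move=> b0; have [||_ //] := bounded_extends (a := - e) (b := b) (B := Num.max K (fnorm (A 0)))
    flow_field_lipschitz Amax.
    by rewrite oppr_lt0 e0.
  move=> t It /andP[et tb]; rewrite le_max; have [t0|t0] := lerP t 0.
    by rewrite AK// (ltW et).
  by apply/orP; right; rewrite (le_trans (mx_norm_fnorm _))// ler_wsqrtr// le0// ltW.
apply/eqP; rewrite eq_le leey /=; apply/eqP.
case: (Tp) ext => [r| |]// ext.
- have := ext (`|r| + 1); rewrite ltr_wpDl// => /(_ isT); rewrite lee_fin.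
  by have := ler_norm r; lra.
- by have := ext 1 ltr01.
Qed.

(** A forward complete solution, from which [scf_immortal] produces an SCF solution on [0, oo). The
    cut-off radius exceeds the initial norm by 1: forward in time it is never reached, backward it
    is avoided for a short time by continuity. *)
Lemma flow_global A0 : exists e (A : R -> 'M[R]_k),
  [/\ 0 < e, A 0 = A0 & mx_flow (- e)%:E +oo%E A].
Proof.
pose B := fnorm A0 + 1.
have B0 : 0 < B by rewrite ltr_wpDl// sqrtr_ge0.
have [L WL] := cutoff_field flow_field_lipschitz B0.
have I0 : inI (- 1)%:E +oo%E (0 : R) by rewrite /inI lte_fin oppr_lt0 ltr01 ltry.
have [y [y0 yd]] := lipschitz_ode A0 WL I0.
have yle t : 0 <= t -> `|y t| <= fnorm A0.
  move=> t0; rewrite (le_trans (mx_norm_fnorm _))// ler_wsqrtr// -y0.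
  apply: (derive_le_incr (f := fun s => sqnorm (y s)) (df := fun s =>
    2 * \tr (cutoff B (y s) *: flow_field (y s) *m (y s)^T))) => // s /andP[s0 _].
    by apply: is_derive_sqnorm; apply: yd; rewrite /inI ltry lte_fin andbT (lt_le_trans _ s0)// oppr_lt0.
  by rewrite pmulr_rle0// -scalemxAl mxtraceZ mulr_ge0_le0 ?cutoff_ge0// flow_field_tr_le0.
have y0d := yd _ I0.
have /cvgrPdist_lt/(_ _ ltr01) := is_derive_continuous y0d.
near_simpl => -[d d0' Hd]; have d0 : 0 < d := d0'.
exists (Num.min d 1), y; split=> //; first by rewrite lt_min d0 ltr01.
move=> t /andP[]; rewrite lte_fin => dt _.
have t1 : inI (-1)%:E +oo%E t.
  by rewrite /inI ltry andbT lte_fin (le_lt_trans _ dt)// lerN2 ge_min lexx orbT.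
rewrite -/(flow_field (y t)); have := yd _ t1.
rewrite cutoff1 ?scale1r//; have [t0|t0] := lerP 0 t.
  by rewrite (le_trans (yle _ t0))// lerDl.
have /= h := Hd t; rewrite -[y t](subrK (y 0)) (le_trans (ler_normD _ _))// addrC lerD//.
  by rewrite yle.
rewrite distrC ltW// h// /ball/= sub0r normrN ltr0_norm// -ltrNl (le_lt_trans _ dt)// lerN2.
by rewrite ge_min lexx.
Qed.

End FlowField.

(** * The flow preserves the class v = 0 *)

Section SpInvariance.
Variables (R : realType) (m : nat) (J1 : 'M[R]_m).
Hypotheses (J1T : J1^T = - J1) (J1J1 : J1 *m J1 = - 1%:M).

Lemma in_spP (B : 'M[R]_m) : in_sp J1 B <-> J1 *m B^T *m J1 = B.
Proof.
rewrite /in_sp; split=> [/eqP|e].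
  rewrite addr_eq0 => /eqP e; rewrite -mulmxA e mulmxN mulmxA J1J1 mulNmx mul1mx.
  by rewrite opprK.
rewrite -[in J1 *m B]e !mulmxA J1J1 !mulNmx mul1mx.
by rewrite subrr.
Qed.

Lemma in_spD B C : in_sp J1 B -> in_sp J1 C -> in_sp J1 (B + C).
Proof. by move=> /in_spP e /in_spP e'; apply/in_spP; rewrite linearD/= mulmxDr mulmxDl e e'. Qed.

Lemma in_spZ c B : in_sp J1 B -> in_sp J1 (c *: B).
Proof. by move=> /in_spP e; apply/in_spP; rewrite linearZ/= -scalemxAr -scalemxAl e. Qed.

Lemma in_sp_tr B : in_sp J1 B -> in_sp J1 B^T.
Proof.
by move=> /in_spP e; apply/in_spP; rewrite -[in RHS]e !trmx_mul trmxK J1T mulNmx !mulmxN opprK mulmxA.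
Qed.

Lemma in_sp_mxbr B C : in_sp J1 B -> in_sp J1 C -> in_sp J1 (mxbr B C).
Proof.
have tri X Y : J1 *m X *m J1 *m (J1 *m Y *m J1) = - (J1 *m (X *m Y) *m J1).
  by rewrite !mulmxA -(mulmxA _ J1 J1) J1J1 mulmxN mulmx1 !mulNmx -!mulmxA.
move=> /in_spP e /in_spP e'; apply/in_spP; rewrite mxbr_tr /mxbr mulmxBr mulmxBl.
rewrite -[in RHS]e -[in RHS]e' !tri opprK addrC.
by rewrite !mulmxA.
Qed.

(** B |-> J_1 B^t J_1 is an involution with fixed space sp; averaging over it gives a linear
    projection, the form in which [loc_lipschitz_invariant] takes an invariant subspace. *)
Definition sp_proj (M : 'M[R]_(1 + m)) : 'M[R]_(1 + m) :=
  mxA (ulsubmx M 0 0) (2^-1 *: (drsubmx M + J1 *m (drsubmx M)^T *m J1)).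

Lemma sp_proj_linear : linear sp_proj.
Proof.
move=> c M N; rewrite /sp_proj /mxA scale_block_mx add_block_mx !scaler0 !addr0.
congr block_mx; first by apply/matrixP => i j; rewrite !ord1 !mxE; ring.
rewrite scalerA mulrC -scalerA -scalerDr; congr (_ *: _).
have -> : drsubmx (c *: M + N) = c *: drsubmx M + drsubmx N by apply/matrixP => i j; rewrite !mxE.
rewrite linearD/= linearZ/= mulmxDr mulmxDl -scalemxAr -scalemxAl scalerDr.
by rewrite addrACA.
Qed.

HB.instance Definition _ := GRing.isLinear.Build R _ _ _ sp_proj sp_proj_linear.

Lemma sp_proj_in M : exists a A1, sp_proj M = mxA a A1 /\ in_sp J1 A1.
Proof.
exists (ulsubmx M 0 0), (2^-1 *: (drsubmx M + J1 *m (drsubmx M)^T *m J1)); split=> //.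
move: (drsubmx M) => B; apply/in_spP.
rewrite linearZ/= linearD/= !trmx_mul trmxK J1T mulNmx !mulmxN opprK -scalemxAr -scalemxAl.
congr (_ *: _); rewrite mulmxDr mulmxDl [RHS]addrC; congr (_ + _).
by rewrite !mulmxA J1J1 !mulNmx mul1mx -mulmxA J1J1 mulmxN mulmx1 opprK.
Qed.

Lemma sp_proj_id a A1 : in_sp J1 A1 -> sp_proj (mxA a A1) = mxA a A1.
Proof.
move=> /in_spP e; rewrite /sp_proj /mxA block_mxKul block_mxKdr e half_double.
by rewrite !mxE mulr1n.
Qed.

Lemma flow_field_in a A1 : in_sp J1 A1 ->
  exists a' A1', flow_field (mxA a A1) = mxA a' A1' /\ in_sp J1 A1'.
Proof.
move=> sp; rewrite /flow_field mxA_mxbr; set c := - _; set d := _ / 2; pose M1 := mxbr A1 A1^T.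
exists (c * a), (c *: A1 + 2^-1 *: mxbr A1 M1 - d *: M1); split.
  have -> : mxbr (mxA a A1) (block_mx 0 0 0 M1) = block_mx 0 0 0 (mxbr A1 M1).
    rewrite /mxbr /mxA !mulmx_block !mulmx0 !mul0mx !addr0 !add0r.
    by rewrite opp_block_mx add_block_mx !oppr0 !addr0.
  rewrite /mxA !scale_block_mx opp_block_mx !add_block_mx !scaler0 !oppr0 !addr0.
  by rewrite scale_scalar_mx.
have spM : in_sp J1 M1 by apply: in_sp_mxbr => //; exact: in_sp_tr.
rewrite -scaleNr; apply: in_spD; last exact: in_spZ.
by apply: in_spD; apply: in_spZ => //; exact: in_sp_mxbr.
Qed.

Lemma flow_in_class Tm Tp (A : R -> 'M[R]_(1 + m)) t0 a A1 : mx_flow Tm Tp A -> inI Tm Tp t0 ->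
  A t0 = mxA a A1 -> in_sp J1 A1 -> forall t, inI Tm Tp t ->
  exists a' A1', A t = mxA a' A1' /\ in_sp J1 A1'.
Proof.
move=> Ad I0 A0 sp t It.
have <- : sp_proj (A t) = A t; last exact: sp_proj_in.
apply: (loc_lipschitz_invariant (p := sp_proj) (@flow_field_lipschitz R _) I0 _ Ad) => //.
  move=> M /=; have [b [B1 [-> spB]]] := sp_proj_in M.
  have [c [C1 [-> spC]]] := flow_field_in b spB.
  exact: sp_proj_id.
by rewrite A0; exact: sp_proj_id.
Qed.

End SpInvariance.

(** * Linear equations with continuous coefficients *)

Section FundamentalMatrix.
Variables (R : realType) (k : nat).

Lemma linear_ode (l : R -> {linear 'M[R]_k -> 'M[R]_k}) Tm Tp t0 x0 : inI Tm Tp t0 ->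
  (forall a b, inI Tm Tp a -> inI Tm Tp b -> exists L, forall t, a <= t <= b ->
    forall M, `|l t M| <= L * `|M|) ->
  (forall x : R -> 'M[R]_k, (forall t, inI Tm Tp t -> {for t, continuous x}) ->
     forall t, inI Tm Tp t -> {for t, continuous (fun s => l s (x s))}) ->
  exists y, y t0 = x0 /\ forall t, inI Tm Tp t -> is_derive t (1 : R) y (l t (y t)).
Proof.
move=> I0 lip cont; apply: (picard_lindelof (F := fun t M => l t M)) => //.
move=> a b Ia Ib; have [L HL] := lip a b Ia Ib; exists L => t tab x y.
by rewrite -linearB; exact: HL.
Qed.

Lemma mulmx_continuous (X Y : R -> 'M[R]_k) t : {for t, continuous X} -> {for t, continuous Y} ->
  {for t, continuous (fun s => X s *m Y s)}.
Proof.
move=> Xc Yc; apply/cvgrPdist_le => e e0.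
pose C := k%:R * (`|X t| + `|Y t| + 1).
have C0 : 0 <= C by rewrite mulr_ge0// addr_ge0// addr_ge0.
pose d := Num.min 1 (e / (C + C + 1)).
have C1 : 0 < C + C + 1 by rewrite ltr_wpDl// addr_ge0.
have d0 : 0 < d by rewrite lt_min ltr01 divr_gt0.
have d1 : d <= 1 by rewrite ge_min lexx.
have de : d * (C + C) <= e.
  have : d <= e / (C + C + 1) by rewrite ge_min lexx orbT.
  rewrite ler_pdivlMr// => h; apply: le_trans h; rewrite ler_wpM2l ?lerDl//; exact: ltW.
move/cvgrPdist_le : Xc => /(_ d d0); near_simpl => Xd.
move/cvgrPdist_le : Yc => /(_ d d0); near_simpl => Yd.
near=> s; have Xs : `|X t - X s| <= d by near: s.
have Ys : `|Y t - Y s| <= d by near: s.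
have Xs1 : `|X s| <= `|X t| + 1.
  rewrite -[X s](subrK (X t)) (le_trans (ler_normD _ _))// addrC lerD// distrC.
  exact: le_trans Xs d1.
have -> : X t *m Y t - X s *m Y s = (X t - X s) *m Y t + X s *m (Y t - Y s).
  by rewrite mulmxBl mulmxBr addrA subrK.
rewrite (le_trans (ler_normD _ _))//; apply: le_trans de; rewrite mulrDr lerD//.
  rewrite (le_trans (mulmx_norm_le _ _))// /C [d * _]mulrA [d * _]mulrC ler_pM ?mulr_ge0//.
    by rewrite ler_wpM2l.
  by rewrite addrAC lerDr addr_ge0.
rewrite (le_trans (mulmx_norm_le _ _))// /C [d * _]mulrC ler_pM ?mulr_ge0// ler_wpM2l//.
by rewrite (le_trans Xs1)// addrAC lerDl.
Unshelve. all: by end_near. Qed.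

(** Invertibility is obtained from the adjoint equation K' = K X, for which K H is constant. *)
Lemma fundamental_matrix (X : R -> 'M[R]_k) Tm Tp t0 : inI Tm Tp t0 ->
  (forall t, inI Tm Tp t -> {for t, continuous X}) ->
  exists H K, [/\ H t0 = 1%:M, forall t, inI Tm Tp t -> is_derive t (1 : R) H (- X t *m H t)
    & forall t, inI Tm Tp t -> K t *m H t = 1%:M].
Proof.
move=> I0 Xc.
have Xb a b : inI Tm Tp a -> inI Tm Tp b -> exists2 K, 0 <= K & forall t, a <= t <= b -> `|X t| <= K.
  by move=> Ia Ib; apply: continuous_mx_bounded => t tab; apply: Xc; exact: inI_conv tab.
have [||H [H0 Hd]] := linear_ode (l := fun t => mulmx (- X t)) (1%:M) I0.
- move=> a b Ia Ib; have [K K0 XK] := Xb a b Ia Ib; exists (k%:R * K) => t tab M.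
  by rewrite (le_trans (mulmx_norm_le _ _))// normrN ler_wpM2r// ler_wpM2l// XK.
- move=> x cx t It; apply: mulmx_continuous; last exact: cx.
  by apply: (@continuousN _ _ _ X); exact: Xc.
have [||K [K0 Kd]] := linear_ode (l := fun t => mulmxr (X t)) (1%:M) I0.
- move=> a b Ia Ib; have [K K0 XK] := Xb a b Ia Ib; exists (k%:R * K) => t tab M.
  rewrite (le_trans (mulmx_norm_le _ _))// mulrAC ler_wpM2r// ler_wpM2l// XK//.
- by move=> x cx t It; apply: mulmx_continuous; [exact: cx|exact: Xc].
exists H, K; split=> // t It; apply/eqP; rewrite -subr_eq0; apply/eqP.
apply: (gronwall0_itv (z := fun s => K s *m H s - 1%:M) (dz := fun=> 0) I0) It.
- move=> s Is; rewrite -[0]subr0; apply: is_deriveB.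
  have -> : 0 = K s *m X s *m H s + K s *m (- X s *m H s).
    by rewrite mulNmx mulmxN mulmxA subrr.
  by apply: is_derive_mulmx; [exact: Kd|exact: Hd].
- by move=> a b _ _; exists 0 => t' _; rewrite normr0 mul0r.
- by rewrite H0 K0 mulmx1 subrr.
Qed.

End FundamentalMatrix.

(** * From the matrix flow to the symplectic curvature flow *)

Lemma conjugation_residue (R : realType) k (X H B C : 'M[R]_k) (r y : R) :
  - X *m (H *m B - y *: (C *m H)) = (- X *m H *m B + H *m 0) -
    ((r * y) *: (C *m H) + y *: ((- r *: C - mxbr X C) *m H + C *m (- X *m H))).
Proof.
rewrite /mxbr mulmx0 addr0 mulmxBr mulmxBl mulmxBl !mulNmx mulmxN -!scalemxAl -!scalemxAr !mulmxA.
by apply/matrixP => i j; rewrite !mxE; ring.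
Qed.

Lemma is_derive_scalar1 (R : realType) (y : R -> R) t dy : is_derive t (1 : R) y dy ->
  is_derive t (1 : R) (fun s => (y s)%:M : 'M[R]_1) (dy%:M).
Proof.
move=> yd; apply/is_derive_mxP => i j; rewrite !ord1 mxE mulr1n.
have -> : (fun s : R => ((y s)%:M : 'M[R]_1) 0 0) = y by apply/funext => s; rewrite mxE mulr1n.
exact: yd.
Qed.

Section FlowToScf.
Variables (R : realType) (m : nat) (J1 : 'M[R]_m).
Hypotheses (J1T : J1^T = - J1) (J1J1 : J1 *m J1 = - 1%:M).
Local Notation w0 := (omega J1).

Lemma is_derive_mxbr k (A B : R -> 'M[R]_k) t dA dB :
  is_derive t (1 : R) A dA -> is_derive t (1 : R) B dB ->
  is_derive t (1 : R) (fun s => mxbr (A s) (B s)) (mxbr dA (B t) + mxbr (A t) dB).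
Proof.
move=> Ad Bd; have -> : mxbr dA (B t) + mxbr (A t) dB =
    (dA *m B t + A t *m dB) - (dB *m A t + B t *m dA).
  by rewrite /mxbr; apply/matrixP => i j; rewrite !mxE; ring.
by apply: is_deriveB; exact: is_derive_mulmx.
Qed.

Lemma is_derive_sympart k (A : R -> 'M[R]_k) t dA : is_derive t (1 : R) A dA ->
  is_derive t (1 : R) (fun s => sympart (A s)) (sympart dA).
Proof.
move=> Ad; rewrite -[sympart dA]add0r -(scale0r (A t + (A t)^T)).
by apply: is_derive_scalemx; apply: is_deriveD; exact: is_derive_trmx.
Qed.

Lemma flow_rate_derivable (A : R -> 'M[R]_(1 + m)) t dA : is_derive t (1 : R) A dA ->
  exists d, is_derive t (1 : R) (fun s => flow_rate (A s)) d.
Proof.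
move=> Ad; have trd := is_derive_mxtrace Ad.
have -> : (fun s => flow_rate (A s)) = (fun s => 2^-1 *
    (\tr (A s) * \tr (A s) + \tr (sympart (A s) *m sympart (A s)))).
  by apply/funext => s; rewrite /flow_rate expr2.
have Sd := is_derive_sympart Ad.
have d1 := is_deriveMR trd trd; have d2 := is_derive_mxtrace (is_derive_mulmx Sd Sd).
by eexists; apply: is_deriveMR; apply: is_deriveD.
Qed.

Lemma flow_op_derivable (A : R -> 'M[R]_(1 + m)) t dA : is_derive t (1 : R) A dA ->
  exists d, is_derive t (1 : R) (fun s => flow_op (A s)) d.
Proof.
move=> Ad; have Atd := is_derive_trmx Ad; have trd := is_derive_mxtrace Ad.
have Sd := is_derive_sympart Ad.
eexists; apply: is_deriveD; last first.
  apply: is_derive_scalemx; apply: is_deriveMR; apply: is_deriveB.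
  by apply: is_derive_mxtrace; apply: is_derive_mulmx.
apply: is_deriveB; first by apply: is_derive_scalemx; apply: is_derive_mxbr.
exact: is_derive_scalemx.
Qed.

Variables (Tm Tp : \bar R) (A : R -> 'M[R]_(1 + m)) (a : R) (A1 : 'M[R]_m).
Hypotheses (Ad : mx_flow Tm Tp A) (I0 : inI Tm Tp 0) (A0 : A 0 = mxA a A1) (sp : in_sp J1 A1).

(** On the class the flow reads A' = -r A - [X_A, A]. Hence the defect Z = H A_0 - y A H satisfies
    Z' = -X_A Z with Z(0) = 0 and vanishes. *)
Lemma flow_conjugation : exists (H : R -> 'M[R]_(1 + m)) (y : R -> R),
  [/\ H 0 = 1%:M, y 0 = 1 & forall t, inI Tm Tp t ->
    [/\ H t \in unitmx, y t != 0, H t *m A 0 = y t *: (A t *m H t),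
      is_derive t (1 : R) H (- flow_op (A t) *m H t)
    & is_derive t (1 : R) y (flow_rate (A t) * y t)]].
Proof.
have opc t : inI Tm Tp t -> {for t, continuous (fun s => flow_op (A s))}.
  by move=> It; have [d dd] := flow_op_derivable (Ad It); exact: is_derive_continuous dd.
have [H [K [H0 Hd KH]]] := fundamental_matrix I0 opc.
pose X t : 'M[R]_1 := (- flow_rate (A t))%:M.
(* Taking y as a fundamental matrix of size 1 gives y <> 0 by the same lemma. *)
have [|Y [L [Y0 Yd LY]]] := @fundamental_matrix R 1 X Tm Tp 0 I0.
  move=> t It; have [d dd] := flow_rate_derivable (Ad It).
  suff : is_derive t (1 : R) X (- d)%:M by exact: is_derive_continuous.
  by apply: is_derive_scalar1; exact: is_deriveN.
pose y t := Y t 0 0.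
have yd t : inI Tm Tp t -> is_derive t (1 : R) y (flow_rate (A t) * y t).
  move=> It; have /is_derive_mxP/(_ 0 0) := Yd t It.
  have -> : (- X t *m Y t) 0 0 = flow_rate (A t) * y t.
    by rewrite /X mulNmx mul_scalar_mx scaleNr opprK mxE.
  by [].
have Hu t : inI Tm Tp t -> H t \in unitmx.
  by move=> /KH/mulmx1_unit[].
exists H, y; split=> //; first by rewrite /y Y0 mxE.
move=> t It; split=> //; [exact: Hu| | |exact: Hd|exact: yd].
  apply/eqP => y0; have /matrixP/(_ 0 0)/eqP := LY t It.
  by rewrite !mxE big_ord_recl big_ord0 -/(y t) y0 mulr0 addr0 mulr1n eq_sym oner_eq0.
apply/eqP; rewrite -subr_eq0; apply/eqP.
pose Z s := H s *m A 0 - y s *: (A s *m H s).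
apply: (gronwall0_itv (z := Z) (dz := fun s => - flow_op (A s) *m Z s) I0) It.
- move=> s Is; have [b [B1 [AE spB]]] := flow_in_class J1T J1J1 Ad I0 A0 sp Is.
  have VE : flow_field (A s) = - flow_rate (A s) *: A s - mxbr (flow_op (A s)) (A s).
    rewrite AE (flow_op_mxbr b J1J1 spB) /flow_field -/(flow_rate _) (mxA_trace b J1J1 spB) (mxbrC _ (mxbr _ _)).
    by rewrite scalerN opprD addrA.
  have -> : - flow_op (A s) *m Z s = (- flow_op (A s) *m H s *m A 0 + H s *m 0) -
      ((flow_rate (A s) * y s) *: (A s *m H s) +
       y s *: (flow_field (A s) *m H s + A s *m (- flow_op (A s) *m H s))).
    by rewrite VE; exact: conjugation_residue.
  apply: is_deriveB.
  + exact: (is_derive_mulmx (Hd s Is) (is_derive_cstmx (A 0) s)).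
  + apply: is_derive_scalemx; first exact: yd.
    by apply: is_derive_mulmx; [exact: Ad|exact: Hd].
- move=> b c Ib Ic; have [|C C0 XC] := @continuous_mx_bounded _ _ _ (fun s => flow_op (A s)) b c.
    by move=> s sbc; apply: opc; exact: inI_conv sbc.
  exists ((1 + m)%:R * C) => s sbc.
  by rewrite (le_trans (mulmx_norm_le _ _))// normrN ler_wpM2r// ler_wpM2l// XC.
- by rewrite /Z H0 /y Y0 mxE mulr1n scale1r mul1mx mulmx1 subrr.
Qed.

Lemma flow_scf (H : R -> 'M[R]_(1 + m)) (y : R -> R) :
  (forall t, inI Tm Tp t ->
    [/\ H t \in unitmx, y t != 0, H t *m A 0 = y t *: (A t *m H t),
      is_derive t (1 : R) H (- flow_op (A t) *m H t)
    & is_derive t (1 : R) y (flow_rate (A t) * y t)]) ->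
  let h t := ga_lin (H t) 0 (y t) in
  scf_solution (ga_bracket (A 0)) Tm Tp
    (fun t => ((h t)^T *m w0 *m h t, (h t)^T *m 1%:M *m h t)).
Proof.
move=> Hy h t It; have [Hu y0 HA Hd yd] := Hy t It.
have [b [B1 [AE spB]]] := flow_in_class J1T J1J1 Ad I0 A0 sp It.
have lA := ga_bracket_lie (A 0); have lB := ga_bracket_lie (A t).
have hu : h t \in unitmx by exact: ga_lin_unit.
have hom := ga_lin_hom 0 HA.
have ak : almost_kahler (ga_bracket (A t)) w0 1%:M by rewrite AE; exact: mxA_almost_kahler.
have [_ wu _ _ _] := ak; have gu : 1%:M \in unitmx := @unitmx1 R (1 + m + 1).
pose X := flow_op_ext (A t); have XT : X^T = X by rewrite /X AE flow_op_ext_sym.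
have hd : is_derive t (1 : R) h (- (X *m h t)).
  have -> : - (X *m h t) = block_mx (- flow_op (A t) *m H t) 0 0 (flow_rate (A t) * y t)%:M.
    rewrite /X /h /flow_op_ext /ga_lin mulmx_block !mulmx0 !mul0mx !addr0 !add0r.
    by rewrite opp_block_mx !oppr0 -scalar_mxM mulNr raddfN/= opprK mulNmx.
  apply: is_derive_block.
  exact: is_derive_scalar1.
(* As h' = -X h, the form h^t q h has derivative minus the pullback of X^t q + q X; for omega and
   the metric this is the SCF right-hand side on G_{A(t)}. *)
have congd (q : 'M[R]_(1 + m + 1)) :
    is_derive t (1 : R) (fun s => (h s)^T *m q *m h s)
      (- ((h t)^T *m (X^T *m q + q *m X) *m h t)).
  have -> : - ((h t)^T *m (X^T *m q + q *m X) *m h t) =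
     ((- (X *m h t))^T *m q + (h t)^T *m 0) *m h t + (h t)^T *m q *m (- (X *m h t)).
    move: (h t) => k; rewrite mulmx0 addr0 linearN/= trmx_mul !mulNmx mulmxN.
    by rewrite mulmxDr mulmxDl opprD !mulmxA.
  exact: (is_derive_mulmx (is_derive_mulmx (is_derive_trmx hd) (is_derive_cstmx q t)) hd).
split=> /=.
- by apply/(almost_kahler_transport _ _ hu hom).
- have -> : -2 *: chern_ricci (ga_bracket (A 0)) ((h t)^T *m w0 *m h t) ((h t)^T *m 1%:M *m h t) =
      - ((h t)^T *m (X^T *m w0 + w0 *m X) *m h t).
    rewrite (chern_ricci_transport lA lB _ hu hom gu) scaleNr; congr (- _).
    rewrite /X AE -mxA_chern_ricci_flow//.
    by move: (h t) => k; rewrite -scalemxAr -scalemxAl.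
  exact: congd.
- set p := chern_ricci _ _ _; set r := ricci _ _.
  have -> : -2 *: (form_c ((h t)^T *m w0 *m h t) ((h t)^T *m 1%:M *m h t) p *m
        Jop ((h t)^T *m w0 *m h t) ((h t)^T *m 1%:M *m h t)) -
      2 *: form_ac ((h t)^T *m w0 *m h t) ((h t)^T *m 1%:M *m h t) r =
      - ((h t)^T *m (X^T *m 1%:M + 1%:M *m X) *m h t).
    rewrite /p /r (chern_ricci_transport lA lB _ hu hom gu) (ricci_transport lB hu hom gu).
    rewrite (form_c_transport _ hu gu) (form_ac_transport _ hu gu) (Jop_transport _ hu gu).
    rewrite XT mulmx1 mul1mx /X AE -(mxA_metric_flow b J1T J1J1 spB).
    rewrite -AE; move: (form_c _ _ _) (Jop _ _) (form_ac _ _ _) (h t) hu => u v z k ku.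
    rewrite scaleNr -opprD -scalerDr; congr (- _).
    have -> : k^T *m u *m k *m (invmx k *m v *m k) = k^T *m (u *m v) *m k.
      by rewrite !mulmxA mulmxK.
    by rewrite -mulmxDl -mulmxDr [in RHS]mulmxDr [RHS]mulmxDl scaler_nat mulr2n.
  exact: congd.
Qed.

End FlowToScf.

(** Serves [invmx_continuous], with C = |X_t^{-1}|, i = |X_s^{-1}|, x = |X_t - X_s| and y =
    |X_t^{-1} - X_s^{-1}|. The unknown i is eliminated: y <= q i <= q (y + C) with q = k^2 C x <=
    1/2, whence y <= 2 q C. *)
Lemma contraction_bound (R : realFieldType) (k C x i y e : R) : 0 <= C -> 0 <= y -> 0 <= i -> 0 <= x ->
  y <= k * (k * i * x) * C -> i <= y + C -> x * (k * k * C + 1) <= 2^-1 ->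
  x * (2 * (k * k * C * C) + 1) <= e -> 0 <= k * k -> y <= e.
Proof.
move=> C0 y0 i0 x0 h1 h2 h3 h4 kk.
pose q := k * k * C * x; have q0 : 0 <= q by rewrite mulr_ge0// mulr_ge0.
have h1' : y <= q * i by rewrite (le_trans h1)// /q le_eqVlt; apply/orP; left; apply/eqP; ring.
have h2' : q * i <= q * (y + C) by rewrite ler_wpM2l.
have q2 : q <= 2^-1 by rewrite (le_trans _ h3)// /q mulrDr mulr1 [x * _]mulrC lerDl.
have h3' : q * y <= 2^-1 * y by rewrite ler_wpM2r.
have h4' : 2 * (q * C) <= e.
  by rewrite (le_trans _ h4)// mulrDr mulr1 /q -[leLHS]addr0 lerD// le_eqVlt; apply/orP; left; apply/eqP; ring.
by move: h1' h2' h3' h4'; rewrite mulrDr; move: (q * i) (q * y) (q * C) => a b c; clear; lra.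
Qed.

Section InverseContinuous.
Variables (R : realType) (n : nat).

Lemma invmx_dist (X Y : 'M[R]_n) : X \in unitmx -> Y \in unitmx ->
  `|invmx X - invmx Y| <= n%:R * (n%:R * `|invmx X| * `|Y - X|) * `|invmx Y|.
Proof.
move=> Xu Yu; have -> : invmx X - invmx Y = invmx X *m (Y - X) *m invmx Y.
  by rewrite mulmxBr mulmxBl mulVmx// mul1mx -mulmxA mulmxV// mulmx1.
by rewrite (le_trans (mulmx_norm_le _ _))// ler_wpM2r// ler_wpM2l// mulmx_norm_le.
Qed.

Lemma invmx_continuous (X : R -> 'M[R]_n) t : {for t, continuous X} ->
  (\forall s \near t, X s \in unitmx) -> {for t, continuous (fun s => invmx (X s))}.
Proof.
move=> Xc Xu; have Xtu := nbhs_singleton Xu; apply/cvgrPdist_le => e e0.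
pose N : R := n%:R * n%:R; pose C := `|invmx (X t)|.
have N0 : 0 <= N by rewrite mulr_ge0.
have C0 : 0 <= C := normr_ge0 _.
pose d := Num.min (2^-1 / (N * C + 1)) (e / (2 * (N * C * C) + 1)).
have d1 : 0 < N * C + 1 by rewrite ltr_wpDl// mulr_ge0.
have d2 : 0 < 2 * (N * C * C) + 1 by rewrite ltr_wpDl// !mulr_ge0.
have d0 : 0 < d by rewrite lt_min !divr_gt0.
move/cvgrPdist_le : Xc => /(_ d d0); near_simpl => Xd.
near=> s; have Xs : `|X t - X s| <= d by near: s.
have Xsu : X s \in unitmx by near: s.
have h := invmx_dist Xsu Xtu; rewrite distrC -/C in h.
have hs : `|invmx (X s)| <= `|invmx (X t) - invmx (X s)| + C.
  have := ler_normD (invmx (X s) - invmx (X t)) (invmx (X t)).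
  by rewrite subrK [`|_ - invmx (X t)|]distrC.
have db1 : `|X t - X s| * (N * C + 1) <= 2^-1.
  by rewrite -ler_pdivlMr// (le_trans Xs)// ge_min lexx.
have db2 : `|X t - X s| * (2 * (N * C * C) + 1) <= e.
  by rewrite -ler_pdivlMr// (le_trans Xs)// ge_min lexx orbT.
rewrite /N in N0 db1 db2; move: h hs db1 db2 N0.
have := normr_ge0 (X t - X s); have := normr_ge0 (invmx (X s)).
have := normr_ge0 (invmx (X t) - invmx (X s)).
move: `|X t - X s| `|invmx (X s)| `|invmx (X t) - invmx (X s)| (n%:R : R) => x i y k.
by move=> y0 i0 x0; exact: contraction_bound.
Unshelve. all: by end_near. Qed.

End InverseContinuous.

(** * Uniqueness for the symplectic curvature flow *)

Section ScfUniqueness.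
Variables (R : realType) (d : nat) (br : 'cV[R]_d -> 'cV[R]_d -> 'cV[R]_d).
Hypothesis hbr : lie_bracket br.

Section CloseTensors.
Variables (S : set R) (delta : R -> R).
Hypothesis delta_ge0 : forall t, S t -> 0 <= delta t.
Local Notation cl := (close S delta).

Lemma close_entry m n (u v : R -> 'M[R]_(m, n)) i j : cl u v ->
  cl (fun t => u t i j) (fun t => v t i j).
Proof.
move=> [K K0 H]; exists K => // t /H[h1 h2 h3]; split.
- exact: le_trans (mx_entry_le _ _ _) h1.
- exact: le_trans (mx_entry_le _ _ _) h2.
- by apply: le_trans h3; have := mx_entry_le (u t - v t) i j; rewrite !mxE.
Qed.

Lemma close_ad (u v : R -> 'cV[R]_d) : cl u v ->
  cl (fun t => ad br (u t)) (fun t => ad br (v t)).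
Proof.
move=> uv; have adE (X : 'cV[R]_d) : \sum_i X i 0 *: ad br (basisv R i) = ad br X.
  by rewrite -(linear_sum_basis (adD hbr)).
apply: (eq_close (u := fun t => \sum_i u t i 0 *: ad br (basisv R i))
  (v := fun t => \sum_i v t i 0 *: ad br (basisv R i))) => //.
apply: close_sum => // i; apply: close_scale; first exact: close_entry.
exact: close_cst.
Qed.

Variables (w w' g g' : R -> 'M[R]_d).
Hypotheses (ww : cl w w') (gg : cl g g').
Hypothesis ii : cl (fun t => invmx (g t)) (fun t => invmx (g' t)).

Lemma close_Jop : cl (fun t => Jop (w t) (g t)) (fun t => Jop (w' t) (g' t)).
Proof. by apply: close_trmx; exact: close_mulmx. Qed.

Lemma close_form (X Y : 'cV[R]_d) : cl (fun t => form (g t) X Y) (fun t => form (g' t) X Y).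
Proof.
by apply: close_entry; apply: close_mulmx; [apply: close_mulmx => //|]; exact: close_cst.
Qed.

Lemma close_nabla (X : 'cV[R]_d) : cl (fun t => nabla br (g t) X) (fun t => nabla br (g' t) X).
Proof.
apply: close_mulmx => //; apply: close_mx => // i j.
apply: (eq_close (u := fun t => koszul br (g t) X (basisv R j) (basisv R i))
  (v := fun t => koszul br (g' t) X (basisv R j) (basisv R i))) => [t|t|]; rewrite ?mxE//.
apply: closeM; first exact: close_cst.
by apply: closeD; [apply: closeB|]; exact: close_form.
Qed.

Lemma close_riemann (X Y : 'cV[R]_d) :
  cl (fun t => riemann br (g t) X Y) (fun t => riemann br (g' t) X Y).
Proof.
apply: closeB; last exact: close_nabla.
by apply: closeB; apply: close_mulmx; exact: close_nabla.
Qed.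

Lemma close_ricci : cl (fun t => ricci br (g t)) (fun t => ricci br (g' t)).
Proof.
apply: close_mx => // i j.
apply: (eq_close (u := fun t => \sum_(k < d) (riemann br (g t) (basisv R k) (basisv R i) *m basisv R j) k 0)
  (v := fun t => \sum_(k < d) (riemann br (g' t) (basisv R k) (basisv R i) *m basisv R j) k 0)) => [t|t|].
- by rewrite mxE.
- by rewrite mxE.
apply: close_sum => // k; apply: close_entry; apply: close_mulmx; last exact: close_cst.
exact: close_riemann.
Qed.

Lemma close_chern_ricci :
  cl (fun t => chern_ricci br (w t) (g t)) (fun t => chern_ricci br (w' t) (g' t)).
Proof.
apply: close_mx => // i j; set B := br (basisv R i) (basisv R j).
apply: (eq_close (u := fun t => - 2^-1 * \tr (Jop (w t) (g t) *m ad br B) + 2^-1 * \tr (ad br (Jop (w t) (g t) *m B)))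
  (v := fun t => - 2^-1 * \tr (Jop (w' t) (g' t) *m ad br B) + 2^-1 * \tr (ad br (Jop (w' t) (g' t) *m B)))) => [t|t|].
- by rewrite mxE.
- by rewrite mxE.
have Jc := close_Jop.
apply: closeD; apply: closeM; try exact: close_cst; apply: close_mxtrace.
  by apply: close_mulmx => //; exact: close_cst.
by apply: close_ad; apply: close_mulmx => //; exact: close_cst.
Qed.

Lemma close_form_c (p p' : R -> 'M[R]_d) : cl p p' ->
  cl (fun t => form_c (w t) (g t) (p t)) (fun t => form_c (w' t) (g' t) (p' t)).
Proof.
move=> pp; have Jc := close_Jop; apply: close_scale; first exact: close_cst.
by apply: closeD => //; apply: close_mulmx => //; apply: close_mulmx => //; exact: close_trmx.
Qed.

Lemma close_form_ac (p p' : R -> 'M[R]_d) : cl p p' ->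
  cl (fun t => form_ac (w t) (g t) (p t)) (fun t => form_ac (w' t) (g' t) (p' t)).
Proof.
move=> pp; have Jc := close_Jop; apply: close_scale; first exact: close_cst.
by apply: closeB => //; apply: close_mulmx => //; apply: close_mulmx => //; exact: close_trmx.
Qed.

End CloseTensors.

Lemma block_diag_norm (A D : 'M[R]_d) : `|A| <= `|block_mx A 0 0 D| /\ `|D| <= `|block_mx A 0 0 D|.
Proof.
split; apply: mx_norm_leP => // i j.
  by have := mx_entry_le (block_mx A 0 0 D) (lshift d i) (lshift d j); rewrite block_mxEul.
by have := mx_entry_le (block_mx A 0 0 D) (rshift d i) (rshift d j); rewrite block_mxEdr.
Qed.

Lemma block_diag_norm_le (A D : 'M[R]_d) K : `|A| <= K -> `|D| <= K ->
  `|block_mx A 0 0 D| <= K.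
Proof.
move=> AK DK; have K0 : 0 <= K := le_trans (normr_ge0 _) AK.
apply: mx_norm_leP => // i j; rewrite !mxE; case: (fintype.split i) => k; rewrite !mxE;
  case: (fintype.split j) => l; rewrite ?mxE ?normr0//; apply: le_trans (mx_entry_le _ _ _) _ => //.
Qed.

Lemma scf_metric_unit Tm Tp wg t : scf_solution br Tm Tp wg -> inI Tm Tp t ->
  (wg t).2 \in unitmx.
Proof. by move=> sol It; have [[_ _ _ [_ gpos] _] _ _] := sol t It; exact: posdef_unitmx. Qed.

Lemma scf_inverse_bounded Tm Tp wg a b : scf_solution br Tm Tp wg -> inI Tm Tp a -> inI Tm Tp b ->
  exists2 K, 0 <= K & forall t, a <= t <= b -> `|invmx (wg t).2| <= K.
Proof.
move=> sol Ia Ib; apply: continuous_mx_bounded => t tab.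
have It := inI_conv Ia Ib tab; apply: invmx_continuous.
  by have [_ _ gd] := sol t It; exact: is_derive_continuous gd.
by have := inI_near It; apply: filterS => s Is; exact: scf_metric_unit Is.
Qed.

(** The right-hand sides are polynomial in omega, g and g^{-1}, hence Lipschitz along two solutions
    on a compact interval, where g^{-1} is bounded by continuity of inversion. One block diagonal
    matrix holds the differences of both components for Gronwall's argument. *)
Lemma scf_unique Tm Tp wg wg' t0 : inI Tm Tp t0 ->
  scf_solution br Tm Tp wg -> scf_solution br Tm Tp wg' -> wg t0 = wg' t0 ->
  forall t, inI Tm Tp t -> wg t = wg' t.
Proof.
move=> I0 sol sol' e0 t It.
pose F w g : 'M[R]_d := - 2 *: chern_ricci br w g.
pose G w g : 'M[R]_d := - 2 *: (form_c w g (chern_ricci br w g) *m Jop w g)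
         - 2 *: form_ac w g (ricci br g).
pose z s := block_mx ((wg s).1 - (wg' s).1) 0 0 ((wg s).2 - (wg' s).2).
pose dz s := block_mx (F (wg s).1 (wg s).2 - F (wg' s).1 (wg' s).2) 0 0
  (G (wg s).1 (wg s).2 - G (wg' s).1 (wg' s).2).
suff : z t = 0.
  rewrite -block_mx0 => /eq_block_mx[/eqP e1 _ _ /eqP e2].
  move: e1 e2; rewrite !subr_eq0; case: (wg t) (wg' t) => [w g] [w' g'] /=.
  by move=> /eqP -> /eqP ->.
apply: (gronwall0_itv (z := z) (dz := dz) I0) It.
- move=> s Is; have [_ wd gd] := sol s Is; have [_ wd' gd'] := sol' s Is.
  by apply: is_derive_block.
- move=> a b Ia Ib.
  pose S : set R := [set s | a <= s <= b]; pose delta s := `|z s|.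
  have bd (f : R -> 'M[R]_d) : (forall s, inI Tm Tp s -> exists df, is_derive s (1 : R) f df) ->
      exists2 K, 0 <= K & forall s, a <= s <= b -> `|f s| <= K.
    move=> fd; apply: continuous_mx_bounded => s sab.
    by have [df] := fd s (inI_conv Ia Ib sab); exact: is_derive_continuous.
  have [|K1 K10 H1] := bd (fun s => (wg s).1).
    by move=> s Is; have [] := sol s Is; eexists; eassumption.
  have [|K2 K20 H2] := bd (fun s => (wg' s).1).
    by move=> s Is; have [] := sol' s Is; eexists; eassumption.
  have [|K3 K30 H3] := bd (fun s => (wg s).2).
    by move=> s Is; have [] := sol s Is; eexists; eassumption.
  have [|K4 K40 H4] := bd (fun s => (wg' s).2).
    by move=> s Is; have [] := sol' s Is; eexists; eassumption.
  have [K5 K50 H5] := scf_inverse_bounded sol Ia Ib.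
  have [K6 K60 H6] := scf_inverse_bounded sol' Ia Ib.
  have d0 s : S s -> 0 <= delta s by move=> _; exact: normr_ge0.
  have cw : close S delta (fun s => (wg s).1) (fun s => (wg' s).1).
    exists (1 + (K1 + K2)) => [|s Ss]; first by rewrite !addr_ge0.
    have [n1 n2] := block_diag_norm ((wg s).1 - (wg' s).1) ((wg s).2 - (wg' s).2).
    split; [apply: le_trans (H1 s Ss) _|apply: le_trans (H2 s Ss) _|apply: le_trans n1 _].
    + by clear -K10 K20; lra.
    + by clear -K10 K20; lra.
    + by rewrite ler_peMl// lerDl addr_ge0.
  have cg : close S delta (fun s => (wg s).2) (fun s => (wg' s).2).
    exists (1 + (K3 + K4)) => [|s Ss]; first by rewrite !addr_ge0.
    have [n1 n2] := block_diag_norm ((wg s).1 - (wg' s).1) ((wg s).2 - (wg' s).2).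
    split; [apply: le_trans (H3 s Ss) _|apply: le_trans (H4 s Ss) _|apply: le_trans n2 _].
    + by clear -K30 K40; lra.
    + by clear -K30 K40; lra.
    + by rewrite ler_peMl// lerDl addr_ge0.
  have ci : close S delta (fun s => invmx (wg s).2) (fun s => invmx (wg' s).2).
    apply: close_invmx => // [s Ss|s Ss|].
    + exact: scf_metric_unit sol (inI_conv Ia Ib Ss).
    + exact: scf_metric_unit sol' (inI_conv Ia Ib Ss).
    + exists (K5 + K6) => s Ss; split; [apply: le_trans (H5 s Ss) _|apply: le_trans (H6 s Ss) _].
        by clear -K50 K60; lra.
      by clear -K50 K60; lra.
  have cc := close_chern_ricci d0 cw ci.
  have [L1 L10 HF] : close S delta (fun s => F (wg s).1 (wg s).2) (fun s => F (wg' s).1 (wg' s).2).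
    by apply: close_scale => //; exact: close_cst.
  have [L2 L20 HG] : close S delta (fun s => G (wg s).1 (wg s).2) (fun s => G (wg' s).1 (wg' s).2).
    apply: closeB; apply: close_scale; try exact: close_cst.
      by apply: close_mulmx; [exact: close_form_c|exact: close_Jop].
    by apply: close_form_ac => //; exact: close_ricci.
  exists (L1 + L2) => s Ss; have [_ _ h1] := HF s Ss; have [_ _ h2] := HG s Ss.
  have n0 : 0 <= delta s := normr_ge0 _.
  apply: block_diag_norm_le; [apply: le_trans h1 _|apply: le_trans h2 _].
    by rewrite ler_wpM2r// lerDl.
  by rewrite ler_wpM2r// lerDr.
- by rewrite /z e0 !subrr block_mx0.
Qed.

End ScfUniqueness.

(** * Exponentials and isomorphisms of the groups *)

Section MatrixExponential.
Variables (R : realType) (k : nat).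
Implicit Types A B H : 'M[R]_k.

Lemma mx_exp_term_le A i : `|(i`!%:R)^-1 *: A ^+ i| <= exp_coeff (k%:R * `|A|) i.
Proof.
rewrite normrZ ger0_norm ?invr_ge0// /exp_coeff /= mulrC ler_wpM2r ?invr_ge0//.
elim: i => [|i IH].
  rewrite !expr0; apply: mx_norm_leP => // i j; rewrite mxE.
  by case: eqP => _; rewrite ?normr1// normr0.
rewrite exprS -mulmxE exprS (le_trans (mulmx_norm_le _ _))// ler_wpM2l// mulr_ge0//.
Qed.

Lemma mx_exp_cvg A : series (fun i : nat => (i`!%:R)^-1 *: A ^+ i) @ \oo --> mx_exp A.
Proof.
pose u := fun i : nat => (i`!%:R)^-1 *: A ^+ i.
have cv i j : cvgn (series (fun l => u l i j)).
  apply: normed_cvg; apply: series_le_cvg (is_cvg_series_exp_coeff (k%:R * `|A|)).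
  - by move=> l; exact: normr_ge0.
  - by move=> l; apply: exp_coeff_ge0; rewrite mulr_ge0.
  - by move=> l; rewrite (le_trans (mx_entry_le _ _ _))// mx_exp_term_le.
pose L := \matrix_(i, j) limn (series (fun l => u l i j)).
have uL : series u @ \oo --> L.
  have entB (M N : 'M[R]_k) i j : (M - N) i j = M i j - N i j by rewrite !mxE.
  apply/cvgrPdist_le => e e0.
  have H ij : \forall n \near \oo, `|L ij.1 ij.2 - series u n ij.1 ij.2| <= e.
    have /cvgrPdist_le/(_ _ e0) := cv ij.1 ij.2; apply: filterS => n.
    by rewrite /series /= mxE summxE.
  near=> n; have Hn : forall ij, `|L ij.1 ij.2 - series u n ij.1 ij.2| <= e.
    by near: n; exact: filter_forall.
  by apply: mx_norm_leP => [|i j]; [exact: ltW|rewrite entB; exact: (Hn (i, j))].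
by rewrite /mx_exp (cvg_lim _ uL)//; exact: norm_hausdorff.
Unshelve. all: by end_near. Qed.

Lemma mx_exp_intertwine A B H : H *m A = B *m H -> H *m mx_exp A = mx_exp B *m H.
Proof.
move=> HA; set u := fun C : 'M[R]_k => series (fun i : nat => (i`!%:R)^-1 *: C ^+ i).
have HS n : H *m u A n = u B n *m H.
  rewrite /u /series /= mulmx_sumr mulmx_suml; apply: eq_bigr => i _.
  by rewrite -scalemxAr -scalemxAl (mulmx_exp_intertwine (esym HA)).
have cont (l : {linear 'M[R]_k -> 'M[R]_k}) C : (fun n => l (u C n)) @ \oo --> l (mx_exp C).
  have [K K0 lK] := linmx_bound l; apply/cvgrPdist_le => e e0.
  have K1 : 0 < K + 1 by rewrite ltr_wpDl.
  have /cvgrPdist_le/(_ (e / (K + 1))) := @mx_exp_cvg C; rewrite divr_gt0// => /(_ isT).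
  apply: filterS => n h; rewrite -linearB (le_trans (lK _))//.
  apply: le_trans (_ : (K + 1) * `|mx_exp C - u C n| <= _); first by rewrite ler_wpM2r// lerDl.
  by rewrite mulrC -ler_pdivlMr.
have c1 := cont (mulmx H) A; have c2 := cont (mulmxr H) B.
have -> : H *m mx_exp A = lim ((fun n => H *m u A n) @ \oo) by rewrite (cvg_lim _ c1)//; exact: norm_hausdorff.
have -> : (fun n => H *m u A n) = (fun n => u B n *m H) by apply/funext => n; exact: HS.
by rewrite (cvg_lim _ c2)//; exact: norm_hausdorff.
Qed.

Lemma linmx_continuous m n (V : normedModType R) (l : {linear 'M[R]_(m, n) -> V}) : continuous l.
Proof.
have [K K0 lK] := linmx_bound l; apply/linear_bounded_continuous/linear_boundedP.
have := nbhs_pinfty_ge (num_real K); apply: filterS => r Kr x.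
by rewrite (le_trans (lK x))// ler_wpM2r.
Qed.

(** H A = y B H intertwines the one-parameter groups: H exp(s A) = exp(y s B) H. *)
Lemma ga_lin_iso A B H y : H \in unitmx -> y != 0 -> H *m A = y *: (B *m H) ->
  ga_iso A B (mulmx (ga_lin H 0 y)).
Proof.
move=> Hu y0 HA; have hu : ga_lin H 0 y \in unitmx by exact: ga_lin_unit.
split.
  move=> X Y; rewrite !ga_lin_col /ga_mul !npart_col !epart_col !mxE !mulr1n !scaler0 !addr0.
  rewrite mulrDr mulmxDr mulmxA; congr (col_mx (_ + _) _).
  rewrite (mx_exp_intertwine (B := (y * epart X) *: B)) -?mulmxA//.
  by rewrite -scalemxAr HA scalerA mulrC -scalemxAl.
exists (mulmx (invmx (ga_lin H 0 y))); split.
- exact: mulKmx.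
- exact: mulKVmx.
- by move=> X; apply: linear_differentiable; exact: linmx_continuous.
- by move=> X; apply: linear_differentiable; exact: linmx_continuous.
Qed.

Lemma is_pullback_lin (h q : 'M[R]_(k + 1)) : is_pullback (mulmx h) q (h^T *m q *m h).
Proof.
move=> X Y; rewrite form_congr.
by rewrite (@diff_lin R _ _ (mulmx h) 0 (@linmx_continuous _ _ _ (mulmx h))).
Qed.

End MatrixExponential.

(** * Equivalence of the two flows *)

Section Equivalence.
Variables (R : realType) (m : nat) (J1 : 'M[R]_m) (a : R) (A1 : 'M[R]_m).
Hypotheses (J1T : J1^T = - J1) (J1J1 : J1 *m J1 = - 1%:M) (sp : in_sp J1 A1).
Local Notation w0 := (omega J1).
Local Notation A0 := (mxA a A1).

Lemma inI_cap (A B C D : \bar R) t :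
  inI (Order.max A C) (Order.min B D) t <-> inI A B t /\ inI C D t.
Proof. by rewrite /inI gt_max lt_min andbACA; split=> /andP. Qed.

(** The pullback of the standard structure along diag(H, y) solves the SCF on the interval of the
    flow. By uniqueness it agrees with the given solution, whose maximality yields the inclusion of
    intervals. *)
Lemma scf_absorb Tm Tp A Sm Sp wg : inI Tm Tp 0 -> mx_flow Tm Tp A -> A 0 = A0 ->
  maximal_solution (scf_solution (ga_bracket A0)) Sm Sp wg -> wg 0 = (w0, 1%:M) ->
  exists (H : R -> 'M[R]_(1 + m)) (y : R -> R), [/\ (Sm <= Tm)%E, (Tp <= Sp)%E
    & forall t, inI Tm Tp t -> [/\ H t \in unitmx, y t != 0, H t *m A0 = y t *: (A t *m H t)
      & wg t = ((ga_lin (H t) 0 (y t))^T *m w0 *m ga_lin (H t) 0 (y t),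
                (ga_lin (H t) 0 (y t))^T *m 1%:M *m ga_lin (H t) 0 (y t))]].
Proof.
move=> I0 Ad A00 smax wg0; have [S0 sol _] := smax.
have [H [y [H0 y0 Hy]]] := flow_conjugation J1T J1J1 Ad I0 A00 sp.
have sol' := flow_scf J1T J1J1 Ad I0 A00 sp Hy; rewrite A00 /= in sol'.
pose wg' t := ((ga_lin (H t) 0 (y t))^T *m w0 *m ga_lin (H t) 0 (y t),
                (ga_lin (H t) 0 (y t))^T *m 1%:M *m ga_lin (H t) 0 (y t)).
have wg'0 : wg' 0 = (w0, 1%:M).
  rewrite /wg' H0 y0; have -> : ga_lin 1%:M 0 1 = 1%:M :> 'M[R]_(1 + m + 1).
    by rewrite /ga_lin -scalar_mx_block.
  by rewrite trmx1 !mulmx1 mul1mx.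
have agree t : inI Sm Sp t -> inI Tm Tp t -> wg' t = wg t.
  move=> St It; have Ic : inI (Order.max Sm Tm) (Order.min Sp Tp) t by apply/inI_cap.
  apply: (@scf_unique _ _ _ (ga_bracket_lie A0) (Order.max Sm Tm) (Order.min Sp Tp) wg' wg 0) => //.
  - by apply/inI_cap.
  - by move=> s /inI_cap[_ Is]; exact: sol'.
  - by move=> s /inI_cap[Is _]; exact: sol.
  - by rewrite wg'0 wg0.
pose Pt (x : R -> 'M[R]_(1 + m + 1) * 'M[R]_(1 + m + 1)) (t : R) :=
  [/\ almost_kahler (ga_bracket A0) (x t).1 (x t).2,
    is_derive t (1 : R) (fun s => (x s).1) (- 2 *: chern_ricci (ga_bracket A0) (x t).1 (x t).2)
  & is_derive t (1 : R) (fun s => (x s).2)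
    (- 2 *: (form_c (x t).1 (x t).2 (chern_ricci (ga_bracket A0) (x t).1 (x t).2) *m Jop (x t).1 (x t).2)
         - 2 *: form_ac (x t).1 (x t).2 (ricci (ga_bracket A0) (x t).2))].
have germ u v t : (\forall s \near t, u s = v s) -> Pt u t -> Pt v t.
  move=> uv [ak d1 d2]; have e := nbhs_singleton uv; rewrite /Pt -e; split=> //.
    by apply: near_eq_is_derive d1; apply: filterS uv => s ->.
  by apply: near_eq_is_derive d2; apply: filterS uv => s ->.
have [e1 e2] := maximal_solution_absorbs germ smax sol' S0 I0 agree.
exists H, y; split=> // t It; have [Hu y0' HA _ _] := Hy t It; split=> //.
  by rewrite -A00.
rewrite -agree//; case/andP: It => Tt tT; apply/andP; split.
  exact: le_lt_trans Tt.
exact: lt_le_trans e2.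
Qed.

Lemma scf_immortal Sm Sp wg : maximal_solution (scf_solution (ga_bracket A0)) Sm Sp wg ->
  wg 0 = (w0, 1%:M) -> Sp = +oo%E.
Proof.
move=> smax wg0; have [e [A [e0 A00 Ad]]] := flow_global A0.
have I0 : inI (- e)%:E +oo%E (0 : R) by rewrite /inI lte_fin oppr_lt0 e0 ltry.
have [H [y [_ e1 _]]] := scf_absorb I0 Ad A00 smax wg0.
by apply/eqP; rewrite eq_le leey.
Qed.

Lemma norm_le_gram k (h : 'M[R]_k) : `|h| <= Num.sqrt (\tr (h^T *m h)).
Proof.
by rewrite mxtrace_mulC; exact: mx_norm_fnorm.
Qed.

Lemma mxtrace_norm_le k (g : 'M[R]_k) : `|\tr g| <= k%:R * `|g|.
Proof.
rewrite /mxtrace (le_trans (ler_norm_sum _ _ _))// mulr_natl.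
rewrite -[X in _ *+ X](card_ord k) -sumr_const ler_sum// => i _.
exact: mx_entry_le.
Qed.

Lemma invmx_ga_lin k (H : 'M[R]_k) y : H \in unitmx -> y != 0 ->
  invmx (ga_lin H 0 y) = ga_lin (invmx H) 0 y^-1.
Proof.
move=> Hu y0; have hu : ga_lin H 0 y \in unitmx by exact: ga_lin_unit.
apply: (can_inj (mulKmx hu)); rewrite mulmxV// /ga_lin mulmx_block !mulmx0 !mul0mx !addr0 !add0r.
by rewrite mulmxV// -scalar_mxM mulfV// -scalar_mx_block.
Qed.

Lemma ga_lin_norm k (H : 'M[R]_k) y : `|H| <= `|ga_lin H 0 y| /\ `|y| <= `|ga_lin H 0 y|.
Proof.
split.
  apply: mx_norm_leP => // i j.
  by have := mx_entry_le (ga_lin H 0 y) (lshift 1 i) (lshift 1 j); rewrite block_mxEul.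
have := mx_entry_le (ga_lin H 0 y) (rshift k 0) (rshift k 0).
by rewrite block_mxEdr mxE mulr1n.
Qed.

Lemma scf_flow_equiv Tm Tp Sm Sp A wg :
  maximal_solution (@mx_flow R (1 + m)) Tm Tp A -> A 0 = A0 ->
  maximal_solution (scf_solution (ga_bracket A0)) Sm Sp wg -> wg 0 = (w0, 1%:M) ->
  Tm = Sm /\ Tp = Sp /\ forall t : R, (Tm < t%:E < Tp)%E ->
    exists h : 'cV[R]_(1 + m + 1) -> 'cV[R]_(1 + m + 1),
      [/\ ga_iso A0 (A t) h, is_pullback h w0 (wg t).1 & is_pullback h 1%:M (wg t).2].
Proof.
move=> Amax A00 smax wg0; have [I0 Ad _] := Amax; have [S0 sol _] := smax.
have Tpoo := flow_immortal Amax; have Spoo := scf_immortal smax wg0.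
have [H [y [SmTm _ Hy]]] := scf_absorb I0 Ad A00 smax wg0.
split; last first.
  split; first by rewrite Tpoo Spoo.
  move=> t It; have [Hu y0 HA ->] := Hy t It.
  exists (mulmx (ga_lin (H t) 0 (y t))); split=> /=.
  - exact: ga_lin_iso.
  - exact: is_pullback_lin.
  - exact: is_pullback_lin.
apply/eqP; rewrite eq_le SmTm andbT; apply/negP => /negP; rewrite -ltNge => lt.
have [r rE] : exists r, Tm = r%:E.
  case/andP: I0 => I0 _; case: (Tm) lt I0 => [r _ _|_|]; first by exists r.
    by rewrite ltNge leey.
  by rewrite ltNge leNye.
have [b b0 Hb] := inI_ball I0.
have Ib : inI Tm Tp b by apply: Hb; rewrite subr0 gtr0_norm.
(* Suppose that the SCF solution reaches back to some c before the lower end r of the matrix flow; A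
   will turn out to be bounded down to c. *)
have [c [Sc cr]] : exists c : R, (Sm < c%:E)%E /\ c < r.
  case: (Sm) lt => [s| |]; rewrite rE ?lte_fin//.
  - by move=> sr; exists ((s + r) / 2); rewrite lte_fin !midf_lt.
  - by move=> _; exists (r - 1); rewrite ltNye_eq gtrDl oppr_lt0.
have Sc' : inI Sm Sp c by rewrite /inI Sc Spoo ltry.
have Sb : inI Sm Sp b.
  case/andP: Ib => Tb _; rewrite /inI Spoo ltry andbT; exact: le_lt_trans Tb.
have [K K0 gK] : exists2 K, 0 <= K & forall t, c <= t <= b -> `|(wg t).2| <= K.
  apply: continuous_mx_bounded => t tcb.
  by have [_ _ gd] := sol t (inI_conv Sc' Sb tcb); exact: is_derive_continuous gd.
have [K' K'0 igK] := scf_inverse_bounded sol Sc' Sb.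
(* N and N' bound the traces of the metric and of its inverse, hence |h|^2 and |h^{-1}|^2 for h =
   diag(H, y); B is the resulting bound for A = y^{-1} H A_0 H^{-1}. *)
pose N := (1 + m + 1)%:R * K; pose N' := (1 + m + 1)%:R * K'.
pose B := Num.sqrt N' * ((1 + m)%:R * ((1 + m)%:R * Num.sqrt N * `|A0|) * Num.sqrt N').
have [||h _] := bounded_extends (a := c) (b := b) (B := B) (@flow_field_lipschitz R _) Amax.
- rewrite b0 andbT (lt_trans cr)//; have /andP[] := I0; by rewrite rE lte_fin.
- move=> t It /andP[/ltW ct /ltW tb]; have tcb : c <= t <= b by rewrite ct.
  have [Hu y0 HA wgE] := Hy t It.
  have gt := gK t tcb; have igt := igK t tcb; rewrite wgE /= mulmx1 in gt igt.
  have hu : ga_lin (H t) 0 (y t) \in unitmx by exact: ga_lin_unit.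
  have [H1 _] := ga_lin_norm (H t) (y t).
  have [H2 y2] := ga_lin_norm (invmx (H t)) (y t)^-1.
  have h1 : `|ga_lin (H t) 0 (y t)| <= Num.sqrt N.
    apply: le_trans (norm_le_gram _) _; apply: ler_wsqrtr.
    by rewrite (le_trans (ler_norm _))// (le_trans (mxtrace_norm_le _))// /N ler_wpM2l.
  have h2 : `|invmx (ga_lin (H t) 0 (y t))| <= Num.sqrt N'.
    rewrite -trmx_norm; apply: le_trans (norm_le_gram _) _; apply: ler_wsqrtr.
    rewrite trmxK (le_trans (ler_norm _))// (le_trans (mxtrace_norm_le _))// /N' ler_wpM2l//.
    apply: le_trans igt; rewrite le_eqVlt; apply/orP; left; apply/eqP; congr (`|_|).
    apply: (can_inj (mulKmx (_ : (ga_lin (H t) 0 (y t))^T *m ga_lin (H t) 0 (y t) \in unitmx))).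
      by rewrite unitmx_mul unitmx_tr hu.
    move: (ga_lin _ _ _) hu => k ku; rewrite [RHS]mulmxV ?unitmx_mul ?unitmx_tr ?ku//.
    by rewrite mulmxA mulmxK// -trmx_mul mulVmx// trmx1.
  rewrite invmx_ga_lin// in h2.
  have -> : A t = (y t)^-1 *: (H t *m A0 *m invmx (H t)).
    by rewrite HA -scalemxAl scalerA mulVf// scale1r mulmxK.
  rewrite normrZ ler_pM//; first exact: le_trans y2 h2.
  rewrite (le_trans (mulmx_norm_le _ _))// ler_pM ?mulr_ge0//; last exact: le_trans H2 h2.
  rewrite ler_wpM2l// (le_trans (mulmx_norm_le _ _))// ler_wpM2r// ler_wpM2l//.
  exact: le_trans H1 h1.
by move: h; rewrite rE lee_fin leNgt cr.
Qed.

End Equivalence.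

(** * Monotonicity *)

Section Cubic.
Variables (R : realType) (k : nat).
Implicit Types A E : 'M[R]_k.

Lemma mxbrZ c d A E : mxbr (c *: A) (d *: E) = (c * d) *: mxbr A E.
Proof. by rewrite /mxbr -!scalemxAl -!scalemxAr !scalerA scalerBr (mulrC d). Qed.

Lemma flow_field_cubic c A : flow_field (c *: A) = c ^+ 3 *: flow_field A.
Proof.
rewrite /flow_field; have -> : (c *: A)^T = c *: A^T by rewrite linearZ.
have -> : sympart (c *: A) = c *: sympart A.
  by rewrite /sympart linearZ/= -scalerDr !scalerA mulrC.
rewrite (mxbrZ c c) (mxbrZ c (c * c)) -scalemxAl -scalemxAr scalerA !mxtraceZ.
move: (mxbr A (mxbr A A^T)) (mxbr A A^T) (\tr A) (\tr _) => X M x y.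
by apply/matrixP => i j; rewrite !mxE; ring.
Qed.

Lemma sqnormZ c A : sqnorm (c *: A) = c ^+ 2 * sqnorm A.
Proof. by rewrite /sqnorm linearZ/= -scalemxAl -scalemxAr scalerA mxtraceZ expr2. Qed.

Lemma sqnorm_lincomb c d A E : sqnorm (c *: A - d *: E) =
  c ^+ 2 * sqnorm A - 2 * c * d * \tr (A *m E^T) + d ^+ 2 * sqnorm E.
Proof.
have AE : \tr (E *m A^T) = \tr (A *m E^T) by rewrite -mxtrace_tr trmx_mul trmxK.
have trE : (c *: A - d *: E)^T = c *: A^T - d *: E^T.
  by apply/matrixP => i j; rewrite !mxE.
rewrite /sqnorm trE mulmxBl !mulmxBr -!scalemxAl -!scalemxAr !scalerA.
by rewrite !mxtraceB !mxtraceZ AE !expr2; ring.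
Qed.

Definition criticality A : R :=
  sqnorm (mxbr (mxbr A A^T) A) * sqnorm A - sqnorm (mxbr A A^T) ^+ 2.

Lemma mxtrace_critical A : \tr (mxbr (mxbr A A^T) A *m A^T) = sqnorm (mxbr A A^T).
Proof. by rewrite mxtrace_mxbr; exact: mxtrace_mxbr_sq. Qed.

(* Cauchy-Schwarz for [M, A] and A, whose inner product is |M|^2. *)
Lemma criticality_sos A (M := mxbr A A^T) (N := mxbr M A) :
  sqnorm A * criticality A = sqnorm (sqnorm A *: N - sqnorm M *: A).
Proof.
rewrite sqnorm_lincomb mxtrace_critical /criticality -/M -/N.
by rewrite !expr2; ring.
Qed.

Lemma criticality_ge0 A : 0 <= criticality A.
Proof.
have [->|A0] := eqVneq A 0.
  have z : sqnorm (0 : 'M[R]_k) = 0 by apply/eqP; rewrite sqnorm_eq0.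
  have b0 E : mxbr 0 E = 0 :> 'M[R]_k by rewrite /mxbr mul0mx mulmx0 subrr.
  by rewrite /criticality !b0 !z mul0r expr2 mul0r subrr.
by rewrite -(pmulr_rge0 _ (sqnorm_gt0 A0)) criticality_sos sqnorm_ge0.
Qed.

Lemma criticality0 A : criticality A = 0 -> exists mu, mxbr (mxbr A A^T) A = mu *: A.
Proof.
move=> c0; have [->|A0] := eqVneq A 0.
  by exists 0; rewrite /mxbr !(mul0mx, mulmx0, subrr, trmx0) scaler0.
have := criticality_sos A; rewrite c0 mulr0 => /esym/eqP; rewrite sqnorm_eq0 subr_eq0 => /eqP e.
exists (sqnorm (mxbr A A^T) / sqnorm A).
have q0 : sqnorm A != 0 by rewrite sqnorm_eq0.
by rewrite mulrC -scalerA -e scalerA mulVf// scale1r.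
Qed.

Variables (A : R -> 'M[R]_k) (t : R).
Hypothesis Ad : is_derive t (1 : R) A (flow_field (A t)).
Let M := mxbr (A t) (A t)^T.
Let f : R := 2^-1 * ((\tr (A t)) ^+ 2 + \tr (sympart (A t) *m sympart (A t))).

Lemma is_derive_flow_sqnorm :
  is_derive t (1 : R) (fun s => sqnorm (A s)) (- 2 * f * sqnorm (A t) - sqnorm M).
Proof.
have := is_derive_sqnorm Ad; rewrite mxtrace_flow_field -/M -/f.
by have -> : 2 * (- f * sqnorm (A t) - 2^-1 * sqnorm M) = - 2 * f * sqnorm (A t) - sqnorm M by field.
Qed.

(** The term of the field along M does not contribute, because [M, A] is orthogonal to M. *)
Lemma is_derive_flow_moment :
  is_derive t (1 : R) (fun s => sqnorm (mxbr (A s) (A s)^T))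
    (- 4 * f * sqnorm M - 2 * sqnorm (mxbr M (A t))).
Proof.
have Md := is_derive_mxbr Ad (is_derive_trmx Ad).
have := is_derive_sqnorm Md; set V := flow_field (A t); rewrite -/M.
have MT : M^T = M := mxbr_self_tr_sym _.
have e2 : \tr (mxbr (A t) V^T *m M) = \tr (mxbr V (A t)^T *m M).
  by rewrite -mxtrace_tr trmx_mul MT mxbr_tr trmxK mxtrace_mulC.
have NT : (mxbr M (A t))^T = mxbr (A t)^T M by rewrite mxbr_tr MT.
have e3 : \tr (mxbr V (A t)^T *m M) = - f * sqnorm M - 2^-1 * sqnorm (mxbr M (A t)).
  rewrite mxtrace_mxbr -NT /V /flow_field -/M -/f.
  have t1 : \tr (A t *m (mxbr M (A t))^T) = sqnorm M.
    by rewrite -mxtrace_tr trmx_mul trmxK; exact: mxtrace_critical.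
  have t2 : \tr (mxbr (A t) M *m (mxbr M (A t))^T) = - sqnorm (mxbr M (A t)).
    by rewrite mxbrC mulNmx raddfN.
  have t3 : \tr (M *m (mxbr M (A t))^T) = 0.
    by rewrite NT mxtrace_mulC mxtrace_mxbr /mxbr subrr mulmx0 mxtrace0.
  rewrite mulmxBl mulmxDl -!scalemxAl mxtraceB mxtraceD !mxtraceZ t1 t2 t3.
  by rewrite mulr0 subr0 mulrN.
rewrite MT mulmxDl mxtraceD e2 e3.
set x := sqnorm M; set y := sqnorm _.
by have -> : 2 * (- f * x - 2^-1 * y + (- f * x - 2^-1 * y)) = - 4 * f * x - 2 * y by field.
Qed.

End Cubic.

(** * Monotonicity of the scale-invariant quotient *)

Section Monotone.
Variables (R : realType) (k : nat).

Lemma flow_field0 : flow_field (0 : 'M[R]_k) = 0.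
Proof. by rewrite -(scale0r (0 : 'M[R]_k)) flow_field_cubic exprS mul0r !scale0r. Qed.

Lemma fnorm4 (A : 'M[R]_k) : fnorm A ^+ 4 = sqnorm A ^+ 2.
Proof. by rewrite (exprM _ 2 2) sqr_sqrtr ?sqnorm_ge0. Qed.

Definition moment_ratio (A : 'M[R]_k) : R := sqnorm (mxbr A A^T) / sqnorm A ^+ 2.

Lemma moment_ratio_ge0 A : 0 <= moment_ratio A.
Proof. by rewrite divr_ge0 ?sqr_ge0 ?sqnorm_ge0. Qed.

Lemma moment_ratioZ c (A : 'M[R]_k) : c != 0 -> moment_ratio (c *: A) = moment_ratio A.
Proof.
move=> c0; rewrite /moment_ratio linearZ/= mxbrZ !sqnormZ.
have -> : (c ^+ 2 * sqnorm A) ^+ 2 = (c * c) ^+ 2 * sqnorm A ^+ 2 by ring.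
by rewrite -mulf_div divff ?mul1r// expf_neq0// mulf_neq0.
Qed.

(** The quotient is homogeneous of degree 0, so the radial part of the field cancels and only the
    Cauchy-Schwarz defect is left. *)
Lemma is_derive_moment_ratio (A : R -> 'M[R]_k) t : is_derive t (1 : R) A (flow_field (A t)) ->
  A t != 0 ->
  is_derive t (1 : R) (fun s => moment_ratio (A s)) (- 2 * criticality (A t) / sqnorm (A t) ^+ 3).
Proof.
move=> Ad A0; have q0 : sqnorm (A t) != 0 by rewrite sqnorm_eq0.
have dQ := is_derive_flow_sqnorm Ad; have dP := is_derive_flow_moment Ad.
have dQ2 := is_deriveMR dQ dQ.
have Q20 : sqnorm (A t) * sqnorm (A t) != 0 by rewrite mulf_neq0.
have dI := @is_deriveV R (fun s => sqnorm (A s) * sqnorm (A s)) t _ 1 Q20 dQ2.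
have -> : (fun s => moment_ratio (A s)) =
    (fun s => sqnorm (mxbr (A s) (A s)^T) * (sqnorm (A s) * sqnorm (A s))^-1).
  by apply/funext => s; rewrite /moment_ratio expr2.
have := is_deriveMR dP dI; set d := (X in is_derive _ _ _ X).
suff -> : d = - 2 * criticality (A t) / sqnorm (A t) ^+ 3 by [].
rewrite /d /criticality; move: (sqnorm (mxbr (mxbr _ _) _)) (sqnorm (mxbr _ _)) (sqnorm _) q0 (2^-1 * _) => n p q q0 f.
rewrite /GRing.scale /=; field.
by rewrite q0.
Qed.

(** 0 is an equilibrium, so by uniqueness no other solution meets it. *)
Lemma flow_nonzero Tm Tp (A : R -> 'M[R]_k) t0 : inI Tm Tp t0 -> mx_flow Tm Tp A ->
  A t0 != 0 -> forall t, inI Tm Tp t -> A t != 0.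
Proof.
move=> I0 Ad A0 t It; apply: contra A0 => /eqP At; apply/eqP.
apply: (loc_lipschitz_unique (y := fun=> 0) (@flow_field_lipschitz R k) It Ad _ At I0).
by move=> s Is; rewrite flow_field0; exact: is_derive_cstmx.
Qed.

Lemma moment_ratio_le Tm Tp (A : R -> 'M[R]_k) s t : mx_flow Tm Tp A ->
  inI Tm Tp s -> inI Tm Tp t -> s <= t -> A s != 0 -> moment_ratio (A t) <= moment_ratio (A s).
Proof.
move=> Ad Is It st A0; have nz := flow_nonzero Is Ad A0.
apply: (derive_le_incr (f := fun u => moment_ratio (A u))
  (df := fun u => - 2 * criticality (A u) / sqnorm (A u) ^+ 3)) => // u sut.
  by have Iu := inI_conv Is It sut; apply: is_derive_moment_ratio; [exact: Ad|exact: nz].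
rewrite mulNr mulNr oppr_le0 divr_ge0 ?exprn_ge0 ?sqnorm_ge0//.
by rewrite mulr_ge0// criticality_ge0.
Qed.

(* A critical point lies on an invariant ray because the field is cubic. *)
Lemma critical_ray Tm Tp (A : R -> 'M[R]_k) t1 c : mx_flow Tm Tp A -> inI Tm Tp t1 ->
  A t1 != 0 -> flow_field (A t1) = c *: A t1 ->
  forall t, inI Tm Tp t -> exists x, A t = x *: A t1.
Proof.
move=> Ad I1 A0 Vc t It; pose E := A t1.
(* M |-> l M E is the orthogonal projection onto the line of E, which the field maps to itself. *)
pose l (M : 'M[R]_k) : R := \tr (M *m E^T) / sqnorm E.
have lin : linear (fun M : 'M[R]_k => l M *: E).
  move=> x M N; rewrite /l mulmxDl -scalemxAl mxtraceD mxtraceZ.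
  by rewrite mulrDl scalerDl -mulrA scalerA.
pose p := GRing.isLinear.Build R _ _ _ _ lin.
pose pL : {linear 'M[R]_k -> 'M[R]_k} := HB.pack (fun M : 'M[R]_k => l M *: E) p.
have pZ x : pL (x *: E) = x *: E.
  by rewrite /pL /= /l -scalemxAl mxtraceZ -/(sqnorm E) mulfK// sqnorm_eq0.
exists (l (A t)).
suff e : pL (A t) = A t by rewrite -[LHS]e.
apply: (loc_lipschitz_invariant (p := pL) (@flow_field_lipschitz R k) I1 _ Ad) => //.
  move=> M; have -> : pL M = l M *: E by [].
  by rewrite flow_field_cubic Vc scalerA pZ.
by rewrite -[A t1]scale1r pZ.
Qed.

End Monotone.

Section StrictMonotone.
Variables (R : realType) (m : nat) (J1 : 'M[R]_m) (a : R) (A1 : 'M[R]_m).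
Hypotheses (J1T : J1^T = - J1) (J1J1 : J1 *m J1 = - 1%:M) (sp : in_sp J1 A1).
Local Notation A0 := (mxA a A1).

(** If b = 0, the term with tr A is absent. If b <> 0, then mu = 0, so A is normal and the field is
    radial. *)
Lemma mxA_critical_field b B1 mu (A := mxA b B1) : in_sp J1 B1 ->
  mxbr (mxbr A A^T) A = mu *: A -> exists c, flow_field A = c *: A.
Proof.
move=> spB crit; have mub := critical_a0 crit.
rewrite /flow_field (mxA_trace b J1J1 spB) (mxbrC A (mxbr A A^T)) crit.
set f := 2^-1 * _; have [b0|b0] := eqVneq b 0.
  exists (- f - 2^-1 * mu); rewrite b0 mul0r scale0r subr0.
  by rewrite scalerN scalerA scalerBl.
have mu0 : mu = 0 by move/eqP: mub; rewrite mulf_eq0 (negbTE b0) orbF => /eqP.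
have M0 : mxbr A A^T = 0.
  by apply/eqP; rewrite -sqnorm_eq0 -mxtrace_critical crit mu0 scale0r mul0mx mxtrace0.
by exists (- f); rewrite M0 mu0 scale0r oppr0 !scaler0 addr0 subr0.
Qed.

Lemma moment_ratio_strict Tm Tp (A : R -> 'M[R]_(1 + m)) :
  maximal_solution (@mx_flow R (1 + m)) Tm Tp A -> A 0 = A0 -> A0 != 0 ->
  ~ scf_soliton (ga_bracket A0) (omega J1) 1%:M ->
  forall s t : R, (Tm < s%:E)%E -> s < t -> (t%:E < Tp)%E ->
    sqnorm (mxbr (A t) (A t)^T) / fnorm (A t) ^+ 4 <
    sqnorm (mxbr (A s) (A s)^T) / fnorm (A s) ^+ 4.
Proof.
move=> [I0 Ad _] A00 A0n nsol s t Ts st tT; rewrite !fnorm4.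
have Is : inI Tm Tp s by rewrite /inI Ts (lt_trans _ tT).
have It : inI Tm Tp t by rewrite /inI tT (lt_trans Ts).
have nz : forall u, inI Tm Tp u -> A u != 0.
  by apply: (flow_nonzero I0 Ad); rewrite A00.
pose df u := - 2 * criticality (A u) / sqnorm (A u) ^+ 3.
have drho u : inI Tm Tp u -> is_derive u (1 : R) (fun u => moment_ratio (A u)) (df u).
  by move=> Iu; apply: is_derive_moment_ratio; [exact: Ad|exact: nz].
(* If A(u) were critical, the whole solution would lie on its line, so A(0) would be critical and
   hence a soliton. *)
have crit0 u : inI Tm Tp u -> criticality (A u) != 0.
  move=> Iu; apply/eqP => /criticality0[mu crit]; apply: nsol.
  have [b [B1 [AE spB]]] := flow_in_class J1T J1J1 Ad I0 A00 sp Iu.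
  have [c Vc] : exists c, flow_field (A u) = c *: A u.
    by rewrite AE; apply: (mxA_critical_field (mu := mu) spB); rewrite -AE.
  have [x A0x] := critical_ray Ad Iu (nz _ Iu) Vc I0.
  apply: (mxA_soliton_of_critical J1T J1J1 sp (mu := x ^+ 2 * mu)).
  rewrite -A00 A0x linearZ/= !mxbrZ crit !scalerA; congr (_ *: _).
  by rewrite expr2; ring.
have dlt u : inI Tm Tp u -> df u < 0.
  move=> Iu; rewrite /df mulNr mulNr oppr_lt0 divr_gt0 ?exprn_gt0 ?sqnorm_gt0 ?nz//.
  by rewrite mulr_gt0// lt0r crit0//= criticality_ge0.
have stI u : u \in `]s, t[ -> inI Tm Tp u.
  by rewrite in_itv/= => /andP[/ltW su /ltW ut]; apply: (inI_conv Is It); rewrite su.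
have [||u uI e] := @MVT R (fun u => moment_ratio (A u)) df s t st.
- by move=> u /stI; exact: drho.
- apply: derivable_within_continuous => u; rewrite in_itv/= => ust.
  by have [] := drho u (inI_conv Is It ust).
have du := dlt u (stI u uI).
suff : moment_ratio (A t) - moment_ratio (A s) < 0 by rewrite subr_lt0.
by rewrite e pmulr_llt0 // subr_gt0.
Qed.

End StrictMonotone.

(** * Limits of the normalised flow *)

Lemma inI_pinfty (R : realType) (Tm : \bar R) (t : R) : inI Tm +oo%E 0 -> 0 <= t -> inI Tm +oo%E t.
Proof.
by rewrite /inI !ltry !andbT => h t0; rewrite (lt_le_trans h).
Qed.

Lemma cluster_pinfty (R : realType) (V : normedModType R) (f : R -> V) (p : V) :
  cluster (f @ +oo%R) p -> forall T e : R, 0 < e -> exists2 t, T <= t & `|f t - p| <= e.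
Proof.
move=> cl T e e0.
have FT : (f @ +oo%R) [set x | exists2 t, T <= t & x = f t].
  by exists T; split; [exact: num_real|move=> t /ltW Tt; exists t].
have Np : nbhs p [set x | `|x - p| <= e].
  have : \forall x \near p, `|p - x| <= e by exact: (@cvgr_dist_le _ _ _ (nbhs p) _ id p).
  by apply: filterS => x; rewrite /= distrC.
by have [x [[t Tt ->] xp]] := cl _ _ FT Np; exists t.
Qed.

Lemma small_norm0 (R : realType) (V : normedModType R) (x : V) (C : R) :
  (forall e : R, 0 < e -> `|x| <= C * e) -> x = 0.
Proof.
move=> H; apply/eqP; rewrite -normr_le0 leNgt; apply/negP => x0.
have C1 : 0 < `|C| + 1 by rewrite ltr_wpDl.
have := H (`|x| / (2 * (`|C| + 1))); rewrite divr_gt0 ?mulr_gt0// => /(_ isT).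
rewrite mulrCA -[leLHS]mulr1 ler_pM2l// ler_pdivlMr ?mulr_gt0// mul1r.
by have := ler_norm C; move: C1; clear; lra.
Qed.

Lemma is_derive_mx_affine (R : realType) m n (x : R -> 'M[R]_(m, n)) (s c u : R) dx :
  is_derive (s + c * u) (1 : R) x dx ->
  is_derive u (1 : R) (fun v => x (s + c * v)) (c *: dx).
Proof.
have d1 : is_derive u (1 : R) (fun v => s + c * v) c.
  have d2 := @is_deriveZ _ _ _ id c u 1 _ (is_derive_id u 1).
  rewrite /GRing.scale/= mulr1 in d2.
  by rewrite -[c in X in is_derive _ _ _ X]add0r; apply: is_deriveD.
move=> /is_derive_mxP xd; apply/is_derive_mxP => i j; rewrite mxE mulrC.
exact: (@is_derive1_comp R (fun s => x s i j) (fun v => s + c * v)).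
Qed.

Section LimitCritical.
Variables (R : realType) (k : nat).
Implicit Types M N : 'M[R]_k.

Lemma criticality_lipschitz (B : R) : exists2 L, 0 <= L & forall M N, `|M| <= B -> `|N| <= B ->
  `|criticality M - criticality N| <= L * `|M - N|.
Proof.
pose S : set ('M[R]_k * 'M[R]_k) := [set p | `|p.1| <= B /\ `|p.2| <= B].
pose delta (p : 'M[R]_k * 'M[R]_k) := `|p.1 - p.2|.
have d0 t : S t -> 0 <= delta t by move=> _; exact: normr_ge0.
have cA : close S delta fst snd := @close_ball R k B; have cT := close_trmx cA.
have cbr u v u' v' : close S delta u v -> close S delta u' v' ->
    close S delta (fun p => mxbr (u p) (u' p) : 'M[R]_k) (fun p => mxbr (v p) (v' p)).
  by move=> c c'; apply: closeB; exact: close_mulmx.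
have csq (u v : 'M[R]_k * 'M[R]_k -> 'M[R]_k) : close S delta u v ->
    close S delta (fun p => sqnorm (u p)) (fun p => sqnorm (v p)).
  by move=> c; apply: close_mxtrace; apply: close_mulmx => //; exact: close_trmx.
have cM := cbr _ _ _ _ cA cT; have cN := cbr _ _ _ _ cM cA.
have [K K0 HK] : close S delta (fun p => criticality p.1) (fun p => criticality p.2).
  apply: closeB; first by apply: closeM; exact: csq.
  by apply: eq_close (closeM (csq _ _ cM) (csq _ _ cM)) => p; rewrite expr2.
by exists K => // M N MB NB; have [] := HK (M, N) (conj MB NB).
Qed.

Variables (Tm : \bar R) (A : R -> 'M[R]_k).
Hypotheses (I0 : inI Tm +oo%E 0) (Ad : mx_flow Tm +oo%E A) (A0 : A 0 != 0).

(* The flow through A(s), rescaled to start on the unit sphere, stays near Ap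
   for a time that does not depend on s. *)
Lemma moment_ratio_drop (Ap : 'M[R]_k) : 0 < criticality Ap ->
  exists e k : R, [/\ 0 < e, 0 < k & forall s, 0 <= s ->
    `|(fnorm (A s))^-1 *: A s - Ap| <= e ->
    exists2 t, s <= t & moment_ratio (A t) <= moment_ratio (A s) - k].
Proof.
set g := criticality Ap => g0; pose B := Num.max 1 `|Ap|.
have [L L0 HL] := criticality_lipschitz B.
have [V V0 HV] := @flow_field_lipschitz R k 1.
(* The rescaled solution has speed at most V, so for time T it stays within 2 e of [Ap], where the
   defect is at least g - 2 L e >= g / 2. *)
pose e := g / (4 * (L + 1)); have e0 : 0 < e by rewrite divr_gt0// mulr_gt0// ltr_wpDl.
pose T := e / (V + 1); have V1 : 0 < V + 1 by rewrite ltr_wpDl.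
have T0 : 0 < T by rewrite divr_gt0.
exists e, (g * T); split=> // [|s s0 near_s]; first exact: mulr_gt0.
have nz (u : R) : 0 <= u -> A u != 0 by move=> u0; exact: (flow_nonzero I0 Ad A0 (inI_pinfty I0 u0)).
pose l := fnorm (A s); have l0 : 0 < l by rewrite sqrtr_gt0 sqnorm_gt0// nz.
(* The field is cubic, so the solution divided by l solves the same equation in the time u with t =
   s + u / l^2. *)
pose c := (l ^+ 2)^-1; have c0 : 0 < c by rewrite invr_gt0 exprn_gt0.
pose x (u : R) : 'M[R]_k := l^-1 *: A (s + c * u).
have cu (u : R) : 0 <= u -> 0 <= c * u by move=> u0; rewrite mulr_ge0// ltW.
have xd (u : R) : 0 <= u -> is_derive u (1 : R) x (flow_field (x u)).
  move=> u0; have := is_derive_mx_affine (Ad (inI_pinfty I0 (addr_ge0 s0 (cu u u0)))).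
  rewrite -/(flow_field _) => d1; have d2 := is_derive_scalemx (is_derive_cst l^-1 u 1) d1.
  rewrite scale0r add0r in d2; rewrite /x flow_field_cubic.
  suff -> : l^-1 ^+ 3 *: flow_field (A (s + c * u)) = l^-1 *: (c *: flow_field (A (s + c * u))) by [].
  by rewrite scalerA /c exprS exprVn.
have xn (u : R) : 0 <= u -> sqnorm (x u) <= 1.
  move=> u0; have -> : 1 = sqnorm (x 0).
    rewrite /x mulr0 addr0 sqnormZ exprVn sqr_sqrtr ?sqnorm_ge0// mulVf//.
    by rewrite sqnorm_eq0 nz.
  apply: (derive_le_incr (f := fun s => sqnorm (x s))
    (df := fun s => 2 * \tr (flow_field (x s) *m (x s)^T))) => // v /andP[v0 _].
    by apply: is_derive_sqnorm; exact: xd.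
  by rewrite pmulr_rle0// flow_field_tr_le0.
have x1 (u : R) : 0 <= u -> `|x u| <= 1.
  move=> u0; rewrite (le_trans (mx_norm_fnorm _))// -sqrtr1 ler_wsqrtr//; exact: xn.
have xx (u : R) : 0 <= u -> `|x u - x 0| <= V * u.
  move=> u0; have := @mx_MVT_le R _ _ x (fun v => flow_field (x v)) (fun v => V * v) (fun=> V) 0 u u0.
  rewrite mulr0 subr0; apply.
  - by move=> v /andP[v0 _]; exact: xd.
  - move=> v _; have := @is_deriveZ _ _ _ id V v 1 _ (is_derive_id v 1).
    by rewrite /GRing.scale/= mulr1.
  - move=> v /andP[v0 _]; have := HV (x v) 0 (x1 v v0); rewrite normr0 => /(_ ler01).
    rewrite flow_field0 !subr0 => /le_trans; apply.
    by rewrite -[leRHS]mulr1 ler_wpM2l// x1.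
have crit (u : R) : 0 <= u <= T -> 2^-1 * g <= criticality (x u).
  move=> /andP[u0 uT].
  have le1 : `|x u - Ap| <= e + e.
    rewrite -[x u - Ap](subrKA (x 0)) (le_trans (ler_normD _ _))// lerD//.
      rewrite (le_trans (xx u u0))// (le_trans (ler_wpM2l V0 uT))// /T mulrA ler_pdivrMr//.
      by rewrite mulrC ler_wpM2l ?(ltW e0)// lerDl.
    by rewrite /x mulr0 addr0.
  have := HL (x u) Ap; rewrite /B !le_max (x1 u u0) lexx orbT => /(_ isT isT) h.
  have le2 : L * `|x u - Ap| <= 2^-1 * g.
    rewrite (le_trans (ler_wpM2l L0 le1))//.
    have -> : 2^-1 * g = (L + 1) * (e + e).
      by rewrite /e; field; rewrite gt_eqF// ltr_wpDl.
    by rewrite ler_wpM2r ?lerDl// addr_ge0// ltW.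
  have := le_trans h le2; rewrite ler_norml => /andP[h1 _].
  by rewrite -/g in h1; clear -h1; lra.
exists (s + c * T); first by rewrite lerDl cu// ltW.
have xn0 (u : R) : 0 <= u -> x u != 0.
  by move=> u0; rewrite scaler_eq0 invr_eq0 (gt_eqF l0)/= nz// addr_ge0// cu.
have rx (u : R) : moment_ratio (x u) = moment_ratio (A (s + c * u)).
  by rewrite moment_ratioZ// invr_eq0 gt_eqF.
have x0s : moment_ratio (x 0) = moment_ratio (A s) by rewrite rx mulr0 addr0.
move: (rx T) => xTs; clearbody x.
have := MVT_le (f := fun u => moment_ratio (x u))
  (df := fun u => - 2 * criticality (x u) / sqnorm (x u) ^+ 3) (M := - g) (ltW T0).
rewrite subr0 mulNr lerBlDl x0s xTs => h; apply: h.
- move=> u /andP[u0 _]; exact: (is_derive_moment_ratio (xd u u0) (xn0 u u0)).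
- move=> u uT; have /andP[u0 _] := uT; rewrite mulNr mulNr lerN2.
  have xp : 0 < sqnorm (x u) by rewrite sqnorm_gt0 ?xn0.
  rewrite ler_pdivlMr ?exprn_gt0//.
  have h := crit u uT; have h3 : sqnorm (x u) ^+ 3 <= 1 by rewrite exprn_ile1 ?sqnorm_ge0// xn.
  have : g * sqnorm (x u) ^+ 3 <= g by rewrite -[leRHS]mulr1 ler_wpM2l// ltW.
  by move=> /le_trans; apply; clear -h; lra.
Qed.

Lemma limit_critical (Ap : 'M[R]_k) : cluster ((fun t : R => (fnorm (A t))^-1 *: A t) @ +oo%R) Ap ->
  criticality Ap = 0.
Proof.
move=> cl; apply/eqP; rewrite eq_le criticality_ge0 andbT leNgt; apply/negP => g0.
have [e [c [e0 c0 drop]]] := moment_ratio_drop g0.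
have iter (n : nat) : exists2 t, 0 <= t & moment_ratio (A t) <= moment_ratio (A 0) - n%:R * c.
  elim: n => [|n [s s0 sn]]; first by exists 0; rewrite // mul0r subr0.
  have [t st te] := cluster_pinfty cl s e0; have t0 := le_trans s0 st.
  have [t' tt' h] := drop t t0 te; exists t'; first exact: le_trans tt'.
  apply: le_trans h _.
  have As : A s != 0 by exact: (flow_nonzero I0 Ad A0 (inI_pinfty I0 s0)).
  have := le_trans (moment_ratio_le Ad (inI_pinfty I0 s0) (inI_pinfty I0 t0) st As) sn.
  by rewrite mulrS mulrDl mul1r => h; rewrite opprD addrCA addrC lerD2r.
(* More drops by c than the initial value of a nonnegative quantity permits. *)
pose n := (Num.truncn (moment_ratio (A 0) / c)).+1.
have [t _ tn] := iter n; have := le_trans (moment_ratio_ge0 _) tn.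
rewrite subr_ge0 leNgt -ltr_pdivrMr// truncnS_gt//.
Qed.

End LimitCritical.

Lemma soliton_normal (R : realType) m (J1 : 'M[R]_m) a A1 (A := mxA a A1) :
  J1^T = - J1 -> J1 *m J1 = - 1%:M -> in_sp J1 A1 -> ~ nilpotent_mx A ->
  scf_soliton (ga_bracket A) (omega J1) 1%:M -> normal_mx A.
Proof.
move=> J1T J1J1 sp nA sol; rewrite /A mxA_block in nA sol.
have [_ M0] := adapted_soliton_normal J1T J1J1 sp nA sol.
by apply/eqP; rewrite -subr_eq0 -/(mxbr _ _) mxA_mxbr M0 block_mx0.
Qed.

(** * Limit points are solitons *)

Section LimitSoliton.
Variables (R : realType) (m : nat) (J1 : 'M[R]_m) (a : R) (A1 : 'M[R]_m).
Hypotheses (J1T : J1^T = - J1) (J1J1 : J1 *m J1 = - 1%:M) (sp : in_sp J1 A1).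
Variables (Tm : \bar R) (A : R -> 'M[R]_(1 + m)) (Ap : 'M[R]_(1 + m)).
Hypotheses (I0 : inI Tm +oo%E 0) (Ad : mx_flow Tm +oo%E A) (A00 : A 0 = mxA a A1).
Hypothesis cl : cluster ((fun t : R => (fnorm (A t))^-1 *: A t) @ +oo%R) Ap.

(** The class is the fixed space of the continuous linear map [sp_proj J1], hence closed. *)
Lemma limit_in_class : exists b B1, Ap = mxA b B1 /\ in_sp J1 B1.
Proof.
have pA t : 0 <= t -> sp_proj J1 ((fnorm (A t))^-1 *: A t) = (fnorm (A t))^-1 *: A t.
  move=> t0; have [b [B1 [-> spB]]] := flow_in_class J1T J1J1 Ad I0 A00 sp (inI_pinfty I0 t0).
  by rewrite linearZ/= sp_proj_id.
suff <- : sp_proj J1 Ap = Ap by exact: sp_proj_in.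
have [C C0 HC] := linmx_bound (sp_proj J1).
apply/eqP; rewrite -subr_eq0; apply/eqP/(small_norm0 (C := 1 + C)) => e e0.
have [t t0 te] := cluster_pinfty cl 0 e0; set Bt := _ *: _ in te.
have -> : sp_proj J1 Ap - Ap = (Bt - Ap) - sp_proj J1 (Bt - Ap).
  by rewrite linearB/= pA// opprB [RHS]addrC subrKA.
rewrite (le_trans (ler_normB _ _))// mulrDl mul1r lerD// (le_trans (HC _))//.
by rewrite ler_wpM2l.
Qed.

Lemma limit_soliton : mxA a A1 != 0 -> scf_soliton (ga_bracket Ap) (omega J1) 1%:M.
Proof.
move=> A0n; have [b [B1 [ApE spB]]] := limit_in_class.
have A0' : A 0 != 0 by rewrite A00.
have [mu crit] := criticality0 (limit_critical I0 Ad A0' cl).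
by rewrite ApE in crit *; exact: mxA_soliton_of_critical crit.
Qed.

End LimitSoliton.

(** Reduces identities of characteristic polynomials to determinants of x - A at scalars x, where
    similarity and limits are at hand. *)
Lemma poly_eq_horner (F : numDomainType) (p q : {poly F}) : (forall x, p.[x] = q.[x]) -> p = q.
Proof.
move=> pq; apply/eqP; rewrite -subr_eq0; apply/eqP.
apply: (roots_geq_poly_eq0 (rs := [seq i%:R | i <- iota 0 (size (p - q))])).
- by apply/allP => x _; rewrite /root !hornerE pq subrr.
- rewrite map_inj_uniq ?iota_uniq// => i j /eqP; rewrite eqr_nat; exact: eqP.
- by rewrite size_map size_iota.
Qed.

Lemma char_poly_horner (F : comNzRingType) k (A : 'M[F]_k) x : (char_poly A).[x] = \det (x%:M - A).
Proof.
rewrite /char_poly -horner_evalE -det_map_mx; congr (\det _); apply/matrixP => i j.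
by rewrite !mxE /= /horner_eval !hornerE hornerMn hornerX.
Qed.

Lemma char_poly_scale (F : numFieldType) k (A : 'M[F]_k) c s : c != 0 ->
  char_poly A = \prod_(z <- s) ('X - z%:P) ->
  char_poly (c *: A) = \prod_(z <- s) ('X - (c * z)%:P).
Proof.
move=> c0 As; have sk : size s = k.
  by apply/eqP; rewrite -eqSS -(size_char_poly A) As size_prod_XsubC.
apply: poly_eq_horner => x; rewrite char_poly_horner.
have -> : x%:M - c *: A = c *: ((x / c)%:M - A).
  by rewrite scalerBr scale_scalar_mx mulrC divfK.
rewrite detZ -char_poly_horner As !horner_prod -sk.
elim: s {As sk} => [|z s IH]; first by rewrite !big_nil mulr1.
rewrite !big_cons exprS mulrACA IH; congr (_ * _).
by rewrite !hornerE; field.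
Qed.

(** Over C all roots of the common characteristic polynomial are eigenvalues of a nilpotent matrix,
    hence 0; it is a power of X, and Cayley-Hamilton applies to A. *)
Lemma nilpotent_char_poly (R : realType) k (A N : 'M[R]_k.+1) : char_poly N = char_poly A ->
  nilpotent_mx N -> nilpotent_mx A.
Proof.
move=> NA [j Nj]; pose B := cplx A.
have [s sE] := closed_field_poly_normal (char_poly B).
rewrite (monicP (char_poly_monic B)) scale1r in sE.
have BN : char_poly B = char_poly (cplx N) by rewrite /B /cplx -!map_char_poly NA.
have s0 z : z \in s -> z = 0.
  move=> zs; have : root (char_poly (cplx N)) z by rewrite -BN sE root_prod_XsubC.
  rewrite -eigenvalue_root_char => /eigenvalueP[v vN v0].
  have : v *m (cplx N ^+ j) = z ^+ j *: v.
    elim: (j) => [|l IH]; first by rewrite !expr0 mulmx1 scale1r.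
    by rewrite exprSr -mulmxE mulmxA IH -scalemxAl vN scalerA exprSr.
  have -> : cplx N ^+ j = 0.
    have -> : cplx N ^+ j = cplx (N ^+ j) by rewrite /cplx rmorphXn.
    by rewrite Nj /cplx raddf0.
  rewrite mulmx0 => /esym/eqP; rewrite scaler_eq0 (negbTE v0) orbF expf_eq0.
  by move=> /andP[_ /eqP].
have BX : char_poly B = 'X^(size s).
  rewrite sE big_seq (eq_bigr (fun=> 'X)) => [|z zs]; last by rewrite (s0 z zs) polyC0 subr0.
  by rewrite -big_seq big_const_seq count_predT -Monoid.iteropE.
exists (size s); have := Cayley_Hamilton B; rewrite BX rmorphXn/= horner_mx_X.
rewrite /B => e; apply: (map_mx_inj (f := real_complex R)).
by rewrite rmorphXn/= raddf0.
Qed.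

Section CloseDet.
Variables (R : realType) (T : Type) (S : set T) (delta : T -> R).
Hypothesis delta_ge0 : forall t, S t -> 0 <= delta t.

Lemma close_bigop I (r : seq I) (op : R -> R -> R) (idx : R) (u v : I -> T -> R) :
  (forall f g f' g', close S delta f g -> close S delta f' g' ->
     close S delta (fun t => op (f t) (f' t)) (fun t => op (g t) (g' t))) ->
  (forall i, close S delta (u i) (v i)) ->
  close S delta (fun t => \big[op/idx]_(i <- r) u i t) (fun t => \big[op/idx]_(i <- r) v i t).
Proof.
move=> opc uv; elim: r => [|i r IH].
  by apply: eq_close (close_cst delta_ge0 idx) => t; rewrite big_nil.
by apply: eq_close (opc _ _ _ _ (uv i) IH) => t; rewrite big_cons.
Qed.

Lemma close_det k (u v : T -> 'M[R]_k) : close S delta u v ->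
  close S delta (fun t => \det (u t)) (fun t => \det (v t)).
Proof.
move=> [K K0 H]; apply: close_bigop => [f g f' g'|s]; first exact: closeD.
apply: closeM; first exact: close_cst.
apply: close_bigop => [f g f' g'|i]; first exact: closeM.
exists K => // t /H[h1 h2 h3]; split.
- exact: le_trans (mx_entry_le _ _ _) h1.
- exact: le_trans (mx_entry_le _ _ _) h2.
- apply: le_trans h3; set j := (X in u t i X).
  by have := mx_entry_le (u t - v t) i j; rewrite !mxE.
Qed.

End CloseDet.

Lemma bounded_cluster (R : realType) (u : nat -> R) K : (forall n, 0 <= u n <= K) ->
  exists2 l, 0 <= l & forall (N : nat) (e : R), 0 < e -> exists2 n, (N <= n)%N & `|u n - l| <= e.
Proof.
move=> uK; have [l [l0 cl]] : `[0, K]%classic `&` cluster (u @ \oo) !=set0.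
  apply: segment_compact; exists 0%N => // n _ /=; rewrite in_itv /=; exact: uK.
exists l; first by move: l0; rewrite /= in_itv/= => /andP[].
move=> N e e0.
have FN : (u @ \oo) [set x | exists2 n, (N <= n)%N & x = u n].
  by exists N => // n /= Nn; exists n.
have Np : nbhs l [set x | `|x - l| <= e] by exact: near_dist_le.
by have [x [[n Nn ->] xl]] := cl _ _ FN Np; exists n.
Qed.

(** * The spectrum of limit points *)

Section LimitSpectrum.
Variables (R : realType) (m : nat) (J1 : 'M[R]_m) (a : R) (A1 : 'M[R]_m).
Hypotheses (J1T : J1^T = - J1) (J1J1 : J1 *m J1 = - 1%:M) (sp : in_sp J1 A1).
Variables (Tm : \bar R) (A : R -> 'M[R]_(1 + m)) (Ap : 'M[R]_(1 + m)).
Hypotheses (I0 : inI Tm +oo%E 0) (Ad : mx_flow Tm +oo%E A) (A00 : A 0 = mxA a A1).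
Hypothesis cl : cluster ((fun t : R => (fnorm (A t))^-1 *: A t) @ +oo%R) Ap.
Hypothesis A0n : mxA a A1 != 0.

(* The isospectral representative y(t) A(t) of A(0) has decreasing norm. *)
Lemma flow_isospectral : exists d : R -> R, forall t, 0 <= t ->
  [/\ 0 <= d t, d t <= fnorm (mxA a A1)
    & char_poly (d t *: ((fnorm (A t))^-1 *: A t)) = char_poly (mxA a A1)].
Proof.
have [H [y [H0 y0 Hy]]] := flow_conjugation J1T J1J1 Ad I0 A00 sp.
exists (fun t => y t * fnorm (A t)) => t t0.
have nz s : 0 <= s -> A s != 0.
  by move=> s0; apply: (flow_nonzero I0 Ad _ (inI_pinfty I0 s0)); rewrite A00.
(* y(0) = 1 and y does not vanish, so it cannot change sign. *)
have ypos : 0 <= y t.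
  rewrite leNgt; apply/negP => yt; have [||c] := @IVT R y 0 t 0 t0.
  - apply: derivable_within_continuous => u; rewrite in_itv/= => /andP[u0 _].
    by have [_ _ _ _ []] := Hy u (inI_pinfty I0 u0).
  - by rewrite y0 ge_min le_max (ltW yt) orbT ler01.
  rewrite in_itv/= => /andP[c0 _] yc0.
  by have [_ /eqP] := Hy c (inI_pinfty I0 c0).
have le0 : sqnorm (y t *: A t) <= sqnorm (y 0 *: A 0).
  pose r s := flow_rate (A s) * y s.
  apply: (derive_le_incr (f := fun s => sqnorm (y s *: A s)) (df := fun s =>
    2 * \tr ((r s *: A s + y s *: flow_field (A s)) *m (y s *: A s)^T))) => // s /andP[s0 _].
    have Is := inI_pinfty I0 s0; have [_ _ _ _ yd] := Hy s Is.
    exact: (is_derive_sqnorm (is_derive_scalemx yd (Ad Is))).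
  rewrite pmulr_rle0// linearZ/= -scalemxAr mulmxDl -!scalemxAl mxtraceZ mxtraceD !mxtraceZ.
  rewrite mxtrace_flow_field -/(flow_rate _) -/(sqnorm _) /r.
  (* The growth rate of y cancels the radial part of the field, leaving only the term in
     |[A, A^t]|^2. *)
  have -> : y s * (flow_rate (A s) * y s * sqnorm (A s)
      + y s * (- flow_rate (A s) * sqnorm (A s) - 2^-1 * sqnorm (mxbr (A s) (A s)^T)))
    = - (y s ^+ 2 * (2^-1 * sqnorm (mxbr (A s) (A s)^T))) by ring.
  by rewrite oppr_le0 mulr_ge0 ?sqr_ge0// mulr_ge0 ?sqnorm_ge0// invr_ge0.
have Fp : 0 < fnorm (A t) by rewrite sqrtr_gt0 sqnorm_gt0// nz.
split; first by rewrite mulr_ge0// ltW.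
  have -> : y t * fnorm (A t) = fnorm (y t *: A t).
    by rewrite /fnorm sqnormZ sqrtrM ?sqr_ge0// sqrtr_sqr ger0_norm.
  by rewrite ler_wsqrtr// (le_trans le0)// y0 scale1r A00.
have [Hu yn HA _ _] := Hy t (inI_pinfty I0 t0).
rewrite scalerA mulfK ?gt_eqF//.
apply: poly_eq_horner => x; rewrite !char_poly_horner.
have e : (x%:M - y t *: A t) *m H t = H t *m (x%:M - A 0).
  by rewrite mulmxBl mulmxBr HA scalar_mxC -scalemxAl.
have := congr1 determinant e; rewrite !det_mulmx mulrC -A00 => /mulfI; apply.
by move: Hu; rewrite unitmxE unitfE.
Qed.

(** The factors [d (t n)] are bounded and have a cluster value l. At indices where they are near l,
    det (x - d B_n) is near det (x - l Ap), while it equals det (x - A_0) throughout. *)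
Lemma limit_char_poly : exists2 d : R, 0 <= d & char_poly (d *: Ap) = char_poly (mxA a A1).
Proof.
have [d Hd] := flow_isospectral.
have /choice[t Ht] : forall n : nat, exists t : R, 0 <= t /\
    `|(fnorm (A t))^-1 *: A t - Ap| <= n.+1%:R^-1.
  by move=> n; have [|t t0 te] := cluster_pinfty cl 0 (e := n.+1%:R^-1); [|exists t].
have [n|l l0 Hl] := bounded_cluster (u := fun n => d (t n)) (K := fnorm (mxA a A1)).
  by have [t0 _] := Ht n; have [-> ->] := Hd _ t0.
exists l => //; apply: poly_eq_horner => x; rewrite !char_poly_horner.
pose B n := (fnorm (A (t n)))^-1 *: A (t n).
pose S : set nat := setT; pose delta n := `|d (t n) - l| + n.+1%:R^-1.
have d0 n : S n -> 0 <= delta n by move=> _; rewrite addr_ge0// invr_ge0.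
have ne1 (n : nat) : n.+1%:R^-1 <= 1 :> R by rewrite invf_le1 ?ltr0Sn// ler1n.
have cd : close S delta (fun n => d (t n)) (fun=> l).
  exists (fnorm (mxA a A1) + l + 1); first by rewrite !addr_ge0// sqrtr_ge0.
  have F0 : 0 <= fnorm (mxA a A1) := sqrtr_ge0 _.
  move=> n _; have [t0 _] := Ht n; have [d1 d2 _] := Hd _ t0; split.
  - by rewrite ger0_norm// (le_trans d2)// -addrA lerDl addr_ge0.
  - by rewrite ger0_norm// addrAC lerDr addr_ge0.
  - rewrite (le_trans _ (ler_peMl (d0 n I) _))//; first by rewrite lerDl invr_ge0.
    by rewrite lerDr addr_ge0.
have cB : close S delta B (fun=> Ap).
  exists (`|Ap| + 1); first by rewrite addr_ge0.
  move=> n _; have [_ te] := Ht n; split.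
  - by rewrite -[B n](subrK Ap) (le_trans (ler_normD _ _))// addrC lerD// (le_trans te).
  - by rewrite lerDl.
  - rewrite (le_trans _ (ler_peMl (d0 n I) _))//; last by rewrite lerDr.
    by rewrite (le_trans te)// lerDr.
have [K K0 HK] := close_det d0 (closeB (close_cst d0 (x%:M)) (close_scale cd cB)).
apply/eqP; rewrite -subr_eq0; apply/eqP/(small_norm0 (C := 2 * K)) => e e0.
have [N Ne] : exists N : nat, N.+1%:R^-1 <= e.
  exists (Num.truncn e^-1); rewrite invf_ple ?posrE ?ltr0Sn// ltW// truncnS_gt//.
have [n Nn le_n] := Hl N e e0; have [_ _] := HK n I; rewrite distrC.
have [t0 _] := Ht n; have [_ _ chp] := Hd _ t0.
have -> : \det (x%:M - d (t n) *: B n) = \det (x%:M - mxA a A1).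
  by rewrite -!char_poly_horner chp.
have -> : 2 * K * e = K * (e + e) by ring.
move=> /le_trans; apply; rewrite ler_wpM2l// lerD//.
by apply: le_trans Ne; rewrite lef_pV2 ?posrE ?ltr0Sn// ler_nat.
Qed.

(** The factor d is nonzero and Ap is not nilpotent, since otherwise A_0 would share its
    characteristic polynomial with a nilpotent matrix. A soliton that is not nilpotent is normal. *)
Lemma limit_spectrum : ~ nilpotent_mx (mxA a A1) ->
  normal_mx Ap /\ same_eigenvalues_upto_scaling Ap (mxA a A1).
Proof.
move=> nA; have [d d0 dE] := limit_char_poly.
have nAp : ~ nilpotent_mx (d *: Ap) by move=> h; apply: nA; exact: nilpotent_char_poly h.
have dn0 : d != 0.
  by apply/eqP => e; apply: nAp; rewrite e scale0r; exists 1%N; rewrite expr1.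
have dp : 0 < d by rewrite lt0r dn0.
split.
  have [b [B1 [ApE spB]]] := limit_in_class J1T J1J1 sp I0 Ad A00 cl.
  have sol := limit_soliton J1T J1J1 sp I0 Ad A00 cl A0n.
  have nB : ~ nilpotent_mx (mxA b B1).
    move=> [j Bj]; apply: nAp; exists j; rewrite ApE.
    by elim: (j) Bj => [|l IH]; rewrite ?exprZn => ->; rewrite ?scaler0.
  by rewrite ApE in sol *; exact: soliton_normal sol.
have [s sE] := closed_field_poly_normal (char_poly (cplx (mxA a A1))).
rewrite (monicP (char_poly_monic _)) scale1r in sE.
exists d^-1, s; split; [by rewrite invr_gt0|exact: sE|].
have -> : cplx Ap = (d^-1%:C)%C *: cplx (d *: Ap) by rewrite -cplxZ scalerA mulVf// scale1r.
apply: char_poly_scale; first by rewrite (fmorph_eq0 (real_complex R)) invr_eq0.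
by rewrite -sE /cplx -!map_char_poly dE.
Qed.

End LimitSpectrum.

(** * The theorem *)

Section StandardConditions.
Variables (R : realType) (m : nat) (J1 : 'M[R]_m) (a : R) (A1 : 'M[R]_m).
Hypotheses (J1T : J1^T = - J1) (J1J1 : J1 *m J1 = - 1%:M) (sp : in_sp J1 A1).
Local Notation A := (mxA a A1).

(** The pairing argument covers matrices that are not nilpotent; a semisimple nilpotent matrix is
    0. *)
Lemma semisimple_soliton_normal : semisimple_mx A ->
  scf_soliton (ga_bracket A) (omega J1) 1%:M <-> normal_mx A.
Proof.
move=> ssA; split=> [sol|nA]; last exact: mxA_soliton_of_normal.
have [nil|nA] := pselect (nilpotent_mx A); last exact: soliton_normal sol.
by rewrite /normal_mx (nilpotent_semisimple0 nil ssA) trmx0.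
Qed.

Lemma nilpotent_soliton_iff : A != 0 -> nilpotent_mx A ->
  scf_soliton (ga_bracket A) (omega J1) 1%:M <->
  mxbr A (mxbr A A^T) = - (sqnorm (mxbr A A^T) / sqnorm A) *: A.
Proof.
move=> A0 nA; split=> [|crit]; first exact: nilpotent_soliton_critical.
apply: (mxA_soliton_of_critical J1T J1J1 sp (mu := sqnorm (mxbr A A^T) / sqnorm A)).
by rewrite mxbrC crit scaleNr opprK.
Qed.

End StandardConditions.

Theorem theorem1p1 (R : realType) (n : nat) (J1 : 'M[R]_(n.-1.*2))
    (a : R) (A1 : 'M[R]_(n.-1.*2)) :
  (2 <= n)%N -> J1^T = - J1 -> J1 *m J1 = - 1%:M ->
  0 <= a -> in_sp J1 A1 ->
  let A0 : 'M[R]_(1 + n.-1.*2) := mxA a A1 in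
  let w0 : 'M[R]_(1 + n.-1.*2 + 1) := omega J1 in
  let g0 : 'M[R]_(1 + n.-1.*2 + 1) := 1%:M in
  (* (i) *)
  ((semisimple_mx A0 \/ nilpotent_mx A0 ->
      exists g : 'M[R]_(1 + n.-1.*2 + 1), scf_soliton (ga_bracket A0) w0 g) /\
   (semisimple_mx A0 ->
      (scf_soliton (ga_bracket A0) w0 g0 <-> normal_mx A0)) /\
   (A0 != 0 -> nilpotent_mx A0 ->
      (scf_soliton (ga_bracket A0) w0 g0 <->
       mxbr A0 (mxbr A0 A0^T) = - (sqnorm (mxbr A0 A0^T) / sqnorm A0) *: A0))) /\
  (* (ii) *)
  (~ nilpotent_mx A0 -> ~ semisimple_mx A0 ->
     forall w g : 'M[R]_(1 + n.-1.*2 + 1),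
       ~ scf_soliton (ga_bracket A0) w g /\
       ~ algebraic_scf_soliton (ga_bracket A0) w g) /\
  (* (iii) *)
  (forall (Tm Tp Sm Sp : \bar R) (A : R -> 'M[R]_(1 + n.-1.*2))
      (wg : R -> 'M[R]_(1 + n.-1.*2 + 1) * 'M[R]_(1 + n.-1.*2 + 1)),
     maximal_solution (@mx_flow R (1 + n.-1.*2)) Tm Tp A -> A 0 = A0 ->
     maximal_solution (scf_solution (ga_bracket A0)) Sm Sp wg ->
     wg 0 = (w0, g0) ->
     Tm = Sm /\ Tp = Sp /\
     forall t : R, (Tm < t%:E < Tp)%E ->
       exists h : 'cV[R]_(1 + n.-1.*2 + 1) -> 'cV[R]_(1 + n.-1.*2 + 1),
         [/\ ga_iso A0 (A t) h, is_pullback h w0 (wg t).1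
           & is_pullback h g0 (wg t).2]) /\
  (* (iv) *)
  (forall (Tm Tp : \bar R)
      (wg : R -> 'M[R]_(1 + n.-1.*2 + 1) * 'M[R]_(1 + n.-1.*2 + 1)),
     maximal_solution (scf_solution (ga_bracket A0)) Tm Tp wg ->
     wg 0 = (w0, g0) -> Tp = +oo%E) /\
  (* (v) *)
  (forall (Tm Tp : \bar R) (A : R -> 'M[R]_(1 + n.-1.*2)),
     maximal_solution (@mx_flow R (1 + n.-1.*2)) Tm Tp A -> A 0 = A0 ->
     A0 != 0 -> ~ scf_soliton (ga_bracket A0) w0 g0 ->
     forall s t : R, (Tm < s%:E)%E -> s < t -> (t%:E < Tp)%E ->
       sqnorm (mxbr (A t) (A t)^T) / fnorm (A t) ^+ 4 <
       sqnorm (mxbr (A s) (A s)^T) / fnorm (A s) ^+ 4) /\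
  (* (vi) *)
  (forall (Tm Tp : \bar R) (A : R -> 'M[R]_(1 + n.-1.*2))
      (Ap : 'M[R]_(1 + n.-1.*2)),
     maximal_solution (@mx_flow R (1 + n.-1.*2)) Tm Tp A -> A 0 = A0 ->
     A0 != 0 ->
     cluster ((fun t : R => (fnorm (A t))^-1 *: A t) @ +oo%R) Ap ->
     scf_soliton (ga_bracket Ap) w0 g0 /\
     (~ nilpotent_mx A0 ->
        normal_mx Ap /\ same_eigenvalues_upto_scaling Ap A0)).
Proof.
move=> _ J1T J1J1 _ sp A0 w0 g0; split.
  split; first by case; [exact: semisimple_compatible|exact: nilpotent_compatible].
  split=> [ssA|A0n nA]; first exact: semisimple_soliton_normal.
  exact: nilpotent_soliton_iff.
split=> [nA ssA w g|].
  by split=> sol; apply: ssA; apply: (soliton_semisimple nA); [left|right]; exact: sol.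
split=> [Tm Tp Sm Sp A wg Amax A00 smax wg0|]; first exact: scf_flow_equiv A00 smax wg0.
split=> [Tm Tp wg smax wg0|]; first exact: scf_immortal smax wg0.
split=> [Tm Tp A Amax A00 A0n nsol|Tm Tp A Ap Amax A00 A0n cl].
  exact: moment_ratio_strict Amax A00 A0n nsol.
have Tpoo := flow_immortal Amax; have [I0 Ad _] := Amax; rewrite Tpoo in I0 Ad.
by split=> [|nA]; [exact: limit_soliton I0 Ad A00 cl A0n|exact: (limit_spectrum J1T J1J1 sp I0 Ad A00 cl A0n nA)].
Qed.
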